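(* Let $G$ be a locally compact abelian group with dual group $\hat G\cong\mathbb R^d\times\mathbb Z^e$, and let $\lambda\in L^1(\hat G)\cap C_0(\hat G)$ be subconvolutive (there is $C$ with $(\lambda*\lambda)(\gamma)\le C\lambda(\gamma)$ for all $\gamma\in\hat G$), symmetric ($\lambda(-\alpha)=\lambda(\alpha)$ for all $\alpha$), and strictly positive. If $\lambda$ satisfies the Gelfand–Raikov–Shilov condition $$\lim_{n\to\infty}\lambda(n\gamma)^{1/n}=1\qquad\text{for all }\gamma\in\hat G,$$ then $\sigma(\mathcal H_\lambda)\cong G$ (homeomorphically) via the Gelfand map $\Gamma\colon G\to\sigma_{co}(\mathcal H_\lambda)\cong\sigma(\mathcal H_\lambda)$, $\Gamma(x)=k_x$.
   Context: $\hat\mu$ is the dual Haar measure on $\hat G$, $C_0$ denotes continuous functions vanishing at infinity, $(\lambda*\lambda)(\gamma)=\int_{\hat G}\lambda(\alpha)\lambda(\gamma-\alpha)\,d\hat\mu(\alpha)$, and $\hat{\mathcal F}(\hat f)(x)=\int_{\hat G}\hat f(\gamma)\gamma(x)\,d\hat\mu(\gamma)$ for $\hat f\in L^1(\hat G)$. $\mathcal H_\lambda$ is the Hilbert space $$\mathcal H_\lambda=\Big\{\hat{\mathcal F}\hat f\in C_0(G):\int_{\hat G}\frac{|\hat f|^2}{\lambda}\,d\hat\mu<\infty\Big\},\qquad\langle f,g\rangle=\int_{\hat G}\frac{\hat f\,\overline{\hat g}}{\lambda}\,d\hat\mu,$$ a reproducing kernel Hilbert space of functions on $G$ with kernel sections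 $k_x(y)=\int_{\hat G}\lambda(\gamma)\overline{\gamma(x)}\gamma(y)\,d\hat\mu(\gamma)$, so $f(x)=\langle f,k_x\rangle$. For subconvolutive $\lambda$ it is a reproducing kernel Hilbert algebra (RKHA): $k_x\mapsto k_x\otimes k_x$ extends to a bounded linear operator $\Delta\colon\mathcal H_\lambda\to\mathcal H_\lambda\otimes\mathcal H_\lambda$ (Hilbert space tensor product), and $\Delta^*$ is pointwise multiplication, making $\mathcal H_\lambda$ a commutative Banach algebra in an equivalent norm. $\sigma(\mathcal H)$ is the set of nonzero multiplicative linear functionals on $\mathcal H$ with the weak-$*$ topology. The cospectrum is $\sigma_{co}(\mathcal H)=\{\xi\in\mathcal H\setminus\{0\}:\Delta(\xi)=\xi\otimes\xi\}$ with the weak topology; $\xi\mapsto\langle\cdot,\xi\rangle$ is a homeomorphism $\sigma_{co}(\mathcal H)\cong\sigma(\mathcal H)$. *)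

(* Defs.v *)
From HB Require Import structures.
From mathcomp Require Import all_boot all_order all_algebra.
From mathcomp Require Import all_classical all_reals all_analysis.
From mathcomp Require Import measurable_realfun.
From mathcomp Require Import complex ring.

Set Implicit Arguments.
Unset Strict Implicit.
Unset Printing Implicit Defensive.

Import Order.TTheory GRing.Theory Num.Theory.
Import numFieldNormedType.Exports.
Import ComplexField.Normc.

Local Open Scope classical_set_scope.
Local Open Scope ring_scope.
Local Open Scope complex_scope.

HB.instance Definition _ (R : realType) := NormedModule.copy R[i] R[i]^o.

HB.instance Definition _ := hasNbhs.Build int principal_filter.
HB.instance Definition _ := Discrete_ofNbhs.Build int erefl.

Definition homeomorphism (X Y : topologicalType) (f : X -> Y) : Prop :=
  continuous f /\
  exists g : Y -> X, [/\ cancel f g, cancel g f & continuous g].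

Section dual_group.
Context (R : realType) (G : topologicalZmodType).

Definition is_character : set {compact-open, G -> R[i]} :=
  [set chi | [/\ continuous (chi : G -> R[i]),
    forall x, `|chi x| = 1 &
    forall x y, chi (x + y) = chi x * chi y]].

Definition dual_group : Type := set_type is_character.

HB.instance Definition _ := Topological.on dual_group.

Definition dual_fun (gamma : dual_group) : G -> R[i] := set_val gamma.
Coercion dual_fun : dual_group >-> Funclass.

Lemma dualP (gamma : dual_group) : is_character gamma.
Proof. by case: gamma => f fP; exact: set_mem. Qed.

Lemma dual_eqP (a b : dual_group) : (forall x, a x = b x) -> a = b.
Proof. by move=> ab; apply: val_inj; apply/funext. Qed.

Lemma is_character0 : is_character (fun=> 1).
Proof. by split=> [x|x|x y]; [exact: cvg_cst|exact: normr1|rewrite mulr1]. Qed.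

Lemma is_characterD (a b : dual_group) : is_character (fun x => a x * b x).
Proof.
have [ca na ma] := dualP a; have [cb nb mb] := dualP b.
split=> [x|x|x y].
- by apply: cvgM; [exact: ca|exact: cb].
- by rewrite normrM na nb mulr1.
- by rewrite ma mb mulrACA.
Qed.

Lemma is_characterN (a : dual_group) : is_character (fun x => (a x)^-1).
Proof.
have [ca na ma] := dualP a; split=> [x|x|x y].
- by apply: cvgV; [rewrite -normr_eq0 na oner_eq0|exact: ca].
- by rewrite normfV na invr1.
- by rewrite ma invfM.
Qed.

Definition dual_zero : dual_group := SigSub (mem_set is_character0).
Definition dual_add (a b : dual_group) : dual_group := SigSub (mem_set (is_characterD a b)).
Definition dual_opp (a : dual_group) : dual_group := SigSub (mem_set (is_characterN a)).

Lemma dual_addA : associative dual_add.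
Proof. by move=> a b c; apply: dual_eqP => x; exact: mulrA. Qed.

Lemma dual_addC : commutative dual_add.
Proof. by move=> a b; apply: dual_eqP => x; exact: mulrC. Qed.

Lemma dual_add0 : left_id dual_zero dual_add.
Proof. by move=> a; apply: dual_eqP => x; exact: mul1r. Qed.

Lemma dual_addN : left_inverse dual_zero dual_opp dual_add.
Proof.
move=> a; apply: dual_eqP => x; apply: mulVf.
by have [_ na _] := dualP a; rewrite -normr_eq0 na oner_eq0.
Qed.

HB.instance Definition _ :=
  GRing.isZmodule.Build dual_group dual_addA dual_addC dual_add0 dual_addN.

End dual_group.

Section borel.
Context (V : PreTopologicalZmodule.type).

Definition borel : Type := V.
HB.instance Definition _ := Choice.on borel.
HB.instance Definition _ := isPointed.Build borel (0 : V).

Definition borel_display := sigma_display (@open V : set (set borel)).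
HB.instance Definition _ := Measurable.copy borel
  (g_sigma_algebraType (@open V : set (set borel))).
End borel.

Section haar.
Context (R : realType) (V : PreTopologicalZmodule.type).

Definition is_haar (mu : {measure set (borel V) -> \bar R}) : Prop :=
  [/\ forall (x : V) (A : set (borel V)), measurable A ->
        mu [set x + y | y in (A : set V)] = mu A,
      forall K : set V, compact K -> (mu K < +oo)%E,
      forall U : set V, open U -> U !=set0 -> (0 < mu U)%E,
      forall A : set (borel V), measurable A ->
        mu A = ereal_inf [set mu U | U in [set U : set V | open U /\ A `<=` U]] &
      forall U : set V, open U ->
        mu U = ereal_sup
          [set mu K | K in [set K : set V | compact K /\ K `<=` U]]].

End haar.

Section complex_integral.
Context d (T : measurableType d) (R : realType) (mu : {measure set T -> \bar R}).

Definition cintegrable (f : T -> R[i]) : Prop :=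
  mu.-integrable setT (fun x => (complex.Re (f x))%:E) /\
  mu.-integrable setT (fun x => (complex.Im (f x))%:E).

Definition cintegral (f : T -> R[i]) : R[i] :=
  (\int[mu]_x complex.Re (f x)) +i* (\int[mu]_x complex.Im (f x)).

Lemma cintegrable_lin (a : R[i]) (f g : T -> R[i]) :
  cintegrable f -> cintegrable g -> cintegrable (fun x => a * f x + g x).
Proof.
move=> [fr fi] [gr gi]; case: a => a b; split.
- apply: (eq_integrable _ (fun x => (a%:E * (complex.Re (f x))%:E +
    ((- b)%:E * (complex.Im (f x))%:E) + (complex.Re (g x))%:E)%E)) => //.
    move=> x _; case: (f x) => u v; case: (g x) => s t /=.
    by rewrite -!EFinM -!EFinD mulNr.
  by apply: integrableD => //; apply: integrableD => //; exact: integrableZl.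
- apply: (eq_integrable _ (fun x => (a%:E * (complex.Im (f x))%:E +
    (b%:E * (complex.Re (f x))%:E) + (complex.Im (g x))%:E)%E)) => //.
    move=> x _; case: (f x) => u v; case: (g x) => s t /=.
    by rewrite -!EFinM -!EFinD.
  by apply: integrableD => //; apply: integrableD => //; exact: integrableZl.
Qed.

Lemma cintegral_lin (a : R[i]) (f g : T -> R[i]) :
  cintegrable f -> cintegrable g ->
  cintegral (fun x => a * f x + g x) = a * cintegral f + cintegral g.
Proof.
move=> [fr fi] [gr gi]; case: a => a b; rewrite /cintegral.
have Z c h : mu.-integrable setT (EFin \o h) ->
    mu.-integrable setT (EFin \o (fun x => c * h x)).
  by move=> ih; exact: (@integrableZl _ _ _ mu setT measurableT c (EFin \o h)).
have D h k : mu.-integrable setT (EFin \o h) ->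
    mu.-integrable setT (EFin \o k) ->
    mu.-integrable setT (EFin \o (fun x => h x + k x)).
  by move=> ih ik; exact: (@integrableD _ _ _ mu setT measurableT
    (EFin \o h) (EFin \o k)).
have eR : (fun x => complex.Re ((a +i* b) * f x + g x)) =
    (fun x => (a * complex.Re (f x) + - b * complex.Im (f x)) + complex.Re (g x)).
  by apply/funext => x; case: (f x) => u v; case: (g x) => s t /=; rewrite mulNr.
have eI : (fun x => complex.Im ((a +i* b) * f x + g x)) =
    (fun x => (a * complex.Im (f x) + b * complex.Re (f x)) + complex.Im (g x)).
  by apply/funext => x; case: (f x) => u v; case: (g x).
rewrite eR eI !RintegralD//; try by [exact: Z | apply: D; exact: Z].
rewrite !RintegralZl//; simpc; congr (_ +i* _); by rewrite mulNr.
Qed.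

End complex_integral.

Section c0.
Context (T : topologicalType) (K : numFieldType).

Definition is_c0 (f : T -> K) : Prop :=
  continuous f /\
  forall e : K, 0 < e -> exists2 A : set T, compact A &
    forall x, ~ A x -> `|f x| < e.

Lemma is_c0_lin (a : K) (f g : T -> K) :
  is_c0 f -> is_c0 g -> is_c0 (fun x => a * f x + g x).
Proof.
move=> [cf vf] [cg vg]; split.
  move=> x; apply: cvgD; last exact: cg.
  by apply: cvgM; [exact: cvg_cst|exact: cf].
move=> e e0; have e20 : 0 < e / 2 by rewrite divr_gt0.
have a0 : 0 < `|a| + 1 by rewrite ltr_wpDl.
have [A cA fA] := vf (e / 2 / (`|a| + 1)) (divr_gt0 e20 a0).
have [B cB gB] := vg _ e20.
exists (A `|` B); first exact: compactU.
move=> x /not_orP[nA nB]; rewrite [e]splitr.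
apply: (le_lt_trans (ler_normD _ _)); rewrite ltrD ?gB//.
rewrite normrM; apply: (@le_lt_trans _ _ ((`|a| + 1) * `|f x|)).
  by rewrite ler_wpM2r// lerDl.
by rewrite mulrC -ltr_pdivlMr// fA.
Qed.

End c0.

Section fourier.
Context (R : realType) (G : topologicalZmodType).
Local Notation dual := (dual_group R G).

Definition fourier (mu : {measure set (borel G) -> \bar R}) (f : G -> R[i])
    (gamma : dual) : R[i] :=
  cintegral mu (fun x : borel G => f x * (gamma x)^*%C).

(* The dual Haar measure of mu is the Haar measure on the dual group for which
   Plancherel's identity holds; this fixes its normalization. *)
Definition is_dual_haar (mu : {measure set (borel G) -> \bar R})
    (nu : {measure set (borel dual) -> \bar R}) : Prop :=
  is_haar nu /\
  forall f : G -> R[i], cintegrable mu f ->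
    (\int[mu]_x (normc (f x) ^+ 2)%:E < +oo)%E ->
    (\int[nu]_gamma (normc (fourier mu f gamma) ^+ 2)%:E =
     \int[mu]_x (normc (f x) ^+ 2)%:E)%E.

Definition inv_fourier (nu : {measure set (borel dual) -> \bar R})
    (fh : dual -> R[i]) (x : G) : R[i] :=
  cintegral nu (fun gamma : borel dual => fh gamma * (gamma : dual) x).

End fourier.

Section rkhs.
Context (R : realType) (G : topologicalZmodType).
Local Notation dual := (dual_group R G).
Context (nu : {measure set (borel dual) -> \bar R}) (lam : dual -> R).

Definition rkhs_density (f : G -> R[i]) : set (dual -> R[i]) :=
  [set fh | [/\ cintegrable nu fh,
    (\int[nu]_gamma (normc (fh gamma) ^+ 2 / lam gamma)%:E < +oo)%E &
    f = inv_fourier nu fh]].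

Definition rkhs_set : set (G -> R[i]) :=
  [set f | is_c0 f /\ rkhs_density f !=set0].

Context (ilam : nu.-integrable setT (EFin \o lam)).
Context (lam_gt0 : forall gamma, 0 < lam gamma).

Lemma eval_continuous (x : G) : continuous (fun gamma : dual => gamma x).
Proof.
have H : continuous (fun f : {compact-open, G -> R[i]} => f x).
  apply/continuousP => O oO.
  have -> : (fun f : {compact-open, G -> R[i]} => f x) @^-1` O =
      [set f : {compact-open, G -> R[i]} | f @` [set x] `<=` O].
    by apply/seteqP; split => [f Ofx _ [_ -> <-]//|f]; apply; exists x.
  by apply: compact_open_open => //; exact: compact_set1.
move=> gamma; apply: (@continuous_comp _ {compact-open, G -> R[i]} _
  (set_val : dual -> {compact-open, G -> R[i]})
  (fun f : {compact-open, G -> R[i]} => f x)).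
  exact: initial_continuous.
exact: H.
Qed.

Lemma continuous_measurable (h : dual -> R) :
  continuous h -> measurable_fun setT (h : borel dual -> R).
Proof.
move=> ch; apply: (measurability _ (RGenOInfty.measurableE R)).
move=> _ [_ [a ->] <-]; rewrite setTI; apply: sub_sigma_algebra.
move/continuousP : ch; apply; rewrite set_itvE; exact: open_gt.
Qed.

Lemma ReIm_continuous (h : R[i] -> R) :
  (forall z w, h z - h w = h (z - w)) -> (forall z, `|h z|%:C <= `|z|) ->
  continuous h.
Proof.
move=> hB hle z; apply/(@cvgrPdist_lt _ _ _ _ (nbhs_filter z)) => e e0.
have ec : 0 < e%:C by rewrite ltcR.
have : \forall w \near (z : R[i]), `|z - w| < e%:C.
  by apply/(nbhs_normP (V := R[i]^o)); exists e%:C.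
by apply: filterS => w; rewrite -ltcR hB; apply: le_lt_trans.
Qed.

Lemma Re_continuous : continuous (@complex.Re R : R[i] -> R).
Proof.
by apply: ReIm_continuous => [[a b] [c d]//|z]; exact: normc_ge_Re.
Qed.

Lemma Im_continuous : continuous (@complex.Im R : R[i] -> R).
Proof.
apply: ReIm_continuous => [[a b] [c d]//|z].
have -> : `|complex.Im z| = `|complex.Re (z * 'i%C)| by rewrite ReiNIm normrN.
apply: le_trans (normc_ge_Re _) _; rewrite normrM [X in _ * X]normc_def /=.
by rewrite expr0n/= add0r expr1n sqrtr1 mulr1.
Qed.

Lemma eval_measurable (x : G) :
  measurable_fun setT (fun gamma : borel dual => complex.Re ((gamma : dual) x)) /\
  measurable_fun setT (fun gamma : borel dual => complex.Im ((gamma : dual) x)).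
Proof.
split; apply: continuous_measurable => gamma.
- exact: (@continuous_comp _ R[i] _ (fun g : dual => g x) (@complex.Re R) gamma
    (@eval_continuous x gamma) (@Re_continuous _)).
- exact: (@continuous_comp _ R[i] _ (fun g : dual => g x) (@complex.Im R) gamma
    (@eval_continuous x gamma) (@Im_continuous _)).
Qed.

Lemma normc_sqr (z : R[i]) :
  normc z ^+ 2 = complex.Re z ^+ 2 + complex.Im z ^+ 2.
Proof. by case: z => a b /=; rewrite sqr_sqrtr// addr_ge0// sqr_ge0. Qed.

Lemma eval_bounded (gamma : dual) (x : G) :
  `|complex.Re (gamma x)| <= 1 /\ `|complex.Im (gamma x)| <= 1.
Proof.
have [_ /(_ x) + _] := dualP gamma.
rewrite /dual_fun; case: (set_val gamma x) => a b /= /(congr1 (@complex.Re R))/= n1.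
have ab1 : a ^+ 2 + b ^+ 2 = 1.
  by rewrite -(sqr_sqrtr (addr_ge0 (sqr_ge0 a) (sqr_ge0 b))) n1 expr1n.
by split; rewrite -(expr_le1 (n := 2))// real_normK ?num_real// -ab1
  ?lerDl ?lerDr sqr_ge0.
Qed.

Lemma cintegrable_eval (fh : dual -> R[i]) (x : G) : cintegrable nu fh ->
  cintegrable nu (fun gamma : borel dual => fh gamma * (gamma : dual) x).
Proof.
move=> [ir ii]; have [mr mi] := eval_measurable x.
have br : [bounded complex.Re ((gamma : dual) x) | gamma in [set: borel dual]].
  exists 1; split => // M M1 gamma _ /=.
  by apply: le_trans (ltW M1); have [] := eval_bounded gamma x.
have bi : [bounded complex.Im ((gamma : dual) x) | gamma in [set: borel dual]].
  exists 1; split => // M M1 gamma _ /=.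
  by apply: le_trans (ltW M1); have [] := eval_bounded gamma x.
split.
- apply: (eq_integrable _ (fun gamma : borel dual =>
    ((complex.Re (fh gamma))%:E * (complex.Re ((gamma : dual) x))%:E -
     (complex.Im (fh gamma))%:E * (complex.Im ((gamma : dual) x))%:E)%E)) => //.
    by move=> gamma _; case: (fh gamma) => a b; case: ((gamma : dual) x).
  by apply: integrableB => //; exact: integrableMl.
- apply: (eq_integrable _ (fun gamma : borel dual =>
    ((complex.Re (fh gamma))%:E * (complex.Im ((gamma : dual) x))%:E +
     (complex.Im (fh gamma))%:E * (complex.Re ((gamma : dual) x))%:E)%E)) => //.
    by move=> gamma _; case: (fh gamma) => a b; case: ((gamma : dual) x).
  by apply: integrableD => //; exact: integrableMl.
Qed.

Lemma weighted_measurable (fh : dual -> R[i]) : cintegrable nu fh ->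
  measurable_fun setT
    (fun gamma : borel dual => (normc (fh gamma) ^+ 2 / lam gamma)%:E).
Proof.
move=> [/measurable_int/measurable_EFinP mr /measurable_int/measurable_EFinP mi].
have /measurable_EFinP ml := measurable_int _ ilam.
apply/measurable_EFinP; apply: measurable_funM.
  under eq_fun do rewrite normc_sqr.
  by apply: measurable_funD; exact: measurable_funX.
rewrite (_ : (fun _ => _) = (fun gamma => lam gamma `^ (- 1))).
  exact: (measurableT_comp (@measurable_powR R (- 1)) ml).
by apply/funext => gamma; rewrite powR_inv1// ltW.
Qed.

Lemma normc_lin (a z w : R[i]) :
  normc (a * z + w) ^+ 2 <= 2 * normc a ^+ 2 * normc z ^+ 2 + 2 * normc w ^+ 2.
Proof.
rewrite -mulrA -exprMn -normcM; set u := a * z.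
rewrite !normc_sqr; case: u => p q; case: w => r s /=.
rewrite -subr_ge0 (_ : _ - _ = (p - r) ^+ 2 + (q - s) ^+ 2).
  by rewrite addr_ge0// sqr_ge0.
ring.
Qed.

Lemma rkhs_set_lin (a : R[i]) (f g : G -> R[i]) :
  rkhs_set f -> rkhs_set g -> rkhs_set (a *: f + g).
Proof.
move=> [cf [fh [ifh lfh ef]]] [cg [gh [igh lgh eg]]]; split.
  exact: is_c0_lin.
exists (fun gamma => a * fh gamma + gh gamma); split.
- exact: cintegrable_lin.
- pose c := 2 * normc a ^+ 2.
  apply: (@le_lt_trans _ _ (\int[nu]_gamma
     (c%:E * (normc (fh gamma) ^+ 2 / lam gamma)%:E +
      2%:E * (normc (gh gamma) ^+ 2 / lam gamma)%:E))%E).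
    apply: ge0_le_integral => //.
    + by move=> gamma _; rewrite lee_fin divr_ge0 ?sqr_ge0// ltW.
    + by apply: weighted_measurable; exact: cintegrable_lin.
    + by apply: emeasurable_funD; apply: measurable_funeM;
        exact: weighted_measurable.
    + move=> gamma _; rewrite -!EFinM -EFinD lee_fin !(mulrA _ _ (lam gamma)^-1) -mulrDl.
      by apply: ler_wpM2r; [rewrite invr_ge0 ltW|exact: normc_lin].
  have mc (k : R) h : 0 <= k -> cintegrable nu h ->
      measurable_fun setT (fun gamma : borel dual =>
        (k%:E * (normc (h gamma) ^+ 2 / lam gamma)%:E)%E) /\
      (forall gamma, (0 <= k%:E * (normc (h gamma) ^+ 2 / lam gamma)%:E)%E).
    move=> k0 ih; split; first by apply: measurable_funeM;
      exact: weighted_measurable.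
    by move=> gamma; rewrite -EFinM lee_fin mulr_ge0// divr_ge0 ?sqr_ge0// ltW.
  have c0 : 0 <= c by rewrite mulr_ge0// sqr_ge0.
  have [m1 p1] := mc _ _ c0 ifh; have [m2 p2] := mc 2 _ (ler0n _ _) igh.
  rewrite ge0_integralD// !ge0_integralZl_EFin//; try solve
    [ exact: weighted_measurable
    | by move=> gamma _; rewrite lee_fin divr_ge0 ?sqr_ge0// ltW ].
  by rewrite lte_add_pinfty// lte_mul_pinfty.
- apply/funext => x; rewrite ef eg.
  transitivity (a * inv_fourier nu fh x + inv_fourier nu gh x); first by [].
  rewrite /inv_fourier -cintegral_lin; try exact: cintegrable_eval.
  by congr cintegral; apply/funext => gamma; rewrite mulrDl mulrA.
Qed.

Lemma rkhs_set0 : rkhs_set 0.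
Proof.
split.
  split; first by move=> x; exact: cvg_cst.
  by move=> e e0; exists set0 => [|x _]; [exact: compact0|rewrite normr0].
exists (fun=> 0); split.
- by split; exact: integrable0.
- under eq_integral do rewrite normc0 expr0n mul0r.
  by rewrite integral0.
- apply/funext => x; rewrite /inv_fourier /cintegral.
  have -> : (fun gamma : borel dual => complex.Re (0 * (gamma : dual) x)) = cst 0.
    by apply/funext => gamma; rewrite mul0r.
  have -> : (fun gamma : borel dual => complex.Im (0 * (gamma : dual) x)) = cst 0.
    by apply/funext => gamma; rewrite mul0r.
  by rewrite Rintegral_cst// mul0r.
Qed.

Definition rkhs_pred & nu.-integrable setT (EFin \o lam)
    & (forall gamma, 0 < lam gamma) : {pred G -> R[i]} :=
  fun f => f \in rkhs_set.

Lemma rkhs_pred_submod : submod_closed (rkhs_pred ilam lam_gt0).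
Proof.
split; first by apply/mem_set; exact: rkhs_set0.
by move=> a f g /set_mem fH /set_mem gH; apply/mem_set; exact: rkhs_set_lin.
Qed.

HB.instance Definition _ := GRing.isSubmodClosed.Build R[i] (G -> R[i])
  (rkhs_pred ilam lam_gt0) rkhs_pred_submod.

Record rkhs : Type := Rkhs {
  rkhs_fun :> G -> R[i];
  _ : rkhs_fun \in rkhs_pred ilam lam_gt0 }.

HB.instance Definition _ := [isSub for rkhs_fun].
HB.instance Definition _ := [Choice of rkhs by <:].
HB.instance Definition _ := [SubChoice_isSubLmodule of rkhs by <:].

(* By injectivity of the inverse Fourier transform on L^1, the chosen density
   is unique up to a null set. *)
Definition density (f : rkhs) : dual -> R[i] :=
  xget (fun=> 0) (rkhs_density f).

Definition rkhs_inner (f g : rkhs) : R[i] :=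
  cintegral nu (fun gamma : borel dual =>
    density f gamma * (density g gamma)^*%C / (lam gamma)%:C).

Definition rkhs_kernel (x y : G) : R[i] :=
  cintegral nu (fun gamma : borel dual =>
    (lam gamma)%:C * ((gamma : dual) x)^*%C * (gamma : dual) y).

(* Set of nonzero multiplicative linear functionals.  The product of two
   elements is their pointwise product, which is again an element when lam is
   subconvolutive.  The topology is that of pointwise convergence. *)
Definition spectrum : set (prod_topology (fun _ : rkhs => R[i])) :=
  [set phi | [/\ scalar (phi : rkhs -> R[i]),
    exists f, phi f != 0 &
    forall f g h : rkhs, (forall x, h x = f x * g x) ->
      phi h = phi f * phi g]].

End rkhs.

Arguments rkhs_inner {R G nu lam} ilam lam_gt0 f g.
Arguments spectrum {R G nu lam} ilam lam_gt0.

Section hilbert.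
Context (R : realType) (V : lmodType R[i]) (ip : V -> V -> R[i]).

Definition ipnorm (v : V) : R := Num.sqrt (complex.Re (ip v v)).

Definition is_inner_product : Prop :=
  [/\ forall a u v w, ip (a *: u + v) w = a * ip u w + ip v w,
    forall u v, ip v u = (ip u v)^*%C,
    forall v, 0 <= ip v v &
    forall v, ip v v = 0 -> v = 0].

Definition is_hilbert : Prop :=
  is_inner_product /\
  forall u : nat -> V,
    (forall e : R, 0 < e -> exists N, forall m n,
      (N <= m)%N -> (N <= n)%N -> ipnorm (u m - u n) < e) ->
    exists l, forall e : R, 0 < e -> exists N, forall n,
      (N <= n)%N -> ipnorm (u n - l) < e.

Definition continuous_dual : Type :=
  {phi : {scalar V} | exists M : R, forall v, normc (phi v) <= M * ipnorm v}.

Definition dual_pairing (v : V) : prod_topology (fun _ : continuous_dual => R[i]) :=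
  fun phi => sval phi v.

Definition weak_space : Type := initial_topology dual_pairing.
HB.instance Definition _ := Topological.on weak_space.

End hilbert.

Definition bounded_operator (R : realType) (V W : lmodType R[i])
    (ipV : V -> V -> R[i]) (ipW : W -> W -> R[i]) (A : {linear V -> W}) : Prop :=
  exists M : R, forall v, ipnorm ipW (A v) <= M * ipnorm ipV v.

(* (T, ipT) with the bilinear map tens is a Hilbert space tensor product of
   (V, ipV) with itself; it is unique up to a unitary isomorphism. *)
Definition is_tensor_square (R : realType) (V T : lmodType R[i])
    (ipV : V -> V -> R[i]) (ipT : T -> T -> R[i]) (tens : V -> V -> T) : Prop :=
  [/\ is_hilbert ipT,
    forall w, linear (tens ^~ w),
    forall v, linear (tens v),
    forall v w v' w', ipT (tens v w) (tens v' w') = ipV v v' * ipV w w' &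
    forall (t : T) (e : R), 0 < e -> exists s : seq (V * V),
      ipnorm ipT (t - \sum_(p <- s) tens p.1 p.2) < e].

Definition cospectrum (R : realType) (V T : lmodType R[i])
    (ip : V -> V -> R[i]) (tens : V -> V -> T) (Delta : V -> T) :
    set (weak_space ip) :=
  [set xi | (xi : V) != 0 /\ Delta xi = tens xi xi].

Arguments cospectrum {R V T} ip tens Delta.

(* Main.v *)
(* Let [nu] be the Haar measure of the dual group and write [f] in the Hilbert
   space as the inverse Fourier transform of a density [phi]; its squared norm
   is the energy [int |phi|^2 / lam].

   A character [chi] of the algebra is automatically continuous: if
   [chi f = 1] with [f] small, the Neumann series [sum f^n], which converges
   because the energy of a convolution is at most [C] times the product of
   the energies, contradicts multiplicativity.  Translating a density by [a]
   multiplies [f] by a continuous character of [G], so [chi] picks up a factor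
   [c a]; the map [c] is a continuous homomorphism from the dual group to the
   nonzero complex numbers, and [chi f = int phi c] for compactly supported
   [phi].  Testing on [phi = c^* lam] gives [int |c|^2 lam <= 2 C].  If
   [|c g| > 1] for some [g], a Baire category argument makes the
   Gelfand-Raikov-Shilov lower bound on [lam (n g)] uniform on an open set of
   directions, and this integral diverges; hence [|c| = 1].  By Pontryagin
   duality [c] is evaluation of the dual at a point [x], so [chi f = f x].

   Pontryagin duality for a dual isomorphic to [R^d * Z^e] is elementary.  The
   frequencies [th] for which [g |-> exp (i <th, g>)] is evaluation at a point
   of [G] form a closed subgroup of [R^(d+e)].  Some nonzero linear form is
   integer-valued on a proper closed subgroup, and it would yield a nonzero
   element of the dual that is trivial on [G].

   An element [xi] of the cospectrum gives the multiplicative functional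
   [<., xi>], so it is some [k_x].  Both bijections are continuous, and so are
   their inverses, because the functions of the space vanish at infinity and
   separate points. *)
Require Import Defs.
From HB Require Import structures.
From mathcomp Require Import all_boot all_order all_algebra.
From mathcomp Require Import all_classical all_reals all_analysis.
From mathcomp Require Import measurable_realfun.
From mathcomp Require Import complex zify ring lra.

Set Implicit Arguments.
Unset Strict Implicit.
Unset Printing Implicit Defensive.

Import Order.TTheory GRing.Theory Num.Theory.
Import numFieldNormedType.Exports.
Import ComplexField.Normc.

Local Open Scope classical_set_scope.
Local Open Scope ring_scope.
Local Open Scope complex_scope.

(** * Complex-valued measurable and integrable functions *)

Section complex_facts.
Context (R : realType).
Implicit Types z w : R[i].

(** The inner product is computed from a chosen density, so densities must first be shown unique up
    to a null set. This injectivity of the inverse transform does not come from an inversion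
    formula: dividing by [lam] reduces it to the density of trigonometric polynomials in
    $L^2(\lambda\,d\nu)$, obtained from a sigma-algebra of approximable sets. What recovers points
    of $G$ from characters is Plancherel's identity, which normalizes [nu]: applied to indicators of
    open sets it separates points and confines points of small frequency to a compact set.

    The functional is at the outset only linear and multiplicative. Its character is read off as a
    ratio of values, on a translate of one fixed density and on that density itself. The fixed
    density is a convolution square because its translates are then uniformly close, which makes the
    ratio continuous.

    The growth condition is a limit along each single ray, whereas the integral bound on
    $|c|^2\lambda$ only sees sets of positive measure; bridging this gap is the purpose of the
    category argument. *)

Lemma normc_ge0 z : 0 <= normc z.
Proof. by case: z => a b /=; exact: sqrtr_ge0. Qed.

Lemma normcE z : `|z| = (normc z)%:C.
Proof. by rewrite normc_def; case: z. Qed.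

Lemma normc_conj z : normc z^*%C = normc z.
Proof. by case: z => a b /=; rewrite sqrrN. Qed.

Lemma normc_real (r : R) : normc r%:C = `|r|.
Proof. by rewrite /= expr0n/= addr0 sqrtr_sqr. Qed.

Lemma Re_le_normc z : `|complex.Re z| <= normc z.
Proof. by rewrite -lecR -normcE normc_ge_Re. Qed.

Lemma Im_le_normc z : `|complex.Im z| <= normc z.
Proof.
by rewrite -normrN -ReiNIm; apply: (le_trans (Re_le_normc _));
  rewrite normcM /= expr0n/= add0r expr1n sqrtr1 mulr1.
Qed.

Lemma normc_le_ReIm z : normc z <= `|complex.Re z| + `|complex.Im z|.
Proof.
rewrite -(@ler_pXn2r _ 2)// ?nnegrE ?addr_ge0 ?normc_ge0// normc_sqr.
rewrite sqrrD !real_normK ?num_real// lerD2r lerDl.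
by rewrite mulrn_wge0// mulr_ge0.
Qed.

Lemma normc_eq0 z : (normc z == 0) = (z == 0).
Proof. by apply/eqP/eqP => [/eq0_normc//|->]; exact: normc0. Qed.

Lemma normcX z n : normc (z ^+ n) = normc z ^+ n.
Proof. by elim: n => [|n IH]; rewrite ?normc1// !exprS normcM IH. Qed.

Lemma normcB z w : normc (z - w) <= normc z + normc w.
Proof. by rewrite -(normcN w); exact: le_normcD. Qed.

Lemma normcBC z w : normc (z - w) = normc (w - z).
Proof. by rewrite -opprB normcN. Qed.

Lemma mul_conjc z : z * z^*%C = (normc z ^+ 2)%:C.
Proof. by rewrite -sqr_normc normcE rmorphXn. Qed.

Lemma sqr_normcD z w : normc (z + w) ^+ 2 <= 2 * normc z ^+ 2 + 2 * normc w ^+ 2.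
Proof.
by have := normc_lin 1 z w; rewrite mul1r normc1 expr1n mulr1.
Qed.

Lemma conjcM z w : (z * w)^*%C = z^*%C * w^*%C.
Proof. exact: rmorphM. Qed.

Lemma conjcD z w : (z + w)^*%C = z^*%C + w^*%C.
Proof. exact: rmorphD. Qed.

End complex_facts.

Section complex_measurable.
Context d (T : measurableType d) (R : realType).
Implicit Types f g : T -> R[i].

Definition cmeas f := measurable_fun setT (fun x => complex.Re (f x)) /\
  measurable_fun setT (fun x => complex.Im (f x)).

Lemma cmeas_cst z : cmeas (fun=> z).
Proof. by split; exact: measurable_cst. Qed.

Lemma cmeasD f g : cmeas f -> cmeas g -> cmeas (fun x => f x + g x).
Proof.
move=> [fr fi] [gr gi]; split.
  by under eq_fun do rewrite raddfD; exact: measurable_funD.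
by under eq_fun do rewrite raddfD; exact: measurable_funD.
Qed.

Lemma cmeasM f g : cmeas f -> cmeas g -> cmeas (fun x => f x * g x).
Proof.
move=> [fr fi] [gr gi]; split.
  rewrite (_ : (fun _ => _) = (fun x => complex.Re (f x) * complex.Re (g x) -
    complex.Im (f x) * complex.Im (g x))).
    by apply: measurable_funB; exact: measurable_funM.
  by apply/funext => x; case: (f x); case: (g x).
rewrite (_ : (fun _ => _) = (fun x => complex.Re (f x) * complex.Im (g x) +
    complex.Im (f x) * complex.Re (g x))).
  by apply: measurable_funD; exact: measurable_funM.
by apply/funext => x; case: (f x); case: (g x).
Qed.

Lemma cmeas_conj f : cmeas f -> cmeas (fun x => (f x)^*%C).
Proof.
move=> [fr fi]; split.
  by rewrite (_ : (fun _ => _) = (fun x => complex.Re (f x)))//;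
    apply/funext => x; case: (f x).
rewrite (_ : (fun _ => _) = (fun x => - complex.Im (f x))).
  exact: measurableT_comp.
by apply/funext => x; case: (f x).
Qed.

Lemma cmeas_real (h : T -> R) : measurable_fun setT h -> cmeas (fun x => (h x)%:C).
Proof. by move=> mh; split => //=; exact: measurable_cst. Qed.

Lemma cmeasB f g : cmeas f -> cmeas g -> cmeas (fun x => f x - g x).
Proof.
move=> mf mg; rewrite (_ : (fun _ => _) = (fun x => f x + (- 1) * g x)).
  by apply: cmeasD => //; apply: cmeasM => //; exact: cmeas_cst.
by apply/funext => x; rewrite mulN1r.
Qed.

Lemma cmeas_indic (A : set T) : measurable A -> cmeas (fun x => (\1_A x : R)%:C).
Proof. by move=> mA; apply: cmeas_real; exact: measurable_indic. Qed.

Lemma measurable_normc f : cmeas f -> measurable_fun setT (fun x => normc (f x)).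
Proof.
move=> [fr fi]; rewrite (_ : (fun _ => _) =
  (fun x => (complex.Re (f x) ^+ 2 + complex.Im (f x) ^+ 2) `^ (2^-1))).
  apply: (measurableT_comp (@measurable_powR R _)).
  by apply: measurable_funD; exact: measurable_funX.
by apply/funext => x; rewrite -normc_sqr -powR_mulrn ?normc_ge0// -powRrM
  divff// powRr1// normc_ge0.
Qed.

Lemma measurable_enormc f : cmeas f ->
  measurable_fun setT (fun x => (normc (f x))%:E).
Proof. by move=> mf; apply/measurable_EFinP; exact: measurable_normc. Qed.

End complex_measurable.

Lemma cmeas_comp d d' (T : measurableType d) (T' : measurableType d')
    (R : realType) (f : T -> R[i]) (h : T' -> T) :
  cmeas f -> measurable_fun setT h -> cmeas (fun x => f (h x)).
Proof.
by move=> [fr fi] mh; split;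
  [exact: (measurableT_comp fr mh)|exact: (measurableT_comp fi mh)].
Qed.

Section complex_integrals.
Context d (T : measurableType d) (R : realType) (mu : {measure set T -> \bar R}).
Implicit Types f g : T -> R[i].

Lemma cintegrableP f : cintegrable mu f <->
  cmeas f /\ (\int[mu]_x (normc (f x))%:E < +oo)%E.
Proof.
split=> [[fr fi]|[mf fy]].
  have mf : cmeas f by split; apply/measurable_EFinP; exact: (measurable_int mu).
  split=> //.
  have [_ rlt] := integrableP _ _ _ fr; have [_ ilt] := integrableP _ _ _ fi.
  apply: le_lt_trans (lte_add_pinfty rlt ilt).
  rewrite -ge0_integralD//; last 2 first.
  - by apply: measurableT_comp => //; exact: (measurable_int mu).
  - by apply: measurableT_comp => //; exact: (measurable_int mu).
  apply: ge0_le_integral => //.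
  - by move=> x _; rewrite lee_fin normc_ge0.
  - exact: measurable_enormc.
  - by apply: emeasurable_funD; apply: measurableT_comp => //; exact: (measurable_int mu).
  - by move=> x _; rewrite lee_fin normc_le_ReIm.
have iN : mu.-integrable setT (fun x => (normc (f x))%:E).
  apply/integrableP; split; first exact: measurable_enormc.
  by under eq_integral do rewrite gee0_abs ?lee_fin ?normc_ge0//.
have [mr mi] := mf.
split; apply: (le_integrable _ _ _ iN) => //.
- exact/measurable_EFinP.
- by move=> x _ /=; rewrite lee_fin [leRHS]ger0_norm ?normc_ge0// Re_le_normc.
- exact/measurable_EFinP.
- by move=> x _ /=; rewrite lee_fin [leRHS]ger0_norm ?normc_ge0// Im_le_normc.
Qed.

Lemma cintegrable_cmeas f : cintegrable mu f -> cmeas f.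
Proof. by move=> /cintegrableP[]. Qed.

Lemma cintegrable_normc f : cintegrable mu f ->
  mu.-integrable setT (fun x => (normc (f x))%:E).
Proof.
move=> /cintegrableP[mf fy]; apply/integrableP; split; first exact: measurable_enormc.
by under eq_integral do rewrite gee0_abs ?lee_fin ?normc_ge0//.
Qed.

Lemma cintegrable_le f (h : T -> R) : cmeas f -> (forall x, normc (f x) <= h x) ->
  mu.-integrable setT (EFin \o h) -> cintegrable mu f.
Proof.
move=> mf fh ih; apply/cintegrableP; split=> //.
have [mh hy] := integrableP _ _ _ ih; apply: le_lt_trans hy.
apply: ge0_le_integral => //.
- by move=> x _; rewrite lee_fin normc_ge0.
- exact: measurable_enormc.
- exact: measurableT_comp.
- by move=> x _ /=; rewrite lee_fin (le_trans (fh x))// ler_norm.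
Qed.

Lemma cintegrable0 : cintegrable mu (fun=> 0 : R[i]).
Proof. by split; exact: integrable0. Qed.

Lemma cintegral0 : cintegral mu (fun=> 0 : R[i]) = 0.
Proof. by rewrite /cintegral /= /Rintegral integral0. Qed.

Lemma cintegrableZ (a : R[i]) f : cintegrable mu f -> cintegrable mu (fun x => a * f x).
Proof.
move=> fi; have := cintegrable_lin a fi cintegrable0.
by under eq_fun do rewrite addr0.
Qed.

Lemma cintegrableD f g : cintegrable mu f -> cintegrable mu g ->
  cintegrable mu (fun x => f x + g x).
Proof.
move=> fi gi; have := cintegrable_lin 1 fi gi.
by under eq_fun do rewrite mul1r.
Qed.

Lemma cintegrableB f g : cintegrable mu f -> cintegrable mu g ->
  cintegrable mu (fun x => f x - g x).
Proof.
move=> fi gi; have := cintegrable_lin (-1) gi fi.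
by under eq_fun do rewrite mulN1r addrC.
Qed.

Lemma cintegralZ (a : R[i]) f : cintegrable mu f ->
  cintegral mu (fun x => a * f x) = a * cintegral mu f.
Proof.
move=> fi; have := cintegral_lin a fi cintegrable0.
by under eq_fun do rewrite addr0; rewrite cintegral0 addr0.
Qed.

Lemma cintegralD f g : cintegrable mu f -> cintegrable mu g ->
  cintegral mu (fun x => f x + g x) = cintegral mu f + cintegral mu g.
Proof.
move=> fi gi; have := cintegral_lin 1 fi gi.
by under eq_fun do rewrite mul1r; rewrite mul1r.
Qed.

Lemma cintegralB f g : cintegrable mu f -> cintegrable mu g ->
  cintegral mu (fun x => f x - g x) = cintegral mu f - cintegral mu g.
Proof.
move=> fi gi; have := cintegral_lin (-1) gi fi.
by under eq_fun do rewrite mulN1r addrC; rewrite mulN1r addrC.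
Qed.

Lemma cintegrableMb f g (M : R) : cintegrable mu f -> cmeas g ->
  (forall x, normc (g x) <= M) -> cintegrable mu (fun x => f x * g x).
Proof.
move=> fi mg gM; have mf := cintegrable_cmeas fi.
apply: (@cintegrable_le _ (fun x => M * normc (f x))).
- exact: cmeasM.
- by move=> x; rewrite normcM mulrC ler_wpM2r ?normc_ge0.
- under [_ \o _]funext do rewrite /= EFinM.
  by apply: integrableZl => //; exact: cintegrable_normc.
Qed.

Lemma cintegral_conj f : cintegrable mu f ->
  cintegral mu (fun x => (f x)^*%C) = (cintegral mu f)^*%C.
Proof.
move=> [fr fi]; rewrite /cintegral; simpc; congr (_ +i* _).
  by apply: eq_Rintegral => x _; case: (f x).
rewrite -mulN1r -RintegralZl//; apply: eq_Rintegral => x _.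
by rewrite mulN1r; case: (f x).
Qed.

Lemma cintegral_real (h : T -> R) :
  cintegral mu (fun x => (h x)%:C) = (\int[mu]_x h x)%:C.
Proof. by rewrite /cintegral /= /Rintegral integral0. Qed.

Lemma eq_cintegral f g : (forall x, f x = g x) -> cintegral mu f = cintegral mu g.
Proof. by move=> fg; congr cintegral; apply/funext. Qed.

Lemma ae_eq_cintegral f g : cmeas f -> cmeas g ->
  {ae mu, forall x, f x = g x} -> cintegral mu f = cintegral mu g.
Proof.
move=> [fr fi] [gr gi] fg; rewrite /cintegral /Rintegral.
congr (fine _ +i* fine _); apply: ae_eq_integral => //.
- exact/measurable_EFinP.
- exact/measurable_EFinP.
- by apply: filterS fg => x -> .
- exact/measurable_EFinP.
- exact/measurable_EFinP.
- by apply: filterS fg => x -> .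
Qed.

(** Multiplying [f] by a unit constant makes a nonzero integral real and positive; it is then the
    integral of a real part, which [normc] dominates. *)
Lemma normc_cintegral f : cintegrable mu f ->
  ((normc (cintegral mu f))%:E <= \int[mu]_x (normc (f x))%:E)%E.
Proof.
move=> fi; set z := cintegral mu f.
have [z0|z0] := eqVneq z 0.
  by rewrite z0 normc0 integral_ge0// => x _; rewrite lee_fin normc_ge0.
have nz : normc z != 0 by rewrite normc_eq0.
pose u := z^*%C * ((normc z)^-1)%:C.
have nu1 : normc u = 1.
  by rewrite normcM normc_conj normc_real ger0_norm ?invr_ge0 ?normc_ge0// divff.
have uz : u * z = (normc z)%:C.
  rewrite /u mulrAC [_ * z]mulrC mul_conjc -rmorphM /= expr2 -mulrA divff// mulr1//.
have ui := cintegrableZ u fi.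
have : cintegral mu (fun x => u * f x) = (normc z)%:C by rewrite cintegralZ// uz.
move=> /(congr1 (@complex.Re R)) /= <-.
have -> : ((\int[mu]_x complex.Re (u * f x))%R)%:E = (\int[mu]_x (complex.Re (u * f x))%:E)%E.
  by rewrite fineK//; apply: integrable_fin_num => //; case: ui.
apply: (le_trans (lee_abs _)); apply: le_trans (le_abse_integral _ _ _) _ => //.
  by case: ui => uir _; exact: (measurable_int mu).
apply: ge0_le_integral => //.
- by apply: measurableT_comp => //; case: ui => uir _; exact: (measurable_int mu).
- by apply: measurable_enormc; exact: cintegrable_cmeas.
- by move=> x _ /=; rewrite lee_fin (le_trans (Re_le_normc _))// normcM nu1 mul1r.
Qed.

End complex_integrals.

(* AM-GM with a free parameter, [2 u <= t p + q / t], encodes Cauchy-Schwarz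
   without square roots; this is its optimization over [t]. *)
Lemma sqr_le_of_amgm (R : realType) (u p q : R) : 0 <= u -> 0 <= p -> 0 <= q ->
  (forall t, 0 < t -> 2 * u <= t * p + q / t) -> u ^+ 2 <= p * q.
Proof.
move=> u0 p0 q0 H.
have [pz|pn] := eqVneq p 0.
  rewrite pz mul0r; have [->|un] := eqVneq u 0; first by rewrite expr0n.
  have up : 0 < u by rewrite lt_neqAle eq_sym un.
  have := H ((q + 1) / u) (divr_gt0 (ltr_wpDl q0 ltr01) up).
  rewrite pz mulr0 add0r invf_div mulrA.
  move=> h; have : 2 * u < 2 * u; last by rewrite ltxx.
  apply: (le_lt_trans h); rewrite ltr_pdivrMr ?ltr_wpDl//.
  rewrite mulrC -mulrA -subr_gt0 (_ : _ - _ = u * (q + 2)); last by ring.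
  by rewrite mulr_gt0// ltr_wpDl.
have pp : 0 < p by rewrite lt_neqAle eq_sym pn.
have [u0'|un] := eqVneq u 0; first by rewrite u0' expr0n/= mulr_ge0.
have up : 0 < u by rewrite lt_neqAle eq_sym un.
have := H (u / p) (divr_gt0 up pp).
rewrite divfK// invf_div mulrA -lerBlDl (_ : 2 * u - u = u); last by ring.
by rewrite ler_pdivlMr// -expr2 mulrC.
Qed.

Section cauchy_schwarz.
Context d (T : measurableType d) (R : realType) (mu : {measure set T -> \bar R}).

(** Cauchy-Schwarz for an integrand dominated pointwise by $\sqrt{pq}$. The integral of [p] may be
    infinite; positivity of [Q] makes the bound infinite, not zero, in that case. *)
Lemma cauchy_schwarz_dom (f : T -> R[i]) (p q : T -> R) (Q : R) :
  0 < Q -> cintegrable mu f -> (forall x, 0 <= p x) -> (forall x, 0 <= q x) ->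
  measurable_fun setT p -> measurable_fun setT q ->
  (forall x, normc (f x) ^+ 2 <= p x * q x) ->
  (\int[mu]_x (q x)%:E <= Q%:E)%E ->
  ((normc (cintegral mu f) ^+ 2)%:E <= (\int[mu]_x (p x)%:E) * Q%:E)%E.
Proof.
move=> Q0 fi p0 q0 mp mq fpq qQ.
have ip0 : (0 <= \int[mu]_x (p x)%:E)%E by apply: integral_ge0 => x _; rewrite lee_fin.
have amgm t x : 0 < t -> 2 * normc (f x) <= t * p x + t^-1 * q x.
  move=> t0; have a0 : 0 <= t * p x + t^-1 * q x.
    by rewrite addr_ge0// mulr_ge0// ?invr_ge0 ltW.
  rewrite -(@ler_pXn2r _ 2)// ?nnegrE ?mulr_ge0 ?normc_ge0// exprMn.
  apply: (@le_trans _ _ (4 * (p x * q x))).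
    by rewrite (_ : 2 ^+ 2 = 4 :> R); [rewrite ler_pM2l|ring].
  rewrite -subr_ge0 (_ : _ - _ = (t * p x - t^-1 * q x) ^+ 2) ?sqr_ge0//.
  by field; rewrite gt_eqF.
have main t : 0 < t -> ((2 * normc (cintegral mu f))%:E <=
    t%:E * (\int[mu]_x (p x)%:E) + (Q / t)%:E)%E.
  move=> t0; rewrite EFinM.
  apply: le_trans (_ : _ <= 2%:E * \int[mu]_x (normc (f x))%:E)%E _.
    by rewrite lee_pmul2l// normc_cintegral.
  have mf : measurable_fun setT (fun x => (normc (f x))%:E).
    by apply: measurable_enormc; exact: cintegrable_cmeas fi.
  rewrite -ge0_integralZl//; last by move=> x _; rewrite lee_fin normc_ge0.
  have mp' : measurable_fun setT (fun x => (p x)%:E) by exact/measurable_EFinP.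
  have mq' : measurable_fun setT (fun x => (q x)%:E) by exact/measurable_EFinP.
  apply: (@le_trans _ _ (\int[mu]_x (t%:E * (p x)%:E + (t^-1)%:E * (q x)%:E))%E).
    apply: ge0_le_integral => //.
    - by move=> x _; rewrite -EFinM lee_fin mulr_ge0// normc_ge0.
    - exact: measurable_funeM.
    - by apply: emeasurable_funD; exact: measurable_funeM.
    - by move=> x _; rewrite -!EFinM -EFinD lee_fin amgm.
  rewrite ge0_integralD//; last 4 first.
  - by move=> x _; rewrite -EFinM lee_fin mulr_ge0// ltW.
  - exact: measurable_funeM.
  - by move=> x _; rewrite -EFinM lee_fin mulr_ge0// invr_ge0 ltW.
  - exact: measurable_funeM.
  have te0 : (0 <= t%:E)%E by rewrite lee_fin ltW.
  have tVe0 : (0 <= (t^-1)%:E)%E by rewrite lee_fin invr_ge0 ltW.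
  rewrite ge0_integralZl//; last by move=> x _; rewrite lee_fin.
  rewrite ge0_integralZl//; last by move=> x _; rewrite lee_fin.
  by apply: leeD => //; rewrite mulrC EFinM lee_pmul2l// lte_fin invr_gt0.
case E : (\int[mu]_x (p x)%:E)%E ip0 main => [P| |] ip0 main.
  rewrite lee_fin in ip0; rewrite -EFinM lee_fin.
  apply: (sqr_le_of_amgm (normc_ge0 _) ip0 (ltW Q0)) => t /main; by rewrite -EFinM -EFinD lee_fin.
  by rewrite gt0_mulye ?leey// lte_fin.
by move: ip0; rewrite leeNy_eq.
Qed.

End cauchy_schwarz.

Section real_fubini.
Context d1 d2 (T1 : measurableType d1) (T2 : measurableType d2) (R : realType).
Context (m1 : {sigma_finite_measure set T1 -> \bar R}).
Context (m2 : {sigma_finite_measure set T2 -> \bar R}).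
Context (f : T1 * T2 -> R).
Hypothesis fi : (m1 \x m2)%E.-integrable setT (EFin \o f).

Let fi1 : m1.-integrable setT (fun x => \int[m2]_y (f (x, y))%:E)%E.
Proof. exact: (integrable_fubini_F fi). Qed.

Let fi2 : m2.-integrable setT (fun y => \int[m1]_x (f (x, y))%:E)%E.
Proof.
have mF := measurable_fubini_G fi.
apply/integrableP; split=> //.
have := fi => /(integrable21ltyP _ _ (measurable_int _ fi)).
apply: le_lt_trans; apply: ge0_le_integral => //.
- exact: measurableT_comp.
- apply: (measurable_fun_fubini_tonelli_G (abse \o (EFin \o f))).
    by apply: measurableT_comp => //; exact: (measurable_int _ fi).
  by move=> z; exact: abse_ge0.
- move=> y _; apply: le_abse_integral => //.
  exact: (measurableT_comp (measurable_int _ fi) (measurable_pair2 y)).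
Qed.

(** The inner integral in Fubini's theorem is finite only almost everywhere; replacing its infinite
    values by 0 through [fine] alters it on a null set. *)
Lemma Rintegral_fineE d (T : measurableType d) (mu : {measure set T -> \bar R})
    (g : T -> \bar R) : mu.-integrable setT g ->
  mu.-integrable setT (EFin \o (fine \o g)) /\
  (\int[mu]_x (fine (g x))%:E = \int[mu]_x g x)%E.
Proof.
move=> gi; have mg := measurable_int _ gi.
have mfg : measurable_fun setT (EFin \o (fine \o g)).
  by apply/measurable_EFinP; exact: measurableT_comp.
have ae : {ae mu, forall x, setT x -> g x = (fine (g x))%:E}.
  have := @integrable_ae _ _ _ mu setT measurableT g gi.
  by apply: filterS => x /(_ I) gx _; rewrite fineK.
split; last by apply: ae_eq_integral => //; apply: filterS ae => x h /h.
apply/integrableP; split => //.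
have [_] := integrableP _ _ _ gi.
rewrite (_ : integral _ _ _ = (\int[mu]_x `|(fine (g x))%:E|)%E)//.
apply: ae_eq_integral => //; [exact: measurableT_comp|exact: measurableT_comp|].
by apply: filterS ae => x /[apply] /= {1}->.
Qed.

Lemma integrable_Rfubini : m2.-integrable setT (EFin \o (fun y => \int[m1]_x f (x, y))).
Proof. by have [] := Rintegral_fineE fi2. Qed.

Lemma Rfubini : \int[m2]_y (\int[m1]_x f (x, y)) = \int[m1]_x (\int[m2]_y f (x, y)).
Proof.
rewrite /Rintegral; congr fine.
have [_ ->] := Rintegral_fineE fi1; have [_ ->] := Rintegral_fineE fi2.
by have /esym := Fubini fi.
Qed.

End real_fubini.

Section complex_fubini.
Context d1 d2 (T1 : measurableType d1) (T2 : measurableType d2) (R : realType).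
Context (m1 : {sigma_finite_measure set T1 -> \bar R}).
Context (m2 : {sigma_finite_measure set T2 -> \bar R}).
Context (f : T1 * T2 -> R[i]).
Hypothesis mf : cmeas f.
Hypothesis fy : (\int[m1]_x \int[m2]_y (normc (f (x, y)))%:E < +oo)%E.

Let fi : cintegrable (m1 \x m2)%E f.
Proof.
apply/cintegrableP; split=> //; rewrite fubini_tonelli1//; first exact: measurable_enormc.
by move=> x; rewrite lee_fin normc_ge0.
Qed.

Lemma cintegrable_fubini : cintegrable m2 (fun y => cintegral m1 (fun x => f (x, y))).
Proof.
by have [fr fim] := fi; split; [exact: (integrable_Rfubini fr)|exact: (integrable_Rfubini fim)].
Qed.

Lemma cfubini : cintegral m2 (fun y => cintegral m1 (fun x => f (x, y))) =
  cintegral m1 (fun x => cintegral m2 (fun y => f (x, y))).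
Proof.
have [fr fim] := fi; rewrite {1 3}/cintegral; congr (_ +i* _).
  exact: (Rfubini fr).
exact: (Rfubini fim).
Qed.

Lemma ae_cintegrable_fubini : {ae m2, forall y, cintegrable m1 (fun x => f (x, y))}.
Proof.
have [fr fim] := fi; apply: filterS2 (ae_integrable2 fr) (ae_integrable2 fim).
by move=> y yr yi; split.
Qed.

End complex_fubini.

Section integral_limits.
Context d (T : measurableType d) (R : realType) (mu : {measure set T -> \bar R}).

Lemma dominated_small (f_ : nat -> T -> R) (g : T -> R) (eps : R) :
  (forall n, measurable_fun setT (f_ n)) ->
  (forall x, f_ ^~ x @ \oo --> (0 : R)) ->
  (forall n x, 0 <= f_ n x <= g x) -> mu.-integrable setT (EFin \o g) ->
  0 < eps -> exists n, (\int[mu]_x (f_ n x)%:E < eps%:E)%E.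
Proof.
move=> mf f0 fg ig e0.
have [|||||_ _] := @dominated_convergence _ _ _ mu setT measurableT
  (fun n x => (f_ n x)%:E) (fun=> 0%E) (EFin \o g).
- by move=> n; exact/measurable_EFinP.
- exact: measurable_cst.
- by apply: aeW => x _; apply: cvg_EFin; [exact: nearW|exact: f0].
- exact: ig.
- apply: aeW => x n _; have /andP[f0x fgx] := fg n x.
  by rewrite gee0_abs ?lee_fin.
move=> /=; rewrite integral0 => /fine_cvgP[+ /cvgrPdist_lt/(_ _ e0)].
move=> [N1 _ H1] [N2 _ H2]; exists (maxn N1 N2).
have fn := H1 _ (leq_maxl N1 N2); have := H2 _ (leq_maxr N1 N2).
rewrite /= sub0r normrN => h; rewrite -(fineK fn) lte_fin.
by apply: le_lt_trans h; exact: ler_norm.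
Qed.

End integral_limits.

(** * Coordinates and Haar measure on the dual group *)

Section coordinates.
Context (R : realType) (G : topologicalZmodType) (d e : nat).
Local Notation dual := (dual_group R G).
Context (Phi : dual -> 'rV[R]_d * 'rV[int]_e).
Hypothesis PhiD : forall a b, Phi (a + b) = Phi a + Phi b.
Hypothesis PhiH : homeomorphism Phi.

(** Integer coordinates are cast to reals, so that all $d+e$ coordinates are treated alike and one
    sup-distance describes the topology. *)
Definition dual_coord (j : 'I_(d + e)) (g : dual) : R :=
  row_mx (Phi g).1 (map_mx intr (Phi g).2) 0 j.

Lemma coordD j a b : dual_coord j (a + b) = dual_coord j a + dual_coord j b.
Proof.
rewrite /dual_coord PhiD; case: (split_ordP j) => i ->.
  by rewrite !row_mxEl mxE.
by rewrite !row_mxEr !mxE rmorphD.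
Qed.

Lemma coord0 j : dual_coord j 0 = 0.
Proof. by apply: (addrI (dual_coord j 0)); rewrite -coordD !addr0. Qed.

Lemma coordN j a : dual_coord j (- a) = - dual_coord j a.
Proof. by apply: (addrI (dual_coord j a)); rewrite -coordD !subrr coord0. Qed.

Lemma coordB j a b : dual_coord j (a - b) = dual_coord j a - dual_coord j b.
Proof. by rewrite coordD coordN. Qed.

Lemma coordMn j a n : dual_coord j (a *+ n) = dual_coord j a *+ n.
Proof. by elim: n => [|n IH]; rewrite ?mulr0n ?coord0// !mulrS coordD IH. Qed.

Lemma coord_cont j : continuous (dual_coord j).
Proof.
have [cPhi _] := PhiH; move=> g; rewrite /dual_coord; case: (split_ordP j) => i ->.
  have -> : (fun g => row_mx (Phi g).1 (map_mx intr (Phi g).2) 0 (lshift e i) : R)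
     = (fun v : 'rV[R]_d => v 0 i) \o fst \o Phi.
    by apply/funext => h /=; rewrite row_mxEl.
  apply: (continuous_comp (cPhi g)); apply: continuous_comp; first exact: cvg_fst.
  exact: coord_continuous.
have -> : (fun g => row_mx (Phi g).1 (map_mx intr (Phi g).2) 0 (rshift d i) : R)
     = (fun v : 'rV[int]_e => (v 0 i)%:~R) \o snd \o Phi.
  by apply/funext => h /=; rewrite row_mxEr mxE.
apply: (continuous_comp (cPhi g)); apply: continuous_comp; first exact: cvg_snd.
move=> O /nbhs_singleton/= Ox; exists (fun i' j' => [set (Phi g).2 i' j']).
  by move=> i' j'; apply/principal_filterP.
by move=> N /= NN; rewrite /= (NN 0 i).
Qed.

Lemma nbhs_coord_lt (g0 : dual) (eps : R) : 0 < eps ->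
  nbhs g0 [set g | forall j, `|dual_coord j (g - g0)| < eps].
Proof.
move=> e0; pose P j : set dual := [set g | `|dual_coord j (g - g0)| < eps].
have H j : nbhs g0 (P j); last exact: (filter_forall _ H).
have /cvgrPdist_lt/(_ _ e0) := @coord_cont j g0.
by apply: filterS => g; rewrite /P/= coordB distrC.
Qed.

Lemma nbhs_coord (g0 : dual) (O : set dual) : nbhs g0 O ->
  exists2 eps : R, 0 < eps & forall g, (forall j, `|dual_coord j (g - g0)| < eps) -> O g.
Proof.
have [cPhi [Psi [PK KP cPsi]]] := PhiH.
move=> gO; have : nbhs (Phi g0) (Psi @^-1` O) by apply: cPsi; rewrite PK.
move=> [[A B] /= [/nbhs_ballP[eps1 /= e10 A1] [P Pg B2]] AB].
exists (Num.min eps1 1); first by rewrite lt_min e10 ltr01.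
move=> g gj; rewrite -(PK g); apply: (AB (Phi g)); split => /=.
  apply: A1; split=> // i' i; have := gj (lshift e i).
  rewrite coordB /dual_coord !row_mxEl lt_min => /andP[+ _].
  by rewrite (ord1 i') distrC.
apply: B2 => i' i; have := gj (rshift d i).
rewrite coordB /dual_coord !row_mxEr !mxE -rmorphB lt_min => /andP[_].
rewrite -intr_norm -[1]/(1%:~R) ltr_int (ord1 i').
rewrite -[X in (_ < X)%R]add0r ltzD1 normr_le0 subr_eq0 => /eqP ->.
exact: nbhs_singleton.
Qed.

Definition cbox (r : R) : set dual := [set g | forall j, `|dual_coord j g| <= r].

Lemma cbox_compact r : compact (cbox r).
Proof.
have [cPhi [Psi [PK KP cPsi]]] := PhiH.
pose A := [set v : 'rV[R]_d | forall i, [set x : R | `|x| <= r] (v ord0 i)].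
pose B := [set v : 'rV[int]_e | forall i, [set x : int | `|x%:~R : R| <= r] (v ord0 i)].
have cA : compact A.
  apply: (@rV_compact _ _ (fun=> [set x : R | `|x| <= r])) => _.
  rewrite (_ : mkset _ = `[- r, r]%classic); first exact: segment_compact.
  by apply/seteqP; split => x /=; rewrite in_itv/= ler_norml.
have cB : compact B.
  pose T : ptopologicalType := HB.pack int (isPointed.Build int 0).
  apply: (@rV_compact T e (fun=> [set x : int | `|x%:~R : R| <= r])) => _.
  apply: finite_compact; pose m := Num.bound `|r|.
  apply: (@sub_finite_set _ _ ((fun k : nat => k%:Z - m%:Z) @` `I_(m + m).+1)).
    move=> x /= xr; have : `|x%:~R : R| < m%:R.
      by apply: (le_lt_trans xr); apply: (le_lt_trans (ler_norm _)); exact: archi_boundP.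
    rewrite -intr_norm -[m%:R]/(m%:Z%:~R) ltr_int => xm.
    exists (absz (x + m%:Z)%R); lia.
  exact: finite_image.
have -> : cbox r = Psi @` (A `*` B).
  apply/seteqP; split=> [g gr|_ [[v w] [/= Av Bw] <-] j].
    exists (Phi g); last exact: PK.
    split=> i /=.
      by have := gr (lshift e i); rewrite /dual_coord row_mxEl.
    by have := gr (rshift d i); rewrite /dual_coord row_mxEr mxE.
  rewrite /dual_coord KP /=; case: (split_ordP j) => i ->.
    by rewrite row_mxEl; exact: Av.
  by rewrite row_mxEr mxE; exact: Bw.
apply: continuous_compact; last exact: compact_setX.
exact: continuous_subspaceT.
Qed.

Lemma cbox_cover g : exists n : nat, cbox n%:R g.
Proof.
pose M := \sum_j `|dual_coord j g|.
exists (Num.bound M) => j; apply: (@le_trans _ _ M).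
  by rewrite /M (bigD1 j)//= lerDl sumr_ge0.
by apply: ltW; apply: archi_boundP; exact: sumr_ge0.
Qed.

Lemma cboxS r s : r <= s -> cbox r `<=` cbox s.
Proof. by move=> rs g gr j; exact: le_trans (gr j) rs. Qed.

Lemma cboxD r s a b : cbox r a -> cbox s b -> cbox (r + s) (a + b).
Proof. by move=> ar bs j; rewrite coordD (le_trans (ler_normD _ _))// lerD. Qed.

Lemma coord_measurable j : measurable_fun setT (dual_coord j : borel dual -> R).
Proof. exact: continuous_measurable (@coord_cont j). Qed.

Lemma cbox_measurable r : measurable (cbox r : set (borel dual)).
Proof.
have -> : cbox r = \bigcap_(j in setT) (dual_coord j @^-1` `[- r, r]%classic).
  by apply/seteqP; split => g gr j; [move=> _ /=|]; [|have := gr j I => /=];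
    rewrite in_itv/= -ler_norml.
apply: fin_bigcap_measurable => //.
move=> j _; rewrite -[X in measurable X]setTI; exact: coord_measurable.
Qed.

(** Half-spaces generate the Borel algebra of the dual, so measurability of a map into it reduces to
    its real coordinates. This makes subtraction measurable for the product algebra, which
    continuity alone does not give. *)
Definition halfspaces : set (set (borel dual)) :=
  [set A | exists j (a : R), A = [set g : dual | a < dual_coord j g]].

Lemma coord_measurable_halfspaces j :
  measurable_fun setT (dual_coord j : g_sigma_algebraType halfspaces -> R).
Proof.
apply: (measurability _ (RGenOInfty.measurableE R)) => _ [_ [a ->] <-].
rewrite setTI; apply: sub_sigma_algebra; exists j, a.
by apply/seteqP; split => g /=; rewrite in_itv/= andbT.
Qed.

(** Second countability in coordinates: an open set is the union of the countably many rational
    boxes [B qk] that it contains. *)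
Lemma open_halfspaces (O : set dual) : open O -> <<s halfspaces >> O.
Proof.
move=> oO; pose B (qk : 'rV[rat]_(d + e) * nat) : set dual :=
  [set g | forall j, `|dual_coord j g - ratr (qk.1 0 j)| < qk.2.+1%:R^-1].
pose I := [set qk | B qk `<=` O].
have -> : O = \bigcup_(qk in I) B qk.
  apply/seteqP; split => [g Og|g [qk]]; last by move=> /[apply].
  have [eps e0 gO] := nbhs_coord (open_nbhs_nbhs (conj oO Og)).
  have [k k2] : exists k : nat, k.+1%:R^-1 + k.+1%:R^-1 < eps.
    exists (Num.bound (2 / eps)).
    rewrite -mulr2n -[X in X < _]mulr_natl ltr_pdivrMr// mulrC -ltr_pdivrMr//.
    apply: (@lt_trans _ _ (Num.bound (2 / eps))%:R); last by rewrite ltr_nat.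
    by apply: archi_boundP; rewrite divr_ge0// ltW.
  have k0 : (0 : R) < k.+1%:R^-1 by rewrite invr_gt0.
  have qj j : {q : rat | `|dual_coord j g - ratr q| < k.+1%:R^-1}.
    apply: cid; have lt2 : dual_coord j g - k.+1%:R^-1 < dual_coord j g + k.+1%:R^-1.
      by rewrite ltrD2l (lt_trans _ k0)// oppr_lt0.
    have [q] := rat_in_itvoo lt2; rewrite in_itv/= => qi; exists q.
    by rewrite distrC ltr_distl.
  exists (\row_j sval (qj j), k) => [g' /= Bg'|j /=]; last first.
    by rewrite mxE; exact: (svalP (qj j)).
  apply: gO => j; apply: lt_trans k2; rewrite coordB.
  have := Bg' j; rewrite mxE => h1; have h2 := svalP (qj j).
  rewrite -(subrKA (ratr (sval (qj j)))); apply: (le_lt_trans (ler_normD _ _)).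
  by apply: ltrD => //; rewrite distrC.
have mB qk : measurable (B qk : set (g_sigma_algebraType halfspaces)).
  have -> : B qk = \bigcap_(j in setT) (dual_coord j @^-1` (ball (ratr (qk.1 0 j) : R) qk.2.+1%:R^-1)).
    apply/seteqP; split => g Bg j; first by move=> _ /=; rewrite /ball/= distrC; exact: Bg.
    by have := Bg j Logic.I; rewrite /= /ball/= distrC.
  apply: fin_bigcap_measurable => //.
  move=> j _; rewrite -[X in measurable X]setTI; apply: coord_measurable_halfspaces => //.
  exact: measurable_ball.
rewrite bigcup_mkcond; apply: (countable_bigcupT_measurable (T := g_sigma_algebraType halfspaces)).
  exact: countableP.
by move=> qk; case: ifP => // _; exact: measurable0.
Qed.

Lemma measurable_borel_coord dT (T : measurableType dT) (h : T -> dual) :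
  (forall j, measurable_fun setT (dual_coord j \o h)) ->
  measurable_fun setT (h : T -> borel dual).
Proof.
move=> mh; apply: (@measurability _ _ T (borel dual) setT h halfspaces).
  apply/seteqP; split; apply: smallest_sub => //.
  - by move=> O; exact: open_halfspaces.
  - exact: (sigma_algebra_measurable (borel dual)).
  - move=> _ [j [a ->]]; apply: sub_sigma_algebra.
    rewrite (_ : mkset _ = dual_coord j @^-1` [set x | a < x])//.
    by apply: open_comp; [move=> ? _; exact: coord_cont|exact: open_gt].
move=> _ [_ [j [a ->]] <-]; rewrite (_ : mkset _ = dual_coord j @^-1` `]a, +oo[%classic).
  by apply: (mh j) => //.
by apply/seteqP; split => g /=; rewrite in_itv/= andbT.
Qed.

Lemma measurable_subr_dual :
  measurable_fun setT (fun x : borel dual * borel dual => (x.2 - x.1 : dual) : borel dual).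
Proof.
apply: measurable_borel_coord => j.
rewrite (_ : _ \o _ = fun x : borel dual * borel dual => dual_coord j x.2 - dual_coord j x.1).
  by apply: measurable_funB; apply: measurableT_comp => //; exact: coord_measurable.
by apply/funext => x /=; rewrite coordB.
Qed.

Lemma measurable_shift_dual (a : dual) :
  measurable_fun setT (fun g : borel dual => (g - a : dual) : borel dual).
Proof.
apply: measurable_borel_coord => j.
rewrite (_ : _ \o _ = fun g : borel dual => dual_coord j g - dual_coord j a).
  by apply: measurable_funB => //; exact: coord_measurable.
by apply/funext => x /=; rewrite coordB.
Qed.

End coordinates.

Section sigma_finite_copy.
Context d (T : measurableType d) (R : realType) (mu : {measure set T -> \bar R}).

(** Fubini's theorem expects sigma-finiteness as a structure on the measure; a copy of [mu] indexed
    by the proof carries that structure with the same values. *)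
Definition sfmeasure & sigma_finite setT mu : set T -> \bar R := mu.

Context (sf : sigma_finite setT mu).
HB.instance Definition _ := Measure.on (sfmeasure sf).
HB.instance Definition _ := Measure_isSigmaFinite.Build _ _ _ (sfmeasure sf) sf.

End sigma_finite_copy.

Section L1_norm.
Context d (T : measurableType d) (R : realType) (mu : {measure set T -> \bar R}).
Implicit Types f g : T -> R[i].

Definition L1 f : \bar R := (\int[mu]_x (normc (f x))%:E)%E.

Lemma L1_ge0 f : (0 <= L1 f)%E.
Proof. by apply: integral_ge0 => x _; rewrite lee_fin normc_ge0. Qed.

Lemma L1_le f g : cmeas f -> cmeas g -> (forall x, normc (f x) <= normc (g x)) ->
  (L1 f <= L1 g)%E.
Proof.
move=> mf mg fg; apply: ge0_le_integral => //.
- by move=> x _; rewrite lee_fin normc_ge0.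
- exact: measurable_enormc.
- exact: measurable_enormc.
- by move=> x _; rewrite lee_fin.
Qed.

Lemma L1D f g : cmeas f -> cmeas g -> (L1 (fun x => f x + g x)%R <= L1 f + L1 g)%E.
Proof.
move=> mf mg; rewrite /L1 -ge0_integralD//; last 4 first.
- by move=> x _; rewrite lee_fin normc_ge0.
- exact: measurable_enormc.
- by move=> x _; rewrite lee_fin normc_ge0.
- exact: measurable_enormc.
apply: ge0_le_integral => //.
- by move=> x _; rewrite lee_fin normc_ge0.
- by apply: measurable_enormc; exact: cmeasD.
- by apply: emeasurable_funD; exact: measurable_enormc.
- by move=> x _; rewrite lee_fin le_normcD.
Qed.

Lemma L1Z (a : R[i]) f : cmeas f -> L1 (fun x => a * f x)%R = ((normc a)%:E * L1 f)%E.
Proof.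
move=> mf; rewrite /L1 -ge0_integralZl//.
- by apply: eq_integral => x _; rewrite normcM EFinM.
- exact: measurable_enormc.
- by move=> x _; rewrite lee_fin normc_ge0.
- by rewrite lee_fin normc_ge0.
Qed.

Lemma L1_lty f : cintegrable mu f -> (L1 f < +oo)%E.
Proof. by move=> /cintegrableP[]. Qed.

Lemma L1_indic (A : set T) : measurable A ->
  L1 (fun x => (\1_A x : R)%:C) = mu A.
Proof.
move=> mA; rewrite /L1 -(setIT A) -integral_indic//; apply: eq_integral => x _.
by rewrite setIT normc_real ger0_norm.
Qed.

Lemma cintegrable_indic (A : set T) : measurable A -> (mu A < +oo)%E ->
  cintegrable mu (fun x => (\1_A x : R)%:C).
Proof.
move=> mA Ay; apply/cintegrableP; split; first exact: cmeas_indic.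
by rewrite -/(L1 _) L1_indic.
Qed.

End L1_norm.

Definition gshift (V : PreTopologicalZmodule.type) (a : V) (g : borel V) : borel V :=
  (g : V) - a.

Section haar_translation.
Context (R : realType) (V : PreTopologicalZmodule.type).
Context (m : {measure set (borel V) -> \bar R}) (haar_m : is_haar m).
Hypothesis mshift : forall a : V, measurable_fun setT (gshift a).

Lemma haar_gshift (a : V) (A : set (borel V)) : measurable A ->
  m (gshift a @^-1` A) = m A.
Proof.
move=> mA; have [+ _ _ _ _] := haar_m => /(_ a A mA) <-; congr (m _).
apply/seteqP; split => [g Ag|_ [g Ag <-]]; last first.
  by rewrite /preimage /gshift /= addrAC subrr add0r.
by exists (gshift a g) => //; rewrite addrC /gshift subrK.
Qed.

Lemma measurable_shift (a : V) dY (Y : measurableType dY) (f : borel V -> Y) :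
  measurable_fun setT f -> measurable_fun setT (f \o gshift a).
Proof. by move=> mf; apply: (measurableT_comp mf); exact: mshift. Qed.

Lemma cmeas_shift (a : V) (f : borel V -> R[i]) :
  cmeas f -> cmeas (f \o gshift a).
Proof.
by move=> [fr fi]; split; [exact: (measurable_shift a fr)|exact: (measurable_shift a fi)].
Qed.

Lemma haar_pushforward (a : V) (f : borel V -> \bar R) :
  (\int[pushforward m (gshift a)]_g f g = \int[m]_g f g)%E.
Proof.
pose mg := isMeasurableFun.Build _ _ _ _ _ (mshift a).
pose h : {mfun _ >-> _} := MeasurableFun.Pack (MeasurableFun.Class mg).
apply: (@eq_measure_integral _ _ _ setT m (pushforward m h)) => A mA _.
exact: haar_gshift.
Qed.

Lemma ge0_integral_shift (a : V) (f : borel V -> \bar R) :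
  measurable_fun setT f -> (forall g, 0 <= f g)%E ->
  (\int[m]_g f (gshift a g) = \int[m]_g f g)%E.
Proof.
move=> mf f0; by rewrite -(haar_pushforward a f) (ge0_integral_pushforward (mshift a)).
Qed.

Lemma L1_shift (a : V) (f : borel V -> R[i]) : cmeas f ->
  L1 m (f \o gshift a) = L1 m f.
Proof.
move=> mf; apply: (ge0_integral_shift a (measurable_enormc mf)) => g.
by rewrite lee_fin normc_ge0.
Qed.

Lemma cintegrable_shift (a : V) (f : borel V -> R[i]) : cintegrable m f ->
  cintegrable m (f \o gshift a).
Proof.
move=> /cintegrableP[mf fy]; apply/cintegrableP; split; first exact: cmeas_shift.
by rewrite -/(L1 _ _) L1_shift.
Qed.

Lemma Rintegral_shift (a : V) (f : borel V -> R) :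
  m.-integrable setT (EFin \o (f \o gshift a)) ->
  measurable_fun setT f ->
  \int[m]_g f (gshift a g) = \int[m]_g f g.
Proof.
move=> fi mf; rewrite /Rintegral; congr fine.
rewrite -(haar_pushforward a (EFin \o f)) (integral_pushforward (mshift a))//.
exact/measurable_EFinP.
Qed.

Lemma cintegral_shift (a : V) (f : borel V -> R[i]) : cintegrable m f ->
  cintegral m (f \o gshift a) = cintegral m f.
Proof.
move=> fi; have [fsr fsi] := cintegrable_shift a fi; have [mr mi] := cintegrable_cmeas fi.
by rewrite /cintegral; congr (_ +i* _);
  [exact: (Rintegral_shift fsr mr)|exact: (Rintegral_shift fsi mi)].
Qed.

End haar_translation.

Section borel_topology.
Context (R : realType) (V : PreTopologicalZmodule.type).

Lemma open_measurable_borel (U : set V) : open U -> measurable (U : set (borel V)).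
Proof. by move=> oU; exact: sub_sigma_algebra. Qed.

Lemma continuous_measurable_borel (h : V -> R) :
  continuous h -> measurable_fun setT (h : borel V -> R).
Proof.
move=> ch; apply: (measurability _ (RGenOInfty.measurableE R)).
move=> _ [_ [a ->] <-]; rewrite setTI; apply: sub_sigma_algebra.
by move/continuousP : ch; apply; rewrite set_itvE; exact: open_gt.
Qed.

Lemma continuous_cmeas_borel (h : V -> R[i]) : continuous h -> cmeas (h : borel V -> R[i]).
Proof.
move=> ch; split; apply: continuous_measurable_borel => x.
- exact: (@continuous_comp _ R[i] _ h (@complex.Re R) x (ch x) (@Re_continuous _ _)).
- exact: (@continuous_comp _ R[i] _ h (@complex.Im R) x (ch x) (@Im_continuous _ _)).
Qed.

End borel_topology.

Section dual_haar.
Context (R : realType) (G : topologicalZmodType).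
Local Notation dual := (dual_group R G).
Context (nu : {measure set (borel dual) -> \bar R}) (haar_nu : is_haar nu).
Context (d e : nat) (Phi : dual -> 'rV[R]_d * 'rV[int]_e).
Hypothesis PhiD : forall a b, Phi (a + b) = Phi a + Phi b.
Hypothesis PhiH : homeomorphism Phi.
Local Notation coord := (dual_coord Phi).
Local Notation cbox := (cbox Phi).

Lemma measurable_gshift (a : dual) : measurable_fun setT (gshift a).
Proof. exact: (measurable_shift_dual PhiD PhiH a). Qed.

Lemma cbox_lty r : (nu (cbox r) < +oo)%E.
Proof. by have [_ + _ _ _] := haar_nu; apply; exact: cbox_compact PhiH _. Qed.

Lemma haar_sigma_finite : sigma_finite setT nu.
Proof.
exists (fun n => cbox n%:R); last first.
  by move=> n; split; [exact: cbox_measurable PhiH _|exact: cbox_lty].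
by apply/seteqP; split => // g _; have [n ng] := cbox_cover Phi g; exists n.
Qed.

Lemma coord_inj a b : (forall j, coord j a = coord j b) -> a = b.
Proof.
have [_ [Psi [PK _ _]]] := PhiH; move=> ab; apply: (can_inj PK).
rewrite [LHS]surjective_pairing [RHS]surjective_pairing; congr pair.
  by apply/rowP => i; have := ab (lshift e i); rewrite /dual_coord !row_mxEl.
apply/rowP => i; have := ab (rshift d i); rewrite /dual_coord !row_mxEr !mxE => /eqP.
by rewrite eqr_int => /eqP.
Qed.

Lemma dual_hausdorff : hausdorff_space dual.
Proof.
move=> a b ab; apply: coord_inj => j; apply/eqP; rewrite -subr_eq0 -normr_le0 leNgt.
apply/negP; rewrite -(coordB PhiD) => h; set r := (X in 0 < X) in h.
have r2 : 0 < r / 2 by rewrite divr_gt0.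
have [c [ca cb]] := ab _ _ (nbhs_coord_lt PhiD PhiH a r2) (nbhs_coord_lt PhiD PhiH b r2).
have : r < r; last by rewrite ltxx.
rewrite {1}/r -(subrKA c) (coordD PhiD) [ltRHS]splitr.
apply: (le_lt_trans (ler_normD _ _)); apply: ltrD; last exact: cb.
by have := ca j; rewrite !(coordB PhiD) distrC.
Qed.

Lemma dual_compact_measurable (K : set dual) : compact K ->
  measurable (K : set (borel dual)).
Proof.
move=> cK; have : closed K by exact: compact_closed dual_hausdorff cK.
by move=> /closed_openC oK; rewrite -(setCK K); apply: measurableC; exact: sub_sigma_algebra.
Qed.

Lemma compact_cbox (K : set dual) : compact K -> exists n : nat, K `<=` cbox n%:R.
Proof.
move=> cK; have := cK; rewrite compact_near_coveringP => /(_ nat \oo (fun n => cbox n%:R)).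
move=> /(_ _)[].
  move=> g Kg; have [n ng] := cbox_cover Phi g.
  exists ([set h | forall j, `|coord j (h - g)| < 1], [set m | (n < m)%N]).
    by split; [exact: (nbhs_coord_lt PhiD PhiH)|exists n.+1].
  move=> [h m] [/= hg nm] j; rewrite -(subrK g h) (coordD PhiD).
  apply: (le_trans (ler_normD _ _)); apply: (@le_trans _ _ (1 + n%:R)).
    by apply: lerD; [exact/ltW/hg|exact: ng].
  by rewrite addrC natr1 ler_nat.
by move=> N _ KN; exists N; exact: (KN N (leqnn _)).
Qed.

Lemma near_shift (K U : set dual) : compact K -> open U -> K `<=` U ->
  nbhs (0 : dual) [set a | forall k, K k -> U (k + a)].
Proof.
move=> cK oU KU; have := cK; rewrite compact_near_coveringP.
move=> /(_ dual (nbhs (0 : dual)) (fun a => [set k | U (k + a)]) _); apply.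
move=> k Kk; have [eps e0 H] := nbhs_coord PhiD PhiH (open_nbhs_nbhs (conj oU (KU _ Kk))).
have e2 : 0 < eps / 2 by rewrite divr_gt0.
exists ([set h | forall j, `|coord j (h - k)| < eps / 2], [set a | forall j, `|coord j (a - 0)| < eps / 2]).
  by split; exact: (nbhs_coord_lt PhiD PhiH).
move=> [h a] [/= hk a0]; apply: H => j; rewrite addrAC (coordD PhiD) [eps]splitr.
by apply: (le_lt_trans (ler_normD _ _)); apply: ltrD; [exact: hk|have := a0 j; rewrite subr0].
Qed.

Lemma integral_tail (h : dual -> R) (eps : R) : nu.-integrable setT (EFin \o h) ->
  (forall g, 0 <= h g) -> 0 < eps ->
  exists n : nat, (\int[nu]_g (h g * \1_(~` cbox n%:R) g)%:E < eps%:E)%E.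
Proof.
move=> ih h0; apply: (@dominated_small _ _ _ nu _ h) => //.
- move=> n; apply: measurable_funM.
    by apply/measurable_EFinP; exact: (measurable_int _ ih).
  by apply: measurable_indic; apply: measurableC; exact: cbox_measurable PhiH _.
- move=> g; have [n ng] := cbox_cover Phi g.
  apply: cvg_near_cst; exists n => // m /= nm; rewrite indicE memNset ?mulr0//.
  by move=> /(_ (cboxS _ ng)); apply; rewrite ler_nat.
- by move=> n g; rewrite mulr_ge0//= ler_piMr// indicE; case: (_ \in _).
Qed.

End dual_haar.

(** * Continuity of translation in $L^1$ of the dual group *)

Section translation_continuity.
Context (R : realType) (G : topologicalZmodType).
Local Notation dual := (dual_group R G).
Context (nu : {measure set (borel dual) -> \bar R}) (haar_nu : is_haar nu).
Context (d e : nat) (Phi : dual -> 'rV[R]_d * 'rV[int]_e).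
Hypothesis PhiD : forall a b, Phi (a + b) = Phi a + Phi b.
Hypothesis PhiH : homeomorphism Phi.
Implicit Types phi psi : borel dual -> R[i].
Let mshift := measurable_gshift PhiD PhiH.

(** Continuity at 0 of the translation orbit of [phi] in $L^1$. It feeds the decay of inverse
    transforms and the uniform continuity of convolutions. *)
Definition tcont phi := forall eps : R, 0 < eps ->
  nbhs (0 : dual) [set a | (L1 nu (fun g => phi (gshift a g) - phi g)%R < eps%:E)%E].

Lemma cmeas_shiftB (a : dual) phi : cmeas phi ->
  cmeas (fun g => phi (gshift a g) - phi g).
Proof. by move=> mp; apply: cmeasB => //; exact: (cmeas_shift mshift a mp). Qed.

(** A three-term estimate: by invariance, the translated error has the same norm as the error. *)
Lemma tcont_approx phi : cmeas phi ->
  (forall eps : R, 0 < eps -> exists psi, [/\ cmeas psi, tcont psi &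
    (L1 nu (fun g => phi g - psi g)%R < eps%:E)%E]) -> tcont phi.
Proof.
move=> mphi H eps e0; have e3 : 0 < eps / 3 by rewrite divr_gt0.
have [psi [mpsi tpsi cl]] := H _ e3; have := tpsi _ e3.
apply: filterS => a /= ha.
have mB : cmeas (fun g => phi g - psi g) by exact: cmeasB.
have -> : (fun g => phi (gshift a g) - phi g) = (fun g =>
   ((phi (gshift a g) - psi (gshift a g)) + (psi (gshift a g) - psi g)) + (-1) * (phi g - psi g)).
  by apply/funext => g; ring.
have m1 := cmeas_shift mshift a mB.
have m2 := cmeas_shiftB a mpsi.
have m3 : cmeas (fun g => (-1) * (phi g - psi g)) by apply: cmeasM => //; exact: cmeas_cst.
have m12 := cmeasD m1 m2.
apply: (le_lt_trans (L1D nu m12 m3)).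
have -> : eps = eps / 3 + eps / 3 + eps / 3 by field.
rewrite EFinD; apply: lteD; last first.
  by rewrite L1Z// normcN normc1 mul1e.
apply: (le_lt_trans (L1D nu m1 m2)).
rewrite EFinD; apply: lteD => //.
by have /= -> := L1_shift haar_nu mshift a mB.
Qed.

Lemma tcontD phi psi : cmeas phi -> cmeas psi -> tcont phi -> tcont psi ->
  tcont (fun g => phi g + psi g).
Proof.
move=> mphi mpsi tphi tpsi eps e0; have e2 : 0 < eps / 2 by rewrite divr_gt0.
apply: filterS2 (tphi _ e2) (tpsi _ e2) => a /= h1 h2.
rewrite (_ : (fun _ => _) = (fun g => (phi (gshift a g) - phi g) + (psi (gshift a g) - psi g))).
  apply: (le_lt_trans (L1D nu (cmeas_shiftB a mphi) (cmeas_shiftB a mpsi))).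
  by rewrite [eps]splitr EFinD; apply: lteD.
by apply/funext => g; ring.
Qed.

Lemma tcont0 : tcont (fun=> 0).
Proof.
move=> eps e0; apply: filterE => a /=; rewrite /L1.
by under eq_integral do rewrite subr0 normc0; rewrite integral0 lte_fin.
Qed.

Lemma tcontZ (c : R[i]) phi : cmeas phi -> tcont phi -> tcont (fun g => c * phi g).
Proof.
move=> mphi tphi eps e0.
have c0 : 0 < normc c + 1 by rewrite ltr_wpDl ?normc_ge0.
have := tphi _ (divr_gt0 e0 c0); apply: filterS => a /= h.
rewrite (_ : (fun _ => _) = (fun g => c * (phi (gshift a g) - phi g))); last first.
  by apply/funext => g; rewrite mulrBr.
rewrite L1Z; last exact: cmeas_shiftB.
apply: (@le_lt_trans _ _ ((normc c + 1)%:E * L1 nu (fun g => phi (gshift a g) - phi g)%R)%E).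
  by apply: lee_wpmul2r; [exact: L1_ge0|rewrite lee_fin lerDl].
by rewrite muleC -lte_pdivlMr// -EFinM.
Qed.

(** Pointwise $|1_A-1_B|+1_A+1_B\le 2\cdot 1_U$. Integration bounds the distance by
    $2\nu(U)-\nu(A)-\nu(B)$, with no reference to the intersection of [A] and [B]. *)
Lemma L1_indic_close (A B U : set (borel dual)) (eps : R) :
  measurable A -> measurable B -> measurable U -> A `<=` U -> B `<=` U ->
  nu A \is a fin_num -> nu B \is a fin_num ->
  (nu U < nu A + (eps / 2)%:E)%E -> (nu U < nu B + (eps / 2)%:E)%E ->
  (L1 nu (fun g => (\1_A g : R)%:C - (\1_B g : R)%:C)%R < eps%:E)%E.
Proof.
move=> mA mB mU AU BU Af Bf UA UB.
have Uf : nu U \is a fin_num.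
  rewrite ge0_fin_numE//; apply: lt_trans UA _; rewrite -(fineK Af) -EFinD.
  exact: ltry.
have key : (L1 nu (fun g => (\1_A g : R)%:C - (\1_B g : R)%:C)%R + (nu A + nu B) <= nu U + nu U)%E.
  rewrite -!(@L1_indic _ _ R nu)// -!/(L1 _ _).
  have mi (S : set (borel dual)) : measurable S ->
      measurable_fun setT (fun g => (normc (\1_S g : R)%:C)%:E).
    by move=> mS; apply: measurable_enormc; exact: cmeas_indic.
  have mAB : measurable_fun setT (fun g => (normc ((\1_A g : R)%:C - (\1_B g : R)%:C))%:E).
    by apply: measurable_enormc; apply: cmeasB; exact: cmeas_indic.
  rewrite /L1 -!ge0_integralD//; try (by [exact: mi | apply: emeasurable_funD; exact: mi
     | move=> g _; rewrite ?adde_ge0 ?lee_fin ?normc_ge0]).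
  apply: ge0_le_integral => //.
  - by move=> g _; rewrite !adde_ge0 ?lee_fin ?normc_ge0.
  - by apply: emeasurable_funD => //; apply: emeasurable_funD; exact: mi.
  - by apply: emeasurable_funD; exact: mi.
  - move=> g _; rewrite -!EFinD lee_fin -rmorphB !normc_real !indicE.
    have [gA|gA] := boolP (g \in A); have [gB|gB] := boolP (g \in B).
    - by rewrite (mem_set (AU _ (set_mem gA)))/= subrr normr0 normr1 add0r.
    - by rewrite (mem_set (AU _ (set_mem gA)))/= subr0 normr0 normr1 addr0.
    - by rewrite (mem_set (BU _ (set_mem gB)))/= sub0r normrN normr0 normr1 add0r.
    - by rewrite /= subr0 normr0 !add0r; apply: addr_ge0.
move: key UA UB; rewrite -(fineK Uf) -(fineK Af) -(fineK Bf) -!EFinD !lte_fin => key UA UB.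
have : (L1 nu (fun g => (\1_A g : R)%:C - (\1_B g : R)%:C)%R <=
  (fine (nu U) + fine (nu U) - (fine (nu A) + fine (nu B)))%:E)%E.
  by rewrite EFinB leeBrDr.
by move/le_lt_trans; apply; rewrite lte_fin; lra.
Qed.

Lemma haar_outer (A : set (borel dual)) (eps : R) : measurable A ->
  nu A \is a fin_num -> 0 < eps ->
  exists U : set dual, [/\ open U, A `<=` U & (nu U < nu A + eps%:E)%E].
Proof.
move=> mA Af e0; have [_ _ _ + _] := haar_nu => /(_ A mA) outer.
have Af' : ereal_inf [set nu U | U in [set U : set dual | open U /\ A `<=` U]] \is a fin_num.
  by rewrite -outer.
have [_ [U [oU AU] <-] Ult] := lb_ereal_inf_adherent e0 Af'.
by exists U; split => //; rewrite outer.
Qed.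

Lemma haar_inner (U : set dual) (eps : R) : open U ->
  nu U \is a fin_num -> 0 < eps ->
  exists K : set dual, [/\ compact K, K `<=` U & (nu U < nu K + eps%:E)%E].
Proof.
move=> oU Uf e0; have [_ _ _ _ /(_ U oU) inner] := haar_nu.
have Uf' : ereal_sup [set nu K | K in [set K : set dual | compact K /\ K `<=` U]] \is a fin_num.
  by rewrite -inner.
have [_ [K [cK KU] <-] Klt] := ub_ereal_sup_adherent e0 Uf'.
by exists K; split => //; rewrite inner -lteBlDr.
Qed.

Lemma compact_fin_num (K : set dual) : compact K -> nu K \is a fin_num.
Proof. by move=> cK; rewrite ge0_fin_numE//; have [_ + _ _ _] := haar_nu; exact. Qed.

(** An open [U] barely larger than [K] contains the small translates of [K]; they have the measure
    of [K], so each of them also nearly fills [U]. *)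
Lemma tcont_compact (K : set dual) : compact K -> tcont (fun g => (\1_(K : set (borel dual)) g : R)%:C).
Proof.
move=> cK eps e0; have e2 : 0 < eps / 2 by rewrite divr_gt0.
have mK := dual_compact_measurable PhiD PhiH cK.
have Kf := compact_fin_num cK.
have [U [oU KU nU]] := haar_outer mK Kf e2.
have := near_shift PhiD PhiH cK oU KU; apply: filterS => a /= Ka.
have mKa : measurable (gshift a @^-1` (K : set (borel dual))).
  by rewrite -[X in measurable X]setTI; exact: (mshift a).
apply: (@L1_indic_close (gshift a @^-1` K) K U) => //.
- exact: open_measurable_borel.
- by move=> g /Ka; rewrite /gshift subrK.
- by rewrite (haar_gshift haar_nu).
- by rewrite (haar_gshift haar_nu).
Qed.

(** Inner regularity is given for open sets only. The compact set is therefore taken inside an open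
    [U] around [A], not inside [A]; both nearly fill [U], which is what [L1_indic_close] asks. *)
Lemma tcont_indic (A : set (borel dual)) : measurable A -> (nu A < +oo)%E ->
  tcont (fun g => (\1_A g : R)%:C).
Proof.
move=> mA Ay; have Af : nu A \is a fin_num by rewrite ge0_fin_numE.
apply: tcont_approx => [|eps e0]; first exact: cmeas_indic.
have e2 : 0 < eps / 2 by rewrite divr_gt0.
have [U [oU AU nU]] := haar_outer mA Af e2.
have Uf : nu U \is a fin_num.
  rewrite ge0_fin_numE//; apply: lt_trans nU _; rewrite -(fineK Af) -EFinD.
  exact: ltry.
have [K [cK KU nK]] := haar_inner oU Uf e2.
have mK := dual_compact_measurable PhiD PhiH cK.
exists (fun g => (\1_(K : set (borel dual)) g : R)%:C); split.
- exact: cmeas_indic.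
- exact: tcont_compact.
- apply: (@L1_indic_close A K U) => //; first exact: open_measurable_borel.
  exact: compact_fin_num.
Qed.

Lemma tcont_sum (I : Type) (s : seq I) (F : I -> borel dual -> R[i]) :
  (forall i, cmeas (F i) /\ tcont (F i)) ->
  cmeas (fun g => \sum_(i <- s) F i g) /\ tcont (fun g => \sum_(i <- s) F i g).
Proof.
move=> H; elim: s => [|i s [IHm IHt]].
  under eq_fun do rewrite big_nil.
  by split; [exact: cmeas_cst|exact: tcont0].
under eq_fun do rewrite big_cons.
by have [mi ti] := H i; split; [exact: cmeasD|exact: tcontD].
Qed.

Import HBSimple.

Lemma tcont_sfun (f : {sfun borel dual >-> R}) : nu.-integrable setT (EFin \o f) ->
  tcont (fun g => (f g)%:C).
Proof.
move=> fi.
have -> : (fun g => (f g)%:C) = (fun g => \sum_(y <- finmap.enum_fset (fset_set (range f)))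
    y%:C * (\1_(f @^-1` [set y]) g : R)%:C).
  apply/funext => g; rewrite {1}fimfunE fsbig_finite/=; last exact: (fimfunP f).
  rewrite (big_morph (fun r : R => r%:C) (rmorphD (real_complex R)) (rmorph0 (real_complex R))).
  by apply: eq_bigr => y _; exact: (rmorphM (real_complex R)).
apply: (tcont_sum _ _).2 => y; have mfy : measurable (f @^-1` [set y]).
  exact: measurable_sfunP.
split; first by apply: cmeasM; [exact: cmeas_cst|exact: cmeas_indic].
(* The level set of 0 may have infinite measure, but its term vanishes; the other level sets have
   finite measure by integrability. *)
have [->|y0] := eqVneq y 0.
  by under eq_fun do rewrite mul0r; exact: tcont0.
apply: tcontZ; first exact: cmeas_indic.
apply: tcont_indic => //.
have [mf fy] := integrableP _ _ _ fi.
have : ((`|y|)%:E * nu (f @^-1` [set y]) < +oo)%E.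
  apply: le_lt_trans fy; rewrite -(L1_indic nu mfy) /L1 -ge0_integralZl//; last 2 first.
  - by apply: measurable_enormc; exact: cmeas_indic.
  - by move=> g _; rewrite lee_fin normc_ge0.
  apply: ge0_le_integral => //.
  - by move=> g _; rewrite -EFinM lee_fin mulr_ge0// normc_ge0.
  - by apply: measurable_funeM; apply: measurable_enormc; exact: cmeas_indic.
  - exact: measurableT_comp.
  - move=> g _; rewrite -EFinM lee_fin normc_real indicE.
    by case: (boolP (g \in _)) => [/set_mem/= <-|_]; rewrite ?normr1 ?normr0 ?mulr1 ?mulr0.
case E : (nu (f @^-1` [set y])) => [r| |] //; first by move=> _; exact: ltry.
by rewrite gt0_muley ?lte_fin ?normr_gt0.
Qed.

Lemma tcont_real (h : borel dual -> R) : nu.-integrable setT (EFin \o h) ->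
  tcont (fun g => (h g)%:C).
Proof.
move=> ih; have mh : measurable_fun setT h by apply/measurable_EFinP; exact: (measurable_int _ ih).
apply: tcont_approx => [|eps e0]; first exact: cmeas_real.
have [g_ [ig _ /fine_cvgP[+ /cvgrPdist_lt/(_ _ e0)]]] := approximation_sfun_integrable measurableT ih.
move=> [N1 _ H1] [N2 _ H2]; have n1 := H1 _ (leq_maxl N1 N2); have n2 := H2 _ (leq_maxr N1 N2).
set n := maxn N1 N2 in n1 n2; exists (fun g => (g_ n g)%:C); split.
- by apply: cmeas_real; exact: measurable_funP.
- exact: tcont_sfun.
- rewrite /L1; under eq_integral do rewrite -rmorphB normc_real.
  rewrite /= sub0r normrN in n2; rewrite /= in n1; rewrite -(fineK n1) lte_fin.
  exact: (le_lt_trans (ler_norm _)).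
Qed.

Lemma cintegrable_tcont phi : cintegrable nu phi -> tcont phi.
Proof.
move=> iphi; have [ir ii] := iphi; have [mr mi] := cintegrable_cmeas iphi.
have -> : phi = fun g => (complex.Re (phi g))%:C + 'i%C * (complex.Im (phi g))%:C.
  by apply/funext => g; exact: complexE.
apply: tcontD.
- exact: cmeas_real.
- by apply: cmeasM; [exact: cmeas_cst|exact: cmeas_real].
- exact: tcont_real.
- by apply: tcontZ; [exact: cmeas_real|exact: tcont_real].
Qed.

End translation_continuity.

(** * Characters as functions on the group *)

Section dual_evaluation.
Context (R : realType) (G : topologicalZmodType).
Local Notation dual := (dual_group R G).
Implicit Types (g h : dual) (x y : G).

Lemma normc_dual g x : normc (g x) = 1.
Proof. by have [_ /(_ x) + _] := dualP g; rewrite normcE => /(congr1 (@complex.Re R)). Qed.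

Lemma dual_addr g x y : g (x + y) = g x * g y.
Proof. by have [_ _] := dualP g; exact. Qed.

Lemma dual_neq0 g x : g x != 0.
Proof. by rewrite -normc_eq0 normc_dual oner_eq0. Qed.

Lemma dual_at0 g : g 0 = 1.
Proof. by apply: (mulfI (dual_neq0 g 0)); rewrite -dual_addr addr0 mulr1. Qed.

Lemma inv_unit (z : R[i]) : normc z = 1 -> z^-1 = z^*%C.
Proof.
move=> z1; have z0 : z != 0 by rewrite -normc_eq0 z1 oner_eq0.
by apply: (mulfI z0); rewrite mul_conjc z1 expr1n divff.
Qed.

Lemma dual_opp g x : g (- x) = (g x)^*%C.
Proof.
rewrite -inv_unit ?normc_dual//; apply: (mulfI (dual_neq0 g x)).
by rewrite -dual_addr subrr dual_at0 divff// dual_neq0.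
Qed.

Lemma dual_cont g : continuous (g : G -> R[i]).
Proof. by have [] := dualP g. Qed.

(** In the compact-open topology, convergence to a continuous map is uniform on compact sets. *)
Lemma nbhs_dual_compact g0 (C : set G) (eps : R) : compact C -> 0 < eps ->
  nbhs g0 [set g : dual | forall y, C y -> normc (g y - g0 y) < eps].
Proof.
move=> cC e0.
have cvg1 : {compact-open, (set_val : dual -> {compact-open, G -> R[i]}) @ nbhs g0 --> (g0 : G -> R[i])}.
  exact: (@initial_continuous dual {compact-open, G -> R[i]} set_val g0).
have /(compact_open_fam_compactP (@dual_cont g0)) := cvg1.
pose P : set (G -> R[i]) := [set f | forall y, C y -> normc (f y - g0 y) < eps].
move=> /fam_cvgP/(_ C cC)/(_ P); apply.
apply/uniform_nbhs; exists [set zw : R[i] * R[i] | normc (zw.2 - zw.1) < eps]; split => //.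
rewrite -entourage_ballE; exists eps%:C => /=; first by rewrite ltcR.
move=> [z w] /=; rewrite -ball_normE /ball_/= normcE ltcR; rewrite normcBC; exact.
Qed.

(** On a compact neighbourhood [C] of 0, all characters near a given [g] stay uniformly close to it,
    so continuity of [g] at 0 serves them all at once; compactness of [K] then makes the
    neighbourhood of 0 common. *)
Lemma equicontinuous_at0 (K : set dual) (eps : R) : locally_compact [set: G] ->
  compact K -> 0 < eps ->
  nbhs (0 : G) [set y | forall g, K g -> normc (g y - 1) < eps].
Proof.
move=> lcG cK e0; have e2 : 0 < eps / 2 by rewrite divr_gt0.
have [C C0 [cC _]] := lcG 0 I.
have {}C0 : nbhs (0 : G) C by move: C0; rewrite withinET.
have := cK; rewrite compact_near_coveringP.
move=> /(_ G (nbhs (0 : G)) (fun y => [set g : dual | normc (g y - 1) < eps]) _); apply.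
move=> g Kg.
have n1 : nbhs (0 : G) [set y | normc ((g : dual) y - 1) < eps / 2].
  have /(@cvgrPdist_lt _ R[i] _ _ (nbhs_filter (0 : G))) := @dual_cont g 0.
  have ec : 0 < (eps / 2)%:C by rewrite ltcR.
  by move=> /(_ _ ec); apply: filterS => y; rewrite dual_at0 normcE ltcR normcBC.
exists ([set h : dual | forall y, C y -> normc (h y - (g : dual) y) < eps / 2],
  C `&` [set y | normc ((g : dual) y - 1) < eps / 2]).
  by split; [exact: nbhs_dual_compact|exact: filterI].
move=> [h y] [/= hC [Cy gy]]; rewrite -(subrKA ((g : dual) y)) [eps]splitr.
by apply: (le_lt_trans (le_normcD _ _)); apply: ltrD => //; exact: hC.
Qed.

End dual_evaluation.

(** * Recovering points of the group from Plancherel's identity *)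

Section plancherel.
Context (R : realType) (G : topologicalZmodType).
Local Notation dual := (dual_group R G).
Context (mu : {measure set (borel G) -> \bar R}) (haar_mu : is_haar mu).
Context (nu : {measure set (borel dual) -> \bar R}) (dual_nu : is_dual_haar mu nu).
Context (d e : nat) (Phi : dual -> 'rV[R]_d * 'rV[int]_e).
Hypothesis PhiD : forall a b, Phi (a + b) = Phi a + Phi b.
Hypothesis PhiH : homeomorphism Phi.

Lemma continuous_subr (a : G) : continuous (fun y : G => y - a).
Proof.
move=> y; apply: (@continuous_comp _ _ _ (fun y => (y, - a)) (fun z : G * G => z.1 + z.2)).
  by apply: cvg_pair; [exact: cvg_id|exact: cvg_cst].
exact: add_continuous.
Qed.

Let mshiftG (a : G) : measurable_fun setT (gshift a).
Proof.
apply: (@measurability _ _ _ (borel G) _ _ (@open G)); first by [].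
move=> _ [U oU <-]; rewrite setTI; apply: open_measurable_borel; apply: open_comp => // y _.
exact: continuous_subr.
Qed.

Context (W C : set G) (oW : open W) (W0 : W !=set0) (cC : compact C) (WC : W `<=` C).
Hypothesis hausG : hausdorff_space G.

Let mW : measurable (W : set (borel G)). Proof. exact: open_measurable_borel. Qed.
Let mWy : (mu W < +oo)%E.
Proof.
have [_ + _ _ _] := haar_mu => /(_ C cC); apply: le_lt_trans.
apply: le_measure; rewrite ?inE//.
have : closed C by exact: compact_closed.
move=> /closed_openC oC; rewrite -(setCK C); apply: measurableC.
exact: open_measurable_borel.
Qed.

Lemma measure_open_gt0 : (0 < mu W)%E.
Proof. by have [_ _ + _ _] := haar_mu; exact. Qed.

Let w : borel G -> R[i] := fun y => (\1_(W : set (borel G)) y : R)%:C.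
Let iw : cintegrable mu w. Proof. exact: cintegrable_indic. Qed.

Lemma cintegrable_character (f : borel G -> R[i]) (g : dual) : cintegrable mu f ->
  cintegrable mu (fun y => f y * (g y)^*%C).
Proof.
move=> fi; apply: (@cintegrableMb _ _ _ _ _ _ 1) => //.
  by apply: cmeas_conj; apply: continuous_cmeas_borel; exact: dual_cont.
by move=> y; rewrite normc_conj normc_dual.
Qed.

Lemma fourier_shift (f : borel G -> R[i]) (x : G) (g : dual) : cintegrable mu f ->
  fourier mu (f \o gshift x) g = (g x)^*%C * fourier mu f g.
Proof.
move=> fi; rewrite /fourier -cintegralZ; last exact: cintegrable_character.
rewrite -[RHS](cintegral_shift haar_mu mshiftG x); last first.
  by apply: cintegrableZ; exact: cintegrable_character.
apply: eq_cintegral => y /=; rewrite mulrCA; congr (_ * _).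
by rewrite -conjcM -dual_addr /gshift addrC subrK.
Qed.

Let F : borel dual -> R[i] := fourier mu w.

Lemma fourier_indic_continuous (g0 : dual) : {for g0, continuous (F : dual -> R[i])}.
Proof.
apply/(@cvgrPdist_lt _ R[i] _ _ (nbhs_filter g0)) => eps.
case: eps => eps ie; rewrite ltcE /= => /andP[/eqP -> e0].
have m0 : 0 < fine (mu W) + 1 by rewrite ltr_wpDl// fine_ge0.
have e1 : 0 < eps / (fine (mu W) + 1) by rewrite divr_gt0.
have := nbhs_dual_compact g0 cC e1; apply: filterS => g gC.
rewrite normcE ltcR /F /fourier -cintegralB; try exact: cintegrable_character.
have bnd y : normc (w y * (g0 y)^*%C - w y * (g y)^*%C) <=
    normc ((eps / (fine (mu W) + 1))%:C * w y).
  rewrite -mulrBr normcM mulrC normcM -rmorphB normc_conj normcBC.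
  rewrite /w normc_real indicE; case: (boolP (y \in _)) => [/set_mem Wy|_].
    rewrite normr1 !mulr1 normc_real ger0_norm; last exact: ltW.
    by apply: ltW; apply: gC; exact: WC.
  by rewrite normr0 !mulr0.
have i1 : cintegrable mu (fun y => w y * (g0 y)^*%C - w y * (g y)^*%C).
  by apply: cintegrableB; exact: cintegrable_character.
have h1 := normc_cintegral i1.
have mw := cintegrable_cmeas iw.
have h2 : (L1 mu (fun y => w y * (g0 y)^*%C - w y * (g y)^*%C)%R <=
   L1 mu (fun y => (eps / (fine (mu W) + 1))%:C * w y)%R)%E.
  apply: L1_le => //; first exact: cintegrable_cmeas i1.
  by apply: cmeasM => //; exact: cmeas_cst.
rewrite -lte_fin; apply: (le_lt_trans h1); apply: (le_lt_trans h2).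
rewrite L1Z// L1_indic// normc_real ger0_norm; last exact: ltW.
rewrite -(@fineK _ (mu W)) ?ge0_fin_numE// -EFinM lte_fin.
by rewrite mulrAC ltr_pdivrMr// ltr_pM2l// ltrDl.
Qed.

Let h (g : borel dual) : R := normc (F g) ^+ 2.

Lemma plancherel_indic : (\int[nu]_g (h g)%:E = mu W)%E.
Proof.
have [_ H] := dual_nu; rewrite /h /F.
have sq : (\int[mu]_x (normc (w x) ^+ 2)%:E = mu W)%E.
  rewrite -(L1_indic mu mW) /L1; apply: eq_integral => y _; congr (_%:E).
  by rewrite normc_real real_normK ?num_real// ger0_norm// indicE; case: (_ \in _);
    rewrite ?expr1n ?expr0n.
by rewrite H// sq.
Qed.

(** Disjointness makes the indicators of [W] and of its translate orthogonal, so their sum has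
    squared norm $2\mu(W)$, while its transform is that of [w] times $1+\overline{g(x)}$. *)
Lemma plancherel_shift (x : G) : (forall y, W y -> ~ W (y - x)) ->
  (\int[nu]_g (normc (1 + (g : dual) x) ^+ 2 * h g)%:E = mu W + mu W)%E.
Proof.
move=> disj; have [_ H] := dual_nu.
have iwx : cintegrable mu (w \o gshift x) by exact: (cintegrable_shift haar_mu mshiftG).
have ww : cintegrable mu (fun y => w y + (w \o gshift x) y) by exact: cintegrableD.
have sq : (\int[mu]_y (normc (w y + (w \o gshift x) y) ^+ 2)%:E = mu W + mu W)%E.
  have mw := measurable_enormc (cintegrable_cmeas iw).
  have mwx := measurable_enormc (cintegrable_cmeas iwx).
  have e1 : L1 mu w = mu W by exact: L1_indic.
  have e2 : L1 mu (w \o gshift x) = mu W.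
    by rewrite (L1_shift haar_mu mshiftG)//; exact: cintegrable_cmeas iw.
  rewrite -{1}e1 -e2 /L1 -ge0_integralD//; try by move=> y _; rewrite lee_fin normc_ge0.
  apply: eq_integral => y _; rewrite -EFinD; congr (_%:E).
  rewrite /w /comp -(rmorphD (real_complex R)) !normc_real !indicE.
  have [/set_mem Wy|nWy] := boolP (y \in (W : set (borel G))).
    rewrite memNset; last exact: disj.
    by rewrite /= !(addr0, normr1, normr0, expr1n).
  by rewrite normr0 !add0r real_normK ?num_real// ger0_norm//; case: (_ \in _);
    rewrite ?expr1n ?expr0n.
rewrite -sq -H//; last first.
  rewrite sq; apply: lte_add_pinfty => //.
apply: eq_integral => g _; congr (_%:E).
rewrite /h -exprMn -normcM; congr (_ ^+ 2).
have -> : fourier mu (fun y => w y + (w \o gshift x) y) g =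
    fourier mu w g + fourier mu (w \o gshift x) g.
  rewrite /fourier -cintegralD; try exact: cintegrable_character.
  by apply: eq_cintegral => y; rewrite mulrDl.
have -> : fourier mu w g + fourier mu (w \o gshift x) g = (1 + ((g : dual) x)^*%C) * F g.
  by rewrite fourier_shift// mulrDl mul1r.
rewrite !normcM; congr (_ * _).
by rewrite -normc_conj conjcD conjc1.
Qed.

Let ih : nu.-integrable setT (EFin \o h).
Proof.
have cF := @continuous_cmeas_borel R dual F fourier_indic_continuous.
apply/integrableP; split.
  by apply/measurable_EFinP; apply: measurable_funX; exact: measurable_normc.
under eq_integral do rewrite gee0_abs ?lee_fin ?sqr_ge0//.
by rewrite plancherel_indic.
Qed.

(** If every character were 1 at [x], the left side of [plancherel_shift] would be $4\mu(W)$ instead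
    of $2\mu(W)$. *)
Lemma character_separates (x : G) : (forall y, W y -> ~ W (y - x)) ->
  exists g : dual, g x != 1.
Proof.
move=> disj; apply: contrapT => nex.
have gx (g : dual) : g x = 1.
  by apply/eqP/negP => /negP gx; apply: nex; exists g.
have n2 : normc (1 + 1 : R[i]) = 2.
  by rewrite -(rmorphD (real_complex R)) normc_real ger0_norm.
have := plancherel_shift disj.
under eq_integral do rewrite gx n2 EFinM.
have mh : measurable_fun setT (EFin \o h) by exact: (measurable_int _ ih).
rewrite ge0_integralZl//; last by move=> g _; rewrite lee_fin sqr_ge0.
rewrite plancherel_indic; have := measure_open_gt0.
have mf : mu W \is a fin_num by rewrite ge0_fin_numE.
rewrite -(fineK mf) -EFinM -EFinD lte_fin => m0 [] /eqP.
by apply/negP; rewrite gt_eqF// -subr_gt0 (_ : _ - _ = 2 * fine (mu W)) ?mulr_gt0//; ring.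
Qed.

(** Quantitative form of [character_separates]: the characters of one box carry most of the
    Plancherel mass of the indicator of [W], so a point at which they are all near 1 cannot move [W]
    off itself. *)
Lemma polar_bounded : exists n : nat, forall x : G,
  (forall g : dual, cbox Phi n%:R g -> normc (g x - 1) <= 1 / 2) ->
  exists y, W y /\ W (y - x).
Proof.
have m0 := measure_open_gt0; have mf : mu W \is a fin_num by rewrite ge0_fin_numE.
have m1 : 0 < fine (mu W) by rewrite -lte_fin fineK.
(* On the box $|1+g(x)|\ge 3/2$, so disjoint translates would give
   $\frac94\cdot\frac9{10}\,\mu(W)\le 2\mu(W)$; one tenth is small enough to make this false. *)
have eps0 : 0 < fine (mu W) / 10 by rewrite divr_gt0.
have [n hn] := integral_tail PhiH ih (fun g => sqr_ge0 _) eps0.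
exists n => x xn; apply: contrapT => nex.
have disj y : W y -> ~ W (y - x) by move=> Wy Wyx; apply: nex; exists y.
have mh : measurable_fun setT (EFin \o h) by exact: (measurable_int _ ih).
have h0 g : 0 <= h g by exact: sqr_ge0.
have mK : measurable (~` cbox Phi n%:R : set (borel dual)).
  by apply: measurableC; exact: cbox_measurable PhiH _.
have mx : measurable_fun setT (fun g : borel dual => normc (1 + (g : dual) x)).
  apply: measurable_normc; apply: cmeasD; first exact: cmeas_cst.
  by have [] := @eval_measurable R G x.
have mt : measurable_fun setT (fun g : borel dual => (h g * \1_(~` cbox Phi n%:R) g)%:E).
  apply/measurable_EFinP; apply: measurable_funM; last exact: measurable_indic.
  exact/measurable_EFinP.
have mp : measurable_fun setT (fun g : borel dual => (normc (1 + (g : dual) x) ^+ 2 * h g)%:E).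
  apply/measurable_EFinP; apply: measurable_funM; first exact: measurable_funX.
  exact/measurable_EFinP.
have key : ((9 / 4)%:E * mu W <= (mu W + mu W) + (9 / 4)%:E *
    \int[nu]_g (h g * \1_(~` cbox Phi n%:R) g)%:E)%E.
  rewrite -(plancherel_shift disj) -{1}plancherel_indic.
  rewrite -!ge0_integralZl//; last 2 first.
  - by move=> g _; rewrite lee_fin mulr_ge0// sqr_ge0.
  - by move=> g _; rewrite lee_fin sqr_ge0.
  rewrite -ge0_integralD//; last 3 first.
  - by move=> g _; rewrite lee_fin mulr_ge0// sqr_ge0.
  - by move=> g _; rewrite -EFinM lee_fin; apply: mulr_ge0 => //; apply: mulr_ge0.
  - exact: measurable_funeM.
  apply: ge0_le_integral => //.
  - by move=> g _; rewrite -EFinM lee_fin mulr_ge0// sqr_ge0.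
  - exact: measurable_funeM.
  - by apply: emeasurable_funD => //; exact: measurable_funeM.
  - move=> g _; rewrite -!EFinM -EFinD lee_fin indicE.
    have [gn|gn] := pselect (cbox Phi n%:R g); last first.
      rewrite mem_set// mulr1 lerDr mulr_ge0// sqr_ge0//.
    rewrite memNset; last by apply.
    rewrite !mulr0 addr0 ler_wpM2r// ?sqr_ge0//.
    have : 3 / 2 <= normc (1 + (g : dual) x).
      have /= := xn g gn => h1.
      have : normc (1 + 1 : R[i]) <= normc (1 + (g : dual) x) + normc ((g : dual) x - 1).
        rewrite (normcBC ((g : dual) x)); apply: le_trans (le_normcD _ _).
        by rewrite (_ : 1 + _ + _ = 1 + 1)//; ring.
      rewrite -(rmorphD (real_complex R)) normc_real ger0_norm//; lra.
    by move=> h1; rewrite (_ : 9 / 4 = (3 / 2) ^+ 2) ?ler_sqr ?nnegrE ?normc_ge0//; field.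
have tf : (\int[nu]_g (h g * \1_(~` cbox Phi n%:R) g)%:E \is a fin_num)%E.
  rewrite ge0_fin_numE; first exact: lt_trans hn (ltry _).
  by apply: integral_ge0 => g _; rewrite lee_fin mulr_ge0.
move: key hn; rewrite -(fineK mf) -(fineK tf).
rewrite -!EFinM -!EFinD lee_fin lte_fin; lra.
Qed.

End plancherel.

(** * Closed subgroups of a real vector space and integral linear forms *)

Section closed_subgroups.
Context (R : realType).

Definition is_subgroup (V : zmodType) (H : set V) :=
  H 0 /\ forall a b, H a -> H b -> H (a - b).

Lemma subgroupN (V : zmodType) (H : set V) a : is_subgroup H -> H a -> H (- a).
Proof. by move=> [H0 HB] Ha; rewrite -sub0r; exact: HB. Qed.

Lemma subgroupD (V : zmodType) (H : set V) a b : is_subgroup H -> H a -> H b -> H (a + b).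
Proof. by move=> sH Ha Hb; rewrite -(opprK b); apply: sH.2 => //; exact: subgroupN. Qed.

Lemma subgroup_int (V : zmodType) (H : set V) a (k : int) : is_subgroup H -> H a -> H (a *~ k).
Proof.
move=> sH Ha; have Hn n : H (a *+ n).
  by elim: n => [|n IH]; rewrite ?mulr0n ?mulrS; [exact: sH.1|exact: subgroupD].
by case: k => n; rewrite ?NegzE ?mulrNz; [exact: Hn|apply: subgroupN => //; exact: Hn].
Qed.

Lemma subgroup_sum (V : zmodType) (H : set V) (I : Type) (s : seq I) (F : I -> V) :
  is_subgroup H -> (forall i, H (F i)) -> H (\sum_(i <- s) F i).
Proof.
by move=> sH HF; elim/big_ind: _ => //; [exact: sH.1|move=> x y; exact: subgroupD].
Qed.

Lemma nbhs_rV n (w : 'rV[R]_n) (A : set 'rV[R]_n) : nbhs w A ->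
  exists2 eps : R, 0 < eps & forall w' : 'rV[R]_n, (forall j, `|w 0 j - w' 0 j| < eps) -> A w'.
Proof.
move=> /nbhs_ballP[eps /= e0 H]; exists eps => // w' h; apply: H; split => // i j.
by rewrite (ord1 i); exact: h.
Qed.

Lemma near_rV n (w : 'rV[R]_n) (eps : R) : 0 < eps ->
  nbhs w [set w' : 'rV[R]_n | forall j, `|w 0 j - w' 0 j| < eps].
Proof.
by move=> e0; apply/nbhs_ballP; exists eps => //= w' [_ h] j; exact: h.
Qed.

Lemma closed_rV n (H : set 'rV[R]_n) (w : 'rV[R]_n) : closed H ->
  (forall eps : R, 0 < eps -> exists2 h : 'rV[R]_n, H h & forall j, `|w 0 j - h 0 j| < eps) -> H w.
Proof.
move=> cH wH; apply: cH => A /nbhs_rV[eps e0 hA].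
by have [h Hh wh] := wH _ e0; exists h; split => //; exact: hA.
Qed.

Lemma rV_coord_le n (w : 'rV[R]_n) j : `|w 0 j| <= `|w|.
Proof.
rewrite [leRHS](mx_normrE w).
exact: (le_bigmax _ (fun ij : 'I_1 * 'I_n => `|w ij.1 ij.2|) (0, j)).
Qed.

Lemma rV_norm_le n (w : 'rV[R]_n) (b : R) : 0 <= b -> (forall j, `|w 0 j| <= b) ->
  `|w| <= b.
Proof.
move=> b0 wb; rewrite [leLHS](mx_normrE w); apply/bigmax_leP; split => // -[i j] _ /=.
by rewrite (ord1 i).
Qed.

Lemma mulmx_continuous m n (D : 'M[R]_(m, n)) : continuous (fun w : 'rV[R]_m => w *m D).
Proof.
move=> w A /nbhs_rV[eps e0 wA].
pose b := \sum_k \sum_j `|D k j| + 1.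
have S0 : 0 <= \sum_k \sum_j `|D k j| by apply: sumr_ge0 => k _; exact: sumr_ge0.
have b0 : 0 < b by rewrite ltr_wpDl.
have := near_rV w (divr_gt0 e0 b0); apply: filterS => w' h; apply: wA => j.
rewrite !mxE -sumrB; apply: (le_lt_trans (ler_norm_sum _ _ _)).
apply: (@le_lt_trans _ _ (\sum_k (eps / b) * \sum_i `|D k i|)).
  apply: ler_sum => k _; rewrite -mulrBl normrM; apply: ler_pM => //; first exact/ltW/h.
  by rewrite (bigD1 j)//= lerDl sumr_ge0.
by rewrite -mulr_sumr mulrAC ltr_pdivrMr// ltr_pM2l// ltrDl.
Qed.

Definition has_integral_form n (H : set 'rV[R]_n) :=
  exists2 a : 'cV[R]_n, a != 0 & forall h, H h -> exists k : int, (h *m a) 0 0 = k%:~R.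

Lemma line_subgroup_step n (H : set 'rV[R]_(1 + n)) (v : 'rV[R]_(1 + n)) :
  (forall H' : set 'rV[R]_n, closed H' -> is_subgroup H' -> H' = setT \/ has_integral_form H') ->
  closed H -> is_subgroup H -> v != 0 -> (forall t : R, H (t *: v)) ->
  H = setT \/ has_integral_form H.
Proof.
move=> IH cH sH v0 Hv.
pose B := row_ebase v; have uB : B \in unitmx by exact: row_ebase_unit.
(* The rank-one factorization of the row [v] exhibits it as a nonzero multiple of the first row of
   the invertible matrix [B]. *)
have [c c0 vE] : exists2 c : R, c != 0 & v = c *: (row_mx 1%:M 0 *m B).
  have rv : \rank v = 1%N by rewrite rank_rV v0.
  exists ((col_ebase v) 0 0).
    have := col_ebase_unit v; rewrite {1}[col_ebase v]mx11_scalar unitmxE det_scalar.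
    by rewrite expr1 unitfE.
  rewrite -[LHS]mulmx_ebase rv {1}[col_ebase v]mx11_scalar pid_mx_row mul_scalar_mx.
  by rewrite -scalemxAl.
have Hl (x : 'rV[R]_1) : H (row_mx x 0 *m B).
  have -> : row_mx x 0 *m B = (x 0 0 / c) *: v.
    rewrite vE scalerA divfK// [x in LHS]mx11_scalar scalemxAl; congr (_ *m _).
    by rewrite scale_row_mx scaler0 scalemx1.
  exact: Hv.
have dec (h : 'rV[R]_(1 + n)) : exists x y, h = row_mx x 0 *m B + row_mx 0 y *m B.
  exists (lsubmx (h *m invmx B)), (rsubmx (h *m invmx B)).
  by rewrite -mulmxDl add_row_mx addr0 add0r hsubmxK mulmxKV.
pose H' : set 'rV[R]_n := [set w | H (row_mx 0 w *m B)].
have H'E w : row_mx 0 w *m B = w *m dsubmx B.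
  by rewrite -{1}[B]vsubmxK mul_row_col mul0mx add0r.
have cH' : closed H'.
  have -> : H' = (fun w => w *m dsubmx B) @^-1` H.
    by apply/seteqP; split => w /=; rewrite /H'/= H'E.
  by apply: closed_comp => // w _; exact: mulmx_continuous.
have sH' : is_subgroup H'.
  split; first by rewrite /H' /= row_mx0 mul0mx; exact: sH.1.
  move=> a b Ha Hb; rewrite /H' /= (_ : row_mx 0 (a - b) = row_mx 0 a - row_mx 0 b).
    by rewrite mulmxBl; exact: sH.2.
  by rewrite opp_row_mx add_row_mx oppr0 addr0.
have [HT|[a a0 aH]] := IH H' cH' sH'; [left|right].
  apply/seteqP; split => // h _; have [x [y ->]] := dec h.
  by apply: (subgroupD sH (Hl x)); have : H' y by rewrite HT.
exists (invmx B *m col_mx 0 a).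
  apply: contra a0 => /eqP /(congr1 (mulmx B)); rewrite mulKVmx// mulmx0.
  by move=> /(congr1 dsubmx); rewrite col_mxKd linear0 => ->.
move=> h Hh; have [x [y hE]] := dec h.
have Hy : H' y.
  rewrite /H' /= (_ : _ *m _ = h - row_mx x 0 *m B); first by apply: sH.2 => //; exact: Hl.
  by rewrite hE addrC addKr.
have [k kE] := aH _ Hy; exists k; rewrite -kE hE -mulmxDl add_row_mx addr0 add0r.
by rewrite -mulmxA mulKVmx// mul_row_col mulmx0 add0r.
Qed.

Lemma sphere_compact n : compact [set u : 'rV[R]_n | `|u| = 1].
Proof.
apply: bounded_closed_compact.
  by exists 1; split; [exact: num_real|move=> x x1 u /= ->; exact: ltW].
have -> : [set u : 'rV[R]_n | `|u| = 1] = (fun u => `|u|) @^-1` [set 1].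
  by apply/seteqP; split.
apply: closed_comp; last exact: (accessible_closed_set1 (hausdorff_accessible (@norm_hausdorff _ R^o))).
by move=> u _; exact: norm_continuous.
Qed.

(** If nonzero elements [h k] of [H] tend to 0, their directions accumulate at a unit vector [v];
    integer multiples of [h k] come arbitrarily close to every $tv$, and closedness puts the line in
    [H]. *)
Lemma no_line_discrete n (H : set 'rV[R]_n) : closed H -> is_subgroup H ->
  (forall v, v != 0 -> exists t : R, ~ H (t *: v)) ->
  exists2 rho : R, 0 < rho & forall h, H h -> `|h| < rho -> h = 0.
Proof.
move=> cH sH nl; apply: contrapT => nd.
have ex k : {h | [/\ H h, h != 0 & `|h| < k.+1%:R^-1]}.
  apply: cid; apply: contrapT => nk; apply: nd; exists k.+1%:R^-1; first by rewrite invr_gt0.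
  by move=> h Hh hk; apply/eqP/negP => /negP h0; apply: nk; exists h.
pose h k := sval (ex k); pose u k := `|h k|^-1 *: h k.
have hk k : [/\ H (h k), 0 < `|h k| & `|h k| < k.+1%:R^-1].
  by have [? h0 ?] := svalP (ex k); split => //; rewrite normr_gt0.
have u1 k : `|u k| = 1.
  by have [_ h0 _] := hk k; rewrite normrZ normfV normr_id mulVf// gt_eqF.
have hE k : h k = `|h k| *: u k.
  by have [_ h0 _] := hk k; rewrite scalerA divff ?gt_eqF// scale1r.
have [v [v1 vcl]] : [set u : 'rV[R]_n | `|u| = 1] `&` cluster (u @ \oo) !=set0.
  by apply: (@sphere_compact n); exists 0%N => // k _; exact: u1.
have v0 : v != 0 by rewrite -normr_eq0 v1 oner_eq0.
have [t] := nl _ v0; apply; apply: (@closed_rV n) => // eps e0.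
have e2 : 0 < eps / 2 by rewrite divr_gt0.
have t1 : 0 < `|t| + 1 by rewrite ltr_wpDl.
pose N := Num.bound (eps / 2)^-1.
have tail : (u @ \oo) [set w | exists2 k, (N <= k)%N & w = u k].
  by exists N => // k /= Nk; exists k.
have [_ [[k Nk ->] /= uk]] := vcl _ _ tail (near_rV v (divr_gt0 e2 t1)).
have [Hk h0 hs] := hk k.
(* Rounds [t] down to a multiple of the length of [h k]; the error is at most that length. *)
pose m := Num.floor (t / `|h k|).
exists (h k *~ m) => [|j]; first exact: subgroup_int.
have hsmall : `|h k| < eps / 2.
  apply: (lt_trans hs); rewrite -[ltRHS]invrK ltf_pV2 ?posrE ?invr_gt0//.
  apply: (lt_trans (archi_boundP (ltW _))); first by rewrite invr_gt0.
  by rewrite ltr_nat ltnS.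
have mE : (h k *~ m) 0 j = m%:~R * `|h k| * u k 0 j.
  by rewrite -scaler_int {1}hE mxE mxE mulrA.
have tm : `|t - m%:~R * `|h k| | <= `|h k|.
  have fl := floor_itv (t / `|h k|); move: fl; rewrite -/m => /andP[f1 f2].
  rewrite ger0_norm; last by rewrite subr_ge0 -ler_pdivlMr.
  by rewrite ltr_pdivrMr// intrD mulrDl mul1r in f2; rewrite lerBlDl; exact: ltW.
have uj : `|u k 0 j| <= 1 by rewrite -(u1 k) rV_coord_le.
rewrite mE mxE.
have -> : t * v 0 j - m%:~R * `|h k| * u k 0 j =
  t * (v 0 j - u k 0 j) + (t - m%:~R * `|h k|) * u k 0 j by ring.
rewrite [eps]splitr; apply: (le_lt_trans (ler_normD _ _)).
rewrite !normrM; apply: ler_ltD.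
  apply: (@le_trans _ _ ((`|t| + 1) * (eps / 2 / (`|t| + 1)))).
    by apply: ler_pM => //; [rewrite lerDl|exact/ltW/uk].
  by rewrite mulrC divfK// gt_eqF.
apply: le_lt_trans hsmall; rewrite -[leRHS]mulr1; exact: ler_pM.
Qed.

(** Provides a basis of the span of [H] made of elements of [H]: an element outside the span would
    enlarge a maximal free family. *)
Lemma maximal_free_rows n (H : set 'rV[R]_n) :
  exists r (A : 'M[R]_(r, n)), [/\ forall i, H (row i A), row_free A &
    forall h, H h -> (h <= A)%MS].
Proof.
pose P r := `[< exists A : 'M[R]_(r, n), (forall i, H (row i A)) /\ row_free A >].
have P0 : exists r, P r.
  exists 0%N; apply/asboolP; exists 0; split; first by case.
  by rewrite /row_free mxrank0.
have Pn r : P r -> (r <= n)%N.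
  by move=> /asboolP[A [_ /eqP <-]]; exact: rank_leq_col.
case: (ex_maxnP P0 Pn) => r /asboolP[A [HA fA]] maxr.
exists r, A; split => // h Hh; apply/negPn/negP => nh.
have : P (1 + r)%N.
  apply/asboolP; exists (col_mx h A); split.
    move=> i; case: (split_ordP i) => k ->.
      by rewrite rowKu row_id.
    by rewrite rowKd.
  rewrite /row_free eqn_leq rank_leq_row /=.
  have lt : (A < col_mx h A)%MS.
    rewrite ltmxE; apply/andP; split; first by rewrite -addsmxE addsmxSr.
    by apply: contra nh; rewrite -addsmxE addsmx_sub => /andP[].
  by move: lt; rewrite ltmxErank (eqP fA) => /andP[].
by move=> /maxr; rewrite ltnn.
Qed.

Definition fracr (x : R) := x - (Num.floor x)%:~R.

Lemma fracr_itv x : 0 <= fracr x < 1.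
Proof.
have /andP[f1 f2] := floor_itv x; rewrite subr_ge0 f1 /= ltrBlDl.
by move: f2; rewrite intrD.
Qed.

(* Pigeonhole: two of the vectors of fractional parts of [j c], [j <= q], fall
   into the same cell of side [1 / N.+1]. *)
Lemma fracr_pigeonhole r N (c : 'I_r -> R) (q := #|{ffun 'I_r -> 'I_N.+1}|) :
  exists j1 j2 : nat, [/\ (j1 < j2)%N, (j2 <= q)%N &
    forall i, `|fracr (j2%:R * c i) - fracr (j1%:R * c i)| < N.+1%:R^-1].
Proof.
pose cell (j : nat) (i : 'I_r) : nat := Num.truncn (N.+1%:R * fracr (j%:R * c i)).
have N0 : (0 : R) < N.+1%:R by [].
have cellP j i : (cell j i)%:R <= N.+1%:R * fracr (j%:R * c i) < (cell j i).+1%:R.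
  by apply: truncn_itv; rewrite mulr_ge0//; have /andP[] := fracr_itv (j%:R * c i).
have cellN j i : (cell j i < N.+1)%N.
  have /andP[h _] := cellP j i; rewrite -(ltr_nat R); apply: (le_lt_trans h).
  by rewrite gtr_pMr//; have /andP[] := fracr_itv (j%:R * c i).
pose f (j : 'I_q.+1) : {ffun 'I_r -> 'I_N.+1} := [ffun i => Ordinal (cellN j i)].
have : ~~ injectiveb f.
  by apply/negP => /injectiveP/leq_card; rewrite card_ord ltnn.
move=> /injectivePn[k1 [k2 k12 fE]].
have dist (j1 j2 : 'I_q.+1) i : f j1 = f j2 ->
    `|fracr (j2%:R * c i) - fracr (j1%:R * c i)| < N.+1%:R^-1.
  move=> /ffunP/(_ i); rewrite !ffunE => /(congr1 val) /= E.
  have /andP[a1 a2] := cellP j1 i; have /andP[b1 b2] := cellP j2 i.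
  rewrite E -natr1 in a1 a2; rewrite -natr1 in b2.
  rewrite -[ltRHS]mul1r ltr_pdivlMr// -(ger0_norm (ltW N0)) -normrM mulrC mulrBr.
  by rewrite ltr_norml; apply/andP; split; lra.
case: (ltngtP k1 k2) => [lt|lt|/val_inj E].
- by exists k1, k2; split => //; [rewrite -ltnS|move=> i; exact: dist].
- by exists k2, k1; split => //; [rewrite -ltnS|move=> i; exact: dist].
- by rewrite E eqxx in k12.
Qed.

(** In the basis [A], elements of [H] have rational coordinates with bounded denominators: by
    pigeonhole some $(j_2-j_1)h$ differs from an integer combination of the basis by an element of
    [H] shorter than [rho], hence by 0. *)
Lemma discrete_integral_form n (H : set 'rV[R]_n.+1) (rho : R) : is_subgroup H ->
  0 < rho -> (forall h, H h -> `|h| < rho -> h = 0) -> has_integral_form H.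
Proof.
move=> sH rho0 Hrho; have [r [A [HA fA hA]]] := maximal_free_rows H.
case: r A HA fA hA => [|r] A HA fA hA.
  (* An empty basis means that [H] is zero, and any nonzero form is integral on it. *)
  exists (const_mx 1); first by apply/eqP => /matrixP/(_ 0 0)/eqP; rewrite !mxE oner_eq0.
  move=> h /hA/submxP[D ->]; exists 0.
  by rewrite (thinmx0 D) !mul0mx mxE.
pose b := \sum_k \sum_j `|A k j| + 1.
have S0 : 0 <= \sum_k \sum_j `|A k j| by apply: sumr_ge0 => k _; exact: sumr_ge0.
have b0 : 0 < b by rewrite ltr_wpDl.
(* With this [N], coordinates smaller than $1/(N+1)$ in the basis [A] give a vector shorter than
   [rho], as [b] bounds the entries of [A]. *)
pose N := Num.bound (b / rho).
have N0 : (0 : R) < N.+1%:R by [].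
have bN : b / N.+1%:R < rho.
  rewrite ltr_pdivrMr// mulrC -ltr_pdivrMr//.
  apply: (lt_trans (archi_boundP (ltW _))); first by rewrite divr_gt0.
  by rewrite ltr_nat.
pose q := #|{ffun 'I_r.+1 -> 'I_N.+1}|.
(* The form is $q!$ times the first coordinate in the basis [A]; the factorial clears every
   denominator $j_2-j_1\le q$. *)
exists (pinvmx A *m ((q`!)%:R *: delta_mx 0 0 : 'cV[R]_r.+1)).
  apply/eqP => /(congr1 (mulmx A)); rewrite mulmxA mulmxVp// mul1mx mulmx0.
  move=> /matrixP/(_ 0 0)/eqP; rewrite !mxE !eqxx mulr1 pnatr_eq0.
  by apply/negP; rewrite -lt0n fact_gt0.
move=> h Hh; have /submxP[c hE] := hA _ Hh.
have -> : (h *m (pinvmx A *m ((q`!)%:R *: delta_mx 0 0 : 'cV[R]_r.+1))) 0 0 = (q`!)%:R * c 0 0.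
  rewrite mulmxA hE -(mulmxA c) mulmxVp// mulmx1 -scalemxAr mxE; congr (_ * _).
  rewrite mxE (bigD1 0)//= mxE !eqxx mulr1 big1 ?addr0// => i i0.
  by rewrite mxE (negbTE i0) mulr0.
have [j1 [j2 [j12 j2q dj]]] := @fracr_pigeonhole r.+1 N (fun i => c 0 i).
pose d : 'rV[R]_r.+1 := \row_i (fracr (j2%:R * c 0 i) - fracr (j1%:R * c 0 i)).
pose z (j : nat) : 'rV[R]_r.+1 := \row_i (Num.floor (j%:R * c 0 i))%:~R.
have dE : d = (j2%:R - j1%:R) *: c - (z j2 - z j1).
  by apply/rowP => i; rewrite !mxE /fracr; ring.
have Hz j : H (z j *m A).
  rewrite mulmx_sum_row; apply: subgroup_sum => // i.
  by rewrite mxE scaler_int; exact: subgroup_int.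
have Hd : H (d *m A).
  rewrite dE mulmxBl mulmxBl -scalemxAl -hE; apply: sH.2; last exact: sH.2.
  rewrite -natrB 1?ltnW// scaler_nat -[_ *+ _]/(h *~ (j2 - j1)%N%:Z).
  exact: subgroup_int.
have d0 : d = 0.
  have : d *m A = 0.
    apply: Hrho => //; apply: le_lt_trans bN.
    apply: rV_norm_le => [|j]; first by rewrite divr_ge0// ltW.
    rewrite mxE; apply: (le_trans (ler_norm_sum _ _ _)).
    apply: (@le_trans _ _ (\sum_k N.+1%:R^-1 * \sum_i `|A k i|)).
      apply: ler_sum => k _; rewrite normrM; apply: ler_pM => //.
        by rewrite mxE; exact/ltW/dj.
      by rewrite (bigD1 j)//= lerDl sumr_ge0.
    by rewrite -mulr_sumr mulrC ler_pM2r ?invr_gt0// lerDl.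
  by move=> /(congr1 (mulmxr (pinvmx A))); rewrite /= -mulmxA mulmxVp// mulmx1 mul0mx.
have sc : (j2 - j1)%:R * c 0 0 = (Num.floor (j2%:R * c 0 0) - Num.floor (j1%:R * c 0 0))%:~R.
  have := congr1 (fun w : 'rV[R]_r.+1 => w 0 0) d0; rewrite dE !mxE => /eqP.
  by rewrite subr_eq0 intrB natrB 1?ltnW// => /eqP.
have /dvdnP[p pE] : (j2 - j1 %| q`!)%N.
  by apply: dvdn_fact; rewrite subn_gt0 j12 (leq_trans (leq_subr _ _)).
exists (p%:Z * (Num.floor (j2%:R * c 0 0) - Num.floor (j1%:R * c 0 0))).
by rewrite pE natrM -mulrA sc intrM.
Qed.

(** Induction on the dimension: a line inside [H] splits off, and without a line [H] is discrete. *)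
Theorem closed_subgroup_integral_form n (H : set 'rV[R]_n) : closed H ->
  is_subgroup H -> H = setT \/ has_integral_form H.
Proof.
elim: n H => [|n IH] H cH sH.
  left; apply/seteqP; split => // h _.
  by have -> : h = 0; [apply/rowP => -[]|exact: sH.1].
have [[v v0 Hv]|nl] := pselect (exists2 v : 'rV[R]_n.+1, v != 0 & forall t : R, H (t *: v)).
  exact: (@line_subgroup_step n H v).
have [|rho rho0 Hrho] := no_line_discrete cH sH; last first.
  by right; exact: discrete_integral_form sH rho0 Hrho.
move=> v v0; apply: contrapT => nt; apply: nl; exists v => // t.
by apply: contrapT => nH; apply: nt; exists t.
Qed.

End closed_subgroups.

#[local] Arguments normc : simpl never.

(** * Continuous unimodular characters of the real line *)

Section cis.
Context (R : realType).
Implicit Types s t : R.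

Definition cis t : R[i] := cos t +i* sin t.

Lemma cisD s t : cis (s + t) = cis s * cis t.
Proof. by rewrite /cis cosD sinD; simpc; congr (_ +i* _); rewrite addrC [X in X + _]mulrC. Qed.

Lemma cis0 : cis 0 = 1.
Proof. by rewrite /cis cos0 sin0. Qed.

Lemma normc_cis t : normc (cis t) = 1.
Proof. by rewrite /normc /cis cos2Dsin2 sqrtr1. Qed.

Lemma cisN t : cis (- t) = (cis t)^-1.
Proof.
have c0 : cis t != 0 by rewrite -normc_eq0 normc_cis oner_eq0.
by apply: (mulfI c0); rewrite -cisD subrr cis0 divff.
Qed.

Lemma cisMn t n : cis (t *+ n) = cis t ^+ n.
Proof. by elim: n => [|n IH]; rewrite ?mulr0n ?cis0// mulrS cisD IH exprS. Qed.

Lemma cis_2pi : cis (2 * pi) = 1.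
Proof.
rewrite mulr_natl cisMn -[pi]add0r; have -> : cis (0 + pi) = -1.
  by rewrite add0r /cis cospi sinpi; apply/eqP; rewrite eq_complex /= oppr0 !eqxx.
by rewrite sqrrN expr1n.
Qed.

Lemma cis_int (k : int) : cis (2 * pi * k%:~R) = 1.
Proof.
have H n : cis (2 * pi * n%:R) = 1 by rewrite mulr_natr cisMn cis_2pi expr1n.
by case: k => n; rewrite ?NegzE ?rmorphN ?mulrN ?cisN H// invr1.
Qed.

Lemma cis_near1 (eps : R) : 0 < eps ->
  exists2 r : R, 0 < r & forall t, `|t| < r -> normc (cis t - 1) < eps.
Proof.
move=> e0; have e2 : 0 < eps / 2 by rewrite divr_gt0.
have /cvgrPdist_lt/(_ _ e2) := @continuous_cos R 0.
have /cvgrPdist_lt/(_ _ e2) := @continuous_sin R 0.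
move=> /nbhs_ballP[r1 /= r10 H1] /nbhs_ballP[r2 /= r20 H2].
exists (Num.min r1 r2) => [|t]; first by rewrite lt_min r10.
rewrite lt_min => /andP[t1 t2]; apply: (le_lt_trans (normc_le_ReIm _)).
rewrite [eps]splitr; apply: ltrD.
  have := H2 t; rewrite /ball /= sub0r normrN => /(_ t2).
  by rewrite cos0 distrC.
have := H1 t; rewrite /ball /= sub0r normrN => /(_ t1).
by rewrite sin0 subr0 sub0r normrN.
Qed.

(** Bisecting an angle leaves two opposite square roots; the sign of the real part selects one. *)
Lemma sqr_inj_Re_gt0 (z w : R[i]) : 0 < complex.Re z -> 0 < complex.Re w ->
  z ^+ 2 = w ^+ 2 -> z = w.
Proof.
move=> z0 w0 /eqP; rewrite eqf_sqr => /orP[/eqP//|/eqP zw].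
by move: z0; rewrite zw; case: w w0 {zw} => a b /= a0; rewrite oppr_gt0 ltNge ltW.
Qed.

(* Roots of order [2 ^ k] with positive real part are determined by their
   powers, which fixes the character on dyadic multiples of a small [t0]. *)
Lemma real_character (c : R -> R[i]) : (forall s t, c (s + t) = c s * c t) ->
  (forall t, normc (c t) = 1) ->
  (forall eps : R, 0 < eps -> exists2 r : R, 0 < r & forall t, `|t| < r -> normc (c t - 1) < eps) ->
  exists theta : R, forall t, c t = cis (theta * t).
Proof.
move=> cD c1 cc.
have c0 : c 0 = 1.
  have cn : c 0 != 0 by rewrite -normc_eq0 c1 oner_eq0.
  by apply: (mulfI cn); rewrite -cD addr0 mulr1.
have [r r0 Hr] := cc 1 ltr01.
have Re0 t : `|t| < r -> 0 < complex.Re (c t).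
  move=> /Hr h; have := le_lt_trans (Re_le_normc _) h.
  by case: (c t) => a b /=; rewrite ltr_norml => /andP[+ _]; lra.
pose t0 := r / 2; have t00 : 0 < t0 by rewrite divr_gt0.
have pw k : (0 : R) < 2 ^+ k by rewrite exprn_gt0.
have tk k : `|t0 / 2 ^+ k| < r.
  rewrite ger0_norm ?divr_ge0 ?ltW// ltr_pdivrMr//.
  apply: (@lt_le_trans _ _ r); first by rewrite /t0; lra.
  by apply: ler_peMr; [exact: ltW|apply: exprn_ege1; rewrite ler1n].
(* The real part of [c t0] is positive, so [asin] of the imaginary part recovers its angle. *)
pose th := asin (complex.Im (c t0)).
have Im1 : -1 <= complex.Im (c t0) <= 1 by rewrite -ler_norml -(c1 t0) Im_le_normc.
have cth : c t0 = cis th.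
  have := Re0 t0; have := tk 0%N; rewrite expr0 divr1 => h /(_ h) re0.
  have := normc_sqr (c t0); rewrite c1 expr1n => n1.
  apply/eqP; rewrite eq_complex /= asinK// eqxx andbT cos_asin// n1 -addrA subrr addr0.
  by rewrite sqrtr_sqr ger0_norm// ltW.
have thb : - (pi / 2) <= th <= pi / 2 by rewrite asin_geNpi2// asin_lepi2.
have half (x : R) n : x / 2 ^+ n = x / 2 ^+ n.+1 + x / 2 ^+ n.+1.
  by rewrite exprS; field; rewrite gt_eqF.
have ck k : c (t0 / 2 ^+ k) = cis (th / 2 ^+ k).
  elim: k => [|k IH]; first by rewrite expr0 !divr1.
  apply: sqr_inj_Re_gt0; first exact: Re0.
    rewrite /cis /=; apply: cos_gt0_pihalf.
    have p0 := @pi_gt0 R.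
    have : `|th / 2 ^+ k.+1| < pi / 2.
      rewrite normrM [`|_^-1|]ger0_norm ?invr_ge0 ?ltW// ltr_pdivrMr//.
      have h : `|th| <= pi / 2 by rewrite ler_norml.
      apply: (le_lt_trans h); rewrite ltr_pMr ?divr_gt0//.
      by rewrite exprn_egt1// ltr1n.
    by rewrite ltr_norml.
  by rewrite !expr2 -cD -cisD -!half.
exists (th / t0) => t.
(* The quotient of [c] by the candidate: it is 1 on the dyadic multiples of [t0], which are dense,
   and it is continuous at 0. *)
pose D t := c t * cis (- (th / t0 * t)).
have DD s u : D (s + u) = D s * D u.
  by rewrite /D cD mulrDr opprD cisD; ring.
have D1 t' : normc (D t') = 1 by rewrite normcM c1 normc_cis mulr1.
have Dk k : D (t0 / 2 ^+ k) = 1.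
  rewrite /D ck -cisD (_ : _ + _ = 0) ?cis0//.
  by field; rewrite !gt_eqF.
have D0 : D 0 = 1 by rewrite /D c0 mulr0 oppr0 cis0 mulr1.
have DN s : D (- s) = (D s)^-1.
  have dn : D s != 0 by rewrite -normc_eq0 D1 oner_eq0.
  by apply: (mulfI dn); rewrite -DD subrr D0 divff.
have Dn s n : D (s *+ n) = D s ^+ n.
  by elim: n => [|n IH]; rewrite ?mulr0n// mulrS DD IH exprS.
have Dint k (m : int) : D (t0 / 2 ^+ k * m%:~R) = 1.
  have H n : D (t0 / 2 ^+ k * n%:R) = 1 by rewrite mulr_natr Dn Dk expr1n.
  by case: m => n; rewrite ?NegzE ?rmorphN ?mulrN ?DN H ?invr1.
suff Dt : D t = 1.
  move: Dt; rewrite /D cisN => /(congr1 (fun z => z * cis (th / t0 * t))).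
  by rewrite mul1r divfK// -normc_eq0 normc_cis oner_eq0.
apply/eqP; rewrite -subr_eq0 -normc_eq0; apply/eqP/le_anti.
rewrite normc_ge0 andbT; apply/ler_addgt0Pl => eps e0; rewrite addr0.
have e2 : 0 < eps / 2 by rewrite divr_gt0.
have [r1 r10 H1] := cc _ e2; have [r2 r20 H2] := cis_near1 e2.
pose b := `|th / t0| + 1; have b0 : 0 < b by rewrite ltr_wpDl.
pose rr := Num.min r1 (r2 / b).
have rr0 : 0 < rr by rewrite lt_min r10 divr_gt0.
pose k := Num.bound (t0 / rr).
have kr : t0 / 2 ^+ k < rr.
  rewrite ltr_pdivrMr// mulrC -ltr_pdivrMr//.
  apply: (lt_le_trans (archi_boundP (ltW _))); first by rewrite divr_gt0.
  by rewrite -natrX ler_nat ltnW// ltn_expl.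
pose m := Num.floor (t / (t0 / 2 ^+ k)).
have q0 : 0 < t0 / 2 ^+ k by rewrite divr_gt0.
pose s := t - t0 / 2 ^+ k * m%:~R.
have tE : t = s + t0 / 2 ^+ k * m%:~R by rewrite /s subrK.
have /andP[f1 f2] := floor_itv (t / (t0 / 2 ^+ k)).
have s0 : 0 <= s by rewrite subr_ge0 mulrC -ler_pdivlMr.
have sr : s < rr.
  apply: lt_trans kr; rewrite ltrBlDl; move: f2; rewrite ltr_pdivrMr// intrD mulrDl mul1r.
  by rewrite mulrC.
rewrite tE DD Dint mulr1.
have := sr; rewrite lt_min => /andP[s1 s2].
have h1 : normc (c s - 1) < eps / 2 by apply: H1; rewrite ger0_norm.
have h2 : normc (cis (- (th / t0 * s)) - 1) < eps / 2.
  apply: H2; rewrite normrN normrM [`|s|]ger0_norm//.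
  apply: (@le_lt_trans _ _ (b * s)); first by rewrite ler_wpM2r// lerDl.
  by rewrite mulrC -ltr_pdivlMr.
have -> : D s - 1 = (c s - 1) * cis (- (th / t0 * s)) + (cis (- (th / t0 * s)) - 1).
  by rewrite /D; ring.
apply: (le_trans (le_normcD _ _)); rewrite normcM normc_cis mulr1.
by rewrite [eps]splitr; apply: lerD; exact: ltW.
Qed.

End cis.

(** * Pontryagin duality through frequency vectors *)

Section pontryagin.
Context (R : realType) (G : topologicalZmodType).
Local Notation dual := (dual_group R G).
Hypothesis hausG : hausdorff_space G.
Hypothesis lcG : locally_compact [set: G].
Context (mu : {measure set (borel G) -> \bar R}) (haar_mu : is_haar mu).
Context (nu : {measure set (borel dual) -> \bar R}) (dual_nu : is_dual_haar mu nu).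
Context (d e : nat) (Phi : dual -> 'rV[R]_d * 'rV[int]_e).
Hypothesis PhiD : forall a b, Phi (a + b) = Phi a + Phi b.
Hypothesis PhiH : homeomorphism Phi.
Local Notation coord := (dual_coord Phi).
Local Notation cbox := (cbox Phi).
Implicit Types (th : 'rV[R]_(d + e)) (g : dual) (x y : G).

Definition pairing th g : R := \sum_j th 0 j * coord j g.

Lemma pairingDl th th' g : pairing (th + th') g = pairing th g + pairing th' g.
Proof. by rewrite /pairing -big_split; apply: eq_bigr => j _; rewrite mxE mulrDl. Qed.

Lemma pairingN th g : pairing (- th) g = - pairing th g.
Proof. by rewrite /pairing -sumrN; apply: eq_bigr => j _; rewrite mxE mulNr. Qed.

Lemma pairing_le th g (r s : R) : 0 <= r -> (forall j, `|th 0 j| <= s) -> cbox r g ->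
  `|pairing th g| <= (d + e)%:R * (s * r).
Proof.
move=> r0 ths gr; apply: (le_trans (ler_norm_sum _ _ _)).
apply: (@le_trans _ _ (\sum_(j < d + e) s * r)).
  by apply: ler_sum => j _; rewrite normrM; exact: ler_pM.
by rewrite big_const_ord iter_addr_0 mulr_natl.
Qed.

(* [lifts x th]: the point [x] acts on the dual as the character of
   [R^d * Z^e] with frequency vector [th]. *)
Definition lifts x th := forall g, g x = cis (pairing th g).

Lemma liftsB x y th th' : lifts x th -> lifts y th' -> lifts (x - y) (th - th').
Proof.
move=> xt yt g; rewrite dual_addr dual_opp xt yt pairingDl pairingN cisD cisN.
by rewrite inv_unit// normc_cis.
Qed.

Lemma lifts0 : lifts 0 0.
Proof. by move=> g; rewrite dual_at0 /pairing big1 ?cis0// => j _; rewrite mxE mul0r. Qed.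

Lemma real_direction (i : 'I_d) (t : R) : {g : dual | coord (lshift e i) g = t &
  forall j, j != lshift e i -> coord j g = 0}.
Proof.
apply: cid2; have [_ [Psi [_ KP _]]] := PhiH.
exists (Psi (t *: delta_mx 0 i, 0)).
  by rewrite /dual_coord KP row_mxEl !mxE !eqxx mulr1.
move=> j; rewrite /dual_coord KP; case: (split_ordP j) => k -> /=.
  by rewrite (inj_eq (@lshift_inj _ _)) row_mxEl !mxE eqxx /= => /negbTE ->; rewrite mulr0.
by rewrite row_mxEr !mxE.
Qed.

Lemma int_direction (i : 'I_e) : {g : dual | coord (rshift d i) g = 1 &
  forall j, j != rshift d i -> coord j g = 0}.
Proof.
apply: cid2; have [_ [Psi [_ KP _]]] := PhiH.
exists (Psi (0, delta_mx 0 i)).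
  by rewrite /dual_coord KP row_mxEr !mxE !eqxx.
move=> j; rewrite /dual_coord KP; case: (split_ordP j) => k -> /=.
  by rewrite row_mxEl !mxE.
by rewrite (inj_eq (@rshift_inj _ _)) row_mxEr !mxE eqxx /= => /negbTE ->.
Qed.

Lemma coord_int (i : 'I_e) g : coord (rshift d i) g = ((Phi g).2 0 i)%:~R.
Proof. by rewrite /dual_coord row_mxEr mxE. Qed.

Definition rdir i t := s2val (real_direction i t).
Definition idir i := s2val (int_direction i).

Lemma rdirE i t j : coord j (rdir i t) = (j == lshift e i)%:R * t.
Proof.
have h1 := s2valP (real_direction i t); have h2 := s2valP' (real_direction i t).
by case: eqVneq => [->|/h2]; rewrite ?mul1r ?mul0r.
Qed.

Lemma idirE i j : coord j (idir i) = (j == rshift d i)%:R.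
Proof.
have h1 := s2valP (int_direction i); have h2 := s2valP' (int_direction i).
by case: eqVneq => [->|/h2].
Qed.

Lemma coord_sum (I : Type) (s : seq I) (F : I -> dual) j :
  coord j (\sum_(i <- s) F i) = \sum_(i <- s) coord j (F i).
Proof. exact: (big_morph _ (coordD PhiD j) (coord0 PhiD j)). Qed.

Lemma coord_mulz j g (k : int) : coord j (g *~ k) = coord j g * k%:~R.
Proof.
case: k => n; first by rewrite -[g *~ _]/(g *+ n) (coordMn PhiD) -mulr_natr.
by rewrite NegzE mulrNz rmorphN mulrN (coordN PhiD) -[g *~ _]/(g *+ n.+1) (coordMn PhiD) -mulr_natr.
Qed.

Lemma dual_decomp g : g = \sum_i rdir i (coord (lshift e i) g) +
  \sum_i idir i *~ ((Phi g).2 0 i).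
Proof.
apply: (coord_inj PhiH) => j; rewrite (coordD PhiD) !coord_sum.
case: (split_ordP j) => k ->.
  rewrite [X in _ = _ + X]big1 ?addr0; last first.
    by move=> i _; rewrite coord_mulz idirE eq_lrshift mul0r.
  rewrite (bigD1 k)//= rdirE eqxx mul1r big1 ?addr0// => i ik.
  by rewrite rdirE (inj_eq (@lshift_inj _ _)) eq_sym (negbTE ik) mul0r.
rewrite [X in _ = X + _]big1 ?add0r; last first.
  by move=> i _; rewrite rdirE eq_rlshift mul0r.
rewrite (bigD1 k)//= coord_mulz idirE eqxx mul1r big1 ?addr0 ?coord_int// => i ik.
by rewrite coord_mulz idirE (inj_eq (@rshift_inj _ _)) eq_sym (negbTE ik) mul0r.
Qed.

Section dual_characters.
Variable c : dual -> R[i].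
Hypothesis cD : forall a b, c (a + b) = c a * c b.
Hypothesis c1 : forall a, normc (c a) = 1.
Hypothesis cc : forall eps : R, 0 < eps -> nbhs (0 : dual) [set a | normc (c a - 1) < eps].

Let c_neq0 a : c a != 0.
Proof. by rewrite -normc_eq0 c1 oner_eq0. Qed.

Let c0 : c 0 = 1.
Proof. by apply: (mulfI (c_neq0 0)); rewrite -cD addr0 mulr1. Qed.

Let cMz a (k : int) (t : R) : c a = cis t -> c (a *~ k) = cis (t * k%:~R).
Proof.
move=> ca; have Hn n : c (a *+ n) = cis (t * n%:R).
  by elim: n => [|n IH]; rewrite ?mulr0n ?mulr0 ?cis0// mulrS cD IH ca mulrS mulrDr mulr1 cisD.
case: k => n; first exact: Hn.
have cn : c (a *+ n.+1) != 0 by [].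
rewrite NegzE mulrNz rmorphN mulrN cisN -[a *~ _]/(a *+ n.+1).
by apply: (mulfI cn); rewrite -cD subrr c0 Hn divff// -normc_eq0 normc_cis oner_eq0.
Qed.

Lemma unit_is_cis (z : R[i]) : normc z = 1 -> exists t, z = cis t.
Proof.
move=> z1; have n1 := normc_sqr z; rewrite z1 expr1n in n1.
have Im1 : -1 <= complex.Im z <= 1 by rewrite -ler_norml -z1 Im_le_normc.
have [r0|r0] := leP 0 (complex.Re z).
  exists (asin (complex.Im z)); apply/eqP; rewrite eq_complex /= asinK// eqxx andbT.
  by rewrite cos_asin// n1 addrK sqrtr_sqr ger0_norm.
exists (pi - asin (complex.Im z)); apply/eqP; rewrite eq_complex /=.
rewrite cosB sinB cospi sinpi asinK// cos_asin// n1 addrK sqrtr_sqr ltr0_norm//.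
by rewrite -!n1; apply/andP; split; apply/eqP; ring.
Qed.

(** The coordinate axes generate the dual: on a real axis [c] is a character of the line, and on an
    integer axis it is determined by its angle at the generator. *)
Lemma dual_character_lift : exists th, forall g, c g = cis (pairing th g).
Proof.
have rd i : {a : R | forall t, c (rdir i t) = cis (a * t)}.
  apply: cid; apply: real_character => [s t|t|eps e0].
  - rewrite -cD; congr c; apply: (coord_inj PhiH) => j.
    by rewrite (coordD PhiD) !rdirE mulrDr.
  - exact: c1.
  - have [r r0 H] := nbhs_coord PhiD PhiH (cc e0).
    exists r => // t tr; apply: H => j; rewrite subr0 rdirE normrM.
    by case: eqP => _; rewrite ?normr1 ?mul1r// normr0 mul0r.
have idr i : {a : R | c (idir i) = cis a} by apply: cid; exact: unit_is_cis.
exists (row_mx (\row_i sval (rd i)) (\row_i sval (idr i))) => g.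
have cS (I : Type) (s : seq I) (F : I -> dual) (A : I -> R) :
    (forall i, c (F i) = cis (A i)) -> c (\sum_(i <- s) F i) = cis (\sum_(i <- s) A i).
  move=> FA; elim: s => [|i s IH]; first by rewrite !big_nil c0 cis0.
  by rewrite !big_cons cD cisD IH FA.
rewrite {1}(dual_decomp g) cD /pairing big_split_ord /= cisD; congr (_ * _).
  by apply: cS => i; rewrite row_mxEl mxE; exact: (svalP (rd i)).
by apply: cS => i; rewrite row_mxEr mxE coord_int; apply: cMz; exact: (svalP (idr i)).
Qed.

End dual_characters.

Lemma lifts_exist x : exists th, lifts x th.
Proof.
apply: (@dual_character_lift (fun g => g x)) => [a b|a|eps e0].
- by [].
- exact: normc_dual.
- have := nbhs_dual_compact (0 : dual) (@compact_set1 G x) e0.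
  by apply: filterS => g /(_ x erefl).
Qed.

Lemma open_core : exists W C : set G, [/\ open W, W 0, compact C & W `<=` C].
Proof.
have [C C0 [cC _]] := @lcG 0 I; have {}C0 : nbhs (0 : G) C by move: C0; rewrite withinET.
by exists C°, C; split => //; [exact: open_interior|exact: interior_subset].
Qed.

Lemma lifts_inj x y th : lifts x th -> lifts y th -> x = y.
Proof.
move=> xt yt; apply: contrapT => xy.
have gxy (g : dual) : g (x - y) = 1.
  by rewrite dual_addr dual_opp xt yt mul_conjc normc_cis expr1n.
have xy0 : x - y != 0 by apply/eqP => h; apply: xy; apply/eqP; rewrite -subr_eq0 h.
have [W [C [oW W0 cC WC]]] := open_core.
have /hausdorff_accessible := hausG => /(_ 0 (x - y)); rewrite eq_sym => /(_ xy0).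
move=> [U [oU U0 Uxy]].
(* With $V-V\subset U$ and $x-y\notin U$, the set $W\cap V$ is disjoint from its translate by
   $x-y$. *)
have [V [oV V0 VU]] : exists V : set G, [/\ open V, V 0 & forall a b, V a -> V b -> U (a - b)].
  have : nbhs ((0, 0) : G * G) ((fun z : G * G => z.1 - z.2) @^-1` U).
    apply: (@sub_continuous G (0, 0)); rewrite /= subrr.
    by apply: open_nbhs_nbhs; split => //; exact: set_mem.
  move=> [[A B] /= [A0 B0] AB]; exists (A `&` B)°; split.
  - exact: open_interior.
  - exact: filterI.
  - move=> a b /interior_subset[Aa _] /interior_subset[_ Bb].
    exact: (AB (a, b)).
have oWV : open (W `&` V) by exact: openI.
have [|g] := @character_separates R G mu haar_mu nu dual_nu (W `&` V) C oWV
  (ex_intro _ 0 (conj W0 V0)) cC (fun z h => WC z h.1) hausG (x - y); last by rewrite gxy eqxx.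
move=> z [_ Vz] [_ Vzx]; have := VU _ _ Vz Vzx; rewrite opprB addrC subrK => h.
by move: Uxy; rewrite inE; apply.
Qed.

Lemma shrink_lt (a b r : R) : 0 < r -> 0 < a * b + 1 -> a * (r / (a * b + 1) * b) < r.
Proof.
move=> r0 ab0; have -> : a * (r / (a * b + 1) * b) = r - r / (a * b + 1).
  by field; rewrite gt_eqF.
by rewrite ltrBlDr ltrDl divr_gt0.
Qed.

(** Small frequencies make all characters of a given box close to 1, so [polar_bounded] places the
    point in $W-W$, hence in the compact set $C-C$. *)
Lemma bounded_lifts : exists L : set G, compact L /\
  exists2 del : R, 0 < del & forall x th, lifts x th -> (forall j, `|th 0 j| < del) -> L x.
Proof.
have [W [C [oW W0 cC WC]]] := open_core.
have [n Hn] := polar_bounded haar_mu dual_nu PhiH oW (ex_intro _ 0 W0) cC WC hausG.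
exists ((fun z : G * G => z.1 - z.2) @` (C `*` C)); split.
  apply: continuous_compact; last exact: compact_setX.
  by apply: continuous_subspaceT => z; exact: sub_continuous.
have [r r0 Hr] := @cis_near1 R (1 / 2) (divr_gt0 ltr01 (ltr0n _ 2)).
have b0 : 0 < (d + e)%:R * n%:R + 1 :> R by rewrite ltr_wpDl// mulr_ge0.
exists (r / ((d + e)%:R * n%:R + 1)) => [|x th xt thr]; first by rewrite divr_gt0.
have [|y [Wy Wyx]] := Hn x.
  move=> g gn; rewrite xt; apply/ltW/Hr.
  apply: (le_lt_trans (pairing_le _ (fun j => ltW (thr j)) gn)) => //.
  exact: shrink_lt.
by exists (y, y - x); [split; exact: WC|rewrite /= opprB addrC subrK].
Qed.

(** Points of [Q] with frequencies near [p] form a filter; relative to one of them, [x0], their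
    frequencies are small, so [bounded_lifts] confines them and they cluster. With [Q] everything,
    this shows that the set of frequencies is closed; with [Q] the complement of a neighbourhood,
    that a point depends continuously on its frequency. *)
Lemma lifts_cluster (Q : set G) (p : 'rV[R]_(d + e)) :
  (forall eps : R, 0 < eps -> exists x (th : 'rV[R]_(d + e)),
    [/\ Q x, lifts x th & forall j, `|p 0 j - th 0 j| < eps]) ->
  exists2 x, lifts x p & closure Q x.
Proof.
move=> H; have [L [cL [del del0 HL]]] := bounded_lifts.
have d2 : 0 < del / 2 by rewrite divr_gt0.
have [x0 [th0 [_ x0t h0]]] := H _ d2.
pose A (eps : R) := [set y | exists th : 'rV[R]_(d + e),
  [/\ Q (y + x0), lifts (y + x0) th & forall j, `|p 0 j - th 0 j| < eps]].
pose F := filter_from [set eps : R | 0 < eps] A.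
have FF : ProperFilter F.
  apply: filter_from_proper.
    apply: filter_from_filter; first by exists 1; rewrite /=.
    move=> e1 e2 /= e10 e20; exists (Num.min e1 e2); first by rewrite /= lt_min e10.
    move=> y [th [Qy yt h]]; split; exists th; split => // j; have := h j;
      by rewrite lt_min => /andP[].
  move=> eps e0; have [x [th [Qx xt h]]] := H _ e0.
  by exists (x - x0), th; rewrite subrK.
have FL : F L.
  exists (del / 2) => // y [th [_ yt h]]; apply: (HL _ (th - th0)).
    by rewrite -(addrK x0 y); exact: liftsB.
  move=> j; rewrite !mxE -(subrKA (p 0 j)) [del]splitr.
  by apply: (le_lt_trans (ler_normD _ _)); apply: ltrD; rewrite // distrC.
have [y [Ly ycl]] := cL F FF FL.
have cadd : continuous (fun z : G => z + x0).
  by move=> z; rewrite -{1}[x0]opprK; exact: continuous_subr.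
exists (y + x0).
  move=> g; apply/eqP; rewrite -subr_eq0 -normc_eq0; apply/eqP/le_anti.
  rewrite normc_ge0 andbT; apply/ler_addgt0Pl => eps e0; rewrite addr0.
  have e2 : 0 < eps / 2 by rewrite divr_gt0.
  have [r r0 Hr] := cis_near1 e2; have [m gm] := cbox_cover Phi g.
  have b0 : 0 < (d + e)%:R * m%:R + 1 :> R by rewrite ltr_wpDl// mulr_ge0.
  have FA : F (A (r / ((d + e)%:R * m%:R + 1))).
    by exists (r / ((d + e)%:R * m%:R + 1)) => //=; rewrite divr_gt0.
  have ny : nbhs y [set z | normc (g y - g z) < eps / 2].
    have /(@cvgrPdist_lt _ R[i] _ _ (nbhs_filter y)) := @dual_cont R G g y.
    have ec : 0 < (eps / 2)%:C by rewrite ltcR.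
    by move=> /(_ _ ec); apply: filterS => z; rewrite normcE ltcR.
  have [z [[th [_ zt h]] /= yz]] := ycl _ _ FA ny.
  have -> : g (y + x0) - cis (pairing p g) =
      (g y - g z) * g x0 + cis (pairing p g) * (cis (pairing (th - p) g) - 1).
    rewrite mulrBr mulr1 -cisD.
    have -> : pairing p g + pairing (th - p) g = pairing th g.
      by rewrite -pairingDl addrC subrK.
    by rewrite -zt !dual_addr; ring.
  apply: (le_trans (le_normcD _ _)); rewrite !normcM normc_dual normc_cis mulr1 mul1r.
  rewrite [eps]splitr; apply: lerD; first exact: ltW.
  apply/ltW/Hr; apply: (le_lt_trans (pairing_le (s := r / ((d + e)%:R * m%:R + 1)) _ _ gm)) => //.
    by move=> j; rewrite !mxE distrC ltW.
  exact: shrink_lt.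
move=> B yB; have nB : nbhs y ((fun z => z + x0) @^-1` B) by exact: cadd.
have FA : F (A 1) by exists 1; rewrite /=.
by have [z [[th [Qz _ _]] Bz]] := ycl _ _ FA nB; exists (z + x0).
Qed.

Theorem lifts_surj th : exists x, lifts x th.
Proof.
pose H : set 'rV[R]_(d + e) := [set th | exists x, lifts x th].
have sH : is_subgroup H.
  split; first by exists 0; exact: lifts0.
  by move=> a b [x xa] [y yb]; exists (x - y); exact: liftsB.
have cH : closed H.
  move=> p pH; have [|x xp _] := @lifts_cluster setT p; last by exists x.
  move=> eps e0; have [t [[x xt] pt]] := pH _ (near_rV p e0).
  by exists x, t.
have [HT|[a a0 aH]] := closed_subgroup_integral_form cH sH.
  by have : H th by rewrite HT.
(* The vector $2\pi e_i$ along an integer axis is a frequency of the point 0, so the form takes an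
   integer value on it. *)
have ha (i : 'I_e) : exists k : int, 2 * pi * a (rshift d i) 0 = k%:~R.
  pose t : 'rV[R]_(d + e) := (2 * pi) *: delta_mx 0 (rshift d i).
  have [|k kE] := aH t.
    exists 0 => g; rewrite dual_at0 /pairing (bigD1 (rshift d i))//= big1.
      by rewrite !mxE !eqxx mulr1 addr0 coord_int cis_int.
    by move=> j ji; rewrite !mxE eqxx (negbTE ji) !mulr0 mul0r.
  exists k; rewrite -kE mxE (bigD1 (rshift d i))//= big1.
    by rewrite !mxE !eqxx mulr1 addr0.
  by move=> j ji; rewrite !mxE eqxx (negbTE ji) !mulr0 mul0r.
have [k kE] := choice ha.
(* This element has coordinates $2\pi a$: it pairs with every frequency into $2\pi\mathbb Z$, so it
   is trivial on the group and $a=0$. *)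
pose g := \sum_i rdir i (2 * pi * a (lshift e i) 0) + \sum_i idir i *~ k i.
have gE j : coord j g = 2 * pi * a j 0.
  rewrite (coordD PhiD) !coord_sum; case: (split_ordP j) => l ->.
    rewrite [X in _ + X]big1 ?addr0; last first.
      by move=> i _; rewrite coord_mulz idirE eq_lrshift mul0r.
    rewrite (bigD1 l)//= rdirE eqxx mul1r big1 ?addr0// => i il.
    by rewrite rdirE (inj_eq (@lshift_inj _ _)) eq_sym (negbTE il) mul0r.
  rewrite [X in X + _]big1 ?add0r; last first.
    by move=> i _; rewrite rdirE eq_rlshift mul0r.
  rewrite (bigD1 l)//= coord_mulz idirE eqxx mul1r -kE big1 ?addr0// => i il.
  by rewrite coord_mulz idirE (inj_eq (@rshift_inj _ _)) eq_sym (negbTE il) mul0r.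
have g0 : g = 0.
  apply: dual_eqP => x; have [t xt] := lifts_exist x.
  have [|m mE] := aH t; first by exists x.
  rewrite xt (_ : pairing t g = 2 * pi * m%:~R) ?cis_int//.
  rewrite -mE mxE mulr_sumr; apply: eq_bigr => j _.
  by rewrite gE mulrCA mulrA.
case/eqP: a0; apply/colP => j; rewrite mxE; have := gE j; rewrite g0 (coord0 PhiD) => /esym/eqP.
by rewrite !mulf_eq0 pnatr_eq0 /= gt_eqF ?pi_gt0// => /eqP.
Qed.

(** Points outside [U] with frequencies tending to 0 would cluster at a point of frequency 0, which
    is 0 itself. *)
Lemma small_lifts (U : set G) : nbhs (0 : G) U ->
  exists2 eps : R, 0 < eps & forall y th, lifts y th -> (forall j, `|th 0 j| < eps) -> U y.
Proof.
move=> U0; apply: contrapT => nU.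
have [|x x0] := @lifts_cluster (~` U) 0.
  move=> eps e0; apply: contrapT => nex; apply: nU; exists eps => // y th yt h.
  apply: contrapT => nUy; apply: nex; exists y, th; split => // j.
  by rewrite mxE sub0r normrN.
rewrite (lifts_inj x0 lifts0) => /(_ _ U0)[z [nUz Uz]]; exact: nUz.
Qed.

Lemma bounded_lifts_compact (S : R) :
  compact [set x | exists2 th, lifts x th & forall j, `|th 0 j| <= S].
Proof.
pose X th := sval (cid (lifts_surj th)).
have Xt th : lifts (X th) th by exact: (svalP (cid (lifts_surj th))).
have cX : continuous X.
  move=> th U XU; have U0 : nbhs (0 : G) ((fun y => y + X th) @^-1` U).
    have cadd : continuous (fun z : G => z + X th).
      by move=> z; rewrite -{1}[X th]opprK; exact: continuous_subr.
    by apply: cadd; rewrite /= add0r.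
  have [eps e0 H] := small_lifts U0.
  have := near_rV th e0; apply: filterS => th' h.
  have /= := H (X th' - X th) (th' - th) (liftsB (Xt _) (Xt _)); rewrite subrK; apply.
  by move=> j; rewrite !mxE distrC; exact: h.
have -> : [set x | exists2 th, lifts x th & forall j, `|th 0 j| <= S] =
    X @` [set th : 'rV[R]_(d + e) | forall j, [set t : R | `|t| <= S] (th ord0 j)].
  apply/seteqP; split => [x [th xt h]|_ [th h <-]]; last by exists th.
  by exists th => //; exact: (lifts_inj (Xt th) xt).
apply: continuous_compact; first exact: continuous_subspaceT.
apply: (@rV_compact _ _ (fun=> [set t : R | `|t| <= S])) => _.
rewrite (_ : mkset _ = `[- S, S]%classic); first exact: segment_compact.
by apply/seteqP; split => t /=; rewrite in_itv/= ler_norml.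
Qed.

Theorem pontryagin_duality (c : dual -> R[i]) :
  (forall a b, c (a + b) = c a * c b) -> (forall a, normc (c a) = 1) ->
  (forall eps : R, 0 < eps -> nbhs (0 : dual) [set a | normc (c a - 1) < eps]) ->
  exists x, forall g, c g = g x.
Proof.
move=> cD c1 cc; have [th cth] := dual_character_lift cD c1 cc.
by have [x xt] := lifts_surj th; exists x => g; rewrite cth xt.
Qed.

(** Outside a compact set some real frequency $\theta_i$ is large, since integer frequencies count
    only modulo $2\pi$. The short step $\pi/\theta_i$ along that axis is a character with value $-1$
    at [x]. *)
Lemma far_character (r : R) : 0 < r -> exists2 A : set G, compact A &
  forall x, ~ A x -> exists2 g, (forall j, `|coord j g| < r) & 1 < normc (g x - 1).
Proof.
(* The first summand makes the step shorter than [r]; the second bounds the frequencies reduced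
   modulo $2\pi$. *)
move=> r0; pose S : R := pi / r + 2 * pi; have p0 := @pi_gt0 R.
have S0 : 0 < S by rewrite addr_gt0 ?divr_gt0 ?mulr_gt0.
exists [set x | exists2 th, lifts x th & forall j, `|th 0 j| <= S].
  exact: bounded_lifts_compact.
move=> x nA; have [th xt] := lifts_exist x.
have [i iS] : exists i : 'I_d, S < `|th 0 (lshift e i)|.
  apply: contrapT => nex; apply: nA.
  have p20 : 0 < 2 * pi :> R by rewrite mulr_gt0.
  pose z (i : 'I_e) := Num.floor (th 0 (rshift d i) / (2 * pi)).
  exists (row_mx (\row_i th 0 (lshift e i)) (\row_i (th 0 (rshift d i) - 2 * pi * (z i)%:~R))).
    move=> g; rewrite xt /pairing !big_split_ord /= !cisD; congr (_ * _).
      by congr cis; apply: eq_bigr => i _; rewrite row_mxEl mxE.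
    have -> : \sum_i th 0 (rshift d i) * coord (rshift d i) g = 
        \sum_i (th 0 (rshift d i) - 2 * pi * (z i)%:~R) * coord (rshift d i) g +
        2 * pi * (\sum_i z i * (Phi g).2 0 i)%:~R.
      rewrite (big_morph _ (@intrD R) (erefl : 0%:~R = 0)) mulr_sumr -big_split /=.
      by apply: eq_bigr => i _; rewrite coord_int intrM; ring.
    rewrite cisD cis_int mulr1; congr cis; apply: eq_bigr => i _.
    by rewrite row_mxEr mxE.
  move=> j; case: (split_ordP j) => l ->.
    rewrite row_mxEl mxE leNgt; apply/negP => h; apply: nex; by exists l.
  rewrite row_mxEr mxE; have /andP[f1 f2] := floor_itv (th 0 (rshift d l) / (2 * pi)).
  rewrite ler_pdivlMr// in f1; rewrite ltr_pdivrMr// intrD mulrDl mul1r in f2.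
  have q0 : 0 < pi / r by rewrite divr_gt0.
  rewrite ger0_norm /z /S; lra.
have t0 : th 0 (lshift e i) != 0.
  by rewrite -normr_gt0 (lt_trans S0).
exists (rdir i (pi / th 0 (lshift e i))).
  move=> j; rewrite rdirE normrM; apply: (@le_lt_trans _ _ (`|pi / th 0 (lshift e i)|)).
    by case: eqP => _; rewrite ?normr1 ?mul1r// normr0 mul0r.
  rewrite normrM normfV ger0_norm ?ltW// ltr_pdivrMr ?normr_gt0// mulrC -ltr_pdivrMr//.
  by apply: lt_trans iS; rewrite ltrDl mulr_gt0.
rewrite xt (_ : pairing _ _ = pi).
  rewrite /cis cospi sinpi -[Complex _ _]/((-1 : R)%:C) -(rmorphB (real_complex R)) normc_real.
  by rewrite -opprD normrN ger0_norm// ltrDl.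
rewrite /pairing (bigD1 (lshift e i))//= rdirE eqxx mul1r big1 ?addr0.
  by rewrite mulrC divfK.
by move=> j ji; rewrite rdirE (negbTE ji) mul0r mulr0.
Qed.

End pontryagin.

(** * Translation, continuity and decay of inverse transforms *)

Section inverse_fourier_shift.
Context (R : realType) (G : topologicalZmodType).
Local Notation dual := (dual_group R G).
Context (nu : {measure set (borel dual) -> \bar R}) (haar_nu : is_haar nu).
Context (d e : nat) (Phi : dual -> 'rV[R]_d * 'rV[int]_e).
Hypothesis PhiD : forall a b, Phi (a + b) = Phi a + Phi b.
Hypothesis PhiH : homeomorphism Phi.
Let mshift := measurable_gshift PhiD PhiH.

Lemma inv_fourier_shift (a : dual) (phi : borel dual -> R[i]) (x : G) : cintegrable nu phi ->
  inv_fourier nu (phi \o gshift a) x = a x * inv_fourier nu phi x.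
Proof.
move=> iphi; have iev := cintegrable_eval x iphi.
rewrite /inv_fourier -cintegralZ// -[RHS](cintegral_shift haar_nu mshift a); last first.
  exact: cintegrableZ.
apply: eq_cintegral => g; rewrite /= mulrCA; congr (_ * _).
by rewrite -[LHS]/((g : dual) x) -{1}(subrK a (g : dual)) addrC.
Qed.

End inverse_fourier_shift.

Section riemann_lebesgue.
Context (R : realType) (G : topologicalZmodType).
Local Notation dual := (dual_group R G).
Hypothesis hausG : hausdorff_space G.
Hypothesis lcG : locally_compact [set: G].
Context (mu : {measure set (borel G) -> \bar R}) (haar_mu : is_haar mu).
Context (nu : {measure set (borel dual) -> \bar R}) (dual_nu : is_dual_haar mu nu).
Context (d e : nat) (Phi : dual -> 'rV[R]_d * 'rV[int]_e).
Hypothesis PhiD : forall a b, Phi (a + b) = Phi a + Phi b.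
Hypothesis PhiH : homeomorphism Phi.
Local Notation coord := (dual_coord Phi).
Local Notation cbox := (cbox Phi).
Let haar_nu : is_haar nu := dual_nu.1.
Let mshift := measurable_gshift PhiD PhiH.
Implicit Types (phi psi : borel dual -> R[i]) (x : G).

Lemma normc_inv_fourier phi x : cintegrable nu phi ->
  ((normc (inv_fourier nu phi x))%:E <= L1 nu phi)%E.
Proof.
move=> iphi; apply: (le_trans (normc_cintegral (cintegrable_eval x iphi))).
by rewrite le_eqVlt; apply/orP; left; apply/eqP; apply: eq_integral => g _;
  rewrite normcM normc_dual mulr1.
Qed.

Lemma inv_fourierB phi psi x : cintegrable nu phi -> cintegrable nu psi ->
  inv_fourier nu (fun g => phi g - psi g) x = inv_fourier nu phi x - inv_fourier nu psi x.
Proof.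
move=> iphi ipsi; rewrite /inv_fourier -cintegralB; try exact: cintegrable_eval.
by apply: eq_cintegral => g; rewrite mulrBl.
Qed.

Lemma normc_dualB (g : dual) (x y : G) : normc (g x - g y) = normc (g (x - y) - 1).
Proof.
rewrite dual_addr dual_opp -[RHS]mulr1 -[in RHS](normc_dual g y) -normcM.
by rewrite mulrBl mul1r -mulrA [_^*%C * _]mulrC mul_conjc normc_dual expr1n mulr1.
Qed.

(** The integral is split at a box: characters of the compact box are equicontinuous, and outside it
    [phi] has little mass. *)
Lemma inv_fourier_continuous phi : cintegrable nu phi -> continuous (inv_fourier nu phi : G -> R[i]).
Proof.
move=> iphi x0; apply/(@cvgrPdist_lt _ R[i] _ _ (nbhs_filter x0)) => eps.
case: eps => eps ie; rewrite ltcE /= => /andP[/eqP -> e0].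
have mphi := cintegrable_cmeas iphi.
have L1f : L1 nu phi \is a fin_num by rewrite ge0_fin_numE ?L1_ge0// L1_lty.
have e4 : 0 < eps / 4 by rewrite divr_gt0.
have [n hn] := integral_tail PhiH (cintegrable_normc iphi) (fun g => normc_ge0 _) e4.
pose b := fine (L1 nu phi) + 1.
have b0 : 0 < b by rewrite ltr_wpDl// fine_ge0// L1_ge0.
have eb : 0 < eps / 2 / b by rewrite !divr_gt0.
have near0 := equicontinuous_at0 lcG (@cbox_compact R G d e Phi PhiH n%:R) eb.
have : nbhs x0 ((fun x => x - x0) @^-1` [set y | forall g : dual, cbox n%:R g -> normc (g y - 1) < eps / 2 / b]).
  by apply: (@continuous_subr G x0 x0); rewrite subrr.
apply: filterS => x /= xn; rewrite normcE ltcR normcBC.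
have i1 := cintegrable_eval x iphi; have i0 := cintegrable_eval x0 iphi.
rewrite /inv_fourier -cintegralB// -lte_fin.
apply: (le_lt_trans (normc_cintegral (cintegrableB i1 i0))).
have mt : measurable_fun setT (fun g : borel dual => (normc (phi g) * \1_(~` cbox n%:R) g)%:E).
  apply/measurable_EFinP; apply: measurable_funM; first exact: measurable_normc.
  by apply: measurable_indic; apply: measurableC; exact: cbox_measurable PhiH _.
have mn := measurable_enormc mphi.
apply: (@le_lt_trans _ _ ((eps / 2 / b)%:E * L1 nu phi +
   2%:E * \int[nu]_g (normc (phi g) * \1_(~` cbox n%:R) g)%:E)%E).
  have ebe : (0 <= (eps / 2 / b)%:E)%E by rewrite lee_fin ltW.
  rewrite /L1 -!ge0_integralZl//; last 2 first.
  - by move=> g _; rewrite lee_fin mulr_ge0// normc_ge0.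
  - by move=> g _; rewrite lee_fin normc_ge0.
  rewrite -ge0_integralD//; last 4 first.
  - by move=> g _; rewrite -EFinM lee_fin mulr_ge0// ?normc_ge0// ltW.
  - exact: measurable_funeM.
  - by move=> g _; rewrite -EFinM lee_fin !mulr_ge0// normc_ge0.
  - exact: measurable_funeM.
  apply: ge0_le_integral => //.
  - by move=> g _; rewrite lee_fin normc_ge0.
  - exact: (measurable_enormc (cintegrable_cmeas (cintegrableB i1 i0))).
  - by apply: emeasurable_funD; exact: measurable_funeM.
  - move=> g _; rewrite -!EFinM -EFinD lee_fin -mulrBr normcM indicE.
    have [gn|gn] := pselect (cbox n%:R g).
      rewrite memNset ?mulr0 ?addr0; last by apply.
      rewrite mulrC ler_wpM2r ?normc_ge0// (normc_dualB (g : dual)).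
      by apply: ltW; exact: xn.
    rewrite mem_set// mulr1 [X in _ <= _ + X]mulrC.
    apply: (@le_trans _ _ (normc (phi g) * 2)).
      rewrite ler_wpM2l ?normc_ge0//; apply: (le_trans (normcB _ _)).
      by rewrite !normc_dual.
    by rewrite lerDr mulr_ge0 ?normc_ge0// ltW.
have tf : (\int[nu]_g (normc (phi g) * \1_(~` cbox n%:R) g)%:E \is a fin_num)%E.
  rewrite ge0_fin_numE; first exact: lt_trans hn (ltry _).
  by apply: integral_ge0 => g _; rewrite lee_fin mulr_ge0// normc_ge0.
move: hn; rewrite -(fineK tf) -(fineK L1f) -!EFinM -EFinD !lte_fin => hn.
have h1 : eps / 2 / b * fine (L1 nu phi) <= eps / 2.
  by rewrite mulrAC ler_pdivrMr// ler_pM2l ?divr_gt0// /b lerDl.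
lra.
Qed.

(** Riemann-Lebesgue. Shifting [phi] by [a] multiplies its transform $f$ by $a(x)$, so
    $|a(x)-1|\,|f(x)|$ is at most the $L^1$ distance between [phi] and its shift; for [x] far away,
    [far_character] supplies a small [a] with $|a(x)-1|>1$. *)
Lemma inv_fourier_c0 phi : cintegrable nu phi -> is_c0 (inv_fourier nu phi : G -> R[i]).
Proof.
move=> iphi; split; first exact: inv_fourier_continuous.
case=> eps ie; rewrite ltcE /= => /andP[/eqP -> e0].
have mphi := cintegrable_cmeas iphi.
have [r r0 Hr] := nbhs_coord PhiD PhiH (cintegrable_tcont haar_nu PhiD PhiH iphi e0).
have [A cA HA] := far_character hausG lcG haar_mu dual_nu PhiD PhiH r0.
exists A => // x /HA[a ar ax]; rewrite normcE ltcR.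
have iB : cintegrable nu (fun g => (phi \o gshift a) g - phi g).
  by apply: cintegrableB => //; exact: (cintegrable_shift haar_nu mshift).
have la : (L1 nu (fun g => phi (gshift a g) - phi g)%R < eps%:E)%E.
  by apply: Hr => j; rewrite subr0; exact: ar.
have := le_lt_trans (normc_inv_fourier x iB) la.
rewrite inv_fourierB//; last exact: (cintegrable_shift haar_nu mshift).
rewrite (inv_fourier_shift haar_nu PhiD PhiH)// -{2}[inv_fourier nu phi x]mul1r -mulrBl normcM lte_fin.
by apply: le_lt_trans; rewrite ler_peMl ?normc_ge0// ltW.
Qed.

End riemann_lebesgue.

(** * Density of trigonometric polynomials *)

Section sign_iteration.
Context (R : realType).

(* Its iterates converge to the sign function, so polynomial closure
   properties suffice to approximate indicators of half-spaces. *)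
Definition signstep (u : R) : R := (3 * u - u ^+ 3) / 2.

Lemma signstep_bound u : `|u| <= 1 -> `|signstep u| <= 1.
Proof.
rewrite !ler_norml => /andP[u1 u2]; apply/andP; split.
  rewrite -subr_ge0 (_ : _ - _ = (1 + u) ^+ 2 * (2 - u) / 2); last by rewrite /signstep; field.
  by rewrite mulr_ge0 ?invr_ge0// mulr_ge0 ?sqr_ge0//; lra.
rewrite -subr_ge0 (_ : _ - _ = (1 - u) ^+ 2 * (2 + u) / 2); last by rewrite /signstep; field.
by rewrite mulr_ge0 ?invr_ge0// mulr_ge0 ?sqr_ge0//; lra.
Qed.

Lemma signstepN u : signstep (- u) = - signstep u.
Proof. by rewrite /signstep; field. Qed.

Lemma iter_signstep_bound n u : `|u| <= 1 -> `|iter n signstep u| <= 1.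
Proof. by move=> u1; elim: n => //= n IH; exact: signstep_bound. Qed.

Lemma iter_signstep_pos u : 0 < u -> u <= 1 -> (fun n => iter n signstep u) @ \oo --> (1 : R).
Proof.
move=> u0 u1.
(* With $v\ge u$ the current iterate, the next error is $(1-v)\cdot(1-v)(2+v)/2$, and the second
   factor is at most $1-u/2$: the convergence is geometric. *)
have H n : u <= iter n signstep u <= 1 /\ 1 - iter n signstep u <= (1 - u / 2) ^+ n.
  elim: n => [|n [/andP[IH1 IH2] IH3]] /=; first by rewrite lexx u1 expr0; split => //; lra.
  set v := iter n signstep u in IH1 IH2 IH3 *.
  have v1 : signstep v <= 1.
    by have := @signstep_bound v; rewrite !ler_norml => /(_ _)/andP[]//; apply/andP; split => //; lra.
  split.
    rewrite v1 andbT (le_trans IH1)// -subr_ge0.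
    rewrite (_ : _ - _ = v * (1 - v) * (1 + v) / 2); last by rewrite /signstep; field.
    by rewrite mulr_ge0 ?invr_ge0// !mulr_ge0//; lra.
  have -> : 1 - signstep v = (1 - v) * ((1 - v) * (2 + v) / 2) by rewrite /signstep; field.
  rewrite exprSr; apply: ler_pM => //; try lra.
    by rewrite mulr_ge0 ?invr_ge0// mulr_ge0//; lra.
  rewrite ler_pdivrMr//; nra.
have q1 : `|1 - u / 2| < 1 by rewrite ltr_norml; apply/andP; split; lra.
have c1 := @cvg_expr R (1 - u / 2) q1.
apply/cvgrPdist_lt => eps e0; have /cvgrPdist_lt/(_ _ e0) := c1.
apply: filterS => n; rewrite sub0r normrN => h.
have [/andP[a b] c] := H n.
rewrite ger0_norm ?subr_ge0//; apply: (le_lt_trans c).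
exact: le_lt_trans (ler_norm _) h.
Qed.

Lemma iter_signstep_cvg u : `|u| <= 1 -> (fun n => iter n signstep u) @ \oo --> Num.sg u.
Proof.
rewrite ler_norml => /andP[u1 u2].
case: (ltrgt0P u) => [u0|u0|->].
- by rewrite gtr0_sg//; exact: iter_signstep_pos.
- rewrite ltr0_sg//.
  have -> : (fun n => iter n signstep u) = (fun n => - iter n signstep (- u)).
    apply/funext; elim=> [|n IH] /=; first by rewrite opprK.
    by rewrite IH signstepN.
  by apply: cvgN; apply: iter_signstep_pos; lra.
- rewrite sgr0 (_ : (fun n => _) = fun=> 0); first exact: cvg_cst.
  by apply/funext; elim=> //= n ->; rewrite /signstep; field.
Qed.

Lemma sin_near0 (eps : R) : 0 < eps -> exists2 r : R, 0 < r &
  forall h, `|h| < r -> `|sin h - h| <= eps * `|h|.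
Proof.
move=> e0; have := @is_derive_sin R 0; rewrite cos0 => -[der dv].
have := der; rewrite /derivable => /cvg_ex[l hl].
have l1 : l = 1 by rewrite -dv; apply/esym/cvg_lim.
move: hl; rewrite l1 => /cvgrPdist_lt/(_ _ e0)[r /= r0 H].
exists r => // h hr; have [->|h0] := eqVneq h 0; first by rewrite sin0 subrr normr0 mulr0.
have := H h; rewrite /= sub0r normrN => /(_ hr h0).
rewrite sin0 subr0 addr0 -[h *: 1]/(h * 1) mulr1 => h1.
have -> : sin h - h = - ((1 - h^-1 *: sin h) * h).
  by rewrite mulrBl mul1r -[_ *: _]/(_ * _) mulrAC mulVf// mul1r opprB.
by rewrite normrN normrM ler_wpM2r// ltW.
Qed.

End sign_iteration.

Section trigonometric_density.
Context (R : realType) (G : topologicalZmodType).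
Local Notation dual := (dual_group R G).
Hypothesis hausG : hausdorff_space G.
Hypothesis lcG : locally_compact [set: G].
Context (mu : {measure set (borel G) -> \bar R}) (haar_mu : is_haar mu).
Context (nu : {measure set (borel dual) -> \bar R}) (dual_nu : is_dual_haar mu nu).
Context (d e : nat) (Phi : dual -> 'rV[R]_d * 'rV[int]_e).
Hypothesis PhiD : forall a b, Phi (a + b) = Phi a + Phi b.
Hypothesis PhiH : homeomorphism Phi.
Local Notation coord := (dual_coord Phi).
Context (lam : dual -> R) (ilam : nu.-integrable setT (EFin \o lam)).
Hypothesis lam_gt0 : forall g, 0 < lam g.
Implicit Types (phi psi : borel dual -> R[i]) (s : seq (R[i] * G)).

Let mlam : measurable_fun setT (lam : borel dual -> R).
Proof. by apply/measurable_EFinP; exact: (measurable_int _ ilam). Qed.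

Definition trig s : borel dual -> R[i] := fun g => \sum_(cx <- s) cx.1 * (g : dual) cx.2.

Lemma trig_cmeas s : cmeas (trig s).
Proof.
elim: s => [|cx s IH]; rewrite /trig.
  by under eq_fun do rewrite big_nil; exact: cmeas_cst.
under eq_fun do rewrite big_cons; apply: cmeasD => //.
by apply: cmeasM; [exact: cmeas_cst|exact: eval_measurable].
Qed.

Lemma trig_bounded s : exists2 M : R, 0 <= M & forall g, normc (trig s g) <= M.
Proof.
elim: s => [|cx s [M M0 IH]].
  by exists 0 => // g; rewrite /trig big_nil normc0.
exists (normc cx.1 + M) => [|g]; first by rewrite addr_ge0// normc_ge0.
rewrite /trig big_cons; apply: (le_trans (le_normcD _ _)); apply: lerD; last exact: IH.
by rewrite normcM normc_dual mulr1.
Qed.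

Lemma trigD s t g : trig (s ++ t) g = trig s g + trig t g.
Proof. by rewrite /trig big_cat. Qed.

Lemma trigM s t g :
  trig [seq (a.1 * b.1, a.2 + b.2) | a <- s, b <- t] g = trig s g * trig t g.
Proof.
rewrite /trig big_allpairs_dep /= big_distrlr /=.
apply: eq_bigr => a _; apply: eq_bigr => b _.
by rewrite dual_addr; ring.
Qed.

(** The squared norm of $L^2(\lambda\,d\nu)$, with values in the extended reals. *)
Definition lam_sq psi : \bar R := (\int[nu]_g (normc (psi g) ^+ 2 * lam g)%:E)%E.

Lemma lam_sq_measurable psi : cmeas psi ->
  measurable_fun setT (fun g : borel dual => (normc (psi g) ^+ 2 * lam g)%:E).
Proof.
move=> mpsi; apply/measurable_EFinP; apply: measurable_funM => //.
by apply: measurable_funX; exact: measurable_normc.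
Qed.

Let w0 psi g : 0 <= normc (psi g) ^+ 2 * lam g.
Proof. by rewrite mulr_ge0 ?sqr_ge0// ltW. Qed.

Lemma lam_sq_le psi psi' (M : R) : cmeas psi -> cmeas psi' -> 0 <= M ->
  (forall g, normc (psi g) ^+ 2 <= M * normc (psi' g) ^+ 2) ->
  (lam_sq psi <= M%:E * lam_sq psi')%E.
Proof.
move=> m1 m2 M0 h; rewrite /lam_sq -ge0_integralZl//; last 2 first.
- exact: lam_sq_measurable.
- by move=> g _; rewrite lee_fin.
apply: ge0_le_integral => //.
- by move=> g _; rewrite lee_fin.
- exact: lam_sq_measurable.
- by apply: measurable_funeM; exact: lam_sq_measurable.
- by move=> g _; rewrite -EFinM lee_fin mulrA ler_wpM2r// ltW.
Qed.

Lemma lam_sqD psi psi' : cmeas psi -> cmeas psi' ->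
  (lam_sq (fun g => psi g + psi' g)%R <= 2%:E * lam_sq psi + 2%:E * lam_sq psi')%E.
Proof.
move=> m1 m2; rewrite /lam_sq -!ge0_integralZl//; try solve
  [exact: lam_sq_measurable | by move=> g _; rewrite lee_fin].
rewrite -ge0_integralD//; try solve
  [by apply: measurable_funeM; exact: lam_sq_measurable
  |by move=> g _; rewrite -EFinM lee_fin mulr_ge0].
apply: ge0_le_integral => //.
- by move=> g _; rewrite lee_fin mulr_ge0 ?sqr_ge0// ltW.
- by apply: lam_sq_measurable; exact: cmeasD.
- by apply: emeasurable_funD; apply: measurable_funeM; exact: lam_sq_measurable.
- move=> g _; rewrite -!EFinM -EFinD lee_fin.
  rewrite (_ : _ + _ = (2 * normc (psi g) ^+ 2 + 2 * normc (psi' g) ^+ 2) * lam g); last by ring.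
  by rewrite ler_wpM2r ?sqr_normcD// ltW.
Qed.

Definition trig_approx psi := forall eps : R, 0 < eps ->
  exists s, (lam_sq (fun g => psi g - trig s g)%R < eps%:E)%E.

(** Boundedness is carried along because approximability in $L^2(\lambda\,d\nu)$ alone is not stable
    under products. *)
Definition trig_bapprox psi := [/\ cmeas psi,
  exists2 M : R, 0 <= M & forall g, normc (psi g) <= M & trig_approx psi].

Lemma trig_bapprox_trig s : trig_bapprox (trig s).
Proof.
split; [exact: trig_cmeas|exact: trig_bounded|move=> eps e0].
exists s; rewrite /lam_sq; under eq_integral do rewrite subrr normc0 expr0n mul0r.
by rewrite integral0 lte_fin.
Qed.

Lemma trig_approx_limit psi : cmeas psi ->
  (forall eps : R, 0 < eps -> exists psi', [/\ cmeas psi', trig_approx psi' &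
    (lam_sq (fun g => psi g - psi' g)%R < eps%:E)%E]) -> trig_approx psi.
Proof.
move=> mpsi H eps e0; have e4 : 0 < eps / 4 by rewrite divr_gt0.
have [psi' [m' a' lt']] := H _ e4; have [s lts] := a' _ e4.
exists s; have ms := trig_cmeas s.
rewrite (_ : (fun _ => _) = (fun g => (psi g - psi' g) + (psi' g - trig s g))); last first.
  by apply/funext => g; ring.
apply: (le_lt_trans (lam_sqD (cmeasB mpsi m') (cmeasB m' ms))).
have -> : eps%:E = (2%:E * (eps / 4)%:E + 2%:E * (eps / 4)%:E)%E.
  by rewrite -!EFinM -EFinD; congr (_%:E); field.
by apply: lteD; rewrite lte_pmul2l// lte_fin.
Qed.

Lemma trig_bapproxD psi psi' : trig_bapprox psi -> trig_bapprox psi' ->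
  trig_bapprox (fun g => psi g + psi' g).
Proof.
move=> [m1 [M1 M10 b1] a1] [m2 [M2 M20 b2] a2]; split.
- exact: cmeasD.
- exists (M1 + M2) => [|g]; first exact: addr_ge0.
  by apply: (le_trans (le_normcD _ _)); exact: lerD.
move=> eps e0; have e4 : 0 < eps / 4 by rewrite divr_gt0.
have [s lts] := a1 _ e4; have [t ltt] := a2 _ e4; exists (s ++ t).
rewrite (_ : (fun _ => _) = (fun g => (psi g - trig s g) + (psi' g - trig t g))); last first.
  by apply/funext => g; rewrite trigD; ring.
have ms := trig_cmeas s; have mt := trig_cmeas t.
apply: (le_lt_trans (lam_sqD (cmeasB m1 ms) (cmeasB m2 mt))).
have -> : eps%:E = (2%:E * (eps / 4)%:E + 2%:E * (eps / 4)%:E)%E.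
  by rewrite -!EFinM -EFinD; congr (_%:E); field.
by apply: lteD; rewrite lte_pmul2l// lte_fin.
Qed.

Lemma trig_bapproxM psi psi' : trig_bapprox psi -> trig_bapprox psi' ->
  trig_bapprox (fun g => psi g * psi' g).
Proof.
move=> [m1 [M1 M10 b1] a1] [m2 [M2 M20 b2] a2]; split.
- exact: cmeasM.
- exists (M1 * M2) => [|g]; first exact: mulr_ge0.
  by rewrite normcM ler_pM ?normc_ge0.
move=> eps e0.
have c2 : 0 < M2 ^+ 2 + 1 by rewrite ltr_wpDl ?sqr_ge0.
have e1 : 0 < eps / 4 / (M2 ^+ 2 + 1) by rewrite !divr_gt0.
(* [s] is fixed before [t], because the accuracy asked of [t] depends on the bound [B] of
   [trig s]. *)
have [s lts] := a1 _ e1; have [B B0 sB] := trig_bounded s.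
have cB : 0 < B ^+ 2 + 1 by rewrite ltr_wpDl ?sqr_ge0.
have e3 : 0 < eps / 4 / (B ^+ 2 + 1) by rewrite !divr_gt0.
have [t ltt] := a2 _ e3; exists [seq (a.1 * b.1, a.2 + b.2) | a <- s, b <- t].
have ms := trig_cmeas s; have mt := trig_cmeas t.
rewrite (_ : (fun _ => _) = (fun g => (psi g - trig s g) * psi' g + trig s g * (psi' g - trig t g))); last first.
  by apply/funext => g; rewrite trigM; ring.
apply: (le_lt_trans (lam_sqD (cmeasM (cmeasB m1 ms) m2) (cmeasM ms (cmeasB m2 mt)))).
have le1 : (lam_sq (fun g => (psi g - trig s g) * psi' g)%R <=
    (M2 ^+ 2 + 1)%:E * lam_sq (fun g => psi g - trig s g)%R)%E.
  apply: lam_sq_le => [||//|g]; [exact: cmeasM (cmeasB m1 ms) m2|exact: cmeasB|exact: ltW|].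
  rewrite normcM exprMn mulrC ler_wpM2r ?sqr_ge0//.
  by apply: (@le_trans _ _ (M2 ^+ 2)); [rewrite ler_sqr ?nnegrE ?normc_ge0|rewrite lerDl].
have le2 : (lam_sq (fun g => trig s g * (psi' g - trig t g))%R <=
    (B ^+ 2 + 1)%:E * lam_sq (fun g => psi' g - trig t g)%R)%E.
  apply: lam_sq_le => [||//|g]; [exact: cmeasM ms (cmeasB m2 mt)|exact: cmeasB|exact: ltW|].
  rewrite normcM exprMn ler_wpM2r ?sqr_ge0//.
  by apply: (@le_trans _ _ (B ^+ 2)); [rewrite ler_sqr ?nnegrE ?normc_ge0|rewrite lerDl].
have lt1 : (lam_sq (fun g => (psi g - trig s g) * psi' g)%R < (eps / 4)%:E)%E.
  by apply: (le_lt_trans le1); rewrite muleC -lte_pdivlMr.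
have lt2 : (lam_sq (fun g => trig s g * (psi' g - trig t g))%R < (eps / 4)%:E)%E.
  by apply: (le_lt_trans le2); rewrite muleC -lte_pdivlMr.
have -> : eps%:E = (2%:E * (eps / 4)%:E + 2%:E * (eps / 4)%:E)%E.
  by rewrite -!EFinM -EFinD; congr (_%:E); field.
by apply: lteD; rewrite lte_pmul2l// lte_fin.
Qed.

Lemma trig_bapprox_cst (c : R[i]) : trig_bapprox (fun=> c).
Proof.
rewrite (_ : (fun=> c) = trig [:: (c, 0)]); first exact: trig_bapprox_trig.
by apply/funext => g; rewrite /trig big_seq1 dual_at0 mulr1.
Qed.

Lemma trig_bapproxZ (c : R[i]) psi : trig_bapprox psi -> trig_bapprox (fun g => c * psi g).
Proof. by move=> h; apply: trig_bapproxM => //; exact: trig_bapprox_cst. Qed.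

Lemma trig_bapproxB psi psi' : trig_bapprox psi -> trig_bapprox psi' ->
  trig_bapprox (fun g => psi g - psi' g).
Proof.
move=> h h'; rewrite (_ : (fun _ => _) = (fun g => psi g + (-1) * psi' g)).
  by apply: trig_bapproxD => //; exact: trig_bapproxZ.
by apply/funext => g; rewrite mulN1r.
Qed.

(** Bounded pointwise limits stay approximable by dominated convergence: [lam] is integrable, and
    $(2M)^2\lambda$ dominates. *)
Lemma trig_bapprox_cvg (h_ : nat -> borel dual -> R) (h : borel dual -> R) (M : R) :
  (forall n, trig_bapprox (fun g => (h_ n g)%:C)) ->
  (forall n g, `|h_ n g| <= M) -> measurable_fun setT h ->
  (forall g, h_ ^~ g @ \oo --> h g) -> trig_bapprox (fun g => (h g)%:C).
Proof.
move=> bh hM mh hcvg.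
have M0 : 0 <= M by apply: le_trans (hM 0%N 0).
have hb g : `|h g| <= M.
  have c : (fun n => `|h_ n g|) @ \oo --> `|h g| by apply: cvg_norm; exact: hcvg.
  rewrite -(cvg_lim (@norm_hausdorff _ R^o) c).
  by apply: limr_le; [exact: (cvgP _ c)|exact: nearW].
split; first exact: cmeas_real.
  by exists M => // g; rewrite normc_real.
apply: trig_approx_limit; first exact: cmeas_real.
move=> eps e0.
have mhn n : measurable_fun setT (h_ n) by have [[+ _] _ _] := bh n.
have [|||||n hn] := @dominated_small _ _ _ nu
   (fun n g => normc ((h g)%:C - (h_ n g)%:C) ^+ 2 * lam g) (fun g => (4 * M ^+ 2) * lam g) eps.
- move=> n; apply: measurable_funM => //; apply: measurable_funX; apply: measurable_normc.
  by apply: cmeasB; exact: cmeas_real.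
- move=> g; rewrite -[X in _ --> X](mul0r (lam g)); apply: cvgMl.
  have -> : (fun n => normc ((h g)%:C - (h_ n g)%:C) ^+ 2) = (fun n => (h g - h_ n g) ^+ 2).
    by apply/funext => n; rewrite -(rmorphB (real_complex R)) normc_real real_normK// num_real.
  rewrite -[X in _ --> X](_ : (h g - h g) ^+ 2 = 0); last by rewrite subrr expr0n.
  by under eq_fun do rewrite expr2; rewrite expr2; apply: cvgM; apply: cvgB; try exact: cvg_cst; exact: hcvg.
- move=> n g; rewrite mulr_ge0 ?sqr_ge0//=; last exact: ltW.
  rewrite ler_wpM2r//; first exact: ltW.
  rewrite -(rmorphB (real_complex R)) normc_real (_ : 4 * M ^+ 2 = (M + M) ^+ 2); last by ring.
  by rewrite ler_sqr ?nnegrE ?addr_ge0//; apply: (le_trans (ler_normB _ _)); exact: lerD.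
- under [_ \o _]funext do rewrite /= EFinM.
  exact: integrableZl.
- exact: e0.
- by exists (fun g => (h_ n g)%:C); split => //; have [] := bh n.
Qed.

(** These sets form a sigma-algebra; once it contains the half-spaces it contains every Borel
    set. *)
Definition trig_set (E : set (borel dual)) :=
  measurable E /\ trig_bapprox (fun g => (\1_E g : R)%:C).

Lemma indic_setC (E : set (borel dual)) g : \1_(~` E) g = 1 - \1_E g :> R.
Proof. by rewrite !indicE in_setC; case: (g \in E); rewrite ?subrr ?subr0. Qed.

Lemma trig_setC E : trig_set E -> trig_set (~` E).
Proof.
move=> [mE aE]; split; first exact: measurableC.
rewrite (_ : (fun _ => _) = (fun g => 1 - (\1_E g : R)%:C)).
  by apply: trig_bapproxB => //; exact: trig_bapprox_cst.
by apply/funext => g; rewrite indic_setC rmorphB.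
Qed.

Lemma trig_setI E F : trig_set E -> trig_set F -> trig_set (E `&` F).
Proof.
move=> [mE aE] [mF aF]; split; first exact: measurableI.
rewrite (_ : (fun _ => _) = (fun g => (\1_E g : R)%:C * (\1_F g : R)%:C)).
  exact: trig_bapproxM.
by apply/funext => g; rewrite indicI -(rmorphM (real_complex R)).
Qed.

Lemma trig_set0 : trig_set set0.
Proof.
split => //; rewrite (_ : (fun _ => _) = (fun=> 0)); first exact: trig_bapprox_cst.
by apply/funext => g; rewrite indic0.
Qed.

Lemma trig_setU E F : trig_set E -> trig_set F -> trig_set (E `|` F).
Proof.
move=> hE hF; rewrite -[E `|` F]setCK setCU.
by apply: trig_setC; apply: trig_setI; exact: trig_setC.
Qed.

Lemma trig_set_bigcup (F : nat -> set (borel dual)) : (forall n, trig_set (F n)) ->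
  trig_set (\bigcup_n F n).
Proof.
move=> hF; pose U n := \big[setU/set0]_(i < n) F i.
have hU n : trig_set (U n).
  rewrite /U; elim: n => [|n IH]; first by rewrite big_ord0; exact: trig_set0.
  by rewrite big_ord_recr; exact: trig_setU.
split; first by apply: bigcupT_measurable => n; case: (hF n).
apply: (@trig_bapprox_cvg (fun n => \1_(U n)) _ 1).
- by move=> n; case: (hU n).
- by move=> n g; rewrite indicE ger0_norm//; case: (_ \in _).
- by apply: measurable_indic; apply: bigcupT_measurable => n; case: (hF n).
- move=> g; rewrite !indicE; have [[n _ Fng]|nF] := pselect ((\bigcup_n F n) g).
    rewrite mem_set; last by exists n.
    apply: cvg_near_cst; exists n.+1 => // m /= nm; rewrite indicE mem_set//.
    by rewrite /U -bigcup_mkord; exists n.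
  rewrite memNset//; apply: cvg_near_cst; apply: nearW => n; rewrite indicE memNset//.
  by rewrite /U -bigcup_mkord => -[i _ Fi]; apply: nF; exists i.
Qed.

Lemma trig_set_sigma_algebra : sigma_algebra setT trig_set.
Proof.
split; [exact: trig_set0|by move=> A; rewrite setTD; exact: trig_setC|].
exact: trig_set_bigcup.
Qed.

(** The iterates of the polynomial [signstep] on [b] stay approximable and converge boundedly to the
    sign of [b]; the indicator of positivity is half the sum of the sign and its square. *)
Lemma trig_set_gt0 (b : borel dual -> R) : trig_bapprox (fun g => (b g)%:C) ->
  (forall g, `|b g| <= 1) -> measurable_fun setT b -> trig_set [set g | 0 < b g].
Proof.
move=> ab b1 mb.
have it n : trig_bapprox (fun g => (iter n (@signstep R) (b g))%:C).
  elim: n => //= n IH.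
  rewrite (_ : (fun _ => _) = (fun g => ((3 / 2 : R)%:C * (iter n (@signstep R) (b g))%:C -
     (1 / 2 : R)%:C * ((iter n (@signstep R) (b g))%:C * ((iter n (@signstep R) (b g))%:C * (iter n (@signstep R) (b g))%:C))))).
    apply: trig_bapproxB; apply: trig_bapproxZ => //.
    by apply: trig_bapproxM => //; exact: trig_bapproxM.
  apply/funext => g; rewrite -!(rmorphM (real_complex R)) -(rmorphB (real_complex R)).
  by congr (_%:C); rewrite /signstep; field.
have mS : measurable [set g : borel dual | 0 < b g].
  have := mb measurableT _ (measurable_itv `]0, +oo[); rewrite setTI.
  by congr measurable; apply/seteqP; split => g /=; rewrite in_itv/= andbT.
have msg : measurable_fun setT (fun g : borel dual => Num.sg (b g)).
  rewrite (_ : (fun _ => _) = (fun g => \1_[set g : borel dual | 0 < b g] g - \1_[set g : borel dual | b g < 0] g)).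
    apply: measurable_funB; apply: measurable_indic => //.
    have := mb measurableT _ (measurable_itv `]-oo, 0[); rewrite setTI.
    by congr measurable; apply/seteqP; split => g /=; rewrite in_itv.
  apply/funext => g; rewrite !indicE; case: (ltrgt0P (b g)) => [h|h|h].
  - by rewrite gtr0_sg// mem_set// memNset ?subr0//= ltNge (ltW h).
  - by rewrite ltr0_sg// memNset ?mem_set ?sub0r//= ltNge (ltW h).
  - by rewrite h sgr0 !memNset ?subrr//= h ltxx.
have asg : trig_bapprox (fun g => (Num.sg (b g))%:C).
  apply: (@trig_bapprox_cvg (fun n g => iter n (@signstep R) (b g)) _ 1) => //.
    by move=> n g; exact: iter_signstep_bound.
  by move=> g; exact: iter_signstep_cvg.
split => //.
rewrite (_ : (fun _ => _) = (fun g => (1 / 2 : R)%:C * ((Num.sg (b g))%:C + (Num.sg (b g))%:C * (Num.sg (b g))%:C))).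
  by apply: trig_bapproxZ; apply: trig_bapproxD => //; exact: trig_bapproxM.
apply/funext => g; rewrite -(rmorphM (real_complex R)) -(rmorphD (real_complex R)) -(rmorphM (real_complex R)).
congr (_%:C); rewrite indicE; case: (ltrgt0P (b g)) => [h|h|h].
- by rewrite gtr0_sg// mem_set//=; field.
- by rewrite ltr0_sg// memNset/=; [field|rewrite ltNge (ltW h)].
- by rewrite h sgr0 memNset/=; [field|rewrite h ltxx].
Qed.

(** By [lifts_surj] some point [x] has frequency $te_j$, so the sine of a multiple of a coordinate
    is a trigonometric polynomial. Division by $1+|a|$ brings the difference into the range that
    [trig_set_gt0] requires. *)
Lemma trig_set_sin (j : 'I_(d + e)) (t a : R) :
  trig_set [set g | a < sin (t * coord j g)].
Proof.
have [x xt] := lifts_surj hausG lcG haar_mu dual_nu PhiD PhiH (t *: delta_mx 0 j).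
have gx (g : dual) : g x = cis (t * coord j g).
  rewrite xt; congr cis; rewrite /pairing (bigD1 j)//= !mxE !eqxx mulr1 big1 ?addr0// => i ij.
  by rewrite !mxE eqxx (negbTE ij) mulr0 mul0r.
pose b (g : borel dual) : R := (sin (t * coord j g) - a) / (1 + `|a|).
have a1 : 0 < 1 + `|a| by rewrite ltr_pwDl.
have -> : [set g : dual | a < sin (t * coord j g)] = [set g : borel dual | 0 < b g].
  by apply/seteqP; split => g /=; rewrite /b pmulr_lgt0 ?invr_gt0// subr_gt0.
have tx : trig_bapprox (fun g : borel dual => (g : dual) x).
  rewrite (_ : (fun _ => _) = trig [:: (1, x)]); first exact: trig_bapprox_trig.
  by apply/funext => g; rewrite /trig big_seq1 mul1r.
have txN : trig_bapprox (fun g : borel dual => ((g : dual) x)^*%C).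
  rewrite (_ : (fun _ => _) = trig [:: (1, - x)]); first exact: trig_bapprox_trig.
  by apply/funext => g; rewrite /trig big_seq1 mul1r dual_opp.
apply: trig_set_gt0.
- rewrite (_ : (fun _ => _) = (fun g : borel dual => (1 / (1 + `|a|) : R)%:C *
      (('i%C / 2%:R) * (((g : dual) x)^*%C - (g : dual) x) - a%:C))).
    apply: trig_bapproxZ; apply: trig_bapproxB; last exact: trig_bapprox_cst.
    by apply: trig_bapproxZ; exact: trig_bapproxB.
  apply/funext => g; rewrite /b gx /cis mulrC mul1r (rmorphM (real_complex R)); congr (_ * _).
  rewrite (rmorphB (real_complex R)); congr (_ - _).
  have := ImJ_sub (cos (t * coord j g) +i* sin (t * coord j g)) => /= ->; ring.
- move=> g; have i0 : 0 < (1 + `|a|)^-1 by rewrite invr_gt0.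
  rewrite normrM (gtr0_norm i0) ler_pdivrMr// mul1r.
  by apply: (le_trans (ler_normB _ _)); rewrite lerD2r ler_norml sin_geN1 sin_le1.
- apply: measurable_funM; last exact: measurable_cst.
  apply: measurable_funB; last exact: measurable_cst.
  have [_ mi] := @eval_measurable R G x.
  rewrite (_ : (fun _ => _) = (fun g : borel dual => complex.Im ((g : dual) x)))//.
  by apply/funext => g; rewrite gx.
Qed.

Lemma trig_set_bigcap (F : nat -> set (borel dual)) : (forall n, trig_set (F n)) ->
  trig_set (\bigcap_n F n).
Proof.
move=> hF; rewrite -[\bigcap_n F n]setCK setC_bigcap.
by apply: trig_setC; apply: trig_set_bigcup => n; exact: trig_setC.
Qed.

Lemma sin_scaled (v eps : R) : 0 < eps ->
  exists N, forall n, (N <= n)%N -> `|n.+1%:R * sin (n.+1%:R^-1 * v) - v| < eps.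
Proof.
move=> e0; have v0 : 0 < `|v| + 1 by rewrite ltr_wpDl.
have [r r0 Hr] := @sin_near0 R _ (divr_gt0 e0 v0).
exists (Num.bound (`|v| / r)) => n Nn.
have n0 : (0 : R) < n.+1%:R by [].
have vr : `|n.+1%:R^-1 * v| < r.
  rewrite normrM gtr0_norm ?invr_gt0// mulrC ltr_pdivrMr// mulrC -ltr_pdivrMr//.
  apply: (lt_le_trans (archi_boundP _)); first by rewrite divr_ge0// ltW.
  by rewrite ler_nat; exact: leqW.
have := Hr _ vr; rewrite normrM [`|_^-1|]gtr0_norm ?invr_gt0// => h.
have -> : n.+1%:R * sin (n.+1%:R^-1 * v) - v = n.+1%:R * (sin (n.+1%:R^-1 * v) - n.+1%:R^-1 * v).
  by rewrite mulrBr mulrA divff ?gt_eqF// mul1r.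
rewrite normrM gtr0_norm//.
apply: (@le_lt_trans _ _ (n.+1%:R * (eps / (`|v| + 1) * (n.+1%:R^-1 * `|v|)))).
  by rewrite ler_wpM2l// ltW.
rewrite (_ : _ * _ = eps * (`|v| / (`|v| + 1))); last by field; rewrite !gt_eqF.
by rewrite gtr_pMr// ltr_pdivrMr// mul1r ltrDl.
Qed.

Lemma trig_set_halfspace (j : 'I_(d + e)) (a : R) : trig_set [set g | a < coord j g].
Proof.
pose S k n : set (borel dual) :=
  [set g | (a + k.+1%:R^-1) / n.+1%:R < sin (n.+1%:R^-1 * coord j g)].
have SE k n g : S k n g <-> a + k.+1%:R^-1 < n.+1%:R * sin (n.+1%:R^-1 * coord j g).
  by rewrite /S /= ltr_pdivrMr// mulrC.
(* The half-space is recovered from sines because $(n+1)\sin(v/(n+1))\to v$; the margin $1/(k+1)$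
   keeps the inequality strict in the limit. *)
have -> : [set g : borel dual | a < coord j g] =
    \bigcup_k \bigcup_N \bigcap_n S k (N + n)%N.
  apply/seteqP; split => [g /= ag|g [k _ [N _ h]]] /=.
    have [k ak] := ltr_add_invr ag.
    have d0 : 0 < coord j g - (a + k.+1%:R^-1) by rewrite subr_gt0.
    have [N HN] := sin_scaled (coord j g) d0.
    exists k => //; exists N => // n _; apply/SE.
    have := HN _ (leq_addr n N); rewrite ltr_norml => /andP[h _].
    by move: h; rewrite opprB ltrBrDr subrK.
  have k0 : (0 : R) < k.+1%:R^-1 by rewrite invr_gt0.
  have [M HM] := sin_scaled (coord j g) k0.
  have /SE := h M I; have := HM _ (leq_addl N M); rewrite ltr_norml => /andP[_].
  rewrite ltrBlDr => h1 h2; have := lt_trans h2 h1.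
  by rewrite addrC ltrD2l.
apply: trig_set_bigcup => k; apply: trig_set_bigcup => N; apply: trig_set_bigcap => n.
exact: trig_set_sin.
Qed.

Lemma trig_set_measurable (E : set (borel dual)) : measurable E -> trig_set E.
Proof.
apply: (smallest_sub trig_set_sigma_algebra) => O oO.
apply: (smallest_sub trig_set_sigma_algebra _ (open_halfspaces PhiD PhiH oO)).
by move=> _ [j [a ->]]; exact: trig_set_halfspace.
Qed.

Import HBSimple HBNNSimple.

Lemma trig_bapprox_sum (I : Type) (s : seq I) (F : I -> borel dual -> R[i]) :
  (forall i, trig_bapprox (F i)) -> trig_bapprox (fun g => \sum_(i <- s) F i g).
Proof.
move=> hF; elim: s => [|i s IH].
  by under eq_fun do rewrite big_nil; exact: trig_bapprox_cst.
by under eq_fun do rewrite big_cons; exact: trig_bapproxD.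
Qed.

Lemma trig_bapprox_sfun (f : {nnsfun borel dual >-> R}) : trig_bapprox (fun g => (f g)%:C).
Proof.
have -> : (fun g => (f g)%:C) = (fun g => \sum_(y <- finmap.enum_fset (fset_set (range f)))
    y%:C * (\1_(f @^-1` [set y]) g : R)%:C).
  apply/funext => g; rewrite {1}fimfunE fsbig_finite/=; last exact: (fimfunP f).
  rewrite (big_morph (fun r : R => r%:C) (rmorphD (real_complex R)) (rmorph0 (real_complex R))).
  by apply: eq_bigr => y _; exact: (rmorphM (real_complex R)).
apply: trig_bapprox_sum => y; apply: trig_bapproxZ.
by have [] := trig_set_measurable (measurable_sfunP f (measurable_set1 y)).
Qed.

Lemma trig_bapprox_real_ge0 (h : borel dual -> R) (M : R) : measurable_fun setT h ->
  (forall g, 0 <= h g <= M) -> trig_bapprox (fun g => (h g)%:C).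
Proof.
move=> mh hM; have meh : measurable_fun setT (EFin \o h) by exact/measurable_EFinP.
pose f := nnsfun_approx measurableT meh.
have eh0 (g : borel dual) : setT g -> (0 <= (EFin \o h) g)%E by case/andP: (hM g).
have cf g : f ^~ g @ \oo --> h g.
  by have /fine_cvgP[_] := cvg_nnsfun_approx measurableT meh eh0 (x := g) I.
apply: (@trig_bapprox_cvg f h M) => //.
- by move=> n; exact: trig_bapprox_sfun.
- move=> n g; have /andP[_ h1] := hM g; rewrite ger0_norm//; apply: le_trans h1.
  by rewrite /f nnsfun_approxE -lee_fin; apply: (le_approx n (x := g)) => //; exact: eh0.
Qed.

Lemma trig_bapprox_real (h : borel dual -> R) (M : R) : measurable_fun setT h ->
  (forall g, `|h g| <= M) -> trig_bapprox (fun g => (h g)%:C).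
Proof.
move=> mh hM.
rewrite (_ : (fun _ => _) = (fun g => (h g + M)%:C - M%:C)).
  apply: trig_bapproxB; last exact: trig_bapprox_cst.
  apply: (@trig_bapprox_real_ge0 _ (M + M)); first exact: measurable_funD.
  by move=> g; have := hM g; rewrite ler_norml => /andP[h1 h2]; lra.
by apply/funext => g; rewrite (rmorphD (real_complex R)) addrK.
Qed.

Lemma trig_bapprox_bounded psi (M : R) : cmeas psi ->
  (forall g, normc (psi g) <= M) -> trig_bapprox psi.
Proof.
move=> [mr mi] hM.
rewrite (_ : psi = (fun g => (complex.Re (psi g))%:C + 'i%C * (complex.Im (psi g))%:C)).
  apply: trig_bapproxD; last apply: trig_bapproxZ; apply: (@trig_bapprox_real _ M) => // g.
    by apply: le_trans (hM g); exact: Re_le_normc.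
  by apply: le_trans (hM g); exact: Im_le_normc.
by apply/funext => g; rewrite [LHS]complexE.
Qed.

(** Cutting [psi] off where its modulus exceeds [n] leaves a bounded function, and the error tends
    to 0 by domination. *)
Lemma trig_approx_lam_sq psi : cmeas psi -> (lam_sq psi < +oo)%E -> trig_approx psi.
Proof.
move=> mpsi wpsi; apply: trig_approx_limit => // eps e0.
pose cut n : set (borel dual) := [set g | normc (psi g) <= n%:R].
have mcut n : measurable (cut n).
  have := measurable_normc mpsi measurableT (measurable_itv `]-oo, n%:R]); rewrite setTI.
  by congr measurable; apply/seteqP; split => g /=; rewrite in_itv.
have mc n : cmeas (fun g => psi g * (\1_(cut n) g : R)%:C).
  by apply: cmeasM => //; exact: cmeas_indic.
have [|||||n hn] := @dominated_small _ _ _ nu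
   (fun n g => normc (psi g - psi g * (\1_(cut n) g : R)%:C) ^+ 2 * lam g)
   (fun g => normc (psi g) ^+ 2 * lam g) eps.
- move=> n; apply: measurable_funM => //; apply: measurable_funX; apply: measurable_normc.
  exact: cmeasB.
- move=> g; apply: cvg_near_cst; exists (Num.bound (normc (psi g))) => // n /= bn.
  rewrite indicE mem_set ?mulr1 ?subrr ?normc0 ?expr0n ?mul0r//= /cut/=.
  by apply: ltW; apply: (lt_le_trans (archi_boundP (normc_ge0 _))); rewrite ler_nat.
- move=> n g; rewrite mulr_ge0 ?sqr_ge0//=; last exact: ltW.
  rewrite ler_wpM2r//; first exact: ltW.
  rewrite ler_sqr ?nnegrE ?normc_ge0// -{1}[psi g]mulr1 -mulrBr normcM.
  rewrite ler_piMr ?normc_ge0// -(rmorphB (real_complex R)) normc_real indicE.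
  by case: (_ \in _); rewrite ?subrr ?normr0// subr0 normr1.
- apply/integrableP; split; first exact: lam_sq_measurable.
  by under eq_integral do rewrite gee0_abs ?lee_fin//.
- exact: e0.
exists (fun g => psi g * (\1_(cut n) g : R)%:C); split => //.
have [g|//] := @trig_bapprox_bounded (fun g => psi g * (\1_(cut n) g : R)%:C) n%:R (mc n).
rewrite normcM normc_real indicE; case: (asboolP (cut n g)) => [h|h].
  by rewrite mem_set// normr1 mulr1.
by rewrite memNset// normr0 mulr0.
Qed.

End trigonometric_density.

(** * The weighted space of densities *)

Section weighted_space.
Context (R : realType) (G : topologicalZmodType).
Local Notation dual := (dual_group R G).
Context (nu : {measure set (borel dual) -> \bar R}).
Context (lam : dual -> R) (ilam : nu.-integrable setT (EFin \o lam)).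
Hypothesis lam_gt0 : forall g, 0 < lam g.
Implicit Types (phi psi : borel dual -> R[i]) (x : G).

Lemma lam_measurable : measurable_fun setT (lam : borel dual -> R).
Proof. by apply/measurable_EFinP; exact: (measurable_int _ ilam). Qed.

Lemma lamV_measurable : measurable_fun setT (fun g : borel dual => (lam g)^-1).
Proof.
rewrite (_ : (fun _ => _) = (fun g => lam g `^ (- 1))).
  exact: (measurableT_comp (@measurable_powR R (- 1)) lam_measurable).
by apply/funext => g; rewrite powR_inv1// ltW.
Qed.

Definition energy phi : \bar R := (\int[nu]_g (normc (phi g) ^+ 2 / lam g)%:E)%E.

Lemma energyE phi : energy phi = (\int[nu]_g (normc (phi g) ^+ 2 / lam g)%:E)%E.
Proof. by []. Qed.

Definition finite_energy phi := cmeas phi /\ (energy phi < +oo)%E.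

Lemma energy_integrand_ge0 phi (g : dual) : 0 <= normc (phi g) ^+ 2 / lam g.
Proof. by rewrite divr_ge0 ?sqr_ge0// ltW. Qed.
Let w0 := energy_integrand_ge0.

Lemma energy_measurable phi : cmeas phi ->
  measurable_fun setT (fun g : borel dual => normc (phi g) ^+ 2 / lam g).
Proof.
move=> mphi; apply: measurable_funM; last exact: lamV_measurable.
by apply: measurable_funX; exact: measurable_normc.
Qed.

Lemma energy_emeasurable phi : cmeas phi ->
  measurable_fun setT (fun g : borel dual => (normc (phi g) ^+ 2 / lam g)%:E).
Proof. by move=> mphi; apply/measurable_EFinP; exact: energy_measurable. Qed.

Lemma energy_ge0 phi : (0 <= energy phi)%E.
Proof. by apply: integral_ge0 => g _; rewrite lee_fin. Qed.

Lemma energy_fin phi : finite_energy phi -> energy phi \is a fin_num.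
Proof. by move=> [_ ?]; rewrite ge0_fin_numE// energy_ge0. Qed.

Lemma energyZ (a : R[i]) phi : cmeas phi ->
  energy (fun g => a * phi g)%R = ((normc a ^+ 2)%:E * energy phi)%E.
Proof.
move=> m; rewrite /energy -ge0_integralZl//.
- by apply: eq_integral => g _; rewrite -EFinM normcM exprMn -!mulrA.
- exact: energy_emeasurable.
- by move=> g _; rewrite lee_fin.
- by rewrite lee_fin sqr_ge0.
Qed.

Lemma energyD phi psi : cmeas phi -> cmeas psi ->
  (energy (fun g => phi g + psi g)%R <= 2%:E * energy phi + 2%:E * energy psi)%E.
Proof.
move=> m1 m2; rewrite /energy -!ge0_integralZl//; try solve
  [exact: energy_emeasurable | by move=> g _; rewrite lee_fin].
rewrite -ge0_integralD//; try solve
  [by apply: measurable_funeM; exact: energy_emeasurable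
  |by move=> g _; rewrite -EFinM lee_fin mulr_ge0].
apply: ge0_le_integral => //.
- by move=> g _; rewrite lee_fin (w0 (fun g => phi g + psi g)).
- by apply: energy_emeasurable; exact: cmeasD.
- by apply: emeasurable_funD; apply: measurable_funeM; exact: energy_emeasurable.
- move=> g _; rewrite -!EFinM -EFinD lee_fin !(mulrA _ _ (lam g)^-1) -mulrDl.
  by rewrite ler_wpM2r ?sqr_normcD// invr_ge0 ltW.
Qed.

Lemma finite_energyZ (a : R[i]) phi : finite_energy phi -> finite_energy (fun g => a * phi g).
Proof.
move=> h; split; first by apply: cmeasM h.1; exact: cmeas_cst.
rewrite energyZ; last exact: h.1.
by rewrite -(fineK (energy_fin h)) -EFinM ltry.
Qed.

Lemma finite_energyD phi psi : finite_energy phi -> finite_energy psi -> finite_energy (fun g => phi g + psi g).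
Proof.
move=> h k; split; first exact: cmeasD h.1 k.1.
apply: (le_lt_trans (energyD h.1 k.1)).
by rewrite -(fineK (energy_fin h)) -(fineK (energy_fin k)) -!EFinM -EFinD ltry.
Qed.

Lemma finite_energyB phi psi : finite_energy phi -> finite_energy psi -> finite_energy (fun g => phi g - psi g).
Proof.
move=> h k; rewrite (_ : (fun _ => _) = (fun g => phi g + (-1) * psi g)).
  by apply: finite_energyD => //; exact: finite_energyZ.
by apply/funext => g; rewrite mulN1r.
Qed.

Lemma finite_energy0 : finite_energy (fun=> 0).
Proof.
split; first exact: cmeas_cst.
rewrite /energy; under eq_integral do rewrite normc0 expr0n mul0r.
by rewrite integral0.
Qed.

Lemma finite_energy_integrable phi : finite_energy phi ->
  nu.-integrable setT (fun g : borel dual => (normc (phi g) ^+ 2 / lam g)%:E).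
Proof.
move=> [m l]; apply/integrableP; split; first exact: energy_emeasurable.
by under eq_integral do rewrite gee0_abs ?lee_fin//.
Qed.

(** Pointwise $|\varphi|\le|\varphi|^2/\lambda+\lambda$, and both terms are integrable. *)
Lemma finite_energy_cintegrable phi : finite_energy phi -> cintegrable nu phi.
Proof.
move=> h; apply: (@cintegrable_le _ _ _ _ _ (fun g => normc (phi g) ^+ 2 / lam g + lam g)).
- exact: h.1.
- move=> g; have l0 := lam_gt0 g.
  rewrite -(ler_pM2r l0) mulrDl divfK ?gt_eqF//.
  have := normc_ge0 (phi g); nra.
- under [_ \o _]funext do rewrite /= EFinD.
  by apply: integrableD => //; exact: finite_energy_integrable.
Qed.

Lemma finite_energy_rkhs_density phi : finite_energy phi <->
  cintegrable nu phi /\ (\int[nu]_g (normc (phi g) ^+ 2 / lam g)%:E < +oo)%E.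
Proof.
split=> [h|[h k]]; first by split; [exact: finite_energy_cintegrable|exact: h.2].
by split => //; exact: cintegrable_cmeas h.
Qed.

Definition energy_inner phi psi : R[i] :=
  cintegral nu (fun g : borel dual => phi g * (psi g)^*%C / (lam g)%:C).

Lemma energy_innerE phi psi : energy_inner phi psi =
  cintegral nu (fun g : borel dual => phi g * (psi g)^*%C / (lam g)%:C).
Proof. by []. Qed.

Lemma normc_lamV (g : dual) : normc ((lam g)%:C)^-1 = (lam g)^-1.
Proof. by rewrite -fmorphV/= normc_real ger0_norm// invr_ge0 ltW. Qed.

Lemma cmeas_lamV : cmeas (fun g : borel dual => ((lam g)%:C)^-1 : R[i]).
Proof.
under eq_fun do rewrite -fmorphV/=.
by apply: cmeas_real; exact: lamV_measurable.
Qed.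

Lemma cintegrable_wip phi psi : finite_energy phi -> finite_energy psi ->
  cintegrable nu (fun g : borel dual => phi g * (psi g)^*%C / (lam g)%:C).
Proof.
move=> h k; apply: (@cintegrable_le _ _ _ _ _
   (fun g => normc (phi g) ^+ 2 / lam g + normc (psi g) ^+ 2 / lam g)).
- apply: cmeasM; last exact: cmeas_lamV.
  by apply: cmeasM; [exact: h.1|apply: cmeas_conj; exact: k.1].
- move=> g; rewrite !normcM normc_lamV normc_conj -mulrDl ler_wpM2r//.
    by rewrite invr_ge0 ltW.
  have := normc_ge0 (phi g); have := normc_ge0 (psi g); nra.
- under [_ \o _]funext do rewrite /= EFinD.
  by apply: integrableD => //; exact: finite_energy_integrable.
Qed.

Lemma energy_inner_cauchy_schwarz phi psi (Q : R) : finite_energy phi -> finite_energy psi -> 0 < Q ->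
  (energy psi <= Q%:E)%E -> ((normc (energy_inner phi psi) ^+ 2)%:E <= energy phi * Q%:E)%E.
Proof.
move=> h k Q0 kQ; apply: (@cauchy_schwarz_dom _ _ _ nu _ (fun g => normc (phi g) ^+ 2 / lam g)
  (fun g => normc (psi g) ^+ 2 / lam g)) => //.
- exact: cintegrable_wip.
- exact: energy_measurable h.1.
- exact: energy_measurable k.1.
- move=> g; rewrite !normcM normc_lamV normc_conj le_eqVlt; apply/orP; left; apply/eqP.
  by rewrite !expr2; ring.
Qed.

Lemma energy_inner_lin (a : R[i]) phi phi' psi : finite_energy phi -> finite_energy phi' -> finite_energy psi ->
  energy_inner (fun g => a * phi g + phi' g) psi = a * energy_inner phi psi + energy_inner phi' psi.
Proof.
move=> h h' k; rewrite /energy_inner -cintegral_lin; try exact: cintegrable_wip.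
by apply: eq_cintegral => g; ring.
Qed.

Lemma energy_inner_conj phi psi : finite_energy phi -> finite_energy psi -> energy_inner psi phi = (energy_inner phi psi)^*%C.
Proof.
move=> h k; rewrite /energy_inner -cintegral_conj; last exact: cintegrable_wip.
apply: eq_cintegral => g; rewrite !conjcM conjcK.
have -> : (((lam g)%:C)^-1)^*%C = ((lam g)%:C)^-1 :> R[i].
  by rewrite -(fmorphV (real_complex R)) /=; simpc.
by rewrite [(phi g)^*%C * _]mulrC.
Qed.

Lemma energy_inner_diag phi : energy_inner phi phi = (fine (energy phi))%:C.
Proof.
rewrite -[fine _]/(\int[nu]_g (normc (phi g) ^+ 2 / lam g)) -cintegral_real.
by apply: eq_cintegral => g; rewrite mul_conjc -fmorphV/= -rmorphM.
Qed.

Lemma energy_inner_ae phi phi' psi psi' : finite_energy phi -> finite_energy phi' -> finite_energy psi -> finite_energy psi' ->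
  {ae nu, forall g, phi g = phi' g} -> {ae nu, forall g, psi g = psi' g} ->
  energy_inner phi psi = energy_inner phi' psi'.
Proof.
move=> h h' k k' e1 e2; apply: ae_eq_cintegral.
- exact: (cintegrable_cmeas (cintegrable_wip h k)).
- exact: (cintegrable_cmeas (cintegrable_wip h' k')).
- by apply: filterS2 e1 e2 => g -> ->.
Qed.

(** The density of the kernel section at [x]: pairing [phi] with it in the energy inner product
    gives the inverse transform of [phi] at [x]. *)
Definition kernel_density x : borel dual -> R[i] := fun g => (lam g)%:C * ((g : dual) x)^*%C.

Lemma cmeas_kernel_density x : cmeas (kernel_density x).
Proof.
apply: cmeasM; first exact: cmeas_real lam_measurable.
by apply: cmeas_conj; exact: eval_measurable.
Qed.

Lemma energy_kernel_density x : energy (kernel_density x) = (\int[nu]_g (lam g)%:E)%E.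
Proof.
apply: eq_integral => g _; congr EFin; have l0 := lam_gt0 (g : dual).
rewrite normcM normc_conj normc_dual mulr1 normc_real (gtr0_norm l0) expr2.
by rewrite mulfK// gt_eqF.
Qed.

Lemma lam_total_fin : (\int[nu]_g (lam g)%:E)%E \is a fin_num.
Proof. exact: integrable_fin_num. Qed.

Lemma finite_energy_kernel_density x : finite_energy (kernel_density x).
Proof.
split; first exact: cmeas_kernel_density.
by rewrite energy_kernel_density -(fineK lam_total_fin) ltry.
Qed.

Lemma energy_inner_kernel_density phi x : energy_inner phi (kernel_density x) = inv_fourier nu phi x.
Proof.
apply: eq_cintegral => g; have l0 := lam_gt0 (g : dual).
rewrite conjcM conjcK conjc_real.
have l1 : ((lam g)%:C : R[i]) != 0 by rewrite (fmorph_eq0 (real_complex R)) gt_eqF.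
by field.
Qed.

(** The summand 1 makes this bound on the energy of every [kernel_density] positive, as the
    Cauchy-Schwarz lemma requires. *)
Definition lam_mass : R := fine (\int[nu]_g (lam g)%:E)%E + 1.

Lemma lam_mass_gt0 : 0 < lam_mass.
Proof.
rewrite ltr_wpDl// fine_ge0// integral_ge0// => g _.
by rewrite lee_fin ltW.
Qed.

Lemma inv_fourier_energy phi x : finite_energy phi ->
  ((normc (inv_fourier nu phi x) ^+ 2)%:E <= energy phi * lam_mass%:E)%E.
Proof.
move=> h; rewrite -energy_inner_kernel_density; apply: energy_inner_cauchy_schwarz => //.
- exact: finite_energy_kernel_density.
- exact: lam_mass_gt0.
- by rewrite energy_kernel_density /lam_mass EFinD (fineK lam_total_fin) leeDl.
Qed.

Lemma energy_eq0_ae phi : cmeas phi -> energy phi = 0%E -> {ae nu, forall g, phi g = 0}.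
Proof.
move=> m n0.
have /ae_eq_integral_abs H : measurable_fun setT
  (fun g : borel dual => (normc (phi g) ^+ 2 / lam g)%:E) by exact: energy_emeasurable.
have : ae_eq nu setT (fun g : borel dual => (normc (phi g) ^+ 2 / lam g)%:E) (cst 0%E).
  by apply/(H _ measurableT); under eq_integral do rewrite gee0_abs ?lee_fin//.
apply: filterS => g /(_ I) [] /eqP.
rewrite mulf_eq0 invr_eq0 (gt_eqF (lam_gt0 (g : dual))) orbF expf_eq0/= normc_eq0.
by move=> /eqP.
Qed.

End weighted_space.

Section density_uniqueness.
Context (R : realType) (G : topologicalZmodType).
Local Notation dual := (dual_group R G).
Hypothesis hausG : hausdorff_space G.
Hypothesis lcG : locally_compact [set: G].
Context (mu : {measure set (borel G) -> \bar R}) (haar_mu : is_haar mu).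
Context (nu : {measure set (borel dual) -> \bar R}) (dual_nu : is_dual_haar mu nu).
Context (d e : nat) (Phi : dual -> 'rV[R]_d * 'rV[int]_e).
Hypothesis PhiD : forall a b, Phi (a + b) = Phi a + Phi b.
Hypothesis PhiH : homeomorphism Phi.
Context (lam : dual -> R) (ilam : nu.-integrable setT (EFin \o lam)).
Hypothesis lam_gt0 : forall g, 0 < lam g.
Implicit Types (phi psi : borel dual -> R[i]) (x : G).
Local Notation energy := (energy nu lam).
Local Notation finite_energy := (finite_energy nu lam).
Local Notation energy_inner := (energy_inner nu lam).

Definition kernel_comb s : borel dual -> R[i] :=
  fun g => \sum_(cx <- s) cx.1 * kernel_density lam cx.2 g.

Lemma finite_energy_kernel_comb s : finite_energy (kernel_comb s).
Proof.
elim: s => [|cx s IH]; rewrite /kernel_comb.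
  by under eq_fun do rewrite big_nil; exact: finite_energy0.
under eq_fun do rewrite big_cons; apply: finite_energyD => //; apply: finite_energyZ => //.
exact: finite_energy_kernel_density.
Qed.

(** Division by [lam] is an isometry from the energy norm to $L^2(\lambda\,d\nu)$ that turns kernel
    densities into conjugate characters, where [trig_approx_lam_sq] applies; the conjugation
    explains the sign change of the points. *)
Lemma kernel_comb_dense phi (eps : R) : finite_energy phi -> 0 < eps ->
  exists s, (energy (fun g => phi g - kernel_comb s g)%R < eps%:E)%E.
Proof.
move=> [m n] e0; pose psi g := phi g / (lam g)%:C.
have mpsi : cmeas psi by apply: cmeasM => //; exact: (cmeas_lamV ilam lam_gt0).
have l1 g : ((lam g)%:C : R[i]) != 0 by rewrite (fmorph_eq0 (real_complex R)) gt_eqF.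
have NW2 (f : borel dual -> R[i]) (g : dual) :
    normc (f g / (lam g)%:C) ^+ 2 * lam g = normc (f g) ^+ 2 / lam g.
  rewrite normcM (normc_lamV lam_gt0) exprMn -mulrA; congr (_ * _).
  by rewrite expr2 -mulrA mulVf ?mulr1// gt_eqF.
have wpsi : (lam_sq nu lam psi < +oo)%E.
  by rewrite /lam_sq; under eq_integral do rewrite NW2.
have [s hs] := trig_approx_lam_sq hausG lcG haar_mu dual_nu PhiD PhiH ilam lam_gt0 mpsi wpsi e0.
exists [seq (cx.1, - cx.2) | cx <- s]; move: hs; rewrite /lam_sq energyE.
rewrite (_ : integral _ _ _ = integral nu setT (fun g : borel dual => (normc (phi g - kernel_comb [seq (cx.1, - cx.2) | cx <- s] g) ^+ 2 / lam g)%:E))//.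
apply: eq_integral => g _; rewrite -(NW2 (fun g => phi g - kernel_comb _ g)); congr ((normc _ ^+ 2 * _)%:E).
rewrite mulrBl; congr (_ - _); rewrite /kernel_comb big_map mulr_suml; apply: eq_bigr => cx _ /=.
rewrite /kernel_density dual_opp conjcK; have := l1 g => l1g; by field.
Qed.

(** A density with zero transform is orthogonal to all kernel densities, so its energy $N$ equals
    its inner product with $\varphi-s$ for any combination $s$ of them. With $s$ close to $\varphi$,
    Cauchy-Schwarz gives $N^2\le N\varepsilon$. *)
Lemma inv_fourier_eq0 phi : finite_energy phi -> (forall x, inv_fourier nu phi x = 0) ->
  {ae nu, forall g, phi g = 0}.
Proof.
move=> h f0; apply: (energy_eq0_ae ilam lam_gt0 h.1); apply/eqP; rewrite eq_le energy_ge0// andbT.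
apply/lee_addgt0Pr => eps e0; rewrite add0e.
have [s hs] := kernel_comb_dense h e0; have gs := finite_energy_kernel_comb s.
have ws t : energy_inner phi (kernel_comb t) = 0.
  elim: t => [|cx t IH].
    by rewrite energy_innerE -[RHS](cintegral0 nu); apply: eq_cintegral => g; rewrite /kernel_comb big_nil conjc0 mulr0 mul0r.
  have gk := finite_energyZ ilam lam_gt0 cx.1 (finite_energy_kernel_density ilam lam_gt0 cx.2).
  rewrite (energy_inner_conj ilam lam_gt0 (finite_energy_kernel_comb _) h) /kernel_comb.
  under [fun _ => _]eq_fun do rewrite big_cons.
  rewrite (energy_inner_lin ilam lam_gt0 _ (finite_energy_kernel_density ilam lam_gt0 cx.2) (finite_energy_kernel_comb t) h).
  rewrite conjcD conjcM -(energy_inner_conj ilam lam_gt0 (finite_energy_kernel_comb t) h) IH.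
  rewrite -(energy_inner_conj ilam lam_gt0 (finite_energy_kernel_density ilam lam_gt0 cx.2) h) (energy_inner_kernel_density nu lam_gt0) f0.
  by rewrite mulr0 addr0.
have gB := finite_energyB ilam lam_gt0 h gs.
have wB : energy_inner phi (fun g => phi g - kernel_comb s g) = energy_inner phi phi.
  rewrite (energy_inner_conj ilam lam_gt0 gB h).
  rewrite (_ : (fun g => _) = (fun g => (-1) * kernel_comb s g + phi g)); last by apply/funext => g; ring.
  by rewrite energy_inner_lin// conjcD conjcM -!energy_inner_conj// ws mulr0 add0r.
have := energy_inner_cauchy_schwarz ilam lam_gt0 h gB e0 (ltW hs).
rewrite wB energy_inner_diag normc_real ger0_norm ?fine_ge0 ?energy_ge0// -{2 3}(fineK (energy_fin lam_gt0 h)).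
rewrite -EFinM !lee_fin expr2; set N := fine _.
have := fine_ge0 (energy_ge0 nu lam_gt0 phi); rewrite -/N le_eqVlt => /orP[/eqP <- _|N0]; first exact: ltW.
by rewrite ler_pM2l.
Qed.

Lemma inv_fourier_inj phi psi : finite_energy phi -> finite_energy psi ->
  (forall x, inv_fourier nu phi x = inv_fourier nu psi x) -> {ae nu, forall g, phi g = psi g}.
Proof.
move=> h k e1; have gB := finite_energyB ilam lam_gt0 h k.
have := inv_fourier_eq0 gB; move=> H.
have /H : forall x, inv_fourier nu (fun g => phi g - psi g) x = 0.
  move=> x; rewrite inv_fourierB; [by rewrite e1 subrr|exact: (finite_energy_cintegrable ilam)|exact: (finite_energy_cintegrable ilam)].
by apply: filterS => g /eqP; rewrite subr_eq0 => /eqP.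
Qed.

End density_uniqueness.

(** * Convolution and Neumann series *)

Section mixtures.
Context (R : realType) (G : topologicalZmodType).
Local Notation dual := (dual_group R G).
Context (nu : {sigma_finite_measure set (borel dual) -> \bar R}).
Context (lam : dual -> R) (ilam : nu.-integrable setT (EFin \o lam)).
Hypothesis lam_gt0 : forall g, 0 < lam g.
Context dA (A : measurableType dA) (m : {sigma_finite_measure set A -> \bar R}).
Context (Psi : A * borel dual -> R[i]) (p w : A * borel dual -> R) (C : R).
Hypothesis C_gt0 : 0 < C.
Hypothesis mPsi : cmeas Psi.
Hypothesis mp : measurable_fun setT p.
Hypothesis mw : measurable_fun setT w.
Hypothesis p_ge0 : forall z, 0 <= p z.
Hypothesis w_ge0 : forall z, 0 <= w z.
Hypothesis Psi_le : forall z, normc (Psi z) ^+ 2 <= p z * w z.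
Hypothesis w_int : forall g : dual, (\int[m]_a (w (a, g))%:E <= (C * lam g)%:E)%E.
Hypothesis p_int : (\int[m]_a \int[nu]_g (p (a, g))%:E < +oo)%E.

Let w_lty : (\int[m]_a \int[nu]_g (w (a, g))%:E < +oo)%E.
Proof.
rewrite (fubini_tonelli (EFin \o w)); first last.
- by move=> z; rewrite /= lee_fin.
- exact/measurable_EFinP.
apply: (@le_lt_trans _ _ (\int[nu]_g (C%:E * (lam g)%:E))%E).
  apply: ge0_le_integral => //.
  - by move=> g _; apply: integral_ge0 => a _; rewrite /= lee_fin.
  - apply: (measurable_fun_fubini_tonelli_G (EFin \o w)); last by move=> z; rewrite /= lee_fin.
    exact/measurable_EFinP.
  - apply: measurable_funeM; exact: (measurable_int _ ilam).
  - by move=> g _; rewrite -EFinM; exact: w_int.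
rewrite integralZl//.
by rewrite -(fineK (lam_total_fin ilam)) -EFinM ltry.
Qed.

Let normc_Psi_le z : normc (Psi z) <= p z + w z.
Proof.
rewrite -(@ler_pXn2r _ 2)// ?nnegrE ?normc_ge0 ?addr_ge0//.
apply: (le_trans (Psi_le z)); have := p_ge0 z; have := w_ge0 z; nra.
Qed.

Lemma mixture_lty : (\int[m]_a \int[nu]_g (normc (Psi (a, g)))%:E < +oo)%E.
Proof.
have ep : measurable_fun setT (EFin \o p) by exact/measurable_EFinP.
have ew : measurable_fun setT (EFin \o w) by exact/measurable_EFinP.
have p0 z : (0 <= (EFin \o p) z)%E by rewrite /= lee_fin.
have v0 z : (0 <= (EFin \o w) z)%E by rewrite /= lee_fin.
have n0 z : (0 <= (normc (Psi z))%:E)%E by rewrite lee_fin normc_ge0.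
have sl (f : A * borel dual -> R) a : measurable_fun setT (EFin \o f) ->
    measurable_fun setT (fun g => (f (a, g))%:E).
  by move=> mf; exact: (measurableT_comp mf (measurable_pair1 a)).
have Fp := measurable_fun_fubini_tonelli_F (EFin \o p) ep p0.
have Fw := measurable_fun_fubini_tonelli_F (EFin \o w) ew v0.
apply: (@le_lt_trans _ _ (\int[m]_a (\int[nu]_g (p (a, g))%:E + \int[nu]_g (w (a, g))%:E))%E).
  apply: ge0_le_integral => //.
  - by move=> a _; exact: integral_ge0.
  - exact: (measurable_fun_fubini_tonelli_F (fun z => (normc (Psi z))%:E) (measurable_enormc mPsi)).
  - exact: (emeasurable_funD (Fp nu) (Fw nu)).
  - move=> a _; rewrite -ge0_integralD//; try exact: sl; last 2 first.
    + by move=> g _; exact: p0.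
    + by move=> g _; exact: v0.
    apply: ge0_le_integral => //.
    + exact: (measurableT_comp (measurable_enormc mPsi) (measurable_pair1 a)).
    + by apply: emeasurable_funD; exact: sl.
    + by move=> g _; rewrite -EFinD lee_fin.
rewrite ge0_integralD//; first exact: lte_add_pinfty.
- by move=> a _; apply: integral_ge0 => g _; exact: p0.
- exact: (Fp nu).
- by move=> a _; apply: integral_ge0 => g _; exact: v0.
- exact: (Fw nu).
Qed.

(** A superposition of the densities [Psi (a, _)]. Convolutions are mixtures over the dual and
    Neumann series are mixtures over the naturals with counting measure, so one energy estimate and
    one use of Fubini serve both. The factors [p] and [w] dominating $|\Psi|^2$ prepare
    Cauchy-Schwarz in [a]. *)
Definition mixture (g : borel dual) : R[i] := cintegral m (fun a => Psi (a, g)).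

Lemma cintegrable_mixture : cintegrable nu mixture.
Proof. exact: (cintegrable_fubini mPsi mixture_lty). Qed.

Lemma inv_fourier_mixture x :
  inv_fourier nu mixture x = cintegral m (fun a => inv_fourier nu (fun g => Psi (a, g)) x).
Proof.
pose Psi' (z : A * borel dual) := Psi z * (z.2 : dual) x.
have mPsi' : cmeas Psi'.
  apply: cmeasM => //; apply: (@cmeas_comp _ _ _ _ R (fun g : borel dual => (g : dual) x) snd) => //.
  exact: eval_measurable.
have PsiE z : normc (Psi' z) = normc (Psi z) by rewrite normcM normc_dual mulr1.
have ly : (\int[m]_a \int[nu]_g (normc (Psi' (a, g)))%:E < +oo)%E.
  under eq_integral do under eq_integral do rewrite PsiE.
  exact: mixture_lty.
rewrite /inv_fourier -(cfubini mPsi' ly); apply: ae_eq_cintegral.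
- exact: (cintegrable_cmeas (cintegrable_eval x cintegrable_mixture)).
- exact: (cintegrable_cmeas (cintegrable_fubini mPsi' ly)).
apply: filterS (ae_cintegrable_fubini mPsi mixture_lty) => g ig.
rewrite /mixture mulrC -cintegralZ//; apply: eq_cintegral => a.
by rewrite mulrC.
Qed.

(** Cauchy-Schwarz in [a] at almost every [g], then Tonelli; the factor [lam g] produced by [w]
    cancels the weight of the energy. *)
Lemma energy_mixture : (energy nu lam mixture <= C%:E * \int[m]_a \int[nu]_g (p (a, g))%:E)%E.
Proof.
have ep : measurable_fun setT (EFin \o p) by exact/measurable_EFinP.
have p0 z : (0 <= (EFin \o p) z)%E by rewrite /= lee_fin.
have Gp := measurable_fun_fubini_tonelli_G (EFin \o p) ep p0.
have Gp0 g : (0 <= \int[m]_a (p (a, g))%:E)%E by apply: integral_ge0 => a _; exact: p0.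
rewrite (fubini_tonelli (EFin \o p))//= -ge0_integralZl//; [|exact: (Gp m)|by rewrite lee_fin ltW].
apply: ae_ge0_le_integral => //.
- by move=> g _; rewrite lee_fin energy_integrand_ge0.
- by apply: (energy_emeasurable ilam lam_gt0); exact: cintegrable_cmeas cintegrable_mixture.
- by move=> g _; rewrite mule_ge0// lee_fin ltW.
- exact: (measurable_funeM _ (Gp m)).
apply: filterS (ae_cintegrable_fubini mPsi mixture_lty) => g ig _.
have l0 := lam_gt0 (g : dual); have Q0 : 0 < C * lam g by rewrite mulr_gt0.
have := @cauchy_schwarz_dom _ A R m (fun a => Psi (a, g)) (fun a => p (a, g)) (fun a => w (a, g)) _ Q0 ig.
move=> /(_ (fun=> p_ge0 _) (fun=> w_ge0 _)).
move=> /(_ (measurableT_comp mp (measurable_pair2 g)) (measurableT_comp mw (measurable_pair2 g))).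
move=> /(_ (fun=> Psi_le _) (w_int g)) h.
rewrite EFinM lee_pdivrMr//; apply: (le_trans h).
by rewrite EFinM muleA [(C%:E * _)%E]muleC.
Qed.

Lemma finite_energy_mixture : finite_energy nu lam mixture.
Proof.
split; first exact: cintegrable_cmeas cintegrable_mixture.
apply: (le_lt_trans energy_mixture); case E : (integral m _ _) p_int => [r| |]//.
- by move=> _; rewrite -EFinM ltry.
- by move=> _; rewrite gt0_muleNy ?ltNye// lte_fin.
Qed.

End mixtures.

Section convolution.
Context (R : realType) (G : topologicalZmodType).
Local Notation dual := (dual_group R G).
Context (nu : {measure set (borel dual) -> \bar R}) (haar_nu : is_haar nu).
Context (d e : nat) (Phi : dual -> 'rV[R]_d * 'rV[int]_e).
Hypothesis PhiD : forall a b, Phi (a + b) = Phi a + Phi b.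
Hypothesis PhiH : homeomorphism Phi.
Context (lam : dual -> R) (ilam : nu.-integrable setT (EFin \o lam)).
Hypothesis lam_gt0 : forall g, 0 < lam g.
Context (C : R) (C_gt0 : 0 < C).
Hypothesis lam_conv : forall g : dual,
  (\int[nu]_a (lam a * lam (g - (a : dual)))%:E <= (C * lam g)%:E)%E.
Implicit Types phi psi : borel dual -> R[i].
Let sf := haar_sigma_finite haar_nu PhiH.
Let mshift := measurable_gshift PhiD PhiH.

Definition conv phi psi (g : borel dual) : R[i] :=
  cintegral nu (fun a : borel dual => phi a * psi (gshift a g)).

Lemma convE phi psi g :
  conv phi psi g = cintegral nu (fun a : borel dual => phi a * psi (gshift a g)).
Proof. by []. Qed.

Section pair.
Variables (phi psi : borel dual -> R[i]).
Hypotheses (gphi : finite_energy nu lam phi) (gpsi : finite_energy nu lam psi).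

Let Psi (z : borel dual * borel dual) := phi z.1 * psi (gshift z.1 z.2).
(** Multiplying and dividing by $\lambda(a)\lambda(g-a)$: the integral of [p] is the product of the
    two energies, and that of [w] in [a] is the convolution of [lam] with itself. *)
Let p (z : borel dual * borel dual) :=
  normc (phi z.1) ^+ 2 / lam z.1 * (normc (psi (gshift z.1 z.2)) ^+ 2 / lam (gshift z.1 z.2)).
Let w (z : borel dual * borel dual) := lam z.1 * lam (gshift z.1 z.2).

Let msub : measurable_fun setT (fun z : borel dual * borel dual => gshift z.1 z.2).
Proof. exact: measurable_subr_dual PhiD PhiH. Qed.

Let mPsi : cmeas Psi.
Proof.
apply: cmeasM; first exact: (@cmeas_comp _ _ _ _ R phi fst gphi.1 measurable_fst).
by split; [exact: (measurableT_comp gpsi.1.1 msub)|exact: (measurableT_comp gpsi.1.2 msub)].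
Qed.

Let mp : measurable_fun setT p.
Proof.
apply: measurable_funM.
  exact: (measurableT_comp (energy_measurable ilam lam_gt0 gphi.1) measurable_fst).
exact: (measurableT_comp (energy_measurable ilam lam_gt0 gpsi.1) msub).
Qed.

Let mw : measurable_fun setT w.
Proof.
apply: measurable_funM; first exact: (measurableT_comp (lam_measurable ilam) measurable_fst).
exact: (measurableT_comp (lam_measurable ilam) msub).
Qed.

Let p0 z : 0 <= p z. Proof. by rewrite mulr_ge0// energy_integrand_ge0. Qed.
Let v0 z : 0 <= w z. Proof. by rewrite mulr_ge0// ltW. Qed.

Let Psi_le z : normc (Psi z) ^+ 2 <= p z * w z.
Proof.
rewrite /Psi /p /w normcM exprMn [leRHS]mulrACA !divfK//; rewrite gt_eqF//; exact: lam_gt0.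
Qed.

Let p_int : (\int[nu]_a \int[nu]_g (p (a, g))%:E = energy nu lam phi * energy nu lam psi)%E.
Proof.
have psi0 := energy_ge0 nu lam_gt0 psi.
rewrite /energy muleC -ge0_integralZl//; last 2 first.
- exact: (energy_emeasurable ilam lam_gt0 gphi.1).
- by move=> g _; rewrite lee_fin energy_integrand_ge0.
apply: eq_integral => a _; rewrite muleC.
rewrite -(ge0_integral_shift haar_nu mshift a (energy_emeasurable ilam lam_gt0 gpsi.1)); last first.
  by move=> g; rewrite lee_fin energy_integrand_ge0.
rewrite -ge0_integralZl//.
- exact: (measurable_shift mshift a (energy_emeasurable ilam lam_gt0 gpsi.1)).
- by move=> g _; rewrite lee_fin energy_integrand_ge0.
- by rewrite lee_fin energy_integrand_ge0.
Qed.

Let p_lty : (\int[nu]_a \int[nu]_g (p (a, g))%:E < +oo)%E.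
Proof.
by rewrite p_int -(fineK (energy_fin lam_gt0 gphi)) -(fineK (energy_fin lam_gt0 gpsi)) -EFinM ltry.
Qed.

Lemma finite_energy_conv : finite_energy nu lam (conv phi psi).
Proof.
exact: (@finite_energy_mixture R G (sfmeasure sf) lam ilam lam_gt0 _ _ (sfmeasure sf) Psi p w C C_gt0
  mPsi mp mw p0 v0 Psi_le lam_conv p_lty).
Qed.

Lemma energy_conv : (energy nu lam (conv phi psi) <= C%:E * (energy nu lam phi * energy nu lam psi))%E.
Proof.
rewrite -p_int; exact: (@energy_mixture R G (sfmeasure sf) lam ilam lam_gt0 _ _ (sfmeasure sf) Psi p w C C_gt0
  mPsi mp mw p0 v0 Psi_le lam_conv p_lty).
Qed.

Lemma inv_fourier_conv x :
  inv_fourier nu (conv phi psi) x = inv_fourier nu phi x * inv_fourier nu psi x.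
Proof.
apply: (etrans (@inv_fourier_mixture R G (sfmeasure sf) lam ilam _ _ (sfmeasure sf) Psi p w C
  mPsi mp mw p0 v0 Psi_le lam_conv p_lty x)).
have ipsi := finite_energy_cintegrable ilam lam_gt0 gpsi.
have iphi := finite_energy_cintegrable ilam lam_gt0 gphi.
rewrite mulrC {2}/inv_fourier -cintegralZ; last exact: cintegrable_eval.
apply: eq_cintegral => a.
transitivity (phi a * inv_fourier nu (psi \o gshift a) x).
  rewrite /inv_fourier -cintegralZ; last first.
    by apply: cintegrable_eval; exact: (cintegrable_shift haar_nu mshift).
  by apply: eq_cintegral => g; rewrite mulrA.
by rewrite (inv_fourier_shift haar_nu PhiD PhiH)// -/(inv_fourier nu psi x) mulrA mulrC.
Qed.

End pair.

End convolution.

Section counting_measure.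
Context (R : realType).

Lemma measurable_fun_natX d (T : measurableType d) d' (Y : measurableType d')
    (f : nat -> T -> Y) : (forall n, measurable_fun setT (f n)) ->
  measurable_fun setT (fun z : nat * T => f z.1 z.2).
Proof.
move=> mf _ B mB; rewrite setTI.
have -> : (fun z : nat * T => f z.1 z.2) @^-1` B = \bigcup_n ([set n] `*` (f n @^-1` B)).
  by apply/seteqP; split=> [[n t] /= h|[n t] [k _] [/= -> h]]; [exists n|].
apply: bigcupT_measurable => n; apply: measurableX => //.
by have := mf n measurableT _ mB; rewrite setTI.
Qed.

Lemma nneseries_le_bound (a : nat -> R) (B : R) : (forall n, 0 <= a n) ->
  (forall n, \sum_(0 <= k < n) a k <= B) -> (\sum_(k <oo) (a k)%:E <= B%:E)%E.
Proof.
move=> a0 aB; apply: lime_le; first by apply: is_cvg_nneseries => n _ _; rewrite lee_fin.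
by apply: nearW => n; rewrite sumEFin lee_fin.
Qed.

Lemma geometric_partial_le (r : R) n : 0 <= r -> r < 1 ->
  \sum_(0 <= k < n) r ^+ k <= (1 - r)^-1.
Proof.
move=> r0 r1; have r10 : 0 < 1 - r by rewrite subr_gt0.
have H : (1 - r) * \sum_(0 <= k < n) r ^+ k = 1 - r ^+ n.
  elim: n => [|n IH]; first by rewrite big_geq// mulr0 expr0 subrr.
  by rewrite big_nat_recr//= mulrDr IH exprS; ring.
rewrite -(ler_pM2l r10) H divff ?gt_eqF//.
by rewrite gerBl exprn_ge0.
Qed.

Lemma integral_counting_summable (v : nat -> R) :
  (@counting nat R).-integrable setT (EFin \o v) ->
  (\int[@counting nat R]_n (v n)%:E = \sum_(k <oo) (v k)%:E)%E.
Proof.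
move=> iv; apply: integral_count.
rewrite /summable -(nneseries_esumT (a := fun n => `|(v n)%:E|%E))//.
by have [_] := integrableP _ _ _ iv; rewrite ge0_integral_count.
Qed.

Lemma Rintegral_counting_telescope (v : nat -> R) :
  (@counting nat R).-integrable setT (EFin \o (fun n => v n - v n.+1)) ->
  v @ \oo --> (0 : R) -> \int[@counting nat R]_n (v n - v n.+1) = v 0%N.
Proof.
move=> iv v0; rewrite /Rintegral (integral_counting_summable iv).
suff -> : (\sum_(k <oo) (v k - v k.+1)%:E = (v 0%N)%:E)%E by [].
apply: cvg_lim => //.
have -> : (fun n => \sum_(0 <= k < n) (v k - v k.+1)%:E)%E = (EFin \o (fun n => v 0%N - v n)).
  apply/funext => n; rewrite sumEFin /=; congr EFin.
  by elim: n => [|n IH]; [rewrite big_geq// subrr|rewrite big_nat_recr//= IH addrA subrK].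
apply: cvg_EFin; first exact: nearW.
rewrite -[X in _ --> X]subr0; apply: cvgB => //; exact: cvg_cst.
Qed.

(** Telescoping: with $s$ the sum, the terms of $s-zs$ are $z^{n+1}-z^{n+2}$, and they sum to $z$.
    The series is written as an integral over counting measure to match [mixture]. *)
Lemma cintegral_counting_geometric (z : R[i]) : normc z < 1 ->
  cintegrable (@counting nat R) (fun n => z ^+ n.+1) ->
  cintegral (@counting nat R) (fun n => z ^+ n.+1) =
  z + z * cintegral (@counting nat R) (fun n => z ^+ n.+1).
Proof.
move=> z1 iz; set s := cintegral _ _.
have izS := cintegrableZ z iz.
have e1 n : z ^+ n.+1 - z * z ^+ n.+1 = z ^+ n.+1 - z ^+ n.+2 by rewrite -exprS.
have c0 : (fun n => normc (z ^+ n.+1)) @ \oo --> (0 : R).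
  have -> : (fun n => normc (z ^+ n.+1)) = (fun n => normc z * normc z ^+ n).
    by apply/funext => n; rewrite normcX exprS.
  rewrite -(mulr0 (normc z)); apply: cvgM; first exact: cvg_cst.
  by apply: cvg_expr; rewrite ger0_norm// normc_ge0.
have part (h : R[i] -> R) : (forall w, `|h w| <= normc w) ->
    (fun n => h (z ^+ n.+1)) @ \oo --> (0 : R).
  move=> hle; apply/cvgrPdist_lt => eps e0; have /cvgrPdist_lt/(_ _ e0) := c0.
  apply: filterS => n; rewrite !sub0r !normrN; apply: le_lt_trans.
  by apply: (le_trans (hle _)); exact: ler_norm.
suff E : z = s - z * s by rewrite {1}E subrK.
rewrite /s -cintegralZ// -cintegralB//.
have [ir ii] := cintegrableB iz izS; move: ir ii.
rewrite /cintegral; under eq_fun do rewrite e1 raddfB/=.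
move=> ir; under eq_fun do rewrite e1 raddfB/=; move=> ii.
under [\int[_]_x complex.Re _]eq_Rintegral do rewrite e1 raddfB/=.
under [\int[_]_x complex.Im _]eq_Rintegral do rewrite e1 raddfB/=.
rewrite (Rintegral_counting_telescope ir (part _ (@Re_le_normc R))).
rewrite (Rintegral_counting_telescope ii (part _ (@Im_le_normc R))).
by rewrite expr1; case: (z).
Qed.

End counting_measure.

Section neumann_series.
Context (R : realType) (G : topologicalZmodType).
Local Notation dual := (dual_group R G).
Context (nu : {measure set (borel dual) -> \bar R}) (haar_nu : is_haar nu).
Context (d e : nat) (Phi : dual -> 'rV[R]_d * 'rV[int]_e).
Hypothesis PhiD : forall a b, Phi (a + b) = Phi a + Phi b.
Hypothesis PhiH : homeomorphism Phi.
Context (lam : dual -> R) (ilam : nu.-integrable setT (EFin \o lam)).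
Hypothesis lam_gt0 : forall g, 0 < lam g.
Context (C : R) (C_gt0 : 0 < C).
Hypothesis lam_conv : forall g : dual,
  (\int[nu]_a (lam a * lam (g - (a : dual)))%:E <= (C * lam g)%:E)%E.
Implicit Types phi psi : borel dual -> R[i].
Local Notation finite_energy := (finite_energy nu lam).
Local Notation energy := (energy nu lam).
Local Notation conv := (conv nu).
Let sf := haar_sigma_finite haar_nu PhiH.

(** Index [n] stands for the convolution power $n+1$, as convolution may have no unit. *)
Fixpoint conv_pow phi n : borel dual -> R[i] :=
  if n is n'.+1 then conv phi (conv_pow phi n') else phi.

Lemma finite_energy_conv_pow phi n : finite_energy phi -> finite_energy (conv_pow phi n).
Proof.
move=> gp; elim: n => //= n IH.
exact: (finite_energy_conv haar_nu PhiD PhiH ilam lam_gt0 C_gt0 lam_conv).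
Qed.

Lemma energy_conv_pow phi (q : R) n : finite_energy phi -> (energy phi <= q%:E)%E ->
  (energy (conv_pow phi n) <= (q * (C * q) ^+ n)%:E)%E.
Proof.
move=> gp pq; elim: n => [|n IH]; first by rewrite expr0 mulr1.
have gn := finite_energy_conv_pow n gp.
apply: (le_trans (energy_conv haar_nu PhiD PhiH ilam lam_gt0 C_gt0 lam_conv gp gn)).
move: pq IH; rewrite -(fineK (energy_fin lam_gt0 gp)) -(fineK (energy_fin lam_gt0 gn)) -!EFinM !lee_fin => pq IH.
rewrite (_ : _ * _ ^+ _ = C * (q * (q * (C * q) ^+ n))); last by rewrite exprS; ring.
rewrite ler_pM2l//.
by apply: ler_pM => //; apply: fine_ge0; exact: energy_ge0.
Qed.

Lemma inv_fourier_conv_pow phi n x : finite_energy phi ->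
  inv_fourier nu (conv_pow phi n) x = inv_fourier nu phi x ^+ n.+1.
Proof.
move=> gp; elim: n => [|n IH] //.
rewrite /= (inv_fourier_conv haar_nu PhiD PhiH ilam lam_gt0 lam_conv)//.
  by rewrite IH -exprS.
exact: finite_energy_conv_pow.
Qed.

(** The sum of all convolution powers as a mixture. Weights $2^n$ in [p] and $2^{-n}$ in [w] keep
    both sums geometric; they are the origin of the 2 in the smallness condition and of the mixture
    constant 2. *)
Lemma neumann_series phi (q : R) : finite_energy phi -> 0 <= q -> (energy phi <= q%:E)%E ->
  2 * C * q < 1 -> exists2 psi, finite_energy psi &
    forall x, inv_fourier nu psi x = inv_fourier nu phi x + inv_fourier nu phi x * inv_fourier nu psi x.
Proof.
move=> gp q0 pq r1; pose r := 2 * C * q.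
have r0 : 0 <= r by rewrite !mulr_ge0// ltW.
pose Psi (z : nat * borel dual) := conv_pow phi z.1 z.2.
pose p (z : nat * borel dual) := 2 ^+ z.1 * (normc (Psi z) ^+ 2 / lam z.2).
pose w (z : nat * borel dual) := (2^-1) ^+ z.1 * lam z.2.
have gn n := finite_energy_conv_pow n gp.
have mPsi : cmeas Psi.
  split.
    apply: (measurable_fun_natX (f := fun n g => complex.Re (conv_pow phi n g))) => n.
    exact: (gn n).1.1.
  apply: (measurable_fun_natX (f := fun n g => complex.Im (conv_pow phi n g))) => n.
  exact: (gn n).1.2.
have mp : measurable_fun setT p.
  apply: (measurable_fun_natX (f := fun n g => 2 ^+ n * (normc (conv_pow phi n g) ^+ 2 / lam g))) => n.
  by apply: measurable_funM => //; exact: (energy_measurable ilam lam_gt0 (gn n).1).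
have mw : measurable_fun setT w.
  apply: (measurable_fun_natX (f := fun n (g : borel dual) => (2^-1) ^+ n * lam g)) => n.
  by apply: measurable_funM => //; exact: (lam_measurable ilam).
have p0 z : 0 <= p z by rewrite mulr_ge0 ?exprn_ge0// energy_integrand_ge0.
have v0 z : 0 <= w z.
  by rewrite mulr_ge0 ?exprn_ge0 ?invr_ge0//; exact: ltW (lam_gt0 _).
have Psi_le z : normc (Psi z) ^+ 2 <= p z * w z.
  rewrite /p /w mulrACA exprVn divff ?expf_neq0// mul1r divfK//.
  by rewrite gt_eqF//; exact: lam_gt0.
pose cnt := sfmeasure (sigma_finite_counting R).
have w_int (g : dual) : (\int[cnt]_a (w (a, g))%:E <= (2 * lam g)%:E)%E.
  rewrite (_ : integral _ _ _ = (\sum_(k <oo) (w (k, g))%:E)%E); last first.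
    by apply: (@ge0_integral_count R (fun k => (w (k, g))%:E)) => k; rewrite lee_fin.
  apply: nneseries_le_bound => // n; rewrite /w/= -mulr_suml ler_wpM2r//; first exact: ltW.
  have := @geometric_partial_le R (2^-1) n; rewrite (_ : (1 - 2^-1)^-1 = 2 :> R); last by field.
  by apply; lra.
have p_int : (\int[cnt]_a \int[nu]_g (p (a, g))%:E < +oo)%E.
  rewrite (_ : integral _ _ _ = (\sum_(k <oo) \int[nu]_g (p (k, g))%:E)%E); last first.
    apply: (@ge0_integral_count R (fun k => \int[nu]_g (p (k, g))%:E)%E) => k.
    by apply: integral_ge0 => g _; rewrite lee_fin.
  have E k : (\int[nu]_g (p (k, g))%:E = (2 ^+ k * fine (energy (conv_pow phi k)))%:E)%E.
    rewrite EFinM (fineK (energy_fin lam_gt0 (gn k))) energyE -ge0_integralZl//.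
    - exact: (energy_emeasurable ilam lam_gt0 (gn k).1).
    - by move=> g _; rewrite lee_fin energy_integrand_ge0.
  under eq_eseriesr do rewrite E.
  apply: (@le_lt_trans _ _ (q * (1 - r)^-1)%:E); last exact: ltry.
  apply: nneseries_le_bound => n.
    by rewrite mulr_ge0 ?exprn_ge0// fine_ge0// energy_ge0.
  apply: (@le_trans _ _ (\sum_(0 <= k < n) q * r ^+ k)).
    apply: ler_sum => k _; have := energy_conv_pow k gp pq.
    rewrite -(fineK (energy_fin lam_gt0 (gn k))) lee_fin => h.
    rewrite (_ : q * r ^+ k = 2 ^+ k * (q * (C * q) ^+ k)); last first.
      by rewrite mulrCA -exprMn mulrA.
    by rewrite ler_wpM2l// exprn_ge0.
  by rewrite -mulr_sumr ler_wpM2l//; exact: geometric_partial_le.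
exists (mixture cnt Psi).
  exact: (@finite_energy_mixture R G (sfmeasure sf) lam ilam lam_gt0 _ _ cnt Psi p w 2 _ mPsi mp mw p0 v0 Psi_le w_int p_int).
move=> x; set f := inv_fourier nu phi x.
(* The energies of the convolution powers decay geometrically, hence so do the values $f^{n+1}$,
   which excludes $|f|\ge 1$. *)
have f1 : normc f < 1.
  rewrite ltNge; apply/negP => f1.
  have M0 := lam_mass_gt0 nu lam_gt0.
  have H n : 1 <= q * lam_mass nu lam * (C * q) ^+ n.
    have := inv_fourier_energy ilam lam_gt0 x (gn n).
    rewrite inv_fourier_conv_pow// -/f normcX => h.
    have := energy_conv_pow n gp pq; rewrite -(fineK (energy_fin lam_gt0 (gn n))) lee_fin => h2.
    move: h; rewrite -(fineK (energy_fin lam_gt0 (gn n))) -EFinM lee_fin => h.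
    apply: (@le_trans _ _ ((normc f ^+ n.+1) ^+ 2)); first by rewrite !exprn_ege1.
    apply: (le_trans h); rewrite mulrAC ler_wpM2r//; exact: ltW.
  have cq : `|C * q| < 1.
    rewrite ger0_norm ?mulr_ge0//; last exact: ltW.
    by apply: le_lt_trans r1; rewrite -mulrA ler_peMl ?mulr_ge0 ?ler1n//; exact: ltW.
  have c0 : (fun n => q * lam_mass nu lam * (C * q) ^+ n) @ \oo --> (0 : R).
    rewrite -[X in _ --> X](mulr0 (q * lam_mass nu lam)); apply: cvgM; first exact: cvg_cst.
    exact: cvg_expr.
  have /cvgrPdist_lt/(_ _ ltr01)[N _ /(_ N (leqnn N))] := c0.
  rewrite /= sub0r normrN => h; have := le_lt_trans (le_trans (H N) (ler_norm _)) h.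
  by rewrite ltxx.
have mE : inv_fourier nu (mixture cnt Psi) x = cintegral (@counting nat R) (fun n => f ^+ n.+1).
  apply: (etrans (@inv_fourier_mixture R G (sfmeasure sf) lam ilam _ _ cnt Psi p w 2 mPsi mp mw p0 v0 Psi_le w_int p_int x)).
  by apply: eq_cintegral => n; exact: inv_fourier_conv_pow.
rewrite mE; apply: cintegral_counting_geometric => //.
have ly := @mixture_lty R G (sfmeasure sf) lam ilam _ _ cnt Psi p w 2 mPsi mp mw p0 v0 Psi_le w_int p_int.
apply/cintegrableP; split; first by split.
apply: le_lt_trans ly; apply: ge0_le_integral => //.
- by move=> n _; rewrite lee_fin normc_ge0.
- move=> n _; rewrite -inv_fourier_conv_pow//.
  by apply: normc_inv_fourier; exact: (finite_energy_cintegrable ilam lam_gt0).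
Qed.

Section multiplicative_functional.
Variable X : (borel dual -> R[i]) -> R[i].
Hypothesis Xlin : forall (a : R[i]) phi psi, finite_energy phi -> finite_energy psi ->
  X (fun g => a * phi g + psi g) = a * X phi + X psi.
Hypothesis Xmul : forall phi psi chi, finite_energy phi -> finite_energy psi -> finite_energy chi ->
  (forall x, inv_fourier nu chi x = inv_fourier nu phi x * inv_fourier nu psi x) ->
  X chi = X phi * X psi.

Lemma functional0 : X (fun=> 0) = 0.
Proof.
have g0 := finite_energy0 nu lam.
have := Xlin 1 g0 g0; under [fun _ => _]eq_fun do rewrite mulr0 addr0.
by rewrite mul1r => /eqP; rewrite -subr_eq subrr eq_sym => /eqP.
Qed.

Lemma functionalZ (a : R[i]) phi : finite_energy phi -> X (fun g => a * phi g) = a * X phi.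
Proof.
move=> gp; have := Xlin a gp (finite_energy0 nu lam); rewrite functional0 addr0 => <-.
by congr X; apply/funext => g; rewrite addr0.
Qed.

Lemma functionalD phi psi : finite_energy phi -> finite_energy psi -> X (fun g => phi g + psi g) = X phi + X psi.
Proof.
move=> gp gs; have := Xlin 1 gp gs; rewrite mul1r => <-.
by congr X; apply/funext => g; rewrite mul1r.
Qed.

Lemma functionalB phi psi : finite_energy phi -> finite_energy psi -> X (fun g => phi g - psi g) = X phi - X psi.
Proof.
move=> gp gs; have := Xlin (-1) gs gp; rewrite mulN1r addrC => <-.
by congr X; apply/funext => g; rewrite mulN1r addrC.
Qed.

(** Were the bound to fail, [phi] scaled to have value 1 would meet the condition of
    [neumann_series]; the sum satisfies $S=\psi+\psi S$ on transforms, and [X] turns this into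
    $X(S)=1+X(S)$. *)
Lemma functional_bound phi : finite_energy phi ->
  ((normc (X phi) ^+ 2)%:E <= (2 * C)%:E * energy phi)%E.
Proof.
move=> gp; rewrite leNgt; apply/negP => H.
have N0 := fine_ge0 (energy_ge0 nu lam_gt0 phi).
move: H; rewrite -(fineK (energy_fin lam_gt0 gp)) -EFinM lte_fin => H.
have X0 : 0 < normc (X phi) ^+ 2.
  by apply: le_lt_trans H; rewrite !mulr_ge0// ltW.
have Xn0 : X phi != 0.
  by apply/eqP => X0'; move: X0; rewrite X0' normc0 expr0n ltxx.
pose psi g := (X phi)^-1 * phi g.
have gs : finite_energy psi by exact: finite_energyZ.
have Xs : X psi = 1 by rewrite functionalZ// mulVf.
pose q := fine (energy phi) / normc (X phi) ^+ 2.
have sq : (energy psi <= q%:E)%E.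
  rewrite energyZ//; last exact: gp.1.
  rewrite -(fineK (energy_fin lam_gt0 gp)) -EFinM lee_fin /q mulrC.
  by rewrite ler_wpM2l// normcV// exprVn.
have q0 : 0 <= q by rewrite divr_ge0// ltW.
have q1 : 2 * C * q < 1 by rewrite /q mulrA ltr_pdivrMr// mul1r.
have [S gS HS] := neumann_series gs q0 sq q1.
have gB := finite_energyB ilam lam_gt0 gS gs.
have := Xmul gs gS gB; rewrite functionalB// Xs mul1r.
have E x : inv_fourier nu (fun g => S g - psi g) x = inv_fourier nu psi x * inv_fourier nu S x.
  rewrite inv_fourierB; [|exact: (finite_energy_cintegrable ilam)|exact: (finite_energy_cintegrable ilam)].
  by rewrite {1}HS addrAC subrr add0r.
by move=> /(_ E)/eqP; rewrite subr_eq -subr_eq0 opprD addrA subrr add0r oppr_eq0 oner_eq0.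
Qed.

End multiplicative_functional.

End neumann_series.

(** * Multiplicative functionals *)

Section compactly_supported_densities.
Context (R : realType) (G : topologicalZmodType).
Local Notation dual := (dual_group R G).
Context (nu : {measure set (borel dual) -> \bar R}) (haar_nu : is_haar nu).
Context (d e : nat) (Phi : dual -> 'rV[R]_d * 'rV[int]_e).
Hypothesis PhiD : forall a b, Phi (a + b) = Phi a + Phi b.
Hypothesis PhiH : homeomorphism Phi.
Context (lam : dual -> R) (ilam : nu.-integrable setT (EFin \o lam)).
Hypothesis lam_gt0 : forall g, 0 < lam g.
Hypothesis lam_cont : continuous lam.
Context (C : R) (C_gt0 : 0 < C).
Hypothesis lam_conv : forall g : dual,
  (\int[nu]_a (lam a * lam (g - (a : dual)))%:E <= (C * lam g)%:E)%E.
Implicit Types phi psi : borel dual -> R[i].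
Local Notation finite_energy := (finite_energy nu lam).
Local Notation energy := (energy nu lam).
Local Notation conv := (conv nu).
Local Notation coord := (dual_coord Phi).
Local Notation cbox := (cbox Phi).
Let mshift := measurable_gshift PhiD PhiH.

(** Since [lam] is bounded below on a box, the sup bound [B] alone controls the energy of such a
    density, and so the value of the functional on it. *)
Definition box_bounded (n : nat) (B : R) phi := [/\ cmeas phi,
  forall g, ~ cbox n%:R g -> phi g = 0 & forall g, normc (phi g) <= B].

Lemma box_bounded_ge0 n B phi : box_bounded n B phi -> 0 <= B.
Proof. by move=> [_ _ h]; apply: le_trans (h 0); exact: normc_ge0. Qed.

Lemma box_measure_fin n : nu (cbox n%:R) \is a fin_num.
Proof. by rewrite ge0_fin_numE//; exact: (cbox_lty haar_nu PhiH). Qed.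

Lemma box_lam_lower n : exists2 l : R, 0 < l & forall g, cbox n%:R g -> l <= lam g.
Proof.
have cK := @cbox_compact R G d e Phi PhiH n%:R.
have := cK; rewrite compact_near_coveringP => /(_ nat \oo (fun m g => m.+1%:R^-1 <= lam g)).
case.
  move=> g _; have l2 : 0 < lam g / 2 by rewrite divr_gt0.
  have /cvgrPdist_lt/(_ _ l2) h := @lam_cont g.
  exists ([set h' | `|lam g - lam h'| < lam g / 2], [set m | (Num.bound (2 / lam g) <= m)%N]).
    by split => //; exists (Num.bound (2 / lam g)).
  move=> [h' m] [/= h1 h2]; apply: (@le_trans _ _ (lam g / 2)).
    rewrite -[leRHS]invrK lef_pV2 ?posrE ?invr_gt0// invf_div.
    apply: (le_trans (ltW (archi_boundP _))); first by rewrite divr_ge0// ltW.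
    by rewrite ler_nat; exact: leqW.
  by move: h1; rewrite ltr_norml => /andP[_]; lra.
by move=> N _ /(_ N (leqnn N)) h; exists N.+1%:R^-1.
Qed.

Lemma box_bounded_cintegrable n B phi : box_bounded n B phi -> cintegrable nu phi.
Proof.
move=> hb; have B0 := box_bounded_ge0 hb; have [m s b] := hb.
apply: (@cintegrable_le _ _ _ _ _ (fun g => B * \1_(cbox n%:R : set (borel dual)) g)) => //.
  move=> g; rewrite indicE; have [gn|gn] := pselect (cbox n%:R g).
    by rewrite mem_set// mulr1.
  by rewrite s// normc0 mulr_ge0.
under [_ \o _]funext do rewrite /= EFinM.
apply: integrableZl => //.
exact: (cintegrable_indic (cbox_measurable PhiH _) (cbox_lty haar_nu PhiH _)).1.
Qed.

Lemma box_bounded_energy n : exists2 A : R, 0 <= A & forall phi B, box_bounded n B phi ->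
  finite_energy phi /\ fine (energy phi) <= A * B ^+ 2.
Proof.
have [l l0 hl] := box_lam_lower n.
have mc : measurable (cbox n%:R : set (borel dual)) by exact: cbox_measurable PhiH _.
exists (l^-1 * fine (nu (cbox n%:R))) => [|phi B hb].
  by rewrite mulr_ge0 ?invr_ge0 ?(ltW l0)// fine_ge0.
have B0 := box_bounded_ge0 hb; have [m s b] := hb.
have H : (energy phi <= (l^-1 * fine (nu (cbox n%:R)) * B ^+ 2)%:E)%E.
  apply: (@le_trans _ _ (\int[nu]_g ((l^-1 * B ^+ 2)%:E * (\1_(cbox n%:R : set (borel dual)) g)%:E))%E).
    apply: ge0_le_integral => //.
    - by move=> g _; rewrite lee_fin energy_integrand_ge0.
    - exact: (energy_emeasurable ilam lam_gt0).
    - by apply: measurable_funeM; apply/measurable_EFinP; exact: measurable_indic.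
    - move=> g _; rewrite -EFinM lee_fin indicE; have [gn|gn] := pselect (cbox n%:R g).
        rewrite mem_set// mulr1 mulrC; apply: ler_pM.
        + by rewrite invr_ge0 ltW.
        + exact: sqr_ge0.
        + by rewrite lef_pV2 ?posrE//; exact: hl.
        + by rewrite ler_sqr ?nnegrE ?normc_ge0.
      by rewrite s// normc0 expr0n/= mul0r mulr_ge0// mulr_ge0 ?sqr_ge0// invr_ge0 ltW.
  rewrite ge0_integralZl//; first last.
  - by rewrite lee_fin mulr_ge0 ?sqr_ge0// invr_ge0 ltW.
  - by apply/measurable_EFinP; exact: measurable_indic.
  rewrite integral_indic// setIT -(fineK (box_measure_fin n)) -EFinM.
  by rewrite lee_fin mulrAC.
have g1 : finite_energy phi by split => //; apply: le_lt_trans H (ltry _).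
by split => //; rewrite -lee_fin (fineK (energy_fin lam_gt0 g1)).
Qed.

Lemma finite_energy_box_bounded n B phi : box_bounded n B phi -> finite_energy phi.
Proof. by have [A _ h] := box_bounded_energy n; move=> /h[]. Qed.

Lemma box_bounded_shift n B phi m a : box_bounded n B phi -> cbox m%:R a ->
  box_bounded (m + n) B (phi \o gshift a).
Proof.
move=> [mp s b] am; split.
- exact: (cmeas_shift mshift).
- move=> g ng; apply: s => h; apply: ng.
  rewrite natrD -(subrK a (g : dual)) addrC; exact: (cboxD PhiD).
- by move=> g; exact: b.
Qed.

Lemma box_bounded_indic n B phi (E : set (borel dual)) : measurable E ->
  box_bounded n B phi -> box_bounded n B (fun g => phi g * (\1_E g : R)%:C).
Proof.
move=> mE [m s b]; split.
- by apply: cmeasM => //; exact: cmeas_indic.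
- by move=> g h; rewrite s// mul0r.
- move=> g; rewrite normcM normc_real ger0_norm//.
  apply: le_trans (b g); rewrite ler_piMr ?normc_ge0// indicE.
Qed.

Lemma box_bounded_dense phi (eps : R) : finite_energy phi -> 0 < eps ->
  exists n psi, box_bounded n n%:R psi /\ (energy (fun g => phi g - psi g)%R < eps%:E)%E.
Proof.
move=> gp e0; have mp := gp.1.
pose cut n : set (borel dual) := [set g | normc (phi g) <= n%:R] `&` cbox n%:R.
have mcut n : measurable (cut n).
  apply: measurableI; last exact: cbox_measurable PhiH _.
  have := measurable_normc mp measurableT (measurable_itv `]-oo, n%:R]); rewrite setTI.
  by congr measurable; apply/seteqP; split => g /=; rewrite in_itv.
have mc n : cmeas (fun g => phi g * (\1_(cut n) g : R)%:C).
  by apply: cmeasM => //; exact: cmeas_indic.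
have [|||||n hn] := @dominated_small _ _ _ nu
   (fun n g => normc (phi g - phi g * (\1_(cut n) g : R)%:C) ^+ 2 / lam g)
   (fun g => normc (phi g) ^+ 2 / lam g) eps.
- by move=> n; apply: (energy_measurable ilam lam_gt0); exact: cmeasB.
- move=> g; have [N gN] := cbox_cover Phi (g : dual).
  apply: cvg_near_cst; exists (maxn N (Num.bound (normc (phi g)))) => // n /=.
  rewrite geq_max => /andP[Nn bn].
  rewrite indicE mem_set ?mulr1 ?subrr ?normc0 ?expr0n ?mul0r//=; split => /=.
    by apply: ltW; apply: (lt_le_trans (archi_boundP (normc_ge0 _))); rewrite ler_nat.
  by apply: cboxS gN; rewrite ler_nat.
- move=> n g; rewrite (energy_integrand_ge0 lam_gt0 (fun g => phi g - _))/=.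
  rewrite ler_wpM2r//; first by rewrite invr_ge0 ltW.
  rewrite ler_sqr ?nnegrE ?normc_ge0// -{1}[phi g]mulr1 -mulrBr normcM.
  rewrite ler_piMr ?normc_ge0// -(rmorphB (real_complex R)) normc_real indicE.
  by case: (_ \in _); rewrite ?subrr ?normr0// subr0 normr1.
- exact: (finite_energy_integrable ilam lam_gt0 gp).
- exact: e0.
exists n, (fun g => phi g * (\1_(cut n) g : R)%:C); split => //; split => //.
- by move=> g ng; rewrite indicE memNset ?mulr0// => -[].
- move=> g; rewrite normcM normc_real indicE; case: (asboolP (cut n g)) => [h|h].
    by rewrite mem_set// normr1 mulr1; case: h.
  by rewrite memNset// normr0 mulr0.
Qed.

Lemma conv_integrable n B phi m B' psi g : box_bounded n B phi -> box_bounded m B' psi ->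
  cintegrable nu (fun a : borel dual => phi a * psi (gshift a g)).
Proof.
move=> hb [mpsi _ bpsi]; apply: (@cintegrableMb _ _ _ _ _ _ B').
- exact: box_bounded_cintegrable hb.
- have ms : measurable_fun setT (fun a : borel dual => gshift a g).
    exact: (measurableT_comp (measurable_subr_dual PhiD PhiH) (measurable_pair2 g)).
  by split; [exact: (measurableT_comp mpsi.1 ms)|exact: (measurableT_comp mpsi.2 ms)].
- by move=> a; exact: bpsi.
Qed.

Lemma conv_box n B phi m B' psi : box_bounded n B phi -> box_bounded m B' psi ->
  forall g, ~ cbox (n + m)%:R g -> conv phi psi g = 0.
Proof.
move=> [_ s1 _] [_ s2 _] g ng; rewrite convE -(cintegral0 nu); apply: eq_cintegral => a.
have [an|an] := pselect (cbox n%:R a); last by rewrite s1// mul0r.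
rewrite s2 ?mulr0// => h; apply: ng; rewrite natrD -(subrK (a : dual) (g : dual)) addrC.
exact: (cboxD PhiD).
Qed.

Lemma conv_box_bounded n B phi m B' psi : box_bounded n B phi -> box_bounded m B' psi ->
  box_bounded (n + m) (fine (L1 nu phi) * B') (conv phi psi).
Proof.
move=> h1 h2; split.
- exact: (finite_energy_conv haar_nu PhiD PhiH ilam lam_gt0 C_gt0 lam_conv (finite_energy_box_bounded h1) (finite_energy_box_bounded h2)).1.
- exact: conv_box h1 h2.
- move=> g; have i1 := box_bounded_cintegrable h1.
  have L1f : L1 nu phi \is a fin_num by rewrite ge0_fin_numE ?L1_ge0// L1_lty.
  have i2 := conv_integrable g h1 h2.
  rewrite -lee_fin EFinM fineK//; apply: (le_trans (normc_cintegral i2)).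
  rewrite muleC /L1 -ge0_integralZl//.
  + apply: ge0_le_integral => //.
    * by move=> a _; rewrite lee_fin normc_ge0.
    * exact: (measurable_enormc (cintegrable_cmeas i2)).
    * by apply: measurable_funeM; exact: (measurable_enormc (cintegrable_cmeas i1)).
    * move=> a _; rewrite -EFinM lee_fin normcM mulrC ler_wpM2r ?normc_ge0//.
      by have [_ _] := h2; exact.
  + exact: (measurable_enormc (cintegrable_cmeas i1)).
  + by move=> a _; rewrite lee_fin normc_ge0.
  + by rewrite lee_fin; exact: box_bounded_ge0 h2.
Qed.

(** Shifting a convolution amounts to shifting its first factor, which moves little in $L^1$; the
    sup bound on the second factor makes the estimate uniform in [g]. *)
Lemma conv_uniform n B phi m B' psi (eps : R) : box_bounded n B phi -> box_bounded m B' psi ->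
  0 < eps -> nbhs (0 : dual) [set b | forall g, normc (conv phi psi (gshift b g) - conv phi psi g) <= eps].
Proof.
move=> h1 h2 e0; have i1 := box_bounded_cintegrable h1; have B0 := box_bounded_ge0 h2.
have B1 : 0 < B' + 1 by rewrite ltr_wpDl.
have := cintegrable_tcont haar_nu PhiD PhiH i1 (divr_gt0 e0 B1).
apply: filterS => b /= hb g.
have hsb : exists k, box_bounded k B (phi \o gshift b).
  by have [k bk] := cbox_cover Phi b; exists (k + n)%N; exact: box_bounded_shift.
have [k hk] := hsb.
have i2 := conv_integrable g hk h2; have i3 := conv_integrable g h1 h2.
have -> : conv phi psi (gshift b g) = conv (phi \o gshift b) psi g.
  rewrite !convE -[LHS](cintegral_shift haar_nu mshift b); last exact: conv_integrable h1 h2.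
  apply: eq_cintegral => a; congr (_ * psi _).
  by rewrite /gshift opprB addrA subrK.
rewrite !convE -cintegralB// -lee_fin.
apply: (le_trans (normc_cintegral (cintegrableB i2 i3))).
have iB : cintegrable nu (fun a => phi (gshift b a) - phi a).
  by apply: cintegrableB => //; exact: (cintegrable_shift haar_nu mshift).
apply: (@le_trans _ _ (B'%:E * L1 nu (fun a => phi (gshift b a) - phi a)%R)%E).
  rewrite /L1 -ge0_integralZl//.
  + apply: ge0_le_integral => //.
    * by move=> a _; rewrite lee_fin normc_ge0.
    * exact: (measurable_enormc (cintegrable_cmeas (cintegrableB i2 i3))).
    * by apply: measurable_funeM; exact: (measurable_enormc (cintegrable_cmeas iB)).
    * move=> a _; rewrite -EFinM lee_fin -mulrBl normcM mulrC ler_wpM2r ?normc_ge0//.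
      by have [_ _] := h2; exact.
  + exact: (measurable_enormc (cintegrable_cmeas iB)).
  + by move=> a _; rewrite lee_fin normc_ge0.
apply: (@le_trans _ _ (B'%:E * (eps / (B' + 1))%:E)%E).
  by apply: lee_wpmul2l => //; exact: ltW.
rewrite -EFinM lee_fin mulrA ler_pdivrMr// mulrC.
by rewrite ler_wpM2l// ?lerDl// ltW.
Qed.

Lemma box_cover n (r : R) : 0 < r -> exists2 s : seq dual, forall a, a \in s -> cbox n%:R a &
  forall g, cbox n%:R g -> exists2 a, a \in s & forall j, `|coord j (g - a)| < r.
Proof.
pose T : ptopologicalType := HB.pack dual (isPointed.Build dual 0).
have cK : @cover_compact T (cbox n%:R).
  by rewrite -compact_cover; exact: (@cbox_compact R G d e Phi PhiH n%:R).
move=> r0; have := cK => /(_ dual (cbox n%:R) (fun a => [set g | forall j, `|coord j (g - a)| < r]))[].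
- move=> a _; rewrite openE => g h.
  pose P j : set dual := [set g | `|coord j (g - a)| < r].
  have H j : nbhs g (P j); last exact: (filter_forall _ H).
  have rj : 0 < r - `|coord j (g - a)| by rewrite subr_gt0; exact: h.
  have /cvgrPdist_lt/(_ _ rj) := @coord_cont R G d e Phi PhiH j g.
  apply: filterS => g' /= h'; rewrite /P/= -(subrKA g) (coordD PhiD).
  by apply: (le_lt_trans (ler_normD _ _)); rewrite -ltrBrDr (coordB PhiD) distrC.
- by move=> g gn; exists g => // j; rewrite subrr (coord0 PhiD) normr0.
move=> D Dn HD; exists (finmap.enum_fset D) => [a /Dn|g /HD[a aD ga]]; first by move/set_mem.
by exists a.
Qed.

End compactly_supported_densities.

(** * The character of the dual attached to a functional *)

Section functional_character.
Context (R : realType) (G : topologicalZmodType).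
Local Notation dual := (dual_group R G).
Context (nu : {measure set (borel dual) -> \bar R}) (haar_nu : is_haar nu).
Context (d e : nat) (Phi : dual -> 'rV[R]_d * 'rV[int]_e).
Hypothesis PhiD : forall a b, Phi (a + b) = Phi a + Phi b.
Hypothesis PhiH : homeomorphism Phi.
Context (lam : dual -> R) (ilam : nu.-integrable setT (EFin \o lam)).
Hypothesis lam_gt0 : forall g, 0 < lam g.
Hypothesis lam_cont : continuous lam.
Context (C : R) (C_gt0 : 0 < C).
Hypothesis lam_conv : forall g : dual,
  (\int[nu]_a (lam a * lam (g - (a : dual)))%:E <= (C * lam g)%:E)%E.
Implicit Types phi psi : borel dual -> R[i].
Local Notation finite_energy := (finite_energy nu lam).
Local Notation energy := (energy nu lam).
Local Notation conv := (conv nu).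
Local Notation coord := (dual_coord Phi).
Local Notation cbox := (cbox Phi).
Local Notation box_bounded := (box_bounded Phi).
Let mshift := measurable_gshift PhiD PhiH.
Let boxgood n B phi (h : box_bounded n B phi) : finite_energy phi :=
  finite_energy_box_bounded haar_nu PhiH ilam lam_gt0 lam_cont h.
Let boxint n B phi (h : box_bounded n B phi) : cintegrable nu phi :=
  box_bounded_cintegrable haar_nu PhiH h.
Variable X : (borel dual -> R[i]) -> R[i].
Hypothesis Xlin : forall (a : R[i]) phi psi, finite_energy phi -> finite_energy psi ->
  X (fun g => a * phi g + psi g) = a * X phi + X psi.
Hypothesis Xmul : forall phi psi chi, finite_energy phi -> finite_energy psi -> finite_energy chi ->
  (forall x, inv_fourier nu chi x = inv_fourier nu phi x * inv_fourier nu psi x) ->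
  X chi = X phi * X psi.
Let XB := functionalB Xlin.
Let XZ := functionalZ Xlin.

Lemma functional_box n : exists2 K : R, 0 <= K & forall phi B, box_bounded n B phi ->
  normc (X phi) <= K * B.
Proof.
have [A A0 hA] := box_bounded_energy haar_nu PhiH ilam lam_gt0 lam_cont n.
have k0 : 0 <= 2 * C * A by rewrite !mulr_ge0// ltW.
(* The square of this constant dominates $2CA$, which avoids a square root. *)
exists (2 * C * A + 1) => [|phi B hb]; first by rewrite addr_ge0.
have B0 := box_bounded_ge0 hb; have [gp NA] := hA _ _ hb.
have := functional_bound haar_nu PhiD PhiH ilam lam_gt0 C_gt0 lam_conv Xlin Xmul gp.
rewrite -(fineK (energy_fin lam_gt0 gp)) -EFinM lee_fin => h.
rewrite -(@ler_pXn2r _ 2)// ?nnegrE ?normc_ge0 ?mulr_ge0 ?addr_ge0//.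
apply: (le_trans h); apply: (@le_trans _ _ (2 * C * A * B ^+ 2)).
  by rewrite -(mulrA (2 * C)) ler_wpM2l// mulr_ge0// ltW.
rewrite exprMn ler_wpM2r ?sqr_ge0//; nra.
Qed.

Section with_kernel.
Variables (N : nat) (M : R) (kap : borel dual -> R[i]).
Hypothesis kap_box : box_bounded N M kap.
Hypothesis kap_unif : forall eps : R, 0 < eps ->
  nbhs (0 : dual) [set b | forall g, normc (kap (gshift b g) - kap g) <= eps].
Hypothesis Xkap : X kap != 0.

Let nXk : 0 < normc (X kap).
Proof. by rewrite lt_neqAle normc_ge0 andbT eq_sym normc_eq0. Qed.

(** The eigenvalue of translation by [a] under [X]; [functional_shift] shows that other test
    densities give the same value. *)
Definition translation_factor (a : dual) : R[i] := X (kap \o gshift a) / X kap.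

Let shift_box n B phi a : box_bounded n B phi -> exists m, box_bounded m B (phi \o gshift a).
Proof.
move=> hb; have [k ak] := cbox_cover Phi a; exists (k + n)%N.
exact: (box_bounded_shift PhiD PhiH).
Qed.

(** With $\tau_a$ the shift by [a], the convolutions of $\tau_a\varphi$ with $\kappa$ and of
    $\varphi$ with $\tau_a\kappa$ have the same transform; multiplicativity evaluates [X] on it in
    two ways. *)
Lemma functional_shift n B phi a : box_bounded n B phi ->
  X (phi \o gshift a) = translation_factor a * X phi.
Proof.
move=> hb; have [m hm] := shift_box a hb; have [k hk] := shift_box a kap_box.
have g1 := boxgood hm; have g2 := boxgood kap_box.
have gc := finite_energy_conv haar_nu PhiD PhiH ilam lam_gt0 C_gt0 lam_conv g1 g2.
have E1 := Xmul g1 g2 gc (inv_fourier_conv haar_nu PhiD PhiH ilam lam_gt0 lam_conv g1 g2).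
have E2 : X (conv (phi \o gshift a) kap) = X phi * X (kap \o gshift a).
  apply: Xmul => //; [exact: boxgood hb|exact: boxgood hk|move=> x].
  rewrite (inv_fourier_conv haar_nu PhiD PhiH ilam lam_gt0 lam_conv g1 g2).
  rewrite !(inv_fourier_shift haar_nu PhiD PhiH); [by rewrite mulrCA mulrA|exact: boxint kap_box|exact: boxint hb].
by apply: (mulIf Xkap); rewrite -E1 E2 /translation_factor [RHS]mulrAC divfK// mulrC.
Qed.

Lemma translation_factor_kap a : X (kap \o gshift a) = translation_factor a * X kap.
Proof. exact: functional_shift kap_box. Qed.

Lemma translation_factorD a b : translation_factor (a + b) = translation_factor a * translation_factor b.
Proof.
have [m hm] := shift_box b kap_box.
apply: (mulIf Xkap); rewrite -[RHS]mulrA -!translation_factor_kap -(functional_shift a hm).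
by congr X; apply/funext => g /=; rewrite /gshift opprD addrA.
Qed.

Lemma translation_factor0 : translation_factor 0 = 1.
Proof.
apply: (mulIf Xkap); rewrite -translation_factor_kap mul1r; congr X; apply/funext => g /=.
by rewrite /gshift subr0.
Qed.

Lemma translation_factor_bound m : exists2 K : R, 0 <= K & forall a, cbox m%:R a -> normc (translation_factor a) <= K.
Proof.
have [K K0 hK] := functional_box (m + N).
exists (K * M / normc (X kap)) => [|a am].
  by rewrite divr_ge0 ?normc_ge0// mulr_ge0//; exact: box_bounded_ge0 kap_box.
rewrite /translation_factor normcM normcV ler_wpM2r ?invr_ge0 ?normc_ge0//.
by apply: hK; exact: (box_bounded_shift PhiD PhiH).
Qed.

(** For small [a], [kap] and its shift differ by a uniformly small function supported in one fixed
    box, on which [functional_box] controls [X]. *)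
Lemma translation_factor_near0 (eps : R) : 0 < eps -> nbhs (0 : dual) [set a | normc (translation_factor a - 1) <= eps].
Proof.
move=> e0; have [K K0 hK] := functional_box (1 + N).
have K1 : 0 < K + 1 by rewrite ltr_wpDl.
have e1 : 0 < eps * normc (X kap) / (K + 1) by rewrite divr_gt0// mulr_gt0.
apply: filterS2 (kap_unif e1) (nbhs_coord_lt PhiD PhiH 0 ltr01) => a /= ha a1.
have ab : cbox 1 a by move=> j; have := a1 j; rewrite subr0 => /ltW.
have hs := box_bounded_shift PhiD PhiH kap_box (ab : cbox 1%:R a).
have hB : box_bounded (1 + N) (eps * normc (X kap) / (K + 1)) (fun g => (kap \o gshift a) g - kap g).
  have [m1 s1 _] := hs; have [m2 s2 _] := kap_box; split => //; first exact: cmeasB.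
  move=> g ng; rewrite s1// s2 ?subrr// => gN; apply: ng; apply: cboxS gN.
  by rewrite ler_nat leq_addl.
have := hK _ _ hB; rewrite XB; [|exact: boxgood hs|exact: boxgood kap_box].
rewrite translation_factor_kap -{2}[X kap]mul1r -mulrBl normcM => h.
rewrite -(ler_pM2r nXk); apply: (le_trans h).
rewrite mulrCA ler_piMr// ?mulr_ge0 ?normc_ge0 ?(ltW e0)// ler_pdivrMr// mul1r.
by rewrite lerDl.
Qed.

Lemma translation_factor_neq0 a : translation_factor a != 0.
Proof.
apply/eqP => a0; have := translation_factor0; rewrite -(subrr a) translation_factorD a0 mul0r => /esym/eqP.
by rewrite oner_eq0.
Qed.

Lemma translation_factor_continuous : continuous translation_factor.
Proof.
move=> a; apply/(@cvgrPdist_lt _ R[i] _ _ (nbhs_filter a)) => eps.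
case: eps => eps ie; rewrite ltcE /= => /andP[/eqP -> e0].
have c0 : 0 < normc (translation_factor a) by rewrite lt_neqAle normc_ge0 andbT eq_sym normc_eq0 translation_factor_neq0.
have e2 : 0 < eps / 2 / normc (translation_factor a) by rewrite !divr_gt0.
have [r r0 Hr] := nbhs_coord PhiD PhiH (translation_factor_near0 e2).
apply: filterS (nbhs_coord_lt PhiD PhiH a r0) => b /= hb.
have := Hr (b - a); rewrite /= => /(_ _)H.
have {H} : normc (translation_factor (b - a) - 1) <= eps / 2 / normc (translation_factor a).
  by apply: H => j; rewrite subr0; exact: hb.
rewrite normcE ltcR => h.
rewrite -[in X in normc (_ - X)](subrK a b) translation_factorD -{1}[translation_factor a]mul1r -mulrBl normcM normcBC.
apply: (@le_lt_trans _ _ (eps / 2)); last by rewrite ltr_pdivrMr// mulr_natr mulr2n ltrDl.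
by rewrite -ler_pdivlMr.
Qed.

Lemma translation_factor_cmeas : cmeas (translation_factor : borel dual -> R[i]).
Proof. exact: continuous_cmeas_borel translation_factor_continuous. Qed.

Lemma cintegrable_translation_factor n B phi : box_bounded n B phi ->
  cintegrable nu (fun g : borel dual => phi g * translation_factor g).
Proof.
move=> hb; have [K K0 hK] := translation_factor_bound n; have [mp s b] := hb.
have mc : measurable (cbox n%:R : set (borel dual)) by exact: cbox_measurable PhiH _.
have -> : (fun g : borel dual => phi g * translation_factor g) =
    (fun g => phi g * (translation_factor g * (\1_(cbox n%:R : set (borel dual)) g : R)%:C)).
  apply/funext => g; have [gn|gn] := pselect (cbox n%:R g).
    by rewrite indicE mem_set// mulr1.
  by rewrite s// !mul0r.
apply: (@cintegrableMb _ _ _ _ _ _ K).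
- exact: boxint hb.
- by apply: cmeasM; [exact: translation_factor_cmeas|exact: cmeas_indic].
- move=> g; rewrite normcM normc_real ger0_norm// indicE.
  have [gn|gn] := pselect (cbox n%:R g); first by rewrite mem_set// mulr1 hK.
  by rewrite memNset// mulr0.
Qed.

Let cint_indic_bound (f : borel dual -> R[i]) (E : set (borel dual)) (B : R) n :
  measurable E -> E `<=` cbox n%:R -> cintegrable nu f -> 0 <= B ->
  (forall g, normc (f g) <= B * \1_E g) -> normc (cintegral nu f) <= B * fine (nu E).
Proof.
move=> mE En fi B0 fB.
have En_fin : nu E \is a fin_num.
  rewrite ge0_fin_numE//; apply: le_lt_trans (cbox_lty haar_nu PhiH n%:R).
  by apply: le_measure => //; rewrite inE//; exact: cbox_measurable PhiH _.
rewrite -lee_fin EFinM fineK//; apply: (le_trans (normc_cintegral fi)).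
rewrite -[X in (_ <= _ * X)%E](_ : (\int[nu]_g (\1_E g)%:E = nu E)%E); last first.
  by rewrite integral_indic// setIT.
rewrite -ge0_integralZl//; last by apply/measurable_EFinP; exact: measurable_indic.
apply: ge0_le_integral => //.
- by move=> g _; rewrite lee_fin normc_ge0.
- exact: (measurable_enormc (cintegrable_cmeas fi)).
- by apply: measurable_funeM; apply/measurable_EFinP; exact: measurable_indic.
- by move=> g _; rewrite -EFinM lee_fin.
Qed.

Section on_box.
Variables (n : nat) (B : R) (phi : borel dual -> R[i]).
Hypothesis phi_box : box_bounded n B phi.
Let phiE (E : set (borel dual)) (g : borel dual) := phi g * (\1_E g : R)%:C.
Let defect (E : set (borel dual)) := X (phiE E) - cintegral nu (fun g : borel dual => phiE E g * translation_factor g).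

Let phiE_box E : measurable E -> box_bounded n B (phiE E).
Proof. by move=> mE; exact: box_bounded_indic. Qed.

Let defectU E F : measurable E -> measurable F -> defect E = defect (E `&` F) + defect (E `\` F).
Proof.
move=> mE mF.
have h1 := phiE_box (measurableI _ _ mE mF); have h2 := phiE_box (measurableD mE mF).
have Esum : phiE E = (fun g => phiE (E `&` F) g + phiE (E `\` F) g).
  apply/funext => g; rewrite /phiE -mulrDr -(rmorphD (real_complex R)); congr (_ * _%:C).
  rewrite !indicE in_setI in_setD; case: (g \in E); case: (g \in F); rewrite ?addr0 ?add0r//=.
rewrite /defect {1}Esum (functionalD Xlin (boxgood h1) (boxgood h2)).
rewrite (_ : cintegral nu _ = cintegral nu (fun g : borel dual => phiE (E `&` F) g * translation_factor g) +
   cintegral nu (fun g : borel dual => phiE (E `\` F) g * translation_factor g)); first by ring.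
rewrite -cintegralD; [|exact: cintegrable_translation_factor h1|exact: cintegrable_translation_factor h2].
by apply: eq_cintegral => g; rewrite Esum mulrDl.
Qed.

(** For [E] near [a], the convolution of [phiE E] with [kap] is close to $I$ times the shift of
    [kap] by [a], $I$ being the integral of [phiE E]. Applying [X] and dividing by its value on
    [kap] compares $X(\varphi 1_E)$ with $c(a)I$, and $c$ is nearly constant on [E]. The error is
    proportional to the measure of [E], so it can be summed over a partition. *)
Let defect_local : exists2 K : R, 0 <= K & forall eps : R, 0 < eps ->
  exists2 r : R, 0 < r & forall (a : dual) (E : set (borel dual)), cbox n%:R a -> measurable E -> E `<=` cbox n%:R ->
    (forall b, E b -> forall j, `|coord j (b - a)| < r) ->
    normc (defect E) <= K * eps * fine (nu E).
Proof.
have [K1 K10 hK1] := functional_box (n + N).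
have [Mc Mc0 hMc] := translation_factor_bound n.
have B0 := box_bounded_ge0 phi_box.
exists (K1 * B / normc (X kap) + B * Mc).
  by rewrite addr_ge0 ?mulr_ge0 ?invr_ge0 ?normc_ge0.
move=> eps e0.
have [r r0 Hr] := nbhs_coord PhiD PhiH (filterI (kap_unif e0) (translation_factor_near0 e0)).
exists r => // a E an mE En Ea.
have Er b : E b -> (forall g, normc (kap (gshift (b - a) g) - kap g) <= eps) /\ normc (translation_factor (b - a) - 1) <= eps.
  by move=> Eb; apply: Hr => j; rewrite subr0; exact: Ea.
have pb := phiE_box mE; have ks := box_bounded_shift PhiD PhiH kap_box an.
have ip := boxint pb; pose I := cintegral nu (phiE E).
have kEb g : normc (phiE E g) <= B * \1_E g.
  rewrite /phiE normcM normc_real ger0_norm// ler_wpM2r//.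
  by have [_ _] := phi_box; exact.
have TE g : conv (phiE E) kap g - I * kap (gshift a g) =
    cintegral nu (fun b : borel dual => phiE E b * (kap (gshift b g) - kap (gshift a g))).
  rewrite mulrC -cintegralZ// -cintegralB; last exact: cintegrableZ.
    by apply: eq_cintegral => b; ring.
  exact: (conv_integrable haar_nu PhiD PhiH g pb kap_box).
have cb := conv_box_bounded haar_nu PhiD PhiH ilam lam_gt0 lam_cont C_gt0 lam_conv pb kap_box.
have Tb : box_bounded (n + N) (B * eps * fine (nu E)) (fun g => conv (phiE E) kap g - I * (kap \o gshift a) g).
  have [m1 s1 _] := cb; have [m2 s2 _] := ks; split.
  - by apply: cmeasB => //; apply: cmeasM => //; exact: cmeas_cst.
  - by move=> g ng; rewrite s1// s2// mulr0 subrr.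
  - move=> g; rewrite TE.
    apply: (cint_indic_bound mE En) => [||b]; last 1 first.
    + rewrite normcM indicE; have [Eb|Eb] := pselect (E b); last first.
        by rewrite /phiE indicE memNset// mulr0 normc0 mul0r mulr0.
      have := kEb b; rewrite indicE mem_set// !mulr1 => h.
      apply: ler_pM => //; try exact: normc_ge0.
      have [h1 _] := Er b Eb; have := h1 (gshift a g).
      by rewrite /gshift opprB addrA subrK.
    + under eq_fun do rewrite mulrBr; apply: cintegrableB.
        exact: (conv_integrable haar_nu PhiD PhiH g pb kap_box).
      under eq_fun do rewrite mulrC; exact: cintegrableZ.
    + by rewrite mulr_ge0// ltW.
have gk := boxgood ks.
have gc := boxgood cb.
have gIk : finite_energy (fun g => I * (kap \o gshift a) g) by exact: finite_energyZ.
have XT : X (fun g => conv (phiE E) kap g - I * (kap \o gshift a) g) = (X (phiE E) - translation_factor a * I) * X kap.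
  rewrite XB// XZ// translation_factor_kap (Xmul (boxgood pb) (boxgood kap_box) gc); first by ring.
  exact: (inv_fourier_conv haar_nu PhiD PhiH ilam lam_gt0 lam_conv (boxgood pb) (boxgood kap_box)).
have H1 : normc (X (phiE E) - translation_factor a * I) <= K1 * B / normc (X kap) * eps * fine (nu E).
  have := hK1 _ _ Tb; rewrite XT normcM -ler_pdivlMr// => h; apply: (le_trans h).
  by rewrite le_eqVlt; apply/orP; left; apply/eqP; ring.
have H2 : normc (translation_factor a * I - cintegral nu (fun g : borel dual => phiE E g * translation_factor g)) <=
    B * Mc * eps * fine (nu E).
  rewrite -cintegralZ// -cintegralB; [|exact: cintegrableZ|exact: cintegrable_translation_factor pb].
  apply: (cint_indic_bound mE En) => [||b]; last 1 first.
  + rewrite -(mulrC (phiE E b)) -mulrBr normcM indicE; have [Eb|Eb] := pselect (E b); last first.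
      by rewrite /phiE indicE memNset// mulr0 normc0 mul0r mulr0.
    have := kEb b; rewrite indicE mem_set// !mulr1 -mulrA => h.
    apply: ler_pM => //; try exact: normc_ge0.
    have [_ h2] := Er b Eb.
    have -> : translation_factor b = translation_factor (b - a) * translation_factor a by rewrite -translation_factorD subrK.
    rewrite -{1}[translation_factor a]mul1r -mulrBl normcM mulrC normcBC.
    by apply: ler_pM => //; try exact: normc_ge0; exact: hMc.
  + by apply: cintegrableB; [exact: cintegrableZ|exact: cintegrable_translation_factor pb].
  + by rewrite !mulr_ge0// ltW.
have -> : defect E = (X (phiE E) - translation_factor a * I) + (translation_factor a * I - cintegral nu (fun g : borel dual => phiE E g * translation_factor g)).
  by rewrite /defect; ring.
apply: (le_trans (le_normcD _ _)); rewrite !mulrDl; exact: lerD.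
Qed.

(** The defect is additive over disjoint pieces and at most a small multiple of the measure of each
    small piece; a finite partition of the box bounds it by an arbitrarily small multiple of the
    measure of the box. *)
Lemma functional_integral_box : X phi = cintegral nu (fun g : borel dual => phi g * translation_factor g).
Proof.
have mc : measurable (cbox n%:R : set (borel dual)) by exact: cbox_measurable PhiH _.
have nun := box_measure_fin haar_nu PhiH n.
have phiEE : phiE (cbox n%:R) = phi.
  apply/funext => g; rewrite /phiE indicE; have [gn|gn] := pselect (cbox n%:R g).
    by rewrite mem_set// mulr1.
  by have [_ s _] := phi_box; rewrite s// mul0r.
suff : defect (cbox n%:R) = 0.
  by rewrite /defect phiEE => /eqP; rewrite subr_eq0 => /eqP.
have [K K0 hK] := defect_local.
suff H (eps : R) : 0 < eps -> normc (defect (cbox n%:R)) <= K * eps * fine (nu (cbox n%:R)).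
  apply/eqP; rewrite -normc_eq0 eq_le normc_ge0 andbT; apply/ler_addgt0Pr => eps e0.
  rewrite add0r; set V := fine _ in H.
  have V0 : 0 <= V by rewrite fine_ge0.
  have KV : 0 < K * V + 1 by rewrite ltr_wpDl// mulr_ge0.
  apply: (le_trans (H _ (divr_gt0 e0 KV))).
  rewrite mulrAC mulrA ler_pdivrMr// mulrC ler_wpM2l ?(ltW e0)// lerDl//.
move=> e0; have [r r0 Hr] := hK _ e0.
have [s sn cov] := box_cover PhiD PhiH n r0.
(* Induction on the list of centres: the part of [E] near the first centre is split off, and the
   rest is covered by the remaining ones. *)
have ind (t : seq dual) : (forall a, a \in t -> cbox n%:R a) -> forall E : set (borel dual),
    measurable E -> E `<=` cbox n%:R ->
    (forall b, E b -> exists2 a, a \in t & forall j, `|coord j (b - a)| < r) ->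
    normc (defect E) <= K * eps * fine (nu E).
  elim: t => [|a t IH] tn E mE En Ecov.
    have E0 : E = set0 by apply/seteqP; split => // b /Ecov[].
    have p0 : phiE E = (fun=> 0).
      by apply/funext => g; rewrite /phiE E0 indic0 mulr0.
    rewrite /defect p0 (functional0 Xlin) sub0r normcN.
    rewrite (_ : cintegral _ _ = 0) ?normc0.
      by rewrite !mulr_ge0 ?(ltW e0)// fine_ge0.
    by rewrite -[RHS](cintegral0 nu); apply: eq_cintegral => g; rewrite mul0r.
  pose F : set (borel dual) := [set b : dual | forall j, `|coord j (b - a)| < r].
  have mF : measurable F.
    rewrite (_ : F = \bigcap_(j in setT) (fun b : borel dual => coord j b - coord j a) @^-1` `]- r, r[%classic).
      apply: fin_bigcap_measurable => // j _; rewrite -[X in measurable X]setTI.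
      apply: measurable_funB => //; exact: (coord_measurable PhiH).
    apply/seteqP; split => b h j; first by move=> _; rewrite /= in_itv/= -ltr_norml -(coordB PhiD).
    by have := h j I; rewrite /= in_itv/= -ltr_norml -(coordB PhiD).
  have mEF := measurableI _ _ mE mF; have mED := measurableD mE mF.
  have fin (A : set (borel dual)) : measurable A -> A `<=` cbox n%:R -> nu A \is a fin_num.
    move=> mA An; rewrite ge0_fin_numE//; apply: le_lt_trans (cbox_lty haar_nu PhiH n%:R).
    by apply: le_measure => //; rewrite inE.
  have -> : fine (nu E) = fine (nu (E `&` F)) + fine (nu (E `\` F)).
    rewrite -fineD; [|by apply: fin => // b [/En]|by apply: fin => // b [/En]].
    rewrite -measureU//; first by rewrite setUIDK.
    by apply/seteqP; split => // b [[_ Fb] [_ /(_ Fb)]].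
  rewrite (defectU mE mF) mulrDr; apply: (le_trans (le_normcD _ _)); apply: lerD.
    apply: (Hr a) => //; first by apply: tn; rewrite mem_head.
      by move=> b [/En].
    by move=> b [].
  apply: IH => //.
  - by move=> a' a't; apply: tn; rewrite inE a't orbT.
  - by move=> b [/En].
  - move=> b [Eb Fb]; have [a' + h] := Ecov b Eb; rewrite inE => /orP[/eqP a'a|a't].
      by case: Fb; rewrite /F/= -a'a.
    by exists a'.
by apply: (ind s).
Qed.

End on_box.

End with_kernel.

(** A box-bounded [psi] close to [phi] in energy still has nonzero value, by [functional_bound]; its
    convolution square has the square of that value and is uniformly continuous. *)
Lemma functional_kernel phi : finite_energy phi -> X phi != 0 -> exists N M kap,
  [/\ box_bounded N M kap, forall eps : R, 0 < eps ->
    nbhs (0 : dual) [set b | forall g, normc (kap (gshift b g) - kap g) <= eps] & X kap != 0].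
Proof.
move=> gp Xp.
have nX : 0 < normc (X phi) ^+ 2 by rewrite exprn_gt0// lt_neqAle normc_ge0 andbT eq_sym normc_eq0.
have C2 : 0 < 2 * C by rewrite mulr_gt0.
have [n [psi [hb hN]]] := box_bounded_dense PhiH ilam lam_gt0 gp (divr_gt0 nX C2).
have gs := boxgood hb.
have Xs : X psi != 0.
  apply/eqP => Xs; have gB := finite_energyB ilam lam_gt0 gp gs.
  have := functional_bound haar_nu PhiD PhiH ilam lam_gt0 C_gt0 lam_conv Xlin Xmul gB.
  rewrite XB// Xs subr0 leNgt => /negP; apply.
  by rewrite muleC -lte_pdivlMr.
have cb := conv_box_bounded haar_nu PhiD PhiH ilam lam_gt0 lam_cont C_gt0 lam_conv hb hb.
exists (n + n)%N, (fine (L1 nu psi) * n%:R), (conv psi psi); split => //.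
  by move=> eps e0; exact: (conv_uniform haar_nu PhiD PhiH hb hb e0).
rewrite (Xmul gs gs (boxgood cb)); first by rewrite mulf_neq0.
exact: (inv_fourier_conv haar_nu PhiD PhiH ilam lam_gt0 lam_conv gs gs).
Qed.

Theorem functional_character : (exists2 phi, finite_energy phi & X phi != 0) ->
  exists c : dual -> R[i], [/\ continuous c, forall a b, c (a + b) = c a * c b, c 0 = 1,
    forall n : nat, exists K : R, forall a, cbox n%:R a -> normc (c a) <= K &
    forall n B phi, box_bounded n B phi ->
      cintegrable nu (fun g : borel dual => phi g * c g) /\
      X phi = cintegral nu (fun g : borel dual => phi g * c g)].
Proof.
move=> [phi gp Xp]; have [N [M [kap [kb ku kX]]]] := functional_kernel gp Xp.
exists (translation_factor kap); split.
- exact: (translation_factor_continuous kb ku kX).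
- exact: (translation_factorD kb kX).
- exact: (translation_factor0 kb kX).
- by move=> n; have [K _ hK] := translation_factor_bound kb n; exists K.
- move=> n B psi hb; split; first exact: (cintegrable_translation_factor kb ku kX hb).
  exact: (functional_integral_box kb ku kX hb).
Qed.

End functional_character.

(** * Unimodularity from the growth condition *)

Section unimodularity.
Context (R : realType) (G : topologicalZmodType).
Local Notation dual := (dual_group R G).
Context (nu : {measure set (borel dual) -> \bar R}) (haar_nu : is_haar nu).
Context (d e : nat) (Phi : dual -> 'rV[R]_d * 'rV[int]_e).
Hypothesis PhiD : forall a b, Phi (a + b) = Phi a + Phi b.
Hypothesis PhiH : homeomorphism Phi.
Context (lam : dual -> R) (ilam : nu.-integrable setT (EFin \o lam)).
Hypothesis lam_gt0 : forall g, 0 < lam g.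
Hypothesis lam_cont : continuous lam.
Hypothesis lam_GRS : forall g : dual,
  (fun n : nat => lam (g *+ n) `^ (n%:R^-1)) @ \oo --> (1 : R).
Local Notation coord := (dual_coord Phi).
Local Notation cbox := (cbox Phi).
Let mshift := measurable_gshift PhiD PhiH.
Variable c : dual -> R[i].
Hypothesis cD : forall a b, c (a + b) = c a * c b.
Hypothesis c0 : c 0 = 1.
Hypothesis c_cont : continuous c.
Variable Q : R.
Hypothesis cQ : forall n : nat,
  (\int[nu]_g (normc (c g) ^+ 2 * lam g * \1_(cbox n%:R : set (borel dual)) g)%:E <= Q%:E)%E.

Lemma character_mulrn a n : c (a *+ n) = c a ^+ n.
Proof. by elim: n => [|n IH]; rewrite ?mulr0n// mulrS cD IH exprS. Qed.

Lemma bernoulli_ge (s : R) n : 1 <= s -> n%:R * (s - 1) <= s ^+ n.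
Proof.
move=> s1; suff : 1 + n%:R * (s - 1) <= s ^+ n by apply: le_trans; rewrite lerDr.
elim: n => [|n IH]; first by rewrite mul0r addr0 expr0.
rewrite exprS -natr1; have n0 : (0 : R) <= n%:R by [].
apply: (@le_trans _ _ (s * (1 + n%:R * (s - 1)))); last by rewrite ler_wpM2l// (le_trans ler01).
rewrite -subr_ge0 (_ : _ - _ = n%:R * (s - 1) ^+ 2); last by ring.
by rewrite mulr_ge0// sqr_ge0.
Qed.

Lemma directionP (v : 'rV[R]_d) : {g : dual | (forall i, coord (lshift e i) g = v 0 i) &
  forall i, coord (rshift d i) g = 0}.
Proof.
apply: cid2; have [_ [Psi [_ KP _]]] := PhiH; exists (Psi (v, 0)) => i.
  by rewrite /dual_coord KP row_mxEl.
by rewrite /dual_coord KP row_mxEr !mxE.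
Qed.

(** Integer coordinates are 0: only the real directions can be varied continuously, so the category
    argument takes place on them. *)
Definition direction v := s2val (directionP v).

Lemma direction_real v i : coord (lshift e i) (direction v) = v 0 i.
Proof. exact: (s2valP (directionP v)). Qed.

Lemma direction_int v i : coord (rshift d i) (direction v) = 0.
Proof. exact: (s2valP' (directionP v)). Qed.

Let U : set dual := [set g | forall j, `|coord j g| < 1].

Let mU : measurable (U : set (borel dual)).
Proof.
rewrite (_ : U = \bigcap_(j in setT) (coord j : borel dual -> R) @^-1` `]- 1, 1[%classic).
  apply: fin_bigcap_measurable => // j _; rewrite -[X in measurable X]setTI.
  exact: (coord_measurable PhiH).
apply/seteqP; split => b h j; first by move=> _; rewrite /= in_itv/= -ltr_norml.
by have := h j I; rewrite /= in_itv/= -ltr_norml.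
Qed.

Let U_lty : (nu U < +oo)%E.
Proof.
apply: le_lt_trans (cbox_lty haar_nu PhiH 1); apply: le_measure; rewrite ?inE//.
  exact: cbox_measurable PhiH _.
by move=> g gU j; exact: ltW.
Qed.

Let U_gt0 : (0 < nu U)%E.
Proof.
have [_ _ h _ _] := haar_nu.
have U0 : nbhs (0 : dual) U.
  apply: filterS (nbhs_coord_lt PhiD PhiH 0 ltr01) => g /= hg j.
  by have := hg j; rewrite subr0.
apply: (lt_le_trans (h U^° (open_interior U) _)); first by exists 0.
apply: le_measure; rewrite ?inE//; last exact: interior_subset.
exact: open_measurable_borel (open_interior U).
Qed.

(* On the translates [n (g1 + v1) + U] the integrand of [cQ] is at least [s^n],
   contradicting the uniform bound [Q]. *)
Lemma no_uniform_growth (g1 : dual) (v1 : 'rV[R]_d) (r s : R) (m : nat) : 0 < r -> 1 < s ->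
  (forall v : 'rV[R]_d, (forall i, `|v 0 i - v1 0 i| < r) ->
    s <= normc (c (g1 + direction v)) /\
    forall n, (m <= n)%N -> s ^- n <= lam ((g1 + direction v) *+ n)) -> False.
Proof.
move=> r0 s1 H; have s0 : 0 < s by apply: lt_trans s1.
pose V := fine (nu U).
have Vfin : nu U \is a fin_num by rewrite ge0_fin_numE.
have V0 : 0 < V by rewrite fine_gt0// U_gt0 U_lty.
have key n : (m <= n)%N -> r^-1 < n%:R -> s ^+ n * V <= Q.
  move=> mn rn; have n0 : (0 : R) < n%:R by apply: lt_trans rn; rewrite invr_gt0.
  pose b := (g1 + direction v1) *+ n.
  have [N0 bN0] := cbox_cover Phi b.
  have inA (g : dual) : U (g - b) -> s ^+ n <= normc (c g) ^+ 2 * lam g.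
    (* Every [g] in the translate is exactly $n(g_1+v)$ for a direction [v] within $1/n$ of [v1];
       the integer coordinates match because those of elements of [U] vanish. *)
    move=> gU; pose v : 'rV[R]_d := \row_i (v1 0 i + coord (lshift e i) (g - b) / n%:R).
    have gE : g = (g1 + direction v) *+ n.
      apply: (coord_inj PhiH) => j.
      have -> : coord j g = coord j (g - b) + (coord j g1 + coord j (direction v1)) *+ n.
        by rewrite -(coordD PhiD j g1) -(coordMn PhiD) -(coordD PhiD) subrK.
      rewrite (coordMn PhiD) (coordD PhiD j g1); case: (split_ordP j) => i ->.
        rewrite !direction_real mxE addrA [RHS]mulrnDl [RHS]addrC; congr (_ + _).
        by rewrite -[RHS]mulr_natr divfK// gt_eqF.
      rewrite !direction_int !addr0; set z := coord _ (g - b).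
      suff -> : z = 0 by rewrite add0r.
      have := gU (rshift d i); rewrite -/z /z /dual_coord row_mxEr mxE -intr_norm.
      rewrite -[1]/(1%:~R) ltr_int -[X in (_ < X)%R]add0r ltzD1 normr_le0 => /eqP ->.
      by rewrite mulr0z.
    have vr i : `|v 0 i - v1 0 i| < r.
      rewrite mxE addrAC subrr add0r normrM [`|_^-1|]gtr0_norm ?invr_gt0//.
      rewrite ltr_pdivrMr//; apply: (lt_trans (gU _)).
      by rewrite -ltr_pdivrMl// mulr1.
    have [h1 h2] := H v vr; rewrite gE character_mulrn normcX -exprM mulnC exprM.
    (* The factor $|c|^2$ gains $s^{2n}$, while [lam] loses at most $s^{-n}$. *)
    apply: (@le_trans _ _ ((s ^+ 2) ^+ n * s ^- n)).
      by rewrite -exprM mul2n -addnn exprD mulfK// expf_neq0// gt_eqF.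
    apply: ler_pM; rewrite ?invr_ge0 ?exprn_ge0 ?(ltW s0)//; last exact: h2.
    by rewrite -!exprM; apply: lerXn2r; rewrite ?nnegrE ?normc_ge0 ?(ltW s0).
  have := cQ (1 + N0); rewrite -lee_fin; apply: le_trans.
  rewrite EFinM fineK// -(haar_gshift haar_nu b mU).
  have mA : measurable (gshift b @^-1` (U : set (borel dual))).
    by have := mshift b measurableT mU; rewrite setTI.
  rewrite -[X in (_ * nu X)%E]setIT -integral_indic// -ge0_integralZl//; first last.
  - by rewrite lee_fin exprn_ge0// ltW.
  - by apply/measurable_EFinP; exact: measurable_indic.
  apply: ge0_le_integral => //.
  - by move=> g _; rewrite -EFinM lee_fin mulr_ge0// exprn_ge0// ltW.
  - by apply: measurable_funeM; apply/measurable_EFinP; exact: measurable_indic.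
  - apply/measurable_EFinP; apply: measurable_funM; last by apply: measurable_indic; exact: cbox_measurable PhiH _.
    apply: measurable_funM; last exact: (lam_measurable ilam).
    by apply: measurable_funX; apply: measurable_normc; exact: continuous_cmeas_borel c_cont.
  - move=> g _; rewrite -EFinM lee_fin indicE; have [Ag|Ag] := pselect ((gshift b @^-1` (U : set (borel dual))) g).
      rewrite mem_set// mulr1 indicE mem_set ?mulr1; first exact: inA.
      rewrite natrD -(subrK b (g : dual)); apply: (cboxD PhiD) => // j.
      by apply: ltW; exact: Ag.
    rewrite memNset// mulr0; apply: mulr_ge0 => //.
    by apply: mulr_ge0; [exact: sqr_ge0|exact/ltW/lam_gt0].
(* Large enough for $s^n\nu(U)\ge n(s-1)\nu(U)>Q$, for $n>1/r$ and for $n\ge m$ together. *)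
pose n := maxn m (Num.bound (r^-1 + `|Q / (V * (s - 1))|)).
have nb : r^-1 + `|Q / (V * (s - 1))| < n%:R.
  apply: (@lt_le_trans _ _ (Num.bound (r^-1 + `|Q / (V * (s - 1))|))%:R).
    by apply: archi_boundP; rewrite addr_ge0// invr_ge0 ltW.
  by rewrite ler_nat leq_maxr.
have rn : r^-1 < n%:R by apply: le_lt_trans nb; rewrite lerDl.
have Qn : Q / (V * (s - 1)) < n%:R.
  by apply: le_lt_trans nb; apply: (le_trans (ler_norm _)); rewrite lerDr invr_ge0 ltW.
have s10 : 0 < s - 1 by rewrite subr_gt0.
move: Qn; rewrite ltr_pdivrMr ?mulr_gt0// => Qn.
have := key n (leq_maxl _ _) rn; apply/negP; rewrite -ltNge.
apply: (lt_le_trans Qn); rewrite mulrCA [leRHS]mulrC ler_pM2l//.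
by apply: bernoulli_ge; exact: ltW.
Qed.

Lemma GRS_lower (g : dual) (s : R) : 1 < s ->
  exists m, forall n, (m <= n)%N -> s ^- n <= lam (g *+ n).
Proof.
move=> s1; have s0 : 0 < s by apply: lt_trans s1.
have s11 : 0 < 1 - s^-1 by rewrite subr_gt0 invf_lt1.
have /cvgrPdist_lt/(_ _ s11)[m _ hm] := lam_GRS g.
exists m.+1 => n mn; have n0 : (0 < n)%N by exact: leq_ltn_trans mn.
have := hm n (ltnW mn); rewrite /= ltr_norml => /andP[_ h].
have sl : s^-1 <= lam (g *+ n) `^ n%:R^-1 by lra.
have -> : lam (g *+ n) = (lam (g *+ n) `^ n%:R^-1) ^+ n.
  by rewrite -powR_mulrn ?powR_ge0// -powRrM mulVf ?pnatr_eq0 ?gtn_eqF// powRr1// ltW.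
by rewrite -exprVn; apply: lerXn2r; rewrite ?nnegrE ?powR_ge0 ?invr_ge0 ?(ltW s0).
Qed.

Lemma character_le1 (g1 : dual) : normc (c g1) <= 1.
Proof.
rewrite leNgt; apply/negP => c1.
(* Midway between 1 and $|c(g_1)|$: above 1 to force growth, below $|c(g_1)|$ to leave room for
   continuity. *)
pose s := (1 + normc (c g1)) / 2.
have s1 : 1 < s by rewrite /s; lra.
have sc : s < normc (c g1) by rewrite /s; lra.
have s0 : 0 < s by apply: lt_trans s1.
have [r0 r00 near_s] : exists2 r0 : R, 0 < r0 & forall v : 'rV[R]_d,
    (forall i, `|v 0 i| < r0) -> s <= normc (c (g1 + direction v)).
  have cs : 0 < (normc (c g1) - s)%:C by rewrite ltcR subr_gt0.
  have /(@cvgrPdist_lt _ R[i] _ _ (nbhs_filter g1))/(_ _ cs) := @c_cont g1.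
  move=> /(nbhs_coord PhiD PhiH)[r0 r00 h]; exists r0 => // v vr.
  have : `|c g1 - c (g1 + direction v)| < (normc (c g1) - s)%:C.
    apply: h => j; rewrite [X in coord _ X]addrC addKr.
    by case: (split_ordP j) => i ->; rewrite ?direction_real ?direction_int ?normr0.
  rewrite normcE ltcR => h2; have := le_normcD (c g1 - c (g1 + direction v)) (c (g1 + direction v)).
  by rewrite subrK; lra.
pose W : completeNormedModType R := HB.pack ('rV[R]_d) (Complete.on 'rV[R]_d).
(* [E m] collects the directions along which the lower bound holds from [m] on. By [GRS_lower] these
   sets cover the space, and by [no_uniform_growth] none contains an open set of directions close to
   0. Joining the open set [far] makes their complements dense everywhere, as Baire's theorem
   requires. *)
pose E m : set W := [set v : 'rV[R]_d | forall n, (m <= n)%N -> s ^- n <= lam ((g1 + direction v) *+ n)].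
pose far : set W := [set v : 'rV[R]_d | exists i, r0 / 2 < `|v 0 i|].
have cont_lam n : continuous (fun v : 'rV[R]_d => lam ((g1 + direction v) *+ n)).
  move=> v; have cdir : (fun w : 'rV[R]_d => (g1 + direction w) *+ n) @ v --> (g1 + direction v) *+ n.
    move=> A /(nbhs_coord PhiD PhiH)[eps e0 H].
    have e1 : 0 < eps / n.+1%:R by rewrite divr_gt0.
    apply: filterS (near_rV v e1) => w hw; apply: H => j.
    rewrite (coordB PhiD) !(coordMn PhiD) !(coordD PhiD) -mulrnBl opprD addrACA subrr add0r.
    case: (split_ordP j) => i ->; last by rewrite !direction_int subrr mul0rn normr0.
    rewrite !direction_real -mulr_natr normrM normr_nat distrC.
    have h := hw i; rewrite ltr_pdivlMr// in h.
    apply: le_lt_trans h; rewrite ler_wpM2l// ler_nat.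
    exact: leqnSn.
  by move=> A /lam_cont /cdir.
have oE m : open (~` E m).
  apply: closed_openC; rewrite (_ : E m = \bigcap_(n in [set n | (m <= n)%N])
      ((fun v : 'rV[R]_d => lam ((g1 + direction v) *+ n)) @^-1` [set t | s ^- n <= t])); last first.
    by apply/seteqP; split => v h n mn; exact: h.
  by apply: closed_bigI => n _; apply: closed_comp => [v _|]; [exact: cont_lam|exact: closed_ge].
have ofar : open far.
  rewrite (_ : far = \bigcup_(i in setT) ((fun v : 'rV[R]_d => v 0 i) @^-1` [set t | r0 / 2 < `|t|])); last first.
    by apply/seteqP; split => v [k] => [h|_ h]; exists k.
  apply: bigcup_open => i _; apply: open_comp => [v _|]; first exact: coord_continuous.
  have -> : [set t : R | r0 / 2 < `|t|] = (@Num.norm R R) @^-1` [set t : R | r0 / 2 < t] by [].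
  by apply: open_comp => [v _|]; [exact: norm_continuous|exact: open_gt].
have dense_O m : dense (~` E m `|` far).
  move=> O [v1 Ov1] oO; apply: contrapT => no.
  have [r rp hr] := nbhs_rV (open_nbhs_nbhs (conj oO Ov1) : nbhs (v1 : 'rV[R]_d) O).
  apply: (@no_uniform_growth g1 v1 r s m rp s1) => v vr.
  have Ov : O v by apply: hr => j; rewrite distrC; exact: vr.
  have nEf : ~ (~` E m `|` far) v by move=> h; apply: no; exists v.
  split; last by apply: contrapT => h; apply: nEf; left.
  apply: near_s => i; rewrite ltNge; apply/negP => h; apply: nEf; right; exists i.
  by apply: lt_le_trans h; rewrite ltr_pdivrMr// mulr_natr mulr2n ltrDl.
have [v [vn0 vF]] : exists v : W, ([set v : 'rV[R]_d | forall i, `|v 0 i| < r0 / 2] `&` \bigcap_m (~` E m `|` far)) v.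
  apply: (@Baire R W (fun m => ~` E m `|` far)).
  - by move=> m; split; [exact: openU|exact: dense_O].
  - by exists (0 : 'rV[R]_d) => i /=; rewrite mxE normr0 divr_gt0.
  - rewrite (_ : mkset _ = \bigcap_(i in [set: 'I_d]) ((fun v : 'rV[R]_d => v 0 i) @^-1` [set t | `|t| < r0 / 2])); last first.
      by apply/seteqP; split => v h k; [move=> _; exact: h|exact: (h k I)].
    rewrite openE => v h; have H i : nbhs v ((fun v : 'rV[R]_d => v 0 i) @^-1` [set t | `|t| < r0 / 2]).
      apply: open_nbhs_nbhs; split; last exact: h.
      apply: open_comp => [w _|]; first exact: coord_continuous.
      have -> : [set t : R | `|t| < r0 / 2] = (@Num.norm R R) @^-1` [set t : R | t < r0 / 2] by [].
      by apply: open_comp => [w _|]; [exact: norm_continuous|exact: open_lt].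
    by apply: filterS (filter_forall _ H) => w hw i _; exact: hw.
have [m hm] := GRS_lower (g1 + direction v) s1.
case: (vF m I); first by apply.
by move=> [k h]; have := lt_trans h (vn0 k); rewrite ltxx.
Qed.

Lemma character_unimodular g : normc (c g) = 1.
Proof.
have h1 := character_le1 g; have h2 := character_le1 (- g).
have : normc (c g) * normc (c (- g)) = 1 by rewrite -normcM -cD subrr c0 normc1.
move=> h; apply/eqP; rewrite eq_le h1 /= -h.
by rewrite ler_piMr// normc_ge0.
Qed.

End unimodularity.

(** * Multiplicative functionals are point evaluations *)

Section multiplicative_functionals.
Context (R : realType) (G : topologicalZmodType).
Local Notation dual := (dual_group R G).
Hypothesis hausG : hausdorff_space G.
Hypothesis lcG : locally_compact [set: G].
Context (mu : {measure set (borel G) -> \bar R}) (haar_mu : is_haar mu).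
Context (nu : {measure set (borel dual) -> \bar R}) (dual_nu : is_dual_haar mu nu).
Context (d e : nat) (Phi : dual -> 'rV[R]_d * 'rV[int]_e).
Hypothesis PhiD : forall a b, Phi (a + b) = Phi a + Phi b.
Hypothesis PhiH : homeomorphism Phi.
Context (lam : dual -> R) (ilam : nu.-integrable setT (EFin \o lam)).
Hypothesis lam_gt0 : forall g, 0 < lam g.
Local Notation finite_energy := (finite_energy nu lam).
Local Notation energy := (energy nu lam).
Local Notation cbox := (cbox Phi).
Let haar_nu : is_haar nu := dual_nu.1.
Implicit Types phi psi : borel dual -> R[i].

Lemma box_upper (h : dual -> R) (n : nat) : continuous h ->
  exists2 M : R, 0 <= M & forall g, cbox n%:R g -> `|h g| <= M.
Proof.
move=> ch; have : compact (h @` cbox n%:R).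
  by apply: continuous_compact; [exact: continuous_subspaceT|exact: cbox_compact PhiH _].
move=> /compact_bounded[M [_ hM]]; exists (`|M| + 1) => [|g gn]; first exact: addr_ge0.
apply: (hM (`|M| + 1)); last by exists g.
by apply: (le_lt_trans (ler_norm _)); rewrite ltrDl.
Qed.

Lemma c0_bounded : is_c0 lam -> exists2 M : R, 0 <= M & forall g, lam g <= M.
Proof.
move=> [cl /(_ 1 ltr01)[A cA hA]]; have [n An] := compact_cbox PhiD PhiH cA.
have [M M0 hM] := box_upper n cl; exists (M + 1) => [|g]; first exact: addr_ge0.
apply: (le_trans (ler_norm _)); have [gA|gA] := pselect (A g).
  by apply: (le_trans (hM _ (An _ gA))); rewrite lerDl.
by apply: (le_trans (ltW (hA _ gA))); rewrite lerDr.
Qed.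

(** The assumed bound concerns a real-valued integral, which is 0 by convention when the integral is
    infinite. Boundedness of [lam] makes the integrand integrable, so the extended integral obeys
    the same bound; $|C|+1$ makes the constant positive. *)
Lemma subconvolutive_bound : is_c0 lam ->
  (exists C : R, forall g : dual, \int[nu]_a (lam a * lam (g - a)) <= C * lam g) ->
  exists2 C : R, 0 < C & forall g : dual,
    (\int[nu]_a (lam a * lam (g - (a : dual)))%:E <= (C * lam g)%:E)%E.
Proof.
move=> lc0 [C hC]; exists (`|C| + 1) => [|g]; first by rewrite ltr_wpDl.
have [M M0 hM] := c0_bounded lc0.
have ml := lam_measurable ilam.
have ms : measurable_fun setT (fun a : borel dual => gshift a (g : borel dual)).
  exact: (measurableT_comp (measurable_subr_dual PhiD PhiH) (measurable_pair2 (g : borel dual))).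
have il : nu.-integrable setT (fun a : borel dual => (lam a * lam (g - (a : dual)))%:E).
  apply: (@le_integrable _ _ _ nu setT measurableT _ (fun a : borel dual => (M%:E * (lam a)%:E)%E)).
  - by apply/measurable_EFinP; apply: measurable_funM => //; exact: (measurableT_comp ml ms).
  - move=> a _; rewrite -EFinM /= lee_fin !ger0_norm ?mulr_ge0// ?(ltW (lam_gt0 _))//.
    by rewrite mulrC ler_wpM2r// ltW.
  - exact: integrableZl.
rewrite -(fineK (integrable_fin_num measurableT il)) lee_fin.
apply: (le_trans (hC g)); rewrite ler_wpM2r//; first exact: ltW.
by apply: (le_trans (ler_norm _)); rewrite lerDl.
Qed.

Hypothesis lam_c0 : is_c0 lam.
Hypothesis lam_GRS : forall g : dual,
  (fun n : nat => lam (g *+ n) `^ (n%:R^-1)) @ \oo --> (1 : R).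
Context (C : R) (C_gt0 : 0 < C).
Hypothesis lam_conv : forall g : dual,
  (\int[nu]_a (lam a * lam (g - (a : dual)))%:E <= (C * lam g)%:E)%E.
Variable X : (borel dual -> R[i]) -> R[i].
Hypothesis Xlin : forall (a : R[i]) phi psi, finite_energy phi -> finite_energy psi ->
  X (fun g => a * phi g + psi g) = a * X phi + X psi.
Hypothesis Xmul : forall phi psi chi, finite_energy phi -> finite_energy psi -> finite_energy chi ->
  (forall x, inv_fourier nu chi x = inv_fourier nu phi x * inv_fourier nu psi x) ->
  X chi = X phi * X psi.
Let Xbound := functional_bound haar_nu PhiD PhiH ilam lam_gt0 C_gt0 lam_conv Xlin Xmul.

(* Testing the functional on [c^* lam] restricted to a box turns its
   continuity into a square-integrability bound on [c]. *)
Lemma character_square_bound (c : dual -> R[i]) (n : nat) : continuous c ->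
  (exists K : R, forall a, cbox n%:R a -> normc (c a) <= K) ->
  (forall B phi, box_bounded Phi n B phi -> X phi = cintegral nu (fun g : borel dual => phi g * c g)) ->
  (\int[nu]_g (normc (c g) ^+ 2 * lam g * \1_(cbox n%:R : set (borel dual)) g)%:E <= (2 * C)%:E)%E.
Proof.
move=> cc [K hK] Xc; have [M M0 hM] := box_upper n lam_c0.1.
have mc := continuous_cmeas_borel cc.
have mbox : measurable (cbox n%:R : set (borel dual)) by exact: cbox_measurable PhiH _.
have l0 (g : dual) : 0 <= lam g by exact: ltW.
pose phi (g : borel dual) : R[i] := (c g)^*%C * (lam g * \1_(cbox n%:R : set (borel dual)) g)%:C.
have hb : box_bounded Phi n (K * M) phi.
  split.
  - apply: cmeasM; first exact: cmeas_conj.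
    apply: cmeas_real; apply: measurable_funM; first exact: (lam_measurable ilam).
    exact: measurable_indic.
  - by move=> g gn; rewrite /phi indicE memNset// !mulr0.
  - move=> g; have K0 : 0 <= K.
      by apply: le_trans (hK 0 _) => [|j]; rewrite ?normc_ge0// (coord0 PhiD) normr0.
    rewrite /phi normcM normc_conj normc_real indicE.
    have [gn|gn] := pselect (cbox n%:R g); last by rewrite memNset// mulr0 normr0 mulr0 mulr_ge0.
    by rewrite mem_set// mulr1; apply: ler_pM; rewrite ?normc_ge0//; [exact: hK|exact: hM].
have gp := finite_energy_box_bounded haar_nu PhiH ilam lam_gt0 lam_c0.1 hb.
pose V g := normc (c g) ^+ 2 * lam g * \1_(cbox n%:R : set (borel dual)) g.
have NV : energy phi = (\int[nu]_g (V g)%:E)%E.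
  apply: eq_integral => g _; congr EFin; have lg := lam_gt0 (g : dual).
  rewrite /phi /V normcM normc_conj normc_real exprMn real_normK ?num_real// indicE.
  have ln : lam g != 0 by rewrite gt_eqF.
  by case: (g \in _) => /=; field.
have XV : X phi = (\int[nu]_g V g)%:C.
  rewrite (Xc _ _ hb) -cintegral_real; apply: eq_cintegral => g.
  rewrite mulrAC [_^*%C * _]mulrC mul_conjc -(rmorphM (real_complex R)); congr (_%:C).
  by rewrite /V mulrA.
(* The functional and the energy both equal the integral $v$ to be bounded, so continuity reads
   $v^2\le 2Cv$. *)
have := Xbound gp; rewrite XV normc_real NV /Rintegral -/(V) real_normK ?num_real//.
have := energy_fin lam_gt0 gp; have := energy_ge0 nu lam_gt0 phi; rewrite NV => i0 ifin.
rewrite -(fineK ifin) -EFinM !lee_fin /= expr2; set v := fine _.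
have := fine_ge0 i0; rewrite -/v le_eqVlt => /orP[/eqP <- _|v0]; first by rewrite mulr_ge0// ltW.
by rewrite ler_pM2r.
Qed.

Theorem functional_evaluation : (exists2 phi, finite_energy phi & X phi != 0) ->
  exists x, forall phi, finite_energy phi -> X phi = inv_fourier nu phi x.
Proof.
move=> Xn0; have [c [cc cD c0 cK Xc]] :=
  functional_character haar_nu PhiD PhiH ilam lam_gt0 lam_c0.1 C_gt0 lam_conv Xlin Xmul Xn0.
have cQ n := character_square_bound cc (cK n) (fun B phi hb => (Xc n B phi hb).2).
have c1 := character_unimodular haar_nu PhiD PhiH ilam lam_gt0 lam_c0.1 lam_GRS cD c0 cc cQ.
have [x cx] : exists x, forall g : dual, c g = g x.
  apply: (pontryagin_duality hausG lcG haar_mu dual_nu PhiD PhiH cD c1) => eps e0.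
  have ec : 0 < eps%:C by rewrite ltcR.
  have /(@cvgrPdist_lt _ R[i] _ _ (nbhs_filter 0))/(_ _ ec) := @cc 0.
  by apply: filterS => a; rewrite /= c0 normcE ltcR normcBC.
exists x => phi gp; apply/eqP; rewrite -subr_eq0 -normc_eq0 -sqrf_eq0 eq_le sqr_ge0 andbT.
apply/ler_addgt0Pr => eps e0; rewrite add0r.
have M0 := lam_mass_gt0 nu lam_gt0.
(* Functional and evaluation agree on box-bounded densities and are both bounded in energy, with
   constants $2C$ and [lam_mass]; the outer 2 comes from squaring a difference. *)
have k0 : 0 < 2 * (2 * C + lam_mass nu lam) by rewrite mulr_gt0// addr_gt0// mulr_gt0.
have [n [psi [hb hN]]] := box_bounded_dense PhiH ilam lam_gt0 gp (divr_gt0 e0 k0).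
have gs := finite_energy_box_bounded haar_nu PhiH ilam lam_gt0 lam_c0.1 hb.
have gB := finite_energyB ilam lam_gt0 gp gs.
have Xs : X psi = inv_fourier nu psi x.
  by rewrite (Xc _ _ _ hb).2; apply: eq_cintegral => g; rewrite cx.
have -> : X phi - inv_fourier nu phi x =
    X (fun g => phi g - psi g) - inv_fourier nu (fun g => phi g - psi g) x.
  rewrite (functionalB Xlin gp gs) inv_fourierB ?Xs; first by ring.
    exact: (finite_energy_cintegrable ilam lam_gt0 gp).
  exact: (finite_energy_cintegrable ilam lam_gt0 gs).
have b1 := Xbound gB; have b2 := inv_fourier_energy ilam lam_gt0 x gB.
move: hN b1 b2; rewrite -(fineK (energy_fin lam_gt0 gB)) -!EFinM lte_fin !lee_fin; set q := fine _ => hN b1 b2.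
apply: (le_trans (sqr_normcD _ _)); rewrite normcN.
apply: (@le_trans _ _ (2 * (2 * C + lam_mass nu lam) * q)); first by nra.
by rewrite mulrC -ler_pdivlMr// ltW.
Qed.

End multiplicative_functionals.

(** * Homeomorphisms *)

Section pointwise_topology.

Lemma prod_topology_continuous (X : topologicalType) (I : Type) (K : I -> topologicalType)
    (f : X -> prod_topology K) :
  (forall i, continuous (fun x => f x i)) -> continuous f.
Proof.
move=> h x; apply/cvg_sup => i.
exact: (@continuous_comp_initial _ X (K i) (fun p : (forall j, K j) => p i) f (h i) x).
Qed.

Lemma prod_topology_eval_continuous (I : Type) (K : I -> topologicalType) (i : I) :
  continuous (fun p : prod_topology K => p i).
Proof.
move=> p A /(@initial_continuous _ _ (fun q : (forall j, K j) => q i) p) pA.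
have /cvg_sup/(_ i) : nbhs p --> p by exact: cvg_id.
by apply.
Qed.

Lemma set_type_continuous (X Y : topologicalType) (A : set Y) (f : X -> A) :
  continuous (fun x => set_val (f x)) -> continuous f.
Proof. by move=> h; exact: continuous_comp_initial. Qed.

(** A function [h k] that vanishes at infinity but not at [g y0] keeps [g y] in a compact set for
    [y] near [y0]. A cluster point has the same values as [g y0] under every [h j], hence equals it,
    and in a compact set a unique cluster point is a limit. *)
Lemma inverse_continuous_c0 (R : realType) (G Y : topologicalType) (g : Y -> G)
    (I : Type) (h : I -> G -> R[i]) : hausdorff_space G ->
  (forall k, continuous (h k)) -> (forall k, continuous (h k \o g)) ->
  (forall x x', (forall k, h k x = h k x') -> x = x') ->
  (forall x, exists k, is_c0 (h k) /\ h k x != 0) -> continuous g.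
Proof.
move=> hG ch chg sep van y0; have [k [[chk c0k] hk0]] := van (g y0).
pose eps := `|h k (g y0)| / 2.
have n0 : 0 < `|h k (g y0)| by rewrite normr_gt0.
have e0 : 0 < eps by rewrite divr_gt0.
have [A cA hA] := c0k _ e0.
have nA : nbhs (g y0) A.
  have /(@cvgrPdist_lt _ R[i] _ _ (nbhs_filter (g y0)))/(_ _ e0) := chk (g y0).
  apply: filterS => x hx; apply: contrapT => /hA hx2.
  have : `|h k (g y0)| < `|h k (g y0)|; last by rewrite ltxx.
  rewrite -{1}(subrK (h k x) (h k (g y0))); apply: (le_lt_trans (ler_normD _ _)).
  by rewrite [ltRHS]splitr ltrD.
have value j y : cluster (g @ y0) y -> h j y = h j (g y0).
  move=> cy; apply/esym; apply: (@norm_hausdorff _ R[i]) => P Q nP nQ.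
  have [x [Px Qx]] := cy _ _ (chg j y0 _ nP : (g @ y0) (h j @^-1` P)) (ch j y _ nQ).
  by exists (h j x).
have FA : (g @ y0) A.
  have /(@cvgrPdist_lt _ R[i] _ _ (nbhs_filter y0))/(_ _ e0) := chg k y0.
  apply: filterS => y /= hx; apply: contrapT => /hA hx2.
  have : `|h k (g y0)| < `|h k (g y0)|; last by rewrite ltxx.
  rewrite -{1}(subrK (h k (g y)) (h k (g y0))); apply: (le_lt_trans (ler_normD _ _)).
  by rewrite [ltRHS]splitr ltrD.
apply: (compact_cluster_set1 hG cA nA) => //.
apply/seteqP; split => [y cy|_ ->].
  by apply: sep => j; exact: value.
have [y [Ay cy]] := cA _ _ FA.
by rewrite -[g y0](sep y) // => j; exact: value.
Qed.

End pointwise_topology.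

(** * Inner product, reproducing kernel, spectrum and cospectrum *)

Section inner_products.
Context (R : realType) (V : lmodType R[i]) (ip : V -> V -> R[i]).
Hypothesis ipP : is_inner_product ip.

Lemma ip_lin a u v w : ip (a *: u + v) w = a * ip u w + ip v w.
Proof. by case: ipP => h _ _ _; exact: h. Qed.

Lemma ip_conj u v : ip v u = (ip u v)^*%C.
Proof. by case: ipP => _ h _ _; exact: h. Qed.

Lemma ip0l w : ip 0 w = 0.
Proof.
have := ip_lin 1 0 0 w; rewrite scaler0 addr0 mul1r => /eqP.
by rewrite -subr_eq subrr eq_sym => /eqP.
Qed.

Lemma ipZl a u w : ip (a *: u) w = a * ip u w.
Proof. by have := ip_lin a u 0 w; rewrite ip0l !addr0. Qed.

Lemma ipBl u v w : ip (u - v) w = ip u w - ip v w.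
Proof. by have := ip_lin (-1) v u w; rewrite scaleN1r addrC => ->; rewrite mulN1r addrC. Qed.

Lemma ipZr a u w : ip u (a *: w) = a^*%C * ip u w.
Proof. by rewrite ip_conj ipZl conjcM -ip_conj. Qed.

Lemma ipBr u v w : ip u (v - w) = ip u v - ip u w.
Proof. by rewrite ip_conj ipBl [ip u v]ip_conj [ip u w]ip_conj; exact: rmorphB. Qed.

Lemma ip_self v : ip v v = (ipnorm ip v ^+ 2)%:C.
Proof.
case: ipP => _ _ /(_ v) h _; rewrite /ipnorm; move: h; rewrite lecE /= => /andP[/eqP i0 r0].
by rewrite sqr_sqrtr//; case: (ip v v) i0 => a b /= ->.
Qed.

Lemma ip_cauchy_schwarz u v : normc (ip u v) <= ipnorm ip u * ipnorm ip v.
Proof.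
rewrite -(@ler_pXn2r _ 2)// ?nnegrE ?normc_ge0 ?mulr_ge0 ?sqrtr_ge0// exprMn.
have [v0|v0] := eqVneq (ip v v) 0.
  case: ipP => _ _ _ /(_ v v0) ->.
  by rewrite ip_conj ip0l conjc0 normc0 expr0n mulr_ge0 ?sqr_ge0.
(* [w] is the component of [u] orthogonal to [v], scaled by $\langle v,v\rangle$ so that no division
   occurs. *)
pose z := ip u v; pose w := ip v v *: u - z *: v.
have vv : (ip v v)^*%C = ip v v by rewrite -ip_conj.
have wv : ip w v = 0 by rewrite ipBl !ipZl mulrC subrr.
have ww : ip w w = ip v v * (ip u u * ip v v - z * z^*%C).
  rewrite {2}/w ipBr !ipZr vv wv mulr0 subr0 ipBl !ipZl [ip v u]ip_conj -/z; ring.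
move: ww v0; rewrite !ip_self mul_conjc -(rmorphM (real_complex R)) -(rmorphB (real_complex R)) -(rmorphM (real_complex R)).
move=> /(congr1 (@complex.Re R))/= ww; rewrite (fmorph_eq0 (real_complex R)) => v0.
have vp : 0 < ipnorm ip v ^+ 2 by rewrite lt_neqAle eq_sym v0 sqr_ge0.
have : 0 <= ipnorm ip v ^+ 2 * (ipnorm ip u ^+ 2 * ipnorm ip v ^+ 2 - normc z ^+ 2).
  by rewrite -ww sqr_ge0.
by rewrite pmulr_rge0// subr_ge0.
Qed.

End inner_products.

Section reproducing_kernel_space.
Context (R : realType) (G : topologicalZmodType).
Local Notation dual := (dual_group R G).
Hypothesis hausG : hausdorff_space G.
Hypothesis lcG : locally_compact [set: G].
Context (mu : {measure set (borel G) -> \bar R}) (haar_mu : is_haar mu).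
Context (nu : {measure set (borel dual) -> \bar R}) (dual_nu : is_dual_haar mu nu).
Context (d e : nat) (Phi : dual -> 'rV[R]_d * 'rV[int]_e).
Hypothesis PhiD : forall a b, Phi (a + b) = Phi a + Phi b.
Hypothesis PhiH : homeomorphism Phi.
Context (lam : dual -> R) (ilam : nu.-integrable setT (EFin \o lam)).
Hypothesis lam_gt0 : forall g, 0 < lam g.
Local Notation H := (rkhs ilam lam_gt0).
Local Notation finite_energy := (finite_energy nu lam).
Local Notation energy := (energy nu lam).
Local Notation energy_inner := (energy_inner nu lam).
Local Notation inner := (rkhs_inner ilam lam_gt0).
Implicit Types (phi psi : borel dual -> R[i]) (f g : H) (x y : G).
Let haar_nu : is_haar nu := dual_nu.1.

Lemma density_spec f : finite_energy (density f) /\ (f : G -> R[i]) = inv_fourier nu (density f).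
Proof.
have [_ [fh hf]] : rkhs_set nu lam f by apply/set_mem; exact: (valP f).
have [h1 h2 h3] : rkhs_density nu lam f (density f).
  by apply: (xgetPex (fun=> 0)); exists fh.
by split => //; apply/finite_energy_rkhs_density.
Qed.

Lemma finite_energy_density f : finite_energy (density f). Proof. by case: (density_spec f). Qed.

Lemma rkhsE f x : f x = inv_fourier nu (density f) x.
Proof. by have [_ h] := density_spec f; rewrite {1}h. Qed.

Lemma rkhs_ext f g : (forall x, f x = g x) -> f = g.
Proof. by move=> fg; apply: val_inj; apply/funext. Qed.

Lemma rkhs_continuous f : is_c0 (f : G -> R[i]).
Proof. by have [] : rkhs_set nu lam f by apply/set_mem; exact: (valP f). Qed.

Lemma rkhs_of_density phi : finite_energy phi -> exists f, forall x, f x = inv_fourier nu phi x.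
Proof.
move=> gp; have ip := finite_energy_cintegrable ilam lam_gt0 gp.
have hf : inv_fourier nu phi \in rkhs_pred ilam lam_gt0.
  apply/mem_set; split; first exact: (inv_fourier_c0 hausG lcG haar_mu dual_nu PhiD PhiH).
  by exists phi; split => //; exact: gp.2.
by exists (Rkhs hf).
Qed.

(** Total on densities, with default 0 when the transform is not in the space. Composed with it, a
    functional of the space becomes one of densities, to which [functional_evaluation] applies. *)
Definition of_density phi : H := xget 0 [set f : H | forall x, f x = inv_fourier nu phi x].

Lemma of_densityE phi x : finite_energy phi -> of_density phi x = inv_fourier nu phi x.
Proof. by move=> /rkhs_of_density h; exact: (xgetPex 0 h). Qed.

Lemma of_density_density f : of_density (density f) = f.
Proof.
by apply: rkhs_ext => x; rewrite (of_densityE x (finite_energy_density f)) -rkhsE.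
Qed.

Lemma density_ae f phi : finite_energy phi -> (forall x, f x = inv_fourier nu phi x) ->
  {ae nu, forall a, density f a = phi a}.
Proof.
move=> gp fp; apply: (inv_fourier_inj hausG lcG haar_mu dual_nu PhiD PhiH ilam lam_gt0) => //.
  exact: finite_energy_density.
by move=> x; rewrite -rkhsE.
Qed.

(** Frees the inner product from the chosen densities, by their uniqueness almost everywhere. *)
Lemma innerE f g phi psi : finite_energy phi -> finite_energy psi -> (forall x, f x = inv_fourier nu phi x) ->
  (forall x, g x = inv_fourier nu psi x) -> inner f g = energy_inner phi psi.
Proof.
move=> gp gs fp gps; apply: (energy_inner_ae ilam lam_gt0) => //; try exact: finite_energy_density.
  exact: density_ae.
exact: density_ae.
Qed.

Lemma rkhs_lin_density (a : R[i]) f g x :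
  (a *: f + g) x = inv_fourier nu (fun b => a * density f b + density g b) x.
Proof.
rewrite -[LHS]/(a * f x + g x) !rkhsE /inv_fourier -cintegral_lin.
- by apply: eq_cintegral => b; rewrite mulrDl mulrA.
- by apply: cintegrable_eval; exact: (finite_energy_cintegrable ilam lam_gt0 (finite_energy_density f)).
- by apply: cintegrable_eval; exact: (finite_energy_cintegrable ilam lam_gt0 (finite_energy_density g)).
Qed.

Lemma inner_self f : inner f f = (fine (energy (density f)))%:C.
Proof. by rewrite -energy_inner_diag. Qed.

Lemma rkhs_is_inner_product : is_inner_product inner.
Proof.
split.
- move=> a u v w; rewrite -[inner u w]/(energy_inner (density u) (density w)) -[inner v w]/(energy_inner (density v) (density w)).
  have gu := finite_energy_density u; have gv := finite_energy_density v; have gw := finite_energy_density w.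
  rewrite -(energy_inner_lin ilam lam_gt0 a gu gv gw); apply: innerE => //.
  + by apply: finite_energyD => //; exact: finite_energyZ.
  + exact: rkhs_lin_density.
  + exact: rkhsE.
- by move=> u v; exact: (energy_inner_conj ilam lam_gt0 (finite_energy_density u) (finite_energy_density v)).
- by move=> v; rewrite inner_self lecR fine_ge0// energy_ge0.
- move=> v; rewrite inner_self => /eqP; rewrite (fmorph_eq0 (real_complex R)) => /eqP v0.
  have gv := finite_energy_density v.
  have N0 : energy (density v) = 0%E by rewrite -(fineK (energy_fin lam_gt0 gv)) v0.
  apply: rkhs_ext => x; rewrite rkhsE; apply/eqP.
  have := inv_fourier_energy ilam lam_gt0 x gv; rewrite N0 mul0e lee_fin => h.
  by rewrite -normc_eq0 -sqrf_eq0 eq_le h sqr_ge0.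
Qed.

Definition kernel_section x : H := of_density (kernel_density lam x).

Lemma kernel_sectionE x y : kernel_section x y = inv_fourier nu (kernel_density lam x) y.
Proof. by apply: of_densityE; exact: finite_energy_kernel_density. Qed.

Lemma kernel_section_kernel x y : kernel_section x y = rkhs_kernel nu lam x y.
Proof. exact: kernel_sectionE. Qed.

Lemma reproducing f x : inner f (kernel_section x) = f x.
Proof.
rewrite (innerE (finite_energy_density f) (finite_energy_kernel_density ilam lam_gt0 x) (rkhsE f) (kernel_sectionE x)).
by rewrite (energy_inner_kernel_density nu lam_gt0) -rkhsE.
Qed.

Lemma kernel_section_span_dense f (eps : R) : 0 < eps -> exists s : seq (R[i] * G),
  ipnorm inner (f - \sum_(cx <- s) cx.1 *: kernel_section cx.2) ^+ 2 < eps.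
Proof.
move=> e0; have gf := finite_energy_density f.
have [s hs] := kernel_comb_dense hausG lcG haar_mu dual_nu PhiD PhiH ilam lam_gt0 gf e0.
exists s; set u := f - _; have gl := finite_energy_kernel_comb ilam lam_gt0 s.
have sumE (t : seq (R[i] * G)) x : (\sum_(cx <- t) cx.1 *: kernel_section cx.2 : H) x = inv_fourier nu (kernel_comb lam t) x.
  elim: t => [|cx t IH].
    rewrite big_nil /inv_fourier -[LHS]/0 -[LHS](cintegral0 nu).
    by apply: eq_cintegral => b; rewrite /kernel_comb big_nil mul0r.
  rewrite big_cons -[LHS]/(cx.1 * kernel_section cx.2 x + (\sum_(cx <- t) cx.1 *: kernel_section cx.2 : H) x) IH kernel_sectionE.
  rewrite /inv_fourier -cintegral_lin; last 2 first.
  - by apply: cintegrable_eval; exact: (finite_energy_cintegrable ilam lam_gt0 (finite_energy_kernel_density ilam lam_gt0 _)).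
  - by apply: cintegrable_eval; exact: (finite_energy_cintegrable ilam lam_gt0 (finite_energy_kernel_comb ilam lam_gt0 _)).
  by apply: eq_cintegral => b; rewrite /kernel_comb big_cons mulrDl mulrA.
have gB := finite_energyB ilam lam_gt0 gf gl.
have uE x : u x = inv_fourier nu (fun b => density f b - kernel_comb lam s b) x.
  rewrite inv_fourierB; [|exact: (finite_energy_cintegrable ilam lam_gt0)|exact: (finite_energy_cintegrable ilam lam_gt0)].
  by rewrite -rkhsE -sumE.
have : inner u u = energy_inner (fun b => density f b - kernel_comb lam s b) (fun b => density f b - kernel_comb lam s b).
  exact: innerE.
rewrite energy_inner_diag (ip_self rkhs_is_inner_product) => /(congr1 (@complex.Re R))/= ->.
by rewrite -lte_fin (fineK (energy_fin lam_gt0 gB)).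
Qed.

(** Nonempty open sets have positive Haar measure, so an almost-everywhere statement holds at some
    point of any of them. *)
Lemma ae_open_nonempty (P : borel dual -> Prop) (O : set dual) :
  {ae nu, forall b, P b} -> open O -> O !=set0 -> exists2 b, O b & P b.
Proof.
move=> [A [mA A0 PA]] oO O0; apply: contrapT => no.
have [_ _ h _ _] := haar_nu; have := h O oO O0.
apply/negP; rewrite -leNgt -A0; apply: le_measure; rewrite ?inE//.
  exact: open_measurable_borel.
by move=> b Ob; apply: PA => Pb; apply: no; exists b.
Qed.

(** A zero norm would make the density $\lambda(b)\overline{b(x)}$ vanish almost everywhere, yet it
    vanishes nowhere. *)
Lemma kernel_section_diag_gt0 x : 0 < complex.Re (kernel_section x x).
Proof.
rewrite -(reproducing (kernel_section x) x) (ip_self rkhs_is_inner_product)/=.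
rewrite lt_neqAle sqr_ge0 andbT eq_sym sqrf_eq0; apply/eqP => k0.
have : inner (kernel_section x) (kernel_section x) = 0 by rewrite (ip_self rkhs_is_inner_product) k0 expr0n.
rewrite (innerE (finite_energy_kernel_density ilam lam_gt0 x) (finite_energy_kernel_density ilam lam_gt0 x) (kernel_sectionE x) (kernel_sectionE x)).
rewrite energy_inner_diag => /eqP; rewrite (fmorph_eq0 (real_complex R)) => /eqP N0.
have NE : energy (kernel_density lam x) = 0%E by rewrite -(fineK (energy_fin lam_gt0 (finite_energy_kernel_density ilam lam_gt0 x))) N0.
have [|b _ /eqP] := ae_open_nonempty (energy_eq0_ae ilam lam_gt0 (cmeas_kernel_density ilam x) NE) openT.
  by exists 0.
rewrite mulf_eq0 (fmorph_eq0 (real_complex R)) gt_eqF//= conjc_eq0 -normc_eq0 normc_dual.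
by rewrite oner_eq0.
Qed.

Lemma kernel_section_neq0 x : kernel_section x != 0.
Proof.
apply/eqP => k0; have := kernel_section_diag_gt0 x; rewrite k0.
by rewrite -[(0 : H) x]/(0 : R[i]) ltxx.
Qed.

(** Equal kernel sections have densities equal almost everywhere. The set of characters that
    distinguish [x] from [y] is open, hence empty, and points with the same frequency coincide. *)
Lemma rkhs_separates x y : (forall f, f x = f y) -> x = y.
Proof.
move=> fxy; have kxy : kernel_section x = kernel_section y.
  have [_ _ _ h] := rkhs_is_inner_product; apply/eqP; rewrite -subr_eq0; apply/eqP; apply: h.
  by rewrite (ipBr rkhs_is_inner_product) !reproducing fxy subrr.
have ae1 : {ae nu, forall a, kernel_density lam x a = kernel_density lam y a}.
  apply: (inv_fourier_inj hausG lcG haar_mu dual_nu PhiD PhiH ilam lam_gt0).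
  - exact: finite_energy_kernel_density.
  - exact: finite_energy_kernel_density.
  - by move=> z; rewrite -!kernel_sectionE kxy.
have [th xth] := lifts_exist PhiD PhiH x.
apply: (lifts_inj hausG lcG haar_mu dual_nu xth) => a; rewrite -xth; apply/eqP.
rewrite eq_sym -subr_eq0; apply: contrapT => /negP axy.
have oU : open [set b : dual | b x - b y != 0].
  rewrite (_ : mkset _ = (fun b : dual => b x - b y) @^-1` [set z | z != 0])//.
  apply: open_comp => [b _|].
    exact: (cvgB (@Defs.eval_continuous R G x b) (@Defs.eval_continuous R G y b)).
  rewrite (_ : mkset _ = ~` [set 0]); last by apply/seteqP; split => z /= /eqP.
  apply: closed_openC; apply: accessible_closed_set1.
  by apply: hausdorff_accessible; exact: (@norm_hausdorff _ R[i]).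
have [|b bU /eqP] := ae_open_nonempty ae1 oU; first by exists a.
rewrite /kernel_density -subr_eq0 -mulrBr mulf_eq0 (fmorph_eq0 (real_complex R)) gt_eqF//=.
rewrite (_ : (b x)^*%C - (b y)^*%C = (b x - b y)^*%C); last by rewrite [RHS]rmorphB.
rewrite conjc_eq0.
by move: bU => /= /negbTE ->.
Qed.

Lemma kernel_section_translate x y : kernel_section x y = kernel_section 0 (y - x).
Proof.
rewrite !kernel_sectionE; apply: eq_cintegral => b; rewrite /kernel_density dual_at0 conjc1 mulr1 -mulrA; congr (_ * _).
by rewrite dual_addr dual_opp mulrC.
Qed.

(** By translation invariance of the kernel the squared norm is
    $(k_0(0)-k_0(y-x))+(k_0(0)-k_0(x-y))$, and $k_0$ is continuous. Weak continuity of $x\mapsto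
    k_x$ rests on this. *)
Lemma kernel_section_norm_continuous x (eps : R) : 0 < eps ->
  nbhs x [set y | ipnorm inner (kernel_section y - kernel_section x) ^+ 2 < eps].
Proof.
move=> e0; have e2 : 0 < (eps / 2)%:C by rewrite ltcR divr_gt0.
have /(@cvgrPdist_lt _ R[i] _ _ (nbhs_filter 0))/(_ _ e2) := (rkhs_continuous (kernel_section 0)).1 0.
move=> nb0.
have n1 : nbhs x ((fun y => y - x) @^-1` [set t | `|kernel_section 0 0 - kernel_section 0 t| < (eps / 2)%:C]).
  by apply: (@continuous_subr G x x); rewrite subrr.
have nb1 : nbhs (0 : G) (-%R @^-1` [set t | `|kernel_section 0 0 - kernel_section 0 t| < (eps / 2)%:C]).
  by apply: (@opp_continuous G 0); rewrite oppr0.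
have n2 : nbhs x ((fun y => y - x) @^-1` (-%R @^-1` [set t | `|kernel_section 0 0 - kernel_section 0 t| < (eps / 2)%:C])).
  by apply: (@continuous_subr G x x); rewrite subrr.
apply: filterS2 n1 n2 => y /=; rewrite opprB !normcE !ltcR => h1 h2.
have : inner (kernel_section y - kernel_section x) (kernel_section y - kernel_section x) =
    (kernel_section 0 0 - kernel_section 0 (y - x)) + (kernel_section 0 0 - kernel_section 0 (x - y)).
  rewrite (ipBr rkhs_is_inner_product) !reproducing.
  rewrite -[(kernel_section y - kernel_section x) y]/(kernel_section y y - kernel_section x y) -[(kernel_section y - kernel_section x) x]/(kernel_section y x - kernel_section x x).
  rewrite (kernel_section_translate y y) (kernel_section_translate x y) (kernel_section_translate y x) (kernel_section_translate x x) !subrr.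
  by move: (kernel_section 0 0) (kernel_section 0 (y - x)) (kernel_section 0 (x - y)) => u v w; ring.
rewrite (ip_self rkhs_is_inner_product) => /(congr1 (@normc R)).
rewrite normc_real ger0_norm ?sqr_ge0// => ->.
by apply: (le_lt_trans (le_normcD _ _)); rewrite [ltRHS]splitr ltrD.
Qed.

Lemma rkhs_bounded_functional_continuous (chi : H -> R[i]) (M : R) :
  (forall u v, chi (u - v) = chi u - chi v) ->
  (forall u, normc (chi u) <= M * ipnorm inner u) -> continuous (fun x => chi (kernel_section x)).
Proof.
move=> chiB chiM x; apply/(@cvgrPdist_lt _ R[i] _ _ (nbhs_filter x)) => eps.
case: eps => eps ie; rewrite ltcE /= => /andP[/eqP -> e0].
have M1 : 0 < `|M| + 1 by rewrite ltr_wpDl.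
have d0 : 0 < (eps / (`|M| + 1)) ^+ 2 by rewrite exprn_gt0// divr_gt0.
apply: filterS (kernel_section_norm_continuous x d0) => y /= hy.
rewrite normcE ltcR normcBC -chiB; apply: (le_lt_trans (chiM _)).
set n := ipnorm _ _ in hy *; have n0 : 0 <= n by exact: sqrtr_ge0.
have hn : n < eps / (`|M| + 1).
  by move: hy; rewrite ltr_pXn2r ?nnegrE// divr_ge0 ?ltW.
apply: (@le_lt_trans _ _ ((`|M| + 1) * n)).
  by rewrite ler_wpM2r// (le_trans (ler_norm _))// lerDl.
by rewrite mulrC -ltr_pdivlMr.
Qed.

(** Kernel sections span a dense subspace, and the norm bound carries the vanishing over to its
    closure. *)
Lemma functional_on_span (L : H -> R[i]) (K : R) :
  (forall a u v, L (a *: u + v) = a * L u + L v) ->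
  (forall u, normc (L u) <= K * ipnorm inner u) -> (forall x, L (kernel_section x) = 0) ->
  forall u, L u = 0.
Proof.
move=> Llin LK Lk u; apply/eqP; rewrite -normc_eq0 -sqrf_eq0 eq_le sqr_ge0 andbT.
have L0 : L 0 = 0.
  have := Llin 1 0 0; rewrite scaler0 addr0 mul1r => /eqP.
  by rewrite -subr_eq subrr eq_sym => /eqP.
have LB v w : L (v - w) = L v - L w.
  by have := Llin (-1) w v; rewrite scaleN1r addrC => ->; rewrite mulN1r addrC.
apply/ler_addgt0Pr => eps e0; rewrite add0r.
have K1 : 0 < K ^+ 2 + 1 by rewrite ltr_wpDl ?sqr_ge0.
have [s hs] := kernel_section_span_dense u (divr_gt0 e0 K1).
have Ls : L (\sum_(cx <- s) cx.1 *: kernel_section cx.2) = 0.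
  elim: (s) => [|cx t IH]; first by rewrite big_nil.
  by rewrite big_cons Llin Lk IH mulr0 addr0.
have := LK (u - \sum_(cx <- s) cx.1 *: kernel_section cx.2); rewrite LB Ls subr0 => h.
apply: (@le_trans _ _ ((K * ipnorm inner (u - \sum_(cx <- s) cx.1 *: kernel_section cx.2)) ^+ 2)).
  by rewrite ler_pXn2r ?nnegrE ?normc_ge0//; apply: le_trans h; exact: normc_ge0.
rewrite exprMn; apply: (@le_trans _ _ ((K ^+ 2 + 1) * (eps / (K ^+ 2 + 1)))); last first.
  by rewrite mulrC divfK// gt_eqF.
by apply: ler_pM; rewrite ?sqr_ge0 ?lerDl// ltW.
Qed.

Hypothesis lam_c0 : is_c0 lam.
Hypothesis lam_GRS : forall g : dual,
  (fun n : nat => lam (g *+ n) `^ (n%:R^-1)) @ \oo --> (1 : R).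
Context (C : R) (C_gt0 : 0 < C).
Hypothesis lam_conv : forall g : dual,
  (\int[nu]_a (lam a * lam (g - (a : dual)))%:E <= (C * lam g)%:E)%E.

Lemma rkhs_functional_point (chi : H -> R[i]) :
  (forall a u v, chi (a *: u + v) = a * chi u + chi v) -> (exists f, chi f != 0) ->
  (forall f g h : H, (forall x, h x = f x * g x) -> chi h = chi f * chi g) ->
  exists x, forall f, chi f = f x.
Proof.
move=> chi_lin [f0 cf0] chi_mul.
have Xlin a phi psi : finite_energy phi -> finite_energy psi ->
    chi (of_density (fun b => a * phi b + psi b)) = a * chi (of_density phi) + chi (of_density psi).
  move=> gp gs; rewrite -chi_lin; congr chi; apply: rkhs_ext => x.
  rewrite -[RHS]/(a * of_density phi x + of_density psi x) !of_densityE//; last first.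
    by apply: finite_energyD => //; exact: finite_energyZ.
  rewrite /inv_fourier -cintegral_lin.
  - by apply: eq_cintegral => b; rewrite mulrDl mulrA.
  - by apply: cintegrable_eval; exact: (finite_energy_cintegrable ilam lam_gt0 gp).
  - by apply: cintegrable_eval; exact: (finite_energy_cintegrable ilam lam_gt0 gs).
have Xmul phi psi xi : finite_energy phi -> finite_energy psi -> finite_energy xi ->
    (forall x, inv_fourier nu xi x = inv_fourier nu phi x * inv_fourier nu psi x) ->
    chi (of_density xi) = chi (of_density phi) * chi (of_density psi).
  by move=> gp gs gx h; apply: chi_mul => x; rewrite !of_densityE.
have [|x hx] := functional_evaluation hausG lcG haar_mu dual_nu PhiD PhiH ilam lam_gt0 lam_c0
    lam_GRS C_gt0 lam_conv Xlin Xmul.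
  by exists (density f0); [exact: finite_energy_density|rewrite of_density_density].
exists x => f; rewrite -{1}(of_density_density f) hx ?rkhsE//.
exact: finite_energy_density.
Qed.

Lemma spectrum_eval x : spectrum ilam lam_gt0 (fun f : H => f x).
Proof.
split => //; exists (kernel_section x); apply/eqP => k0; have := kernel_section_diag_gt0 x.
by rewrite k0 ltxx.
Qed.

Lemma spectrum_homeomorphism : exists Theta : G -> spectrum ilam lam_gt0,
  (forall x f, set_val (Theta x) f = inner f (kernel_section x)) /\ homeomorphism Theta.
Proof.
pose Theta x : spectrum ilam lam_gt0 := SigSub (mem_set (spectrum_eval x)).
have TE x f : set_val (Theta x) f = f x by [].
have point (chi : spectrum ilam lam_gt0) : {x | forall f, set_val chi f = f x}.
  apply: cid; have [lin nz mul] : spectrum ilam lam_gt0 (set_val chi) by apply: set_mem; case: chi.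
  exact: rkhs_functional_point.
pose Psi chi := sval (point chi).
have PsiE chi f : f (Psi chi) = set_val chi f by rewrite (svalP (point chi)).
exists Theta; split; first by move=> x f; rewrite reproducing TE.
split.
  apply: set_type_continuous; apply: prod_topology_continuous => f.
  exact: (rkhs_continuous f).1.
exists Psi; split.
- by move=> x; apply: rkhs_separates => f; rewrite PsiE TE.
- by move=> chi; apply: val_inj; apply/funext => f; rewrite -[LHS]/(f (Psi chi)) PsiE.
- apply: (@inverse_continuous_c0 R G _ Psi H (fun f => f : G -> R[i]) hausG).
  + by move=> f; exact: (rkhs_continuous f).1.
  + move=> f; rewrite (_ : _ \o _ = fun chi : spectrum ilam lam_gt0 => set_val chi f); last first.
      by apply/funext => chi /=; rewrite PsiE.
    move=> chi; apply: (@continuous_comp _ _ _ (set_val : spectrum ilam lam_gt0 -> _) (fun p => p f)).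
      exact: initial_continuous.
    exact: prod_topology_eval_continuous.
  + exact: rkhs_separates.
  + move=> x; exists (kernel_section x); split; first exact: rkhs_continuous.
    by apply/eqP => k0; have := kernel_section_diag_gt0 x; rewrite k0 ltxx.
Qed.

Section cospectrum.
Context (T : lmodType R[i]) (ipT : T -> T -> R[i]) (tens : H -> H -> T)
  (Delta : {linear H -> T}).
Hypothesis tensP : is_tensor_square inner ipT tens.
Hypothesis DeltaB : bounded_operator inner ipT Delta.
Hypothesis DeltaK : forall x, Delta (kernel_section x) = tens (kernel_section x) (kernel_section x).

Let innerP := rkhs_is_inner_product.
Let ipTP : is_inner_product ipT. Proof. by case: tensP => -[]. Qed.

(** The adjoint of [Delta] is pointwise multiplication. Both sides are bounded and linear in [u], so
    kernel sections suffice; there the left side is $\overline{f(x)g(x)}$ and the right side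
    $\overline{h(x)}$. *)
Lemma Delta_adjoint (f g h : H) : (forall x, h x = f x * g x) ->
  forall u, ipT (Delta u) (tens f g) = inner u h.
Proof.
move=> hfg u; apply/eqP; rewrite -subr_eq0; apply/eqP.
have [M hM] := DeltaB; have [_ _ _ tip _] := tensP.
apply: (@functional_on_span (fun u => ipT (Delta u) (tens f g) - inner u h)
    (M * ipnorm ipT (tens f g) + ipnorm inner h)).
- by move=> a v w; rewrite linearP (ip_lin ipTP) (ip_lin innerP); ring.
- move=> v; apply: (le_trans (normcB _ _)).
  rewrite mulrDl; apply: lerD; last by rewrite mulrC; exact: ip_cauchy_schwarz.
  apply: (le_trans (ip_cauchy_schwarz ipTP _ _)).
  by rewrite mulrAC ler_wpM2r// sqrtr_ge0.
- move=> x; rewrite DeltaK tip (ip_conj innerP f) (ip_conj innerP g) (ip_conj innerP h).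
  by rewrite !reproducing hfg conjcM subrr.
Qed.

(** The functional $\langle\cdot,\xi\rangle$ is multiplicative, because $\langle h,\xi\rangle$ is
    the conjugate of $\langle\Delta\xi,f\otimes g\rangle$ and $\Delta\xi=\xi\otimes\xi$; being
    evaluation at a point [x], it is represented by the kernel section at [x]. *)
Lemma cospectrum_point (xi : H) : xi != 0 -> Delta xi = tens xi xi -> exists x, xi = kernel_section x.
Proof.
move=> xi0 Dxi; have [_ _ defn _] := innerP; have [_ _ _ tip _] := tensP.
have [|f g h hfg|x hx] := @rkhs_functional_point (fun f => inner f xi) (fun a u v => ip_lin innerP a u v xi).
- exists xi; have [_ _ _ h] := innerP; apply: contra_neq xi0; exact: h.
- rewrite (ip_conj innerP xi) -(Delta_adjoint hfg) Dxi tip conjcM.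
  by rewrite -!(ip_conj innerP).
exists x; have [_ _ _ h] := innerP; apply/eqP; rewrite -subr_eq0; apply/eqP; apply: h.
by rewrite (ipBr innerP) hx reproducing subrr.
Qed.

Lemma cospectrum_kernel_section x : cospectrum inner tens Delta (kernel_section x).
Proof. by split; [exact: kernel_section_neq0|exact: DeltaK]. Qed.

Lemma inner_left_linear (f : H) : linear_for *%R (fun u : H => inner u f).
Proof. by move=> a u v; exact: (ip_lin innerP). Qed.

Lemma cospectrum_homeomorphism : exists Gamma : G -> cospectrum inner tens Delta,
  (forall x, set_val (Gamma x) = kernel_section x) /\ homeomorphism Gamma.
Proof.
pose Gamma x : cospectrum inner tens Delta := SigSub (mem_set (cospectrum_kernel_section x)).
have point (xi : cospectrum inner tens Delta) : {x | set_val xi = kernel_section x}.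
  apply: cid; have [nz dx] : cospectrum inner tens Delta (set_val xi) by apply: set_mem; case: xi.
  exact: cospectrum_point.
pose Psi xi := sval (point xi).
have PsiE xi : kernel_section (Psi xi) = set_val xi by rewrite (svalP (point xi)).
have GE x : set_val (Gamma x) = kernel_section x by [].
exists Gamma; split => //; split.
  apply: set_type_continuous; apply: continuous_comp_initial.
  apply: prod_topology_continuous => -[chi [M hM]].
  apply: (rkhs_bounded_functional_continuous (M := M)) => // u v.
  exact: raddfB.
exists Psi; split.
- move=> x; apply: rkhs_separates => f.
  by rewrite -(reproducing f (Psi _)) PsiE GE reproducing.
- by move=> xi; apply: val_inj; exact: PsiE.
- apply: (@inverse_continuous_c0 R G _ Psi H (fun f => f : G -> R[i]) hausG).
  + by move=> f; exact: (rkhs_continuous f).1.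
  + move=> f.
    (* The weak topology is indexed by bundled bounded functionals, so $\langle\cdot,f\rangle$ is
       packed as one of them. *)
    pose ev : {scalar H} := HB.pack (fun u : H => inner u f)
      (GRing.isLinear.Build R[i] H R[i] *%R (fun u : H => inner u f) (inner_left_linear f)).
    have evB : exists M : R, forall v, normc (ev v) <= M * ipnorm inner v.
      by exists (ipnorm inner f) => v; rewrite mulrC; exact: ip_cauchy_schwarz.
    pose cev : continuous_dual inner := exist _ ev evB.
    have cw : continuous (fun u : weak_space inner => inner u f).
      have -> : (fun u : weak_space inner => inner u f) =
          (fun p : prod_topology (fun _ : continuous_dual inner => R[i]) => p cev) \o
          (@dual_pairing R H inner : weak_space inner -> _) by [].
      move=> u; apply: continuous_comp; first exact: initial_continuous.
      exact: prod_topology_eval_continuous.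
    have ce : continuous (fun xi : cospectrum inner tens Delta => inner (set_val xi : H) f).
      move=> xi; apply: (@continuous_comp _ _ _ (set_val : cospectrum inner tens Delta -> weak_space inner)
        (fun u : weak_space inner => inner u f)); first exact: initial_continuous.
      exact: cw.
    (* The value of [f] at the recovered point is $\langle f,\xi\rangle$, the conjugate of the
       weakly continuous $\langle\xi,f\rangle$, and conjugation is isometric. *)
    rewrite (_ : _ \o _ = fun xi : cospectrum inner tens Delta => (inner (set_val xi : H) f)^*%C); last first.
      by apply/funext => xi /=; rewrite -reproducing PsiE (ip_conj innerP).
    have hn (z w : R[i]) : `|z^*%C - w^*%C| = `|z - w|.
      by rewrite !normcE -(normc_conj (z - w)) (_ : (z - w)^*%C = z^*%C - w^*%C)// rmorphB.
    move=> xi; apply/(@cvgrPdist_lt _ R[i] _ _ (nbhs_filter xi)) => eps e0.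
    have /(@cvgrPdist_lt _ R[i] _ _ (nbhs_filter xi))/(_ _ e0) := ce xi.
    by apply: filterS => xi' h; rewrite hn; exact: h.
  + exact: rkhs_separates.
  + move=> x; exists (kernel_section x); split; first exact: rkhs_continuous.
    by apply/eqP => k0; have := kernel_section_diag_gt0 x; rewrite k0 ltxx.
Qed.

End cospectrum.

End reproducing_kernel_space.

Theorem theorem3p9 (R : realType) (G : topologicalZmodType)
  (hausG : hausdorff_space G) (lcG : locally_compact [set: G])
  (mu : {measure set (borel G) -> \bar R}) (haar_mu : is_haar mu)
  (nu : {measure set (borel (dual_group R G)) -> \bar R})
  (dual_nu : is_dual_haar mu nu)
  (d e : nat)
  (dualG : exists Phi : dual_group R G -> 'rV[R]_d * 'rV[int]_e,
     (forall a b, Phi (a + b) = Phi a + Phi b) /\ homeomorphism Phi)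
  (lam : dual_group R G -> R)
  (lam_int : nu.-integrable [set: borel (dual_group R G)] (EFin \o lam))
  (lam_c0 : is_c0 lam)
  (lam_subconv : exists C : R, forall gamma : dual_group R G,
     \int[nu]_alpha (lam alpha * lam (gamma - alpha)) <= C * lam gamma)
  (lam_sym : forall alpha, lam (- alpha) = lam alpha)
  (lam_gt0 : forall gamma, 0 < lam gamma)
  (lam_GRS : forall gamma : dual_group R G,
     (fun n : nat => lam (gamma *+ n) `^ (n%:R^-1)) @ \oo --> (1 : R)) :
  exists k : G -> rkhs lam_int lam_gt0,
    [/\ forall x y, k x y = rkhs_kernel nu lam x y,
      exists Theta : G -> spectrum lam_int lam_gt0,
        (forall x f, set_val (Theta x) f = rkhs_inner lam_int lam_gt0 f (k x)) /\
        homeomorphism Theta &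
      forall (T : lmodType R[i]) (ipT : T -> T -> R[i])
        (tens : rkhs lam_int lam_gt0 -> rkhs lam_int lam_gt0 -> T)
        (Delta : {linear rkhs lam_int lam_gt0 -> T}),
        is_tensor_square (rkhs_inner lam_int lam_gt0) ipT tens ->
        bounded_operator (rkhs_inner lam_int lam_gt0) ipT Delta ->
        (forall x, Delta (k x) = tens (k x) (k x)) ->
        exists Gamma : G -> cospectrum
            (rkhs_inner lam_int lam_gt0) tens Delta,
          (forall x, set_val (Gamma x) = k x) /\ homeomorphism Gamma].
Proof.
have [Phi [PhiD PhiH]] := dualG.
have [C C_gt0 lam_conv] := subconvolutive_bound PhiD PhiH lam_int lam_gt0 lam_c0 lam_subconv.
exists (kernel_section lam_int lam_gt0); split.
- by move=> x y; exact: (kernel_section_kernel hausG lcG haar_mu dual_nu PhiD PhiH).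
- exact: (spectrum_homeomorphism hausG lcG haar_mu dual_nu PhiD PhiH lam_int lam_gt0
    lam_c0 lam_GRS C_gt0 lam_conv).
- move=> T ipT tens Delta tensP DeltaB DeltaK.
  exact: (cospectrum_homeomorphism hausG lcG haar_mu dual_nu PhiD PhiH lam_c0 lam_GRS
    C_gt0 lam_conv tensP DeltaB DeltaK).
Qed.
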